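(* Let $T$ be a complete, model complete, strongly minimal theory in a recursive signature with flat pregeometry, and let $n$ be as in the context. Suppose $\mathcal N$ is a finite-dimensional recursive model of $T$. Then every model of $T$ of dimension $k\in[n,\dim(\mathcal N)]$ has a recursive presentation.
   Context: The pregeometry of $T$ is the $\mathrm{acl}$-pregeometry of its countable saturated model $\mathbb M$; flat means non-disintegrated and satisfying, for every finite collection $\{E_1,\dots,E_k\}$ of finite-dimensional closed sets, $\sum_{\emptyset\ne s}(-1)^{|s|+1}\mathrm{dm}(\bigcap_{i\in s}E_i)\ge\mathrm{dm}(\bigcup_iE_i)$. A circuit is a dependent tuple all of whose proper subtuples are independent; $n+1$ is the smallest size $>2$ of a circuit in $\mathbb M$. The dimension of a model is the $\mathrm{acl}$-dimension of its universe. A recursive presentation is an isomorphic copy with universe $\subseteq\omega$ and recursive atomic diagram. *)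

(* Defs.v *)
From mathcomp Require Import all_boot all_algebra.
From Stdlib Require Import ClassicalEpsilon.
Set Implicit Arguments. Unset Strict Implicit. Unset Printing Implicit Defensive.
Import GRing.Theory Num.Theory.

Inductive rcode : Type :=
| RZero | RSucc | RProj (i : nat) | RComp (f : rcode) (gs : seq rcode)
| RPrec (f g : rcode) | RMu (f : rcode).

Inductive reval : rcode -> seq nat -> nat -> Prop :=
| ev_zero xs : reval RZero xs 0
| ev_succ x xs : reval RSucc (x :: xs) x.+1
| ev_proj i xs : i < size xs -> reval (RProj i) xs (nth 0 xs i)
| ev_comp f gs xs ys y :
    revals gs xs ys -> reval f ys y -> reval (RComp f gs) xs y
| ev_prec0 f g xs y : reval f xs y -> reval (RPrec f g) (0 :: xs) y
| ev_precS f g m xs y z :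
    reval (RPrec f g) (m :: xs) y -> reval g (m :: y :: xs) z ->
    reval (RPrec f g) (m.+1 :: xs) z
| ev_mu f xs m :
    reval f (m :: xs) 0 ->
    (forall j, j < m -> exists v, reval f (j :: xs) v.+1) ->
    reval (RMu f) xs m
with revals : seq rcode -> seq nat -> seq nat -> Prop :=
| evs_nil xs : revals [::] xs [::]
| evs_cons g gs xs y ys :
    reval g xs y -> revals gs xs ys -> revals (g :: gs) xs (y :: ys).

Definition computable_fun (f : nat -> nat) : Prop :=
  exists c, forall x, reval c [:: x] (f x).

Definition recursive_set (A : nat -> Prop) : Prop :=
  exists c, forall x, (A x -> reval c [:: x] 1) /\ (~ A x -> reval c [:: x] 0).

Record signature := Signature {
  is_fsym : nat -> Prop; fsym_ar : nat -> nat;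
  is_rsym : nat -> Prop; rsym_ar : nat -> nat }.

Definition recursive_signature (L : signature) : Prop :=
  [/\ recursive_set (is_fsym L), computable_fun (fsym_ar L),
      recursive_set (is_rsym L) & computable_fun (rsym_ar L)].

Inductive term : Type := TVar (v : nat) | TApp (f : nat) (ts : seq term).

Inductive formula : Type :=
| FFalse
| FEq (t1 t2 : term)
| FRel (r : nat) (ts : seq term)
| FNot (p : formula)
| FAnd (p q : formula)
| FEx (x : nat) (p : formula).

Fixpoint wf_term (L : signature) (t : term) : Prop :=
  match t with
  | TVar _ => True
  | TApp f ts => [/\ is_fsym L f, size ts = fsym_ar L f &
      (fix wfl (l : seq term) : Prop :=
         match l with [::] => True | u :: l' => wf_term L u /\ wfl l' end) ts]
  end.

Definition wf_terms (L : signature) (ts : seq term) : Prop :=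
  forall t, List.In t ts -> wf_term L t.

Fixpoint wf_formula (L : signature) (p : formula) : Prop :=
  match p with
  | FFalse => True
  | FEq t1 t2 => wf_term L t1 /\ wf_term L t2
  | FRel r ts => [/\ is_rsym L r, size ts = rsym_ar L r & wf_terms L ts]
  | FNot q => wf_formula L q
  | FAnd q1 q2 => wf_formula L q1 /\ wf_formula L q2
  | FEx _ q => wf_formula L q
  end.

Fixpoint tvars (t : term) : seq nat :=
  match t with TVar v => [:: v] | TApp _ ts => flatten (map tvars ts) end.

Fixpoint fv (p : formula) : seq nat :=
  match p with
  | FFalse => [::]
  | FEq t1 t2 => tvars t1 ++ tvars t2
  | FRel _ ts => flatten (map tvars ts)
  | FNot q => fv q
  | FAnd q1 q2 => fv q1 ++ fv q2
  | FEx x q => filter (predC1 x) (fv q)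
  end.

Definition sentence (L : signature) (p : formula) : Prop :=
  wf_formula L p /\ fv p = [::].

(* L-structures (symbols outside L / wrong arities are irrelevant). *)
Record structure (L : signature) := Structure {
  carrier :> Type;
  sfun : nat -> seq carrier -> carrier;
  srel : nat -> seq carrier -> Prop }.
Arguments carrier {L} _.
Arguments sfun {L} _ _ _.
Arguments srel {L} _ _ _.

Definition upd (A : Type) (rho : nat -> A) (x : nat) (a : A) : nat -> A :=
  fun y => if y == x then a else rho y.

Fixpoint teval (L : signature) (M : structure L) (rho : nat -> M) (t : term) : M :=
  match t with
  | TVar v => rho v
  | TApp f ts => sfun M f (map (teval rho) ts)
  end.

Fixpoint sat (L : signature) (M : structure L) (rho : nat -> M) (p : formula) {struct p} : Prop :=
  match p with
  | FFalse => False
  | FEq t1 t2 => teval rho t1 = teval rho t2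
  | FRel r ts => srel M r (map (teval rho) ts)
  | FNot q => ~ sat rho q
  | FAnd q1 q2 => sat rho q1 /\ sat rho q2
  | FEx x q => exists a : M, sat (upd rho x a) q
  end.

Definition theory (L : signature) (T : formula -> Prop) : Prop :=
  forall p, T p -> sentence L p.

Definition is_model L (T : formula -> Prop) (M : structure L) : Prop :=
  inhabited M /\ forall p, T p -> forall rho : nat -> M, sat rho p.

Definition complete L (T : formula -> Prop) : Prop :=
  (exists M : structure L, is_model T M) /\
  forall p, sentence L p ->
    (forall M : structure L, is_model T M -> forall rho : nat -> M, sat rho p) \/
    (forall M : structure L, is_model T M -> forall rho : nat -> M, ~ sat rho p).

Definition embedding L (M N : structure L) (h : M -> N) : Prop :=
  [/\ injective h,
      (forall f (ts : seq M), is_fsym L f -> size ts = fsym_ar L f ->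
         h (sfun M f ts) = sfun N f (map h ts)) &
      (forall r (ts : seq M), is_rsym L r -> size ts = rsym_ar L r ->
         (srel M r ts <-> srel N r (map h ts)))].

Definition elementary L (M N : structure L) (h : M -> N) : Prop :=
  forall p (rho : nat -> M), wf_formula L p -> (sat rho p <-> sat (h \o rho) p).

Definition model_complete L (T : formula -> Prop) : Prop :=
  forall (M N : structure L) (h : M -> N),
    is_model T M -> is_model T N -> embedding h -> elementary h.

Definition isomorphism L (M N : structure L) (h : M -> N) : Prop :=
  embedding h /\ bijective h.

Definition finite_set (A : Type) (S : A -> Prop) : Prop :=
  exists l : seq A, forall a, S a -> List.In a l.

Definition defset L (M : structure L) (rho : nat -> M) (x : nat) (p : formula) : M -> Prop :=
  fun a => sat (upd rho x a) p.

Definition strongly_minimal L (T : formula -> Prop) : Prop :=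
  forall M : structure L, is_model T M ->
    ~ finite_set (fun _ : M => True) /\
    forall p (rho : nat -> M) x, wf_formula L p ->
      finite_set (defset rho x p) \/ finite_set (fun a => ~ defset rho x p a).

Definition acl L (M : structure L) (A : M -> Prop) (a : M) : Prop :=
  exists p x (rho : nat -> M),
    [/\ wf_formula L p,
        (forall y, y \in fv p -> y != x -> A (rho y)),
        finite_set (defset rho x p) & defset rho x p a].

(* countable omega-saturated model: every 1-type over a finite parameter set
   (the parameters are rho 0, ..., rho (m-1)) that is finitely satisfiable
   is realized *)
Definition saturated L (M : structure L) : Prop :=
  forall (rho : nat -> M) (m x : nat) (P : formula -> Prop),
    (forall p, P p -> wf_formula L p /\ forall y, y \in fv p -> y = x \/ y < m) ->
    (forall l : seq formula, (forall p, List.In p l -> P p) ->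
       exists a, forall p, List.In p l -> sat (upd rho x a) p) ->
    exists a, forall p, P p -> sat (upd rho x a) p.

Definition countable_saturated_model L (T : formula -> Prop) (M : structure L) : Prop :=
  [/\ is_model T M, (exists e : nat -> M, forall a, exists i, e i = a) & saturated M].

Section Pregeometry.
Variables (L : signature) (M : structure L).

Definition in_list (l : seq M) : M -> Prop := fun y => List.In y l.

Definition independent (l : seq M) : Prop :=
  forall l1 a l2, l = l1 ++ a :: l2 -> ~ acl (in_list (l1 ++ l2)) a.

Definition basis_of (S : M -> Prop) (b : seq M) : Prop :=
  [/\ independent b, (forall y, List.In y b -> S y) & (forall y, S y -> acl (in_list b) y)].

Definition finite_dim (S : M -> Prop) : Prop := exists b, basis_of S b.

(* dimension of (the closure of) S: size of a basis (used for finite-dim S) *)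
Definition dm (S : M -> Prop) : nat :=
  epsilon (inhabits 0) (fun d => exists b, basis_of S b /\ size b = d).

Definition closed_set (S : M -> Prop) : Prop := forall a, acl S a -> S a.

Definition disintegrated : Prop :=
  forall (A : M -> Prop) a, acl A a ->
    acl (fun _ => False) a \/ exists b, A b /\ acl (fun y => y = b) a.

Definition flat : Prop :=
  ~ disintegrated /\
  forall (k : nat) (E : 'I_k -> M -> Prop),
    (forall i, closed_set (E i) /\ finite_dim (E i)) ->
    ((dm (fun a => exists i, E i a))%:Z <=
       \sum_(s : {set 'I_k} | s != set0)
          (-1) ^+ (#|s|.+1) * (dm (fun a => forall i, i \in s -> E i a))%:Z)%R.

Definition circuit (c : seq M) : Prop :=
  ~ independent c /\
  forall m : bitseq, size m = size c -> false \in m -> independent (mask m c).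

Definition circuit_number (n : nat) : Prop :=
  [/\ 2 <= n, (exists c, circuit c /\ size c = n.+1) &
      forall c, circuit c -> 2 < size c -> n.+1 <= size c].

Definition model_dim (d : nat) : Prop :=
  exists b, basis_of (fun _ => True) b /\ size b = d.

End Pregeometry.

Definition npair (a b : nat) : nat := (a + b) * (a + b).+1 %/ 2 + b.

Definition code_seq (l : seq nat) : nat := foldr (fun c acc => (npair c acc).+1) 0 l.

Fixpoint code_term (t : term) : nat :=
  match t with
  | TVar v => npair 0 v
  | TApp f ts => npair 1 (npair f (code_seq (map code_term ts)))
  end.

Fixpoint code_formula (p : formula) : nat :=
  match p with
  | FFalse => npair 0 0
  | FEq t1 t2 => npair 1 (npair (code_term t1) (code_term t2))
  | FRel r ts => npair 2 (npair r (code_seq (map code_term ts)))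
  | FNot q => npair 3 (code_formula q)
  | FAnd q1 q2 => npair 4 (npair (code_formula q1) (code_formula q2))
  | FEx x q => npair 5 (npair x (code_formula q))
  end.

Definition atomic (p : formula) : Prop :=
  match p with FEq _ _ | FRel _ _ => True | _ => False end.

Definition literal (p : formula) : Prop :=
  atomic p \/ exists q, p = FNot q /\ atomic q.

(* S, with its universe identified via the injection iota with a subset of
   omega (element s is named by the variable iota s), has recursive atomic
   diagram. *)
Definition recursive_structure L (S : structure L) (iota : S -> nat) : Prop :=
  injective iota /\
  recursive_set (fun c => exists p,
    [/\ literal p, wf_formula L p,
        (forall v, v \in fv p -> exists s, iota s = v),
        code_formula p = c &
        forall rho : nat -> S, (forall s, rho (iota s) = s) -> sat rho p]).

Definition has_recursive_presentation L (M : structure L) : Prop :=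
  exists (S : structure L) (iota : S -> nat) (h : S -> M),
    recursive_structure iota /\ isomorphism h.

(* Main.v *)
Require Import Defs.
From mathcomp Require Import all_boot all_algebra.
From Stdlib Require Import ClassicalEpsilon.
From mathcomp Require Import zify boolp.
From mathcomp Require classical_sets filter.
(* [all_algebra] shadows [basis_of]. *)
Import Defs.
Set Implicit Arguments. Unset Strict Implicit. Unset Printing Implicit Defensive.

(* Let [b] be a basis of N, [bk] its first [k] elements and H the closure of [bk]
   in N.  Since independent tuples of equal length have the same type, M is
   isomorphic to H, so it suffices to present H recursively.  Membership in H is
   only Delta_2 in the diagram of N, and a finite injury construction builds an
   enumeration of H whose diagram is nevertheless recursive: when an entry turns
   out to lie outside H, it is replaced, without changing the part of the diagram
   already decided, by an element of an infinite recursively enumerable subset P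
   of H.  Such a replacement exists because an infinite definable set is cofinite.

   The set P is where flatness enters.  A circuit of size [n + 1] gives, over
   [n - 2] fixed elements, a symmetric algebraic ternary relation Q, and model
   completeness makes generic instances of Q, and of 4-cycles and 5-cycles of
   Q with prescribed labels, recursively enumerable.  P is the closure of a finite
   subset of H under the resulting rules.  It is infinite because a finite closed
   set X has bounded size: flatness implies that generic labels determine 4-cycles
   and 5-cycles up to finitely many choices, and counting pairs of 5-cycles with
   the same labels in X gives more of them than generic labels allow. *)

(** * Recursive functions and codings *)

(** Two obstacles shape the proof. One is dimension: the flatness arguments need generic 5-tuples
    over [n - 2] parameters, and [N] may be too small to contain them. The rules are therefore found
    in the saturated model, as finitely many quantifier-free patterns, and pulled back along an
    elementary embedding of [N] with algebraically closed image. Only finite data are pulled back, a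
    list of rules and a bound on closed sets, so they need not be found effectively. The condition
    [n <= k] puts the parameters into H. The other is soundness: rules get applied to tuples that
    cannot be recognised as generic. Each pattern must also force a bound on the number of
    solutions, so that whatever a rule derives is algebraic over its premises and P stays inside H.
    That the rules find all solutions is needed at generic tuples only; the others are of lower
    order in the count. Membership in H is Delta_2 for two reasons. To be algebraic means that some
    pattern has finitely many realisations. And [N] has a finite basis, so an element is outside H
    exactly if it makes some later basis element algebraic over the earlier ones. *)

Definition rc (k : nat) (f : seq nat -> nat) : Prop :=
  exists c, forall xs, size xs = k -> reval c xs (f xs).

Lemma rc_ext k f g : (forall xs, size xs = k -> f xs = g xs) -> rc k f -> rc k g.
Proof. by move=> fg [c cP]; exists c => xs sz; rewrite -fg //; exact: cP. Qed.

Lemma rc_proj k i : i < k -> rc k (fun xs => nth 0 xs i).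
Proof. by move=> ik; exists (RProj i) => xs sz; constructor; rewrite sz. Qed.

Lemma rc_comp k f (gs : seq (seq nat -> nat)) :
  rc (size gs) f -> (forall i, i < size gs -> rc k (nth (fun=> 0) gs i)) ->
  rc k (fun xs => f [seq g xs | g <- gs]).
Proof.
move=> [c cP] gsP.
suff [ds dsP] : exists ds, forall xs, size xs = k -> revals ds xs [seq g xs | g <- gs].
  exists (RComp c ds) => xs sz; apply: ev_comp (dsP _ sz) (cP _ _).
  by rewrite size_map.
elim: gs gsP {c cP} => [|g gs IH] gsP; first by exists [::] => xs _; constructor.
have [d dP] := gsP 0 isT.
have [i ilt|ds dsP] := IH; first by apply: (gsP i.+1).
by exists (d :: ds) => xs sz /=; constructor; [exact: dP | exact: dsP].
Qed.

Lemma rc_comp1 k f g : rc 1 f -> rc k g -> rc k (fun xs => f [:: g xs]).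
Proof. by move=> fP gP; apply: (rc_comp (gs := [:: g])) => // -[]. Qed.

Lemma rc_comp2 k f g1 g2 : rc 2 f -> rc k g1 -> rc k g2 ->
  rc k (fun xs => f [:: g1 xs; g2 xs]).
Proof. by move=> fP g1P g2P; apply: (rc_comp (gs := [:: g1; g2])) => // -[|[]]. Qed.

Lemma rc_succ k g : rc k g -> rc k (fun xs => (g xs).+1).
Proof.
move=> gP; apply: (rc_comp1 (f := fun xs => (head 0 xs).+1)) gP.
by exists RSucc => -[|x xs] // _; constructor.
Qed.

Lemma rc_const k n : rc k (fun=> n).
Proof.
elim: n => [|n IH]; first by exists RZero => xs _; constructor.
exact: rc_succ.
Qed.

(** A recursor with a name, so that the closure lemmas for recursion can be unified with it. The
    step receives the predecessor first and the previous value second, as [RPrec] does. *)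
Definition natrec (B : Type) (f : B) (g : nat -> B -> B) : nat -> B :=
  fix F n := if n is m.+1 then g m (F m) else f.

Lemma rc_prec k f g : rc k f -> rc k.+2 g ->
  rc k.+1 (fun xs => natrec (f (behead xs)) (fun m r => g [:: m, r & behead xs]) (head 0 xs)).
Proof.
move=> [c cP] [d dP]; exists (RPrec c d) => -[|n xs] //= [sz].
elim: n => [|n IH] /=; first by constructor; exact: cP.
by apply: ev_precS IH (dP _ _); rewrite /= sz.
Qed.

Lemma rc_mu k f (h : seq nat -> nat) : rc k.+1 f ->
  (forall xs, size xs = k -> f (h xs :: xs) = 0 /\ forall j, j < h xs -> f (j :: xs) <> 0) ->
  rc k h.
Proof.
move=> [c cP] hP; exists (RMu c) => xs sz; have [h0 hm] := hP xs sz.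
constructor; first by rewrite -h0; apply: cP; rewrite /= sz.
move=> j jlt; exists (f (j :: xs)).-1; rewrite prednK; first by apply: cP; rewrite /= sz.
by rewrite lt0n; apply/eqP; exact: hm.
Qed.

Definition cf2 (F : nat -> nat -> nat) := rc 2 (fun xs => F (nth 0 xs 0) (nth 0 xs 1)).

Lemma rc_cf2 k F g1 g2 : cf2 F -> rc k g1 -> rc k g2 -> rc k (fun xs => F (g1 xs) (g2 xs)).
Proof. by move=> FP g1P g2P; have := rc_comp2 FP g1P g2P. Qed.

Lemma natrec_cf2 F (f : nat -> nat) (g : nat -> nat -> nat -> nat) :
  rc 1 (fun xs => f (nth 0 xs 0)) ->
  rc 3 (fun xs => g (nth 0 xs 0) (nth 0 xs 1) (nth 0 xs 2)) ->
  (forall n y, F n y = natrec (f y) (fun m r => g m r y) n) -> cf2 F.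
Proof.
by move=> fP gP FE; apply: rc_ext (rc_prec fP gP) => -[|n [|y []]] //=.
Qed.

Lemma cf2_add : cf2 addn.
Proof.
apply: (natrec_cf2 (f := id) (g := fun _ r _ => r.+1)).
- exact: (@rc_proj 1 0).
- by apply: rc_succ; exact: (@rc_proj 3 1).
- by elim=> //= n IH y; rewrite addSn IH.
Qed.

Lemma cf2_pred : cf2 (fun x _ => x.-1).
Proof.
apply: (natrec_cf2 (f := fun=> 0) (g := fun m _ _ => m)).
- exact: rc_const.
- exact: (@rc_proj 3 0).
- by case.
Qed.

(** The arguments come reversed because the recursion runs on the first one, which has to be the
    number subtracted. *)
Lemma cf2_sub : cf2 (fun n y => y - n).
Proof.
apply: (natrec_cf2 (f := id) (g := fun _ r _ => r.-1)).
- exact: (@rc_proj 1 0).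
- by apply: (rc_cf2 cf2_pred); exact: (@rc_proj 3 1).
- by elim=> [|n IH] y /=; rewrite ?subn0 // subnS IH.
Qed.

(** The triangular numbers by recursion: the division in [npair] disappears, and Cantor's pairing is
    visibly primitive recursive. *)
Definition tnum (n : nat) := natrec 0 (fun m r => m.+1 + r) n.

Lemma tnumE n : n * n.+1 %/ 2 = tnum n.
Proof.
elim: n => [|n IH] //=; rewrite -IH.
have -> : n.+1 * n.+2 = n.+1 * 2 + n * n.+1 by lia.
by rewrite divnMDl.
Qed.

Lemma npairE a b : npair a b = tnum (a + b) + b.
Proof. by rewrite /npair tnumE. Qed.

Lemma cf2_tri : cf2 (fun x _ => tnum x).
Proof.
apply: (natrec_cf2 (f := fun=> 0) (g := fun m r _ => m.+1 + r)) => //.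
- exact: rc_const.
- by apply: (rc_cf2 cf2_add); [apply: rc_succ|]; exact: rc_proj.
Qed.

Lemma cf2_npair : cf2 npair.
Proof.
apply: (@rc_ext _ (fun xs => tnum (nth 0 xs 0 + nth 0 xs 1) + nth 0 xs 1)) => [xs _|].
  by rewrite npairE.
have p0 := @rc_proj 2 0 isT; have p1 := @rc_proj 2 1 isT.
apply: (rc_cf2 cf2_add) => //.
exact: (rc_cf2 cf2_tri (rc_cf2 cf2_add p0 p1) p1).
Qed.

Lemma leq_tri m n : m <= n -> tnum m <= tnum n.
Proof.
elim: n => [|n IH]; first by case: m.
rewrite leq_eqVlt => /orP[/eqP->//|]; rewrite ltnS => /IH /= h; lia.
Qed.

(** The diagonal of Cantor's pairing on which [z] lies, that is the largest [d] with [tnum d <= z].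
    The truncated difference [1 - (tnum r.+1 - m.+1)] is 1 precisely when [m.+1] has reached the
    next triangular number. *)
Definition ndiag (z : nat) := natrec 0 (fun m r => r + (1 - (tnum r.+1 - m.+1))) z.

Lemma ndiagP z : tnum (ndiag z) <= z < tnum (ndiag z).+1.
Proof.
elim: z => [|z /andP[lo hi]] //=.
case: (ltnP z.+1 (tnum (ndiag z).+1)) => h.
  have -> : 1 - (tnum (ndiag z).+1 - z.+1) = 0 by lia.
  by rewrite addn0 h; rewrite /= in hi h *; lia.
have -> : 1 - (tnum (ndiag z).+1 - z.+1) = 1 by lia.
rewrite addn1; move: hi h => /=; lia.
Qed.

Definition nsnd z := z - tnum (ndiag z).
Definition nfst z := ndiag z - nsnd z.

Lemma nsnd_le z : nsnd z <= ndiag z.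
Proof. by rewrite /nsnd; have := ndiagP z; rewrite /=; lia. Qed.

Lemma npairK z : npair (nfst z) (nsnd z) = z.
Proof.
rewrite npairE /nfst subnK ?nsnd_le // /nsnd.
have := ndiagP z; lia.
Qed.

Lemma ndiag_pair a b : ndiag (npair a b) = a + b.
Proof.
have := ndiagP (npair a b); rewrite npairE => /andP[lo hi].
apply/eqP; rewrite eqn_leq; apply/andP; split; rewrite leqNgt; apply/negP => h.
- have := leq_tri h; rewrite /=; lia.
- have := leq_tri h; rewrite /= in hi *; lia.
Qed.

Lemma nsndK a b : nsnd (npair a b) = b.
Proof. by rewrite /nsnd ndiag_pair npairE; lia. Qed.

Lemma nfstK a b : nfst (npair a b) = a.
Proof. by rewrite /nfst nsndK ndiag_pair; lia. Qed.

Lemma tnum_ge n : n <= tnum n.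
Proof. by case: n => //= n; lia. Qed.

Lemma nfst_le z : nfst z <= z.
Proof. by rewrite -{2}(npairK z) npairE; have := tnum_ge (nfst z + nsnd z); lia. Qed.

Lemma nsnd_lez z : nsnd z <= z.
Proof. by rewrite -{2}(npairK z) npairE; lia. Qed.

Lemma cf2_ndiag : cf2 (fun x _ => ndiag x).
Proof.
apply: (natrec_cf2 (f := fun=> 0) (g := fun m r _ => r + (1 - (tnum r.+1 - m.+1)))) => //.
  exact: rc_const.
have p0 := rc_succ (@rc_proj 3 0 isT); have p1 := @rc_proj 3 1 isT.
have t := rc_cf2 cf2_tri (rc_succ p1) p0.
exact: (rc_cf2 cf2_add p1 (rc_cf2 cf2_sub (rc_cf2 cf2_sub p0 t) (rc_const 3 1))).
Qed.

Lemma cf2_nsnd : cf2 (fun x _ => nsnd x).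
Proof.
have p0 := @rc_proj 2 0 isT.
exact: (rc_cf2 cf2_sub (rc_cf2 cf2_tri (rc_cf2 cf2_ndiag p0 p0) p0) p0).
Qed.

Lemma cf2_nfst : cf2 (fun x _ => nfst x).
Proof.
have p0 := @rc_proj 2 0 isT.
exact: (rc_cf2 cf2_sub (rc_cf2 cf2_nsnd p0 p0) (rc_cf2 cf2_ndiag p0 p0)).
Qed.

Lemma cf_rc f : computable_fun f <-> rc 1 (fun xs => f (nth 0 xs 0)).
Proof.
split=> -[c cP]; exists c; last by move=> x; exact: (cP [:: x]).
by move=> [|x []] //.
Qed.

Lemma cf_comp f g : computable_fun f -> computable_fun g -> computable_fun (f \o g).
Proof. by rewrite !cf_rc => fP gP; have := rc_comp1 fP gP. Qed.

Lemma cf_pair f g : computable_fun f -> computable_fun g ->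
  computable_fun (fun x => npair (f x) (g x)).
Proof. by rewrite !cf_rc => fP gP; exact: (rc_cf2 cf2_npair). Qed.

Lemma cf_natrec f g : computable_fun f -> computable_fun g ->
  computable_fun (fun z => natrec (f (nsnd z)) (fun m r => g (npair m (npair r (nsnd z)))) (nfst z)).
Proof.
rewrite !cf_rc => fP gP.
have g3 : rc 3 (fun xs => g (npair (nth 0 xs 0) (npair (nth 0 xs 1) (nth 0 xs 2)))).
  have p0 := @rc_proj 3 0 isT; have p1 := @rc_proj 3 1 isT; have p2 := @rc_proj 3 2 isT.
  exact: (rc_comp1 gP (rc_cf2 cf2_npair p0 (rc_cf2 cf2_npair p1 p2))).
have p0 := @rc_proj 1 0 isT.
exact: (rc_comp2 (rc_prec fP g3) (rc_cf2 cf2_nfst p0 p0) (rc_cf2 cf2_nsnd p0 p0)).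
Qed.

Lemma cf_mu f (h : nat -> nat) : computable_fun f ->
  (forall x, f (npair (h x) x) = 0 /\ forall j, j < h x -> f (npair j x) <> 0) ->
  computable_fun h.
Proof.
rewrite !cf_rc => fP hP.
apply: (@rc_mu 1 (fun xs => f (npair (nth 0 xs 0) (nth 0 xs 1)))).
  exact: (rc_comp1 fP (rc_cf2 cf2_npair (@rc_proj 2 0 isT) (@rc_proj 2 1 isT))).
by move=> [|x [|? ?]] //= _; exact: hP.
Qed.

(** * Computability on encoded data types *)

Class encodable (A : Type) := Encodable {
  enc : A -> nat; dec : nat -> A; encK : cancel enc dec }.

(** Unbounded search needs every number to be a code: a function defined by [RMu] has to halt on all
    numbers, so each of them must stand for an input on which the search succeeds. *)
Class encodes_all (A : Type) {EA : encodable A} := decK : cancel dec (enc : A -> nat).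
Arguments encodes_all A {EA}.

#[export] Instance enc_nat : encodable nat := @Encodable nat id id (fun=> erefl).
#[export] Instance encall_nat : encodes_all nat := fun=> erefl.

#[export] Instance enc_bool : encodable bool.
Proof. by exists nat_of_bool (fun n => n != 0); case. Defined.

#[export] Instance enc_prod A B (EA : encodable A) (EB : encodable B) : encodable (A * B).
Proof.
exists (fun p => npair (enc p.1) (enc p.2)) (fun n => (dec (nfst n), dec (nsnd n))).
by move=> [a b] /=; rewrite nfstK nsndK !encK.
Defined.

#[export] Instance encall_prod A B (EA : encodable A) (EB : encodable B) :
  encodes_all A -> encodes_all B -> encodes_all (A * B).
Proof. by move=> hA hB n /=; rewrite hA hB npairK. Qed.

(** The tail code [nsnd m] is smaller than [m.+1], so the code itself is enough fuel. *)
Fixpoint unseq (fuel n : nat) : seq nat :=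
  match fuel, n with
  | k.+1, m.+1 => nfst m :: unseq k (nsnd m)
  | _, _ => [::]
  end.

Lemma npair_ge2 a b : b <= npair a b.
Proof. by rewrite npairE; lia. Qed.

Lemma npair_ge1 a b : a <= npair a b.
Proof. by rewrite -{1}(nfstK a b); exact: nfst_le. Qed.

Lemma code_unseq k n : n <= k -> code_seq (unseq k n) = n.
Proof.
elim: k n => [|k IH] [|n] //= nk; rewrite IH ?npairK //.
by have := nsnd_lez n; lia.
Qed.

Lemma unseqK k l : code_seq l <= k -> unseq k (code_seq l) = l.
Proof.
elim: l k => [|a l IH] [|k] //= lk.
by rewrite nfstK nsndK IH //; have := npair_ge2 a (code_seq l); lia.
Qed.

#[export] Instance enc_seq A (EA : encodable A) : encodable (seq A).
Proof.
exists (fun l => code_seq (map enc l)) (fun n => map dec (unseq n n)).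
by move=> l; rewrite unseqK // (mapK encK).
Defined.

#[export] Instance encall_seq A (EA : encodable A) : encodes_all A -> encodes_all (seq A).
Proof.
by move=> hA n; rewrite /enc /dec /= (mapK hA) code_unseq.
Qed.

(** On numbers that code nothing the realizer [g] is unconstrained, apart from being total. *)
Definition comp (A B : Type) {EA : encodable A} {EB : encodable B} (f : A -> B) : Prop :=
  exists g, computable_fun g /\ forall a, g (enc a) = enc (f a).
Arguments comp {A B EA EB} f.

Section Comp.
Context {X A B C Y : Type} {EX : encodable X} {EA : encodable A} {EB : encodable B}
        {EC : encodable C} {EY : encodable Y}.

Lemma comp_ext (f g : X -> A) : f =1 g -> comp f -> comp g.
Proof. by move=> fg [h [hP hE]]; exists h; split=> // a; rewrite hE fg. Qed.

Lemma comp_comp (f : X -> A) (g : A -> B) : comp g -> comp f -> comp (fun x => g (f x)).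
Proof.
move=> [g' [gP gE]] [f' [fP fE]]; exists (g' \o f'); split; first exact: cf_comp.
by move=> a /=; rewrite fE gE.
Qed.

Lemma comp_id : comp (fun x : X => x).
Proof. by exists id; split=> //; apply/cf_rc; exact: (@rc_proj 1 0). Qed.

Lemma comp_const (a : A) : comp (fun _ : X => a).
Proof. by exists (fun=> enc a); split=> //; apply/cf_rc; exact: rc_const. Qed.

End Comp.

Section CompPair.
Context {X A B C Y : Type} {EX : encodable X} {EA : encodable A} {EB : encodable B}
        {EC : encodable C} {EY : encodable Y}.

Lemma comp_pair (f : X -> A) (g : X -> B) : comp f -> comp g -> comp (fun x => (f x, g x)).
Proof.
move=> [f' [fP fE]] [g' [gP gE]]; exists (fun x => npair (f' x) (g' x)).
by split; [exact: cf_pair | move=> a /=; rewrite fE gE].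
Qed.

Lemma cf_nfst : computable_fun nfst.
Proof. by apply/cf_rc; have p := @rc_proj 1 0 isT; exact: (rc_cf2 cf2_nfst p p). Qed.

Lemma cf_nsnd : computable_fun nsnd.
Proof. by apply/cf_rc; have p := @rc_proj 1 0 isT; exact: (rc_cf2 cf2_nsnd p p). Qed.

Lemma comp_fst (f : X -> A * B) : comp f -> comp (fun x => (f x).1).
Proof.
apply: (comp_comp (g := fst)); exists nfst; split; first exact: cf_nfst.
by move=> a /=; rewrite nfstK.
Qed.

Lemma comp_snd (f : X -> A * B) : comp f -> comp (fun x => (f x).2).
Proof.
apply: (comp_comp (g := snd)); exists nsnd; split; first exact: cf_nsnd.
by move=> a /=; rewrite nsndK.
Qed.

Lemma comp_natrec (f : X -> B) (g : nat * (B * X) -> B) (n : X -> nat) :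
  comp f -> comp g -> comp n ->
  comp (fun x => natrec (f x) (fun m r => g (m, (r, x))) (n x)).
Proof.
move=> [f' [fP fE]] [g' [gP gE]] [n' [nP nE]].
have idP : computable_fun id by apply/cf_rc; exact: (@rc_proj 1 0).
exists ((fun z => natrec (f' (nsnd z)) (fun m r => g' (npair m (npair r (nsnd z)))) (nfst z))
        \o (fun z => npair (n' z) (id z))); split.
  by apply: cf_comp; [exact: cf_natrec | exact: cf_pair].
move=> x /=; rewrite nfstK nsndK nE.
have -> : enc (n x) = n x by [].
elim: (n x) => [|k IH] /=; first exact: fE.
by rewrite IH (gE (k, (_, x))).
Qed.

Lemma comp_dec (f : X -> nat) : encodes_all A -> comp f -> comp (fun x => dec (f x) : A).
Proof. by move=> hA [g [gP gE]]; exists g; split=> // a; rewrite hA gE. Qed.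

Lemma comp_enc (f : X -> A) : comp f -> comp (fun x => enc (f x)).
Proof. by move=> [g [gP gE]]; exists g; split=> // a; rewrite gE. Qed.

End CompPair.

Section Comp2.
Context {X A B C Y : Type} {EX : encodable X} {EA : encodable A} {EB : encodable B}
        {EC : encodable C} {EY : encodable Y}.

Lemma comp_if (b : X -> bool) (f g : X -> A) : comp b -> comp f -> comp g ->
  comp (fun x => if b x then f x else g x).
Proof.
move=> bP fP gP.
(* The code 0 or 1 of the Boolean serves as the number of recursion steps: no step gives [g x], one
   step gives [f x]. *)
have H := comp_natrec (g := fun z : nat * (A * X) => f z.2.2) gP _ (comp_enc bP).
apply: comp_ext (H _) => [x /=|]; first by case: (b x).
exact: (comp_comp fP (comp_snd (comp_snd comp_id))).
Qed.

End Comp2.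

Section CompArith.
Context {X A B C Y : Type} {EX : encodable X} {EA : encodable A} {EB : encodable B}
        {EC : encodable C} {EY : encodable Y}.

Lemma comp_succ (f : X -> nat) : comp f -> comp (fun x => (f x).+1).
Proof.
apply: (comp_comp (g := S)); exists S; split=> //.
by apply/cf_rc; apply: rc_succ; exact: (@rc_proj 1 0).
Qed.

Lemma cf2_comp F (f g : X -> nat) : cf2 F -> comp f -> comp g -> comp (fun x => F (f x) (g x)).
Proof.
move=> FP fP gP; apply: (comp_comp (f := fun x => (f x, g x)) (g := fun z => F z.1 z.2)).
  exists (fun z => F (nfst z) (nsnd z)); split; last by move=> [a b] /=; rewrite nfstK nsndK.
  have p0 := @rc_proj 1 0 isT.
  by apply/cf_rc; exact: (rc_cf2 FP (rc_cf2 cf2_nfst p0 p0) (rc_cf2 cf2_nsnd p0 p0)).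
exact: comp_pair.
Qed.

Lemma comp_add (f g : X -> nat) : comp f -> comp g -> comp (fun x => f x + g x).
Proof. exact: cf2_comp cf2_add. Qed.

Lemma comp_sub (f g : X -> nat) : comp f -> comp g -> comp (fun x => f x - g x).
Proof. by move=> fP gP; exact: (cf2_comp cf2_sub gP fP). Qed.

Lemma comp_npair (f g : X -> nat) : comp f -> comp g -> comp (fun x => npair (f x) (g x)).
Proof. exact: cf2_comp cf2_npair. Qed.

Lemma comp_nfst (f : X -> nat) : comp f -> comp (fun x => nfst (f x)).
Proof. by apply: (comp_comp (g := nfst)); exists nfst; split=> //; exact: cf_nfst. Qed.

Lemma comp_nsnd (f : X -> nat) : comp f -> comp (fun x => nsnd (f x)).
Proof. by apply: (comp_comp (g := nsnd)); exists nsnd; split=> //; exact: cf_nsnd. Qed.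

Lemma comp_eqn0 (f : X -> nat) : comp f -> comp (fun x => f x == 0).
Proof.
move=> fP.
have [g [gP gE]] := @comp_sub (fun=> 1) f (comp_const _) fP.
by exists g; split=> // a; rewrite gE /=; case: (f a).
Qed.

Lemma comp_leq (f g : X -> nat) : comp f -> comp g -> comp (fun x => f x <= g x).
Proof. by move=> fP gP; exact: (comp_eqn0 (comp_sub fP gP)). Qed.

Lemma comp_not (b : X -> bool) : comp b -> comp (fun x => ~~ b x).
Proof.
by move=> bP; apply: comp_ext (comp_if bP (comp_const false) (comp_const true)) => x; case: (b x).
Qed.

Lemma comp_and (b c : X -> bool) : comp b -> comp c -> comp (fun x => b x && c x).
Proof.
by move=> bP cP; apply: comp_ext (comp_if bP cP (comp_const false)) => x; case: (b x).
Qed.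

Lemma comp_or (b c : X -> bool) : comp b -> comp c -> comp (fun x => b x || c x).
Proof.
by move=> bP cP; apply: comp_ext (comp_if bP (comp_const true) cP) => x; case: (b x).
Qed.

Lemma comp_imp (b c : X -> bool) : comp b -> comp c -> comp (fun x => b x ==> c x).
Proof.
by move=> bP cP; apply: comp_ext (comp_if bP cP (comp_const true)) => x; case: (b x).
Qed.

Lemma comp_eqn (f g : X -> nat) : comp f -> comp g -> comp (fun x => f x == g x).
Proof.
move=> fP gP; apply: comp_ext (comp_and (comp_leq fP gP) (comp_leq gP fP)) => x.
by rewrite eqn_leq.
Qed.

Lemma comp_eqb (f g : X -> bool) : comp f -> comp g -> comp (fun x => f x == g x).
Proof.
move=> fP gP; apply: comp_ext (comp_if fP gP (comp_not gP)) => x.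
by case: (f x) (g x) => [] [].
Qed.

Lemma comp_min (f g : X -> nat) : comp f -> comp g -> comp (fun x => minn (f x) (g x)).
Proof.
move=> fP gP; apply: comp_ext (comp_if (comp_leq fP gP) fP gP) => x.
by case: leqP; lia.
Qed.

Lemma comp_cons (f : X -> A) (l : X -> seq A) : comp f -> comp l -> comp (fun x => f x :: l x).
Proof.
by move=> fP lP; have [g] := comp_succ (comp_npair (comp_enc fP) (comp_enc lP)); exists g.
Qed.

End CompArith.

Section CompFold.
Context {X A B C Y : Type} {EX : encodable X} {EA : encodable A} {EB : encodable B}
        {EC : encodable C} {EY : encodable Y}.

(** One step of a left fold on the coded state (argument, remaining list, accumulator). A state with
    empty list is left as it is, so surplus steps do no harm. *)
Lemma cf_dec_step (g : X * (A * B) -> B) : comp g ->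
  exists h, computable_fun h /\
  forall x (l : seq A) b, h (npair (enc x) (npair (enc l) (enc b))) =
    npair (enc x) (npair (enc (behead l)) (enc (if l is a :: _ then g (x, (a, b)) else b))).
Proof.
move=> [g' [gP gE]].
pose G (z : nat) := if nfst (nsnd z) == 0 then z else
  npair (nfst z) (npair (nsnd (nfst (nsnd z)).-1)
    (g' (npair (nfst z) (npair (nfst (nfst (nsnd z)).-1) (nsnd (nsnd z)))))).
have [h [hP hE]] : comp G.
  have i := @comp_id nat enc_nat; have a := comp_nfst i; have b := comp_nfst (comp_nsnd i).
  have p : comp (fun z => (nfst (nsnd z)).-1).
    by apply: comp_ext (comp_sub b (comp_const 1)) => x; rewrite subn1.
  have gc : comp g' by exists g'.
  apply: comp_if => //; first exact: comp_eqn0.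
  apply: comp_npair => //; apply: comp_npair; first exact: comp_nsnd.
  apply: (comp_comp gc); apply: comp_npair => //.
  by apply: comp_npair; [exact: comp_nfst | exact: comp_nsnd (comp_nsnd i)].
exists h; split=> // x l b.
rewrite (hE (npair (enc x) (npair (enc l) (enc b)))) /= /G !nsndK !nfstK.
by case: l => [|c l] //=; rewrite !nfstK !nsndK (gE (x, (c, b))).
Qed.

Lemma leq_size_enc (l : seq A) : size l <= enc l.
Proof.
elim: l => [|a l IH] //=; rewrite ltnS (leq_trans IH) //=; exact: npair_ge2.
Qed.

Lemma comp_foldl (f : X -> B) (g : X * (A * B) -> B) (l : X -> seq A) :
  comp f -> comp g -> comp l ->
  comp (fun x => foldl (fun b a => g (x, (a, b))) (f x) (l x)).
Proof.
move=> fP gP lP; have [h [hP hE]] := cf_dec_step gP.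
have [i [iP iE]] : comp (fun x => (x, (l x, f x))).
  by apply: comp_pair; [exact: comp_id | exact: comp_pair].
have hc : comp h by exists h.
(* The code of a list bounds its length, so [enc (l x)] iterations exhaust the list; the length
   itself need not be known to be computable yet. *)
have [j [jP jE]] : comp (fun x => nsnd (nsnd (natrec (enc (x, (l x, f x)))
   (fun m r => h r) (enc (l x))))).
  have H := comp_natrec (g := fun z : nat * (nat * X) => h z.2.1)
    (comp_enc (comp_pair comp_id (comp_pair lP fP))) _ (comp_enc lP).
  by do 2 apply: comp_nsnd; apply: H; exact: (comp_comp hc (comp_fst (comp_snd comp_id))).
exists j; split=> // x; rewrite jE.
set F := fun b a => g (x, (a, b)).
have E n : natrec (enc (x, (l x, f x))) (fun m r => h r) n =
    enc (x, (drop n (l x), foldl F (f x) (take n (l x)))); last first.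
  rewrite E drop_oversize ?take_oversize ?leq_size_enc //.
  rewrite -[enc (x, _)]/(npair (enc x) (npair 0 (enc (foldl F (f x) (l x))))).
  by rewrite !nsndK.
elim: n => [|n IH]; first by rewrite /= take0 drop0.
rewrite -[natrec _ _ _.+1]/(h (natrec _ _ n)) IH.
rewrite -[enc (x, _)]/(npair (enc x) (npair (enc (drop n (l x))) (enc (foldl F (f x) (take n (l x)))))).
rewrite hE -[RHS]/(npair (enc x) (npair (enc (drop n.+1 (l x))) (enc (foldl F (f x) (take n.+1 (l x)))))).
rewrite -addn1 addnC -drop_drop drop1; congr (npair _ (npair _ (enc _))).
rewrite addnC takeD foldl_cat; by case: (drop n (l x)) => //= a s; rewrite take0.
Qed.

End CompFold.

Section Comp3.
Context {X A B : Type} {EX : encodable X} {EA : encodable A} {EB : encodable B}.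

Lemma comp_p1 : comp (fun z : X * A => z.1). Proof. exact: comp_fst comp_id. Qed.
Lemma comp_p2 : comp (fun z : X * A => z.2). Proof. exact: comp_snd comp_id. Qed.

Lemma comp_rev (l : X -> seq A) : comp l -> comp (fun x => rev (l x)).
Proof.
move=> lP.
have H := comp_foldl (g := fun z : X * (A * seq A) => z.2.1 :: z.2.2) (comp_const [::]) _ lP.
apply: comp_ext (H _ _) => [x|].
  rewrite -[rev _]cats0; elim: (l x) [::] => [|a s IH] r //=.
  by rewrite IH rev_cons cat_rcons.
exact: comp_cons (comp_fst (comp_snd comp_id)) (comp_snd (comp_snd comp_id)).
Qed.

Lemma comp_foldr (f : X -> B) (g : X * (A * B) -> B) (l : X -> seq A) :
  comp f -> comp g -> comp l ->
  comp (fun x => foldr (fun a b => g (x, (a, b))) (f x) (l x)).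
Proof.
move=> fP gP lP; have [h [hP hE]] := comp_rev lP.
have hl : comp (fun x => rev (l x)) by exists h.
by apply: comp_ext (comp_foldl fP gP hl) => x; rewrite foldl_rev.
Qed.
End Comp3.

Section Comp4.
Context {X A B : Type} {EX : encodable X} {EA : encodable A} {EB : encodable B}.

Lemma comp_all (g : X * A -> bool) (l : X -> seq A) :
  comp g -> comp l -> comp (fun x => all (fun a => g (x, a)) (l x)).
Proof.
move=> gP lP.
have H := comp_foldr (g := fun z : X * (A * bool) => g (z.1, z.2.1) && z.2.2) (comp_const true) _ lP.
apply: comp_ext (H _ _) => [x|]; first by elim: (l x) => [|a s IH] //=; rewrite IH.
apply: comp_and (comp_snd (comp_snd comp_id)).
exact: comp_comp gP (comp_pair (comp_fst comp_id) (comp_fst (comp_snd comp_id))).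
Qed.

Lemma comp_has (g : X * A -> bool) (l : X -> seq A) :
  comp g -> comp l -> comp (fun x => has (fun a => g (x, a)) (l x)).
Proof.
move=> gP lP.
have H := comp_foldr (g := fun z : X * (A * bool) => g (z.1, z.2.1) || z.2.2) (comp_const false) _ lP.
apply: comp_ext (H _ _) => [x|]; first by elim: (l x) => [|a s IH] //=; rewrite IH.
apply: comp_or (comp_snd (comp_snd comp_id)).
exact: comp_comp gP (comp_pair (comp_fst comp_id) (comp_fst (comp_snd comp_id))).
Qed.

Lemma comp_size (l : X -> seq A) : comp l -> comp (fun x => size (l x)).
Proof.
move=> lP.
have H := comp_foldr (g := fun z : X * (A * nat) => z.2.2.+1) (comp_const 0) _ lP.
apply: comp_ext (H _ _) => [x|]; first by elim: (l x) => [|a s IH] //=; rewrite IH.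
exact: comp_succ (comp_snd (comp_snd comp_id)).
Qed.

Lemma comp_cat (l m : X -> seq A) : comp l -> comp m -> comp (fun x => l x ++ m x).
Proof.
move=> lP mP.
have H := comp_foldr (g := fun z : X * (A * seq A) => z.2.1 :: z.2.2) mP _ lP.
apply: comp_ext (H _) => [x|]; first by elim: (l x) => [|a s IH] //=; rewrite IH.
exact: comp_cons (comp_fst (comp_snd comp_id)) (comp_snd (comp_snd comp_id)).
Qed.

Lemma comp_iota (n : X -> nat) : comp n -> comp (fun x => iota 0 (n x)).
Proof.
move=> nP.
have H := comp_natrec (g := fun z : nat * (seq nat * X) => z.1 :: z.2.1) (comp_const [::]) _ nP.
apply: comp_ext (comp_rev (H _ _)) => [x|].
  elim: (n x) => [|k IH] //.
  by rewrite -[in RHS](addn1 k) iotaD -IH cats1 -rev_cons.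
exact: comp_cons (comp_fst comp_id) (comp_fst (comp_snd comp_id)).
Qed.

End Comp4.

Section Comp5.
Context {X A B : Type} {EX : encodable X} {EA : encodable A} {EB : encodable B}.

Lemma comp_behead (l : X -> seq A) : comp l -> comp (fun x => behead (l x)).
Proof.
have gP : comp (fun z : seq A * (A * nat) => z.2.2) by exact: comp_snd (comp_snd comp_id).
move=> [l' [lP lE]]; exists (fun x => nsnd (l' x).-1); split.
  apply: (cf_comp (f := nsnd)); first exact: cf_nsnd.
  apply: (cf_comp (f := predn)) => //.
  by apply/cf_rc; exact: (rc_cf2 cf2_pred (@rc_proj 1 0 isT) (@rc_proj 1 0 isT)).
move=> x; rewrite lE; case: (l x) => [|a s] //=; exact: nsndK.
Qed.

End Comp5.

Section Comp6.
Context {X A B : Type} {EX : encodable X} {EA : encodable A} {EB : encodable B}.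

Lemma comp_drop (n : X -> nat) (l : X -> seq A) : comp n -> comp l ->
  comp (fun x => drop (n x) (l x)).
Proof.
move=> nP lP.
have H := comp_natrec (g := fun z : nat * (seq A * X) => behead z.2.1) lP _ nP.
apply: comp_ext (H _) => [x|].
  by elim: (n x) => [|k IH] /=; rewrite ?drop0 // IH -drop1 drop_drop.
exact: comp_behead (comp_fst (comp_snd comp_id)).
Qed.

Lemma comp_headn (l : X -> seq A) (d : X -> A) : comp d -> comp l -> comp (fun x => head (d x) (l x)).
Proof.
move=> dP lP.
have H := comp_foldr (g := fun z : X * (A * A) => z.2.1) dP _ lP.
by apply: comp_ext (H (comp_fst (comp_snd comp_id))) => x; case: (l x).
Qed.

Lemma comp_nth (d : X -> A) (n : X -> nat) (l : X -> seq A) : comp d -> comp n -> comp l ->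
  comp (fun x => nth (d x) (l x) (n x)).
Proof.
move=> dP nP lP; apply: comp_ext (comp_headn dP (comp_drop nP lP)) => x.
by rewrite -nth0 nth_drop addn0.
Qed.

Lemma comp_take (n : X -> nat) (l : X -> seq A) : comp n -> comp l ->
  comp (fun x => take (n x) (l x)).
Proof.
move=> nP lP; apply: comp_ext (comp_rev (comp_drop (comp_sub (comp_size lP) nP) (comp_rev lP))) => x.
rewrite drop_rev revK.
case: (leqP (n x) (size (l x))) => h; first by rewrite subKn.
by rewrite (eqP (ltnW h : _ - _ == 0)) subn0 take_size take_oversize // ltnW.
Qed.

Lemma comp_mem (f : X -> nat) (l : X -> seq nat) : comp f -> comp l -> comp (fun x => f x \in l x).
Proof.
move=> fP lP.
have H := comp_has (g := fun z : X * nat => z.2 == f z.1) _ lP.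
apply: comp_ext (H _) => [x|]; first by rewrite -has_pred1.
by apply: comp_eqn; [exact: comp_snd comp_id | exact: comp_comp fP (comp_fst comp_id)].
Qed.

End Comp6.

Section Search.
Context {X Y : Type} {EX : encodable X} {EY : encodable Y}.

Lemma comp_mu (p : X * nat -> bool) : encodes_all X -> comp p ->
  (forall x, exists n, p (x, n)) -> exists h : X -> nat, comp h /\ forall x, p (x, h x).
Proof.
move=> hX pP pE; exists (fun x => ex_minn (pE x)); split; last by move=> x; case: ex_minnP.
have [f [fP fE]] : comp (fun z : nat * X => if p (z.2, z.1) then 0 else 1).
  apply: comp_if; try exact: comp_const.
  exact: comp_comp pP (comp_pair (comp_snd comp_id) (comp_fst comp_id)).
exists (fun n => ex_minn (pE (dec n))); split; last by move=> x; rewrite encK.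
apply: (cf_mu fP) => n; have F m : f (npair m n) = if p (dec n, m) then 0 else 1.
  by rewrite -{1}(hX n) (fE (m, dec n)).
case: ex_minnP => m pm mmin; split=> [|j jm]; rewrite F ?pm //.
by case: ifP => // /mmin; rewrite leqNgt jm.
Qed.

End Search.

Lemma comp_search {X Y : Type} {EX : encodable X} {EY : encodable Y} (p : X * Y -> bool) :
  encodes_all X -> encodes_all Y -> comp p ->
  (forall x, exists y, p (x, y)) -> exists h : X -> Y, comp h /\ forall x, p (x, h x).
Proof.
move=> hX hY pP pE.
have [h [hP hE]] := @comp_mu X _ (fun z => p (z.1, dec z.2)) hX
  (comp_comp pP (comp_pair (comp_fst comp_id) (comp_dec hY (comp_snd comp_id))))
  (fun x => match pE x with ex_intro y py =>
      ex_intro _ (enc y) (eq_ind_r (fun t => p (x, t)) py (encK y)) end).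
exists (fun x => dec (h x)); split; last by move=> x; exact: hE.
exact: comp_dec.
Qed.

Lemma comp_pred {X} {EX : encodable X} (f : X -> nat) : comp f -> comp (fun x => (f x).-1).
Proof.
by move=> fP; apply: comp_ext (comp_sub fP (comp_const 1)) => x; rewrite subn1.
Qed.

Ltac ct1 := lazymatch goal with
  | |- comp (fun x => x) => exact: comp_id
  | |- comp (fun x => (_ , _)) => apply: comp_pair
  | |- comp (fun x => fst _) => apply: comp_fst
  | |- comp (fun x => snd _) => apply: comp_snd
  | |- comp (fun x => if _ then _ else _) => apply: comp_if
  | |- comp (fun x => (_).+1) => apply: comp_succ
  | |- comp (fun x => (_).-1) => apply: comp_pred
  | |- comp (fun x => _ + _) => apply: comp_add
  | |- comp (fun x => _ - _) => apply: comp_sub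
  | |- comp (fun x => npair _ _) => apply: comp_npair
  | |- comp (fun x => nfst _) => apply: comp_nfst
  | |- comp (fun x => nsnd _) => apply: comp_nsnd
  | |- comp (fun x => _ <= _) => apply: comp_leq
  | |- comp (fun x => ~~ _) => apply: comp_not
  | |- comp (fun x => _ && _) => apply: comp_and
  | |- comp (fun x => _ || _) => apply: comp_or
  | |- comp (fun x => _ ==> _) => apply: comp_imp
  | |- comp fst => exact: comp_p1
  | |- comp snd => exact: comp_p2
  | |- comp (fun x => _ == _) => first [apply: comp_eqn | apply: comp_eqb]
  | |- comp (fun x => minn _ _) => apply: comp_min
  | |- comp (fun x => _ :: _) => apply: comp_cons
  | |- comp (fun x => rev _) => apply: comp_rev
  | |- comp (fun x => size _) => apply: comp_size
  | |- comp (fun x => _ ++ _) => apply: comp_cat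
  | |- comp (fun x => iota 0 _) => apply: comp_iota
  | |- comp (fun x => drop _ _) => apply: comp_drop
  | |- comp (fun x => take _ _) => apply: comp_take
  | |- comp (fun x => behead _) => apply: comp_behead
  | |- comp (fun x => nth _ _ _) => apply: comp_nth
  | |- comp (fun x => head _ _) => apply: comp_headn
  | |- comp (fun x => in_mem _ _) => apply: comp_mem
  | |- comp (fun x => enc _) => apply: comp_enc
  end.
Ltac ct := repeat first [assumption | exact: comp_const | ct1].

(** * Substitution on codes of formulas *)

Lemma term_nested_ind (P : term -> Prop) :
  (forall v, P (TVar v)) ->
  (forall f ts, (forall t, List.In t ts -> P t) -> P (TApp f ts)) -> forall t, P t.
Proof.
move=> hv ha; fix IH 1 => -[v|f ts]; first exact: hv.
apply: ha; elim: ts => [|u ts IHts] t; first by case.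
by move=> /= [<-|]; [exact: (IH u) | exact: IHts].
Qed.

Lemma map_ext_In (A B : Type) (f g : A -> B) (s : seq A) :
  (forall a, List.In a s -> f a = g a) -> map f s = map g s.
Proof.
by elim: s => [|a s IH] //= h; rewrite h; [rewrite IH // => b hb; apply: h; right | left].
Qed.

Lemma flatten_map_In (A : Type) (f : A -> seq nat) (s : seq A) v :
  (v \in flatten (map f s)) <-> exists2 a, List.In a s & v \in f a.
Proof.
elim: s => [|a s IH] /=; first by split=> // -[].
rewrite mem_cat; split.
- move=> /orP[h|/IH [b hb hv]]; [by exists a; [left|] | by exists b; [right|]].
- move=> [b [<- -> //|hb] hv]; apply/orP; right; apply/IH; by exists b.
Qed.

Lemma wf_TApp L f ts : wf_term L (TApp f ts) <->
  [/\ is_fsym L f, size ts = fsym_ar L f & wf_terms L ts].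
Proof.
split=> -[h1 h2 h3]; split=> //; rewrite /wf_terms.
- elim: ts {h2} h3 => [|t ts IH] //= [ht hts] u [<- //|]; exact: IH hts u.
- elim: ts {h2} h3 => [|t ts IH] //= h; split; first by apply: h; left.
  by apply: IH => u hu; apply: h; right.
Qed.

Section Locality.
Variables (L : signature) (M : structure L).

Lemma teval_tvars (r1 r2 : nat -> M) t :
  (forall v, v \in tvars t -> r1 v = r2 v) -> teval r1 t = teval r2 t.
Proof.
elim/term_nested_ind: t => [v|f ts IH] h /=; first by apply: h; rewrite /= inE.
congr sfun; apply: map_ext_In => t ht; apply: IH => // v hv; apply: h => /=.
by apply/flatten_map_In; exists t.
Qed.

Lemma map_teval_tvars (r1 r2 : nat -> M) ts :
  (forall v, v \in flatten (map tvars ts) -> r1 v = r2 v) ->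
  map (teval r1) ts = map (teval r2) ts.
Proof.
move=> h; apply: map_ext_In => t ht; apply: teval_tvars => v hv; apply: h.
by apply/flatten_map_In; exists t.
Qed.

Lemma sat_fv p (r1 r2 : nat -> M) : (forall v, v \in fv p -> r1 v = r2 v) -> sat r1 p -> sat r2 p.
Proof.
suff H : forall r1 r2 : nat -> M, (forall v, v \in fv p -> r1 v = r2 v) -> (sat r1 p <-> sat r2 p).
  by move=> h; rewrite (H _ _ h).
elim: p {r1 r2} => [|t1 t2|r ts|p IH|p IHp q IHq|x p IH] r1 r2 h //=.
- rewrite (teval_tvars (r2 := r2)) ?(@teval_tvars r1 r2 t2) // => v hv; apply: h;
  by rewrite /= mem_cat hv ?orbT.
- by rewrite (map_teval_tvars h).
- by rewrite (IH r1 r2 h).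
- rewrite (IHp r1 r2) ?(IHq r1 r2) // => v hv; apply: h; by rewrite /= mem_cat hv ?orbT.
- split=> -[a ha]; exists a; move: ha; apply IH => v hv; rewrite /upd; case: eqP => // /eqP vx;
  by rewrite h //= mem_filter /= vx hv.
Qed.

Lemma sat_fvE p (r1 r2 : nat -> M) : (forall v, v \in fv p -> r1 v = r2 v) -> (sat r1 p <-> sat r2 p).
Proof. by move=> h; split; apply: sat_fv => // v hv; rewrite h. Qed.

End Locality.

Fixpoint tsubst (s : nat -> nat) (t : term) : term :=
  match t with TVar v => TVar (s v) | TApp f ts => TApp f (map (tsubst s) ts) end.

(** Only literals are ever substituted into, so nothing is bound and capture cannot occur; all other
    formulas get the junk value [FFalse]. *)
Definition asubst (s : nat -> nat) (p : formula) : formula :=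
  match p with
  | FEq t1 t2 => FEq (tsubst s t1) (tsubst s t2)
  | FRel r ts => FRel r (map (tsubst s) ts)
  | _ => FFalse
  end.

Definition lsubst (s : nat -> nat) (p : formula) : formula :=
  if p is FNot q then FNot (asubst s q) else asubst s p.

Lemma lsubst_atomic s p : atomic p -> lsubst s p = asubst s p.
Proof. by case: p. Qed.

Lemma tvars_tsubst s t : tvars (tsubst s t) = map s (tvars t).
Proof.
elim/term_nested_ind: t => [v|f ts IH] //=.
by rewrite map_flatten -!map_comp; congr flatten; apply: map_ext_In => t /IH.
Qed.

Lemma fv_lsubst s p : literal p -> fv (lsubst s p) = map s (fv p).
Proof.
have H q : atomic q -> fv (asubst s q) = map s (fv q).
  case: q => //= [t1 t2|r ts] _; first by rewrite map_cat !tvars_tsubst.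
  rewrite map_flatten -!map_comp; congr flatten; apply: eq_map => t; exact: tvars_tsubst.
move=> [a|[q [-> a]]]; last exact: H.
by rewrite lsubst_atomic // H.
Qed.

Lemma teval_tsubst L (M : structure L) (rho : nat -> M) s t :
  teval rho (tsubst s t) = teval (rho \o s) t.
Proof.
elim/term_nested_ind: t => [v|f ts IH] //=; congr sfun.
by rewrite -map_comp; apply: map_ext_In => t /IH.
Qed.

Lemma sat_lsubst L (M : structure L) (rho : nat -> M) s p : literal p ->
  (sat rho (lsubst s p) <-> sat (rho \o s) p).
Proof.
have H q : atomic q -> sat rho (asubst s q) <-> sat (rho \o s) q.
  case: q => //= [t1 t2|r ts] _; first by rewrite !teval_tsubst.
  by rewrite -map_comp (@eq_map _ _ _ (teval (rho \o s))) // => t /=; rewrite teval_tsubst.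
move=> [a|[q [-> a]]]; last by rewrite /= H.
by rewrite lsubst_atomic // H.
Qed.

Lemma wf_tsubst L s t : wf_term L (tsubst s t) <-> wf_term L t.
Proof.
elim/term_nested_ind: t => [v|f ts IH] //; rewrite [tsubst _ _]/= !wf_TApp size_map.
suff -> : wf_terms L (map (tsubst s) ts) = wf_terms L ts by [].
apply/propext; rewrite /wf_terms; split=> h t ht.
- by apply/IH => //; apply: h; exact: List.in_map.
- by move/List.in_map_iff: ht => [u [<- hu]]; apply/IH => //; exact: h.
Qed.

Lemma wf_lsubst L s p : literal p -> (wf_formula L (lsubst s p) <-> wf_formula L p).
Proof.
have H q : atomic q -> wf_formula L (asubst s q) <-> wf_formula L q.
  case: q => //= [t1 t2|r ts] _; first by rewrite !wf_tsubst.
  rewrite size_map; suff -> : wf_terms L (map (tsubst s) ts) = wf_terms L ts by [].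
  apply/propext; rewrite /wf_terms; split=> h t ht.
  + by apply/(wf_tsubst L s); apply: h; exact: List.in_map.
  + by move/List.in_map_iff: ht => [u [<- hu]]; apply/wf_tsubst; exact: h.
move=> [a|[q [-> a]]]; last exact: H.
by rewrite lsubst_atomic // H.
Qed.

Lemma literal_lsubst s p : literal p -> literal (lsubst s p).
Proof.
have H q : atomic q -> atomic (asubst s q) by case: q.
move=> [a|[q [-> a]]]; last by right; exists (asubst s q); split=> //; exact: H.
by left; rewrite lsubst_atomic //; exact: H.
Qed.

Section CodeSubst.

(* [r] lists the values already computed, from the argument [n - 1] down to [0]. *)
Definition sub_step (n : nat) (r : seq (nat * nat)) (l : seq nat) : nat * nat :=
  let get i := nth (0, 0) r (n.-1 - i) in
  (if nfst n == 0 then (if nsnd n < size l then npair 0 (nth 0 l (nsnd n)) else npair 2 0)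
   else if nfst n == 1 then npair 1 (npair (nfst (nsnd n)) (get (nsnd (nsnd n))).2) else n,
   if n == 0 then 0 else (npair (get (nfst n.-1)).1 (get (nsnd n.-1)).2).+1).

Definition sub_hist (l : seq nat) (n : nat) : seq (nat * nat) :=
  natrec [::] (fun m r => sub_step m r l :: r) n.

(** A number may be read as the code of a term or as the code of a list of terms, and each reading
    calls the other; one course-of-values recursion therefore carries both results as a pair. A
    variable beyond [l] yields [npair 2 0], which codes no term. *)
Definition tsub n l := (sub_step n (sub_hist l n) l).1.
Definition ssub n l := (sub_step n (sub_hist l n) l).2.

Lemma sub_histP l n i : i < n -> nth (0, 0) (sub_hist l n) (n.-1 - i) = (tsub i l, ssub i l).
Proof.
elim: n i => [|n IH] i //=; rewrite ltnS leq_eqVlt => /orP[/eqP->|lt].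
  by rewrite subnn /= /tsub /ssub; case: sub_step.
have -> : n - i = (n.-1 - i).+1 by lia.
exact: IH.
Qed.

Lemma tsub0 v l : tsub (npair 0 v) l = if v < size l then npair 0 (nth 0 l v) else npair 2 0.
Proof. by rewrite /tsub /= nfstK nsndK. Qed.

Lemma npair1_gt b : b < npair 1 b.
Proof. by rewrite npairE /=; have := tnum_ge b; lia. Qed.

Lemma tsub1 f s l : tsub (npair 1 (npair f s)) l = npair 1 (npair f (ssub s l)).
Proof.
have lt : s < npair 1 (npair f s) by exact: leq_ltn_trans (npair_ge2 f s) (npair1_gt _).
by rewrite /tsub /= !(nfstK, nsndK) /= sub_histP //= !(nfstK, nsndK).
Qed.

Lemma tsub2 n l : 1 < nfst n -> tsub n l = n.
Proof. by rewrite /tsub /=; case: (nfst n) => [|[]]. Qed.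

Lemma ssubS c a l : ssub (npair c a).+1 l = (npair (tsub c l) (ssub a l)).+1.
Proof.
rewrite /ssub [sub_step _ _ _]/sub_step -[(_, _).2]/(npair _ _).+1.
rewrite -[(npair c a).+1.-1]/(npair c a) nfstK nsndK.
have /= -> := @sub_histP l (npair c a).+1 c (npair_ge1 _ _).
by have /= -> := @sub_histP l (npair c a).+1 a (npair_ge2 _ _).
Qed.

Definition asub c l :=
  if nfst c == 1 then npair 1 (npair (tsub (nfst (nsnd c)) l) (tsub (nsnd (nsnd c)) l))
  else if nfst c == 2 then npair 2 (npair (nfst (nsnd c)) (ssub (nsnd (nsnd c)) l))
  else npair 0 0.

Definition lsub c l := if nfst c == 3 then npair 3 (asub (nsnd c) l) else asub c l.

Lemma tsub_code t l : all (fun v => v < size l) (tvars t) ->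
  tsub (code_term t) l = code_term (tsubst (nth 0 l) t).
Proof.
elim/term_nested_ind: t => [v|f ts IH]; first by rewrite /= andbT tsub0 => ->.
rewrite [tvars _]/= => h; rewrite [code_term _]/= tsub1 /=; congr (npair 1 (npair f _)).
elim: ts IH h => [|t ts IHts] IH //=; rewrite all_cat => /andP[h1 h2].
by rewrite ssubS IH ?IHts //; [move=> u hu; apply: IH; right | left].
Qed.

Lemma ssub_code ts l : all (fun v => v < size l) (flatten (map tvars ts)) ->
  ssub (code_seq (map code_term ts)) l = code_seq (map code_term (map (tsubst (nth 0 l)) ts)).
Proof.
elim: ts => [|t ts IHts] //=; rewrite all_cat => /andP[h1 h2].
by rewrite ssubS tsub_code ?IHts.
Qed.

Lemma lsub_code p l : literal p -> all (fun v => v < size l) (fv p) ->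
  lsub (code_formula p) l = code_formula (lsubst (nth 0 l) p).
Proof.
have H q : atomic q -> all (fun v => v < size l) (fv q) ->
    lsub (code_formula q) l = code_formula (asubst (nth 0 l) q) /\
    asub (code_formula q) l = code_formula (asubst (nth 0 l) q).
  case: q => //= [t1 t2|r ts] _; rewrite /lsub /asub !(nfstK, nsndK) /= ?(nfstK, nsndK) /=.
    by rewrite all_cat => /andP[h1 h2]; rewrite !tsub_code.
  by move=> h; rewrite ssub_code.
move=> [a|[q [-> a]]] h; first by rewrite (H _ a h).1 lsubst_atomic.
by rewrite /lsub /= !(nfstK, nsndK) /= (H _ a h).2.
Qed.

(** Substitution makes no codes out of non-codes: unknown tags are copied, and a variable out of
    range turns into [npair 2 0]. Without this converse a number that codes no literal might be sent
    to the code of a true one, and [truth] would disagree with [tr]. The bound [k] carries the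
    strong induction. *)
Lemma sub_inv l k :
  (forall n t', n < k -> tsub n l = code_term t' ->
     exists t, [/\ n = code_term t, all (fun v => v < size l) (tvars t) & t' = tsubst (nth 0 l) t]) /\
  (forall n ts', n < k -> ssub n l = code_seq (map code_term ts') ->
     exists ts, [/\ n = code_seq (map code_term ts), all (fun v => v < size l) (flatten (map tvars ts))
       & ts' = map (tsubst (nth 0 l)) ts]).
Proof.
elim: k => [|k [IHt IHs]]; first by split.
split=> n.
- move=> t' nk; rewrite -(npairK n) in nk *.
  move: (nfst n) (nsnd n) nk => {n} a b nk.
  case: a nk => [|[|a]] nk; last 1 first.
  + rewrite tsub2 ?nfstK //; case: t' => [v|f ts] /(congr1 nfst) /=; by rewrite !nfstK.
  + rewrite tsub0; case: ifP => h; last first.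
      by case: t' => [v|f ts] /(congr1 nfst) /=; rewrite !nfstK.
    case: t' => [v|f ts]; last by move/(congr1 nfst); rewrite /= !nfstK.
    by move/(congr1 nsnd); rewrite /= !nsndK => <-; exists (TVar b); rewrite /= h.
  + rewrite -(npairK b) in nk *; move: (nfst b) (nsnd b) nk => {b} f s nk.
    rewrite tsub1; case: t' => [v|f' ts']; first by move/(congr1 nfst); rewrite /= !nfstK.
    move/(congr1 nsnd); rewrite /= !nsndK => e.
    move: (congr1 nfst e) (congr1 nsnd e); rewrite !nfstK !nsndK => <- /IHs [].
      rewrite ltnS in nk; apply: leq_trans nk.
      exact: leq_ltn_trans (npair_ge2 f s) (npair1_gt _).
    by move=> ts [-> h ->]; exists (TApp f ts).
- case: n => [|n] ts' nk; first by case: ts' => // _; exists [::].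
  rewrite -(npairK n) in nk *; move: (nfst n) (nsnd n) nk => {n} c a nk.
  rewrite ssubS; case: ts' => [|t' ts'] //= [] e.
  move: (congr1 nfst e) (congr1 nsnd e); rewrite !nfstK !nsndK => /IHt [|t [-> h1 ->]].
    by apply: leq_ltn_trans (npair_ge1 c a) _.
  move=> /IHs [|ts [-> h2 ->]]; first by apply: leq_ltn_trans (npair_ge2 c a) _.
  by exists (t :: ts); rewrite /= all_cat h1.
Qed.

Lemma lsub_inv c l p' : literal p' -> lsub c l = code_formula p' ->
  exists p, [/\ code_formula p = c, literal p, all (fun v => v < size l) (fv p)
    & p' = lsubst (nth 0 l) p].
Proof.
have A d q' : atomic q' -> asub d l = code_formula q' ->
    exists q, [/\ code_formula q = d, atomic q, all (fun v => v < size l) (fv q)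
    & q' = asubst (nth 0 l) q].
  have dE := npairK d; have bE := npairK (nsnd d); rewrite /asub; case: eqP => [d1|_].
    case: q' => // [t1 t2|r ts] _; last by move/(congr1 nfst); rewrite /= !nfstK.
    move/(congr1 nsnd); rewrite /= !nsndK => e.
    move: (congr1 nfst e) (congr1 nsnd e); rewrite !nfstK !nsndK.
    move=> /((sub_inv l (nfst (nsnd d)).+1).1 _ _ (ltnSn _)) [u1 [e1 h1 ->]].
    move=> /((sub_inv l (nsnd (nsnd d)).+1).1 _ _ (ltnSn _)) [u2 [e2 h2 ->]].
    by exists (FEq u1 u2); rewrite /= all_cat h1; split=> //; rewrite -e1 -e2 bE -d1 dE.
  case: eqP => [d2|_]; last by case: q' => // [t1 t2|r ts] _ /(congr1 nfst); rewrite /= !nfstK.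
  case: q' => // [t1 t2|r ts] _; first by move/(congr1 nfst); rewrite /= !nfstK.
  move/(congr1 nsnd); rewrite /= !nsndK => e.
  move: (congr1 nfst e) (congr1 nsnd e); rewrite !nfstK !nsndK => <-.
  move=> /((sub_inv l (nsnd (nsnd d)).+1).2 _ _ (ltnSn _)) [us [e2 h2 ->]].
  by exists (FRel (nfst (nsnd d)) us); split=> //; rewrite /= -e2 bE -d2 dE.
rewrite /lsub; case: eqP => [c3|c3] lit.
- case: lit => [|[q' [-> aq]]]; first by case: p' => //= [t1 t2|r ts] _ /(congr1 nfst); rewrite !nfstK.
  move/(congr1 nsnd); rewrite /= !nsndK => /(A _ _ aq) [q [e1 aq' h ->]].
  by exists (FNot q); split=> //=; [rewrite e1 -c3 npairK | right; exists q].
- case: lit => [a|[q' [-> aq]] /=]; last first.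
    by rewrite /asub; case: ifP => _; [|case: ifP => _] => /(congr1 nfst); rewrite !nfstK.
  move=> /(A _ _ a) [q [e1 aq h ->]]; exists q; split=> //; first by left.
  by rewrite lsubst_atomic.
Qed.

End CodeSubst.

Lemma comp_sub_step : comp (fun z : nat * (seq (nat * nat) * seq nat) => sub_step z.1 z.2.1 z.2.2).
Proof. by rewrite /sub_step; ct. Qed.

Lemma comp_sub_hist : comp (fun z : nat * seq nat => sub_hist z.2 z.1).
Proof.
apply: (comp_natrec (g := fun y : nat * (seq (nat * nat) * (nat * seq nat)) =>
   sub_step y.1 y.2.1 y.2.2.2 :: y.2.1)); ct.
exact: (comp_comp comp_sub_step (f := fun y : nat * (seq (nat * nat) * (nat * seq nat)) =>
   (y.1, (y.2.1, y.2.2.2)))) ltac:(ct).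
Qed.

Section CompSub.
Context {X : Type} {EX : encodable X}.

Lemma comp_sub2 (n : X -> nat) (l : X -> seq nat) : comp n -> comp l ->
  comp (fun x => sub_step (n x) (sub_hist (l x) (n x)) (l x)).
Proof.
move=> nP lP.
have hP : comp (fun x => sub_hist (l x) (n x)) by exact: comp_comp comp_sub_hist (comp_pair nP lP).
exact: comp_comp comp_sub_step (comp_pair nP (comp_pair hP lP)).
Qed.

Lemma comp_tsub (n : X -> nat) (l : X -> seq nat) : comp n -> comp l ->
  comp (fun x => tsub (n x) (l x)).
Proof. by move=> nP lP; exact: comp_fst (comp_sub2 nP lP). Qed.

Lemma comp_ssub (n : X -> nat) (l : X -> seq nat) : comp n -> comp l ->
  comp (fun x => ssub (n x) (l x)).
Proof. by move=> nP lP; exact: comp_snd (comp_sub2 nP lP). Qed.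

Lemma comp_asub (n : X -> nat) (l : X -> seq nat) : comp n -> comp l ->
  comp (fun x => asub (n x) (l x)).
Proof.
by move=> nP lP; rewrite /asub; ct; first [apply: comp_tsub; ct | apply: comp_ssub; ct].
Qed.

Lemma comp_lsub (n : X -> nat) (l : X -> seq nat) : comp n -> comp l ->
  comp (fun x => lsub (n x) (l x)).
Proof.
by move=> nP lP; rewrite /lsub; ct; apply: comp_asub; ct.
Qed.
End CompSub.

Lemma recursive_set_comp (A : nat -> Prop) : recursive_set A <-> comp (fun n => `[< A n >]).
Proof.
split=> -[c cP].
  exists (fun n => enc `[< A n >]); split=> //; exists c => n.
  by have [h1 h2] := cP n; case: asboolP => h /=; auto.
case: cP => -[d dP] cE; exists d => n; have := dP n; rewrite (cE n) /=.
by case: asboolP.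
Qed.

(** * Literals at tuples, and the atomic diagram as an oracle *)

Definition agree (A : Type) (rho : nat -> A) (l : seq A) := map rho (iota 0 (size l)) = l.

Lemma agree_nth (A : Type) (d : A) (l : seq A) : agree (nth d l) l.
Proof. by rewrite /agree map_nth_iota0 // take_size. Qed.

Lemma agreeE (A : Type) (rho : nat -> A) l d v : agree rho l -> v < size l -> rho v = nth d l v.
Proof. by move=> <-; rewrite size_map size_iota => h; rewrite (nth_map 0) ?size_iota ?nth_iota. Qed.

Definition below (k : nat) (p : formula) := all (fun v => v < k) (fv p).

Lemma sat_agree L (M : structure L) (r1 r2 : nat -> M) (l : seq M) p : agree r1 l -> agree r2 l ->
  below (size l) p -> sat r1 p -> sat r2 p.
Proof.
move=> a1 a2 /allP b; apply: sat_fv => v /b h.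
by rewrite (agreeE (r1 0) a1 h) (agreeE (r1 0) a2 h).
Qed.

(** The quantifier-free type of a tuple, one literal code at a time, with variable [i] standing for
    entry [i]. A literal with a variable beyond the tuple counts as false, and so does its
    negation. *)
Definition tr L (M : structure L) (c : nat) (l : seq M) : Prop :=
  exists p, [/\ code_formula p = c, literal p, wf_formula L p, below (size l) p &
    forall rho : nat -> M, agree rho l -> sat rho p].

Section RecursiveDiagram.
Variables (L : signature) (N : structure L) (iota : N -> nat).
Hypothesis hN : recursive_structure iota.

(** The counterpart of [tr] on names: once names are substituted for the variables, the question is
    a single instance of the recursive atomic diagram. *)
Definition truth (c : nat) (l : seq nat) : bool :=
  `[< exists p, [/\ literal p, wf_formula L p, (forall v, v \in fv p -> exists s, iota s = v),
        code_formula p = lsub c l &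
        forall rho : nat -> N, (forall s, rho (iota s) = s) -> sat rho p] >].

Lemma comp_truth {X} {EX : encodable X} (c : X -> nat) (l : X -> seq nat) : comp c -> comp l ->
  comp (fun x => truth (c x) (l x)).
Proof.
move=> cP lP; case: hN => _ /recursive_set_comp H; exact: comp_comp H (comp_lsub cP lP).
Qed.

Lemma truthP c (l : seq N) : truth c (map iota l) <-> tr c l.
Proof.
have [inj _] := hN.
split=> [/asboolP [p' [lit wf rng e satp]]|[p [e lit wf b satp]]].
- have [p [e1 lp b e2]] := lsub_inv lit (esym e); subst p'.
  rewrite size_map in b.
  exists p; split=> //; first by move: wf; rewrite wf_lsubst.
  move=> rho ag.
  (* The diagram speaks of valuations that invert [iota] on its range; off the range the value
     [rho 0] is arbitrary. *)
  have [d dP] : exists rho' : nat -> N, forall s, rho' (iota s) = s.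
    exists (fun v => match pselect (exists s, iota s = v) with
      | left h => projT1 (cid h) | right _ => rho 0 end) => s.
    case: pselect => [h|[]]; last by exists s.
    by case: cid => s' /= /inj.
  have := satp _ dP; rewrite sat_lsubst //; apply: sat_fv => v /(allP b) hv.
  by rewrite /= (nth_map (rho 0)) // dP (agreeE (rho 0) ag hv).
- apply/asboolP; exists (lsubst (nth 0 (map iota l)) p); split.
  + exact: literal_lsubst.
  + by rewrite wf_lsubst.
  + rewrite fv_lsubst // => v /mapP [w /(allP b) hw ->].
    case: l b satp hw => [|d l] // b satp hw.
    by exists (nth d (d :: l) w); rewrite (nth_map d).
  + by rewrite -e lsub_code // size_map.
  + move=> rho hr; rewrite sat_lsubst //.
    have := satp (nth (rho 0) l) (agree_nth _ _); apply: sat_fv => v /(allP b) hv.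
    by rewrite /= (nth_map (rho 0)) // hr.
Qed.

Definition inN (x : nat) : bool := `[< exists s, iota s = x >].

(** The diagram admits only variables that are names, so [x] is a name exactly when the equation of
    the variable [x] with itself belongs to the diagram. *)
Lemma comp_inN {X} {EX : encodable X} (f : X -> nat) : comp f -> comp (fun x => inN (f x)).
Proof.
move=> fP; case: hN => inj /recursive_set_comp H.
have H2 : comp (fun x => code_formula (FEq (TVar (f x)) (TVar (f x)))) by rewrite /=; ct.
apply: comp_ext (comp_comp H H2) => x; apply: asbool_equiv_eq; split.
- move=> [p [lit wf rng e _]]; apply: rng.
  case: p {lit wf} e => [|t1 t2|r ts|p|p q|v p] /= e; move: (congr1 nfst e); rewrite !nfstK //.
  move: (congr1 nfst (congr1 nsnd e)); rewrite !(nfstK, nsndK).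
  by case: t1 {e} => [v|g ts] /= e; move: (congr1 nfst e) (congr1 nsnd e);
    rewrite !(nfstK, nsndK) // => _ ->; rewrite inE eqxx.
- move=> [s e]; exists (FEq (TVar (f x)) (TVar (f x))); split=> //; first by left.
  by move=> v; rewrite !inE orbb => /eqP ->; exists s.
Qed.

End RecursiveDiagram.

(** * A finite injury construction *)

Lemma comp_uniq {X} {EX : encodable X} (l : X -> seq nat) : comp l -> comp (fun x => uniq (l x)).
Proof.
move=> lP.
have H := comp_foldr (g := fun z : X * (nat * (seq nat * bool)) =>
   (z.2.1 :: z.2.2.1, (z.2.1 \notin z.2.2.1) && z.2.2.2)) (comp_const ([::], true)) _ lP.
apply: comp_ext (comp_snd (H _ _)) => [x|]; last by rewrite /=; ct.
suff -> : foldr (fun a b => ((x, (a, b)).2.1 :: (x, (a, b)).2.2.1,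
   ((x, (a, b)).2.1 \notin (x, (a, b)).2.2.1) && (x, (a, b)).2.2.2)) ([::], true) (l x)
   = (l x, uniq (l x)) by [].
by elim: (l x) => //= a s ->.
Qed.

Section Priority.
Variables (V : nat -> bool) (T : nat -> seq nat -> bool) (H : nat -> Prop)
          (g : nat * nat -> bool) (P : nat -> seq nat).
Hypothesis Vc : comp V.
Hypothesis Tc : comp (fun z : nat * seq nat => T z.1 z.2).
Hypothesis gc : comp g.
Hypothesis Pc : comp P.
Hypothesis HV : forall x, H x -> V x.
Hypothesis g_lim : forall x, V x -> exists u0, forall u, u0 <= u -> g (u, x) = `[< H x >].
Hypothesis P_sub : forall u u', u <= u' -> {subset P u <= P u'}.
Hypothesis gP : forall u x, x \in P u -> g (u, x).
Hypothesis T_rcons : forall c l y, all V l -> V y -> c < size l -> T c (rcons l y) = T c l.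
Hypothesis H_inf : forall a : seq nat, exists2 y, H y & y \notin a.
(** The model-theoretic input, supplied later by [move_codes]: all errors can be repaired at once.
    The entries in [K] stay, everything else is brought into [H], and one chosen wrong entry even
    into some [P u], while no literal already decided changes. *)
Hypothesis move : forall f (K : nat -> bool) q, all V f -> uniq f ->
  (forall i, i < size f -> K i -> H (nth 0 f i)) ->
  exists a, [/\ size a = size f, uniq a, (forall x, x \in a -> H x),
    (forall c, c < size f -> T c f = T c a) &
    (forall i, i < size f -> K i -> nth 0 a i = nth 0 f i) /\
    (q < size f -> ~~ K q -> ~ H (nth 0 f q) -> exists u, nth 0 a q \in P u)].

(* From stage [u0] with the finite sequence [f], search for a later stage [u],
   a sequence [a] one entry longer that agrees with [f] on all literals of code
   less than [size f], and the least priority [q] of an entry of [f] that now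
   looks outside [H].  Entry [i] has priority [minn i (nth 0 f i)]; entries of
   priority less than [q] are kept, the entry at position [q] is replaced by an
   element of [P u], which never has to be replaced again, and the freed last
   position goes to the next element of [H] that has no place yet. *)
Definition admissible_step (z : (nat * seq nat) * (nat * (seq nat * nat))) : bool :=
  let u0 := z.1.1 in let f := z.1.2 in let s := size f in
  let u := z.2.1 in let a := z.2.2.1 in let q := z.2.2.2 in
  [&& (u0 <= u) && (s <= u), size a == s.+1, all (fun x => V x && g (u, x)) a, uniq a,
    all (fun c => T c f == T c a) (iota 0 s), q <= s,
    all (fun j => g (u, nth 0 f j) || (q <= minn j (nth 0 f j))) (iota 0 s),
    (q == s) || has (fun j => ~~ g (u, nth 0 f j) && (minn j (nth 0 f j) == q)) (iota 0 s),
    all (fun i => (minn i (nth 0 f i) < q) ==> (nth 0 a i == nth 0 f i)) (iota 0 s),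
    ((q < s) && ~~ g (u, nth 0 f q)) ==> (nth 0 a q \in P u)
  & [&& V (nfst s), g (u, nfst s) & nfst s \notin take s a] ==> (nth 0 a s == nfst s)].

Definition valid (x : nat * seq nat) := all V x.2 && uniq x.2.

Lemma comp_valid : comp (fun x : nat * seq nat => valid x).
Proof.
apply: comp_and; last by apply: comp_uniq; ct.
apply: (comp_all (g := fun z : (nat * seq nat) * nat => V z.2)); last by ct.
exact: comp_comp Vc comp_p2.
Qed.

Lemma comp_acc : comp admissible_step.
Proof.
pose Z := ((nat * seq nat) * (nat * (seq nat * nat)))%type.
have gg (X : Type) (EX : encodable X) (a b : X -> nat) : comp a -> comp b ->
    comp (fun x => g (a x, b x)).
  by move=> aP bP; exact: comp_comp gc (comp_pair aP bP).
have VV (X : Type) (EX : encodable X) (a : X -> nat) : comp a -> comp (fun x => V (a x)).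
  by move=> aP; exact: comp_comp Vc aP.
have TT (X : Type) (EX : encodable X) (a : X -> nat) (b : X -> seq nat) : comp a -> comp b ->
    comp (fun x => T (a x) (b x)).
  by move=> aP bP; exact: comp_comp Tc (comp_pair aP bP).
have PP (X : Type) (EX : encodable X) (a : X -> nat) : comp a -> comp (fun x => P (a x)).
  by move=> aP; exact: comp_comp Pc aP.
rewrite /admissible_step; repeat apply: comp_and; try by [ct].
- apply: (comp_all (g := fun z : Z * nat => V z.2 && g (z.1.2.1, z.2))); last by ct.
  by apply: comp_and; [apply: VV | apply: gg]; ct.
- by apply: comp_uniq; ct.
- apply: (comp_all (g := fun z : Z * nat => T z.2 z.1.1.2 == T z.2 z.1.2.2.1)); last by ct.
  by apply: comp_eqb; apply: TT; ct.
- apply: (comp_all (g := fun z : Z * nat => g (z.1.2.1, nth 0 z.1.1.2 z.2) ||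
     (z.1.2.2.2 <= minn z.2 (nth 0 z.1.1.2 z.2)))); last by ct.
  by apply: comp_or; [apply: gg |]; ct.
- apply: comp_or; first by ct.
  apply: (comp_has (g := fun z : Z * nat => ~~ g (z.1.2.1, nth 0 z.1.1.2 z.2) &&
     (minn z.2 (nth 0 z.1.1.2 z.2) == z.1.2.2.2))); last by ct.
  by apply: comp_and; [apply: comp_not; apply: gg |]; ct.
- apply: (comp_all (g := fun z : Z * nat => (minn z.2 (nth 0 z.1.1.2 z.2) < z.1.2.2.2) ==>
     (nth 0 z.1.2.2.1 z.2 == nth 0 z.1.1.2 z.2))); last by ct.
  by ct.
- apply: comp_imp; first by apply: comp_and; [|apply: comp_not; apply: gg]; ct.
  by apply: comp_mem; [|apply: PP]; ct.
- apply: comp_imp; last by ct.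
  by apply: comp_and; [apply: VV | apply: comp_and; [apply: gg |]]; ct.
Qed.

Lemma settled (l : seq nat) : exists u0, forall u x, u0 <= u -> x \in l -> V x -> g (u, x) = `[< H x >].
Proof.
elim: l => [|y l [u1 IH]]; first by exists 0.
have [u2 h2] : exists u2, forall u, u2 <= u -> V y -> g (u, y) = `[< H y >].
  by case: (boolP (V y)) => [/g_lim [u2 h]|_]; [exists u2 => u /h | exists 0].
exists (maxn u1 u2) => u x; rewrite geq_max => /andP[l1 l2]; rewrite inE => /orP[/eqP->|].
  exact: h2.
exact: IH.
Qed.

Lemma acc_ex x : valid x -> exists y, admissible_step (x, y).
Proof.
case: x => u0 f /andP[/= vf uf]; set s := size f.
have [u1 h1] := settled f.
have memf j : j < s -> nth 0 f j \in f by exact: mem_nth.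
have Vf j : j < s -> V (nth 0 f j) by move=> /memf; exact: (allP vf).
(* The condition that [admissible_step] puts on [q], with the guesses replaced by the truth; [q = s]
   says that no entry is wrong. A repair made according to the truth passes the test at any stage
   where the guesses about the names involved have settled. *)
pose cand q := (q == s) || has (fun j => ~~ `[< H (nth 0 f j) >] && (minn j (nth 0 f j) == q)) (iota 0 s).
have [q qc qmin] := ex_minnP (ex_intro cand s (predU1l _ erefl)).
have KH i : i < s -> minn i (nth 0 f i) < q -> H (nth 0 f i).
  move=> il lt; apply/asboolP; apply: contraLR lt => nh; rewrite -leqNgt; apply: qmin.
  by apply/orP; right; apply/hasP; exists i; rewrite ?mem_iota // nh /=.
have [a [sa ua Ha Ta [Ka Pa]]] := move q vf uf KH.
have [u2 h2] : exists u2, q < s -> ~ H (nth 0 f q) -> nth 0 a q \in P u2.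
  case: (pselect (q < s /\ ~ H (nth 0 f q))) => [[l n]|n]; last by exists 0 => l nh; case: n.
  case: Pa => //; last by move=> u hu; exists u.
  by apply/negP => /KH h; apply: n; apply: h.
pose x := nfst s.
(* The new last entry is the candidate [nfst s] if that lies in [H] and has no place yet, and any
   fresh element of [H] otherwise. *)
have [y [yH ya yx]] : exists y, [/\ H y, y \notin a & H x -> x \notin a -> y = x].
  case: (pselect (H x /\ x \notin a)) => [[hx nx]|n]; first by exists x.
  by have [y hy ny] := H_inf a; exists y; split=> // hx nx; case: n.
have [u3 h3] := settled (x :: rcons a y).
pose u := maxn (maxn u0 s) (maxn u1 (maxn u2 u3)).
have [l0 ls l1 l2 l3] : [/\ u0 <= u, s <= u, u1 <= u, u2 <= u & u3 <= u] by rewrite /u; split; lia.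
exists (u, (rcons a y, q)); rewrite /admissible_step /= -/s l0 ls size_rcons sa eqxx rcons_uniq ya ua /=.
have Hr z : z \in rcons a y -> H z by rewrite mem_rcons inE => /orP[/eqP->|/Ha].
have nthr i : i < s -> nth 0 (rcons a y) i = nth 0 a i by move=> il; rewrite nth_rcons sa il.
have gr z : z \in x :: rcons a y -> H z -> g (u, z).
  by move=> zi hz; rewrite (h3 u z) ?HV //; apply/asboolP.
have memr i : i < s -> nth 0 a i \in x :: rcons a y.
  by move=> il; rewrite inE mem_rcons inE mem_nth ?orbT // sa.
have gf j : j < s -> g (u, nth 0 f j) = `[< H (nth 0 f j) >].
  by move=> jl; apply: h1 => //; [exact: memf | exact: Vf].
repeat (apply/andP; split).
- by apply/allP => z zi; rewrite HV ?gr //; [rewrite inE zi orbT | exact: Hr | exact: Hr].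
- apply/allP => c; rewrite mem_iota add0n => cs; rewrite Ta // T_rcons ?sa ?HV //.
  by apply/allP => z /Ha; exact: HV.
- by apply: qmin; rewrite /cand eqxx.
- apply/allP => j; rewrite mem_iota /= add0n => js; rewrite gf //.
  by case: asboolP => //= nh; rewrite leqNgt; apply/negP => /(KH _ js).
- case/orP: qc => [-> //|/hasP [j]]; rewrite mem_iota /= add0n => js hj.
  by apply/orP; right; apply/hasP; exists j; rewrite ?mem_iota // gf.
- apply/allP => i; rewrite mem_iota /= add0n => il; apply/implyP => /(Ka _ il) <-.
  by rewrite nthr.
- apply/implyP => /andP[qs]; rewrite gf // => /asboolPn nh; rewrite nthr //.
  by apply: (P_sub l2); exact: h2.
- have -> : take s (rcons a y) = a by rewrite -cats1 take_size_cat.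
  rewrite -[nfst s]/x nth_rcons sa ltnn eqxx; apply/implyP => /and3P [vx gx nx].
  apply/eqP; apply: yx => //; apply/asboolP.
  by rewrite -(h3 u x) // inE eqxx.
Qed.

(** Search needs a total specification, so the test is made vacuous on invalid states; the states
    reached from the empty sequence are all valid. *)
Lemma stages : exists st : nat -> nat * seq nat,
  [/\ comp st, st 0 = (0, [::]), forall s, valid (st s) &
   forall s, size (st s).2 = s /\ exists q, admissible_step (st s, ((st s.+1).1, ((st s.+1).2, q)))].
Proof.
have [F [Fc FP]] := @comp_search (nat * seq nat) (nat * (seq nat * nat)) _ _
  (fun z => valid z.1 ==> admissible_step z) _ _ (comp_imp (comp_comp comp_valid comp_p1) comp_acc)
  (fun x => match pselect (valid x) with
            | left v => match acc_ex v with ex_intro y h => ex_intro _ y (introT implyP (fun=> h)) end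
            | right n => ex_intro _ (0, ([::], 0)) (introT implyP (fun v => False_ind _ (n v))) end).
pose nxt x := ((F x).1, (F x).2.1).
pose st s := natrec (0, [::] : seq nat) (fun _ r => nxt r) s.
have stP s : valid (st s) /\ size (st s).2 = s.
  elim: s => [|s [v sz]] //; have := FP (st s); rewrite v /= => /and5P [_ /eqP sz' al un _].
  split; last by rewrite /= sz' sz.
  rewrite /valid /= un andbT; apply/allP => z /(allP al) /andP[] //.
exists st; split=> //.
- have nc : comp nxt by rewrite /nxt; apply: comp_pair; do ?[apply: comp_fst | apply: comp_snd].
  have K := comp_natrec (g := fun z : nat * ((nat * seq nat) * nat) => nxt z.2.1)
    (comp_const (0, [::])) _ (@comp_id nat _).
  apply: K; exact: comp_comp nc (comp_fst comp_p2).
- by move=> s; case: (stP s).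
- move=> s; have [v sz] := stP s; split=> //; exists (F (st s)).2.2.
  by have := FP (st s); rewrite v /=; case: (F (st s)) => u [a q].
Qed.

(** Taking the minimum of position and name as priority serves two ends at once: small positions
    converge, so that the limit [f] exists, and small names keep their place once they have one, so
    that [f] is onto [H]. *)
Lemma priority_limit : exists (f : nat -> nat) (D : nat -> bool),
  [/\ comp D, injective f, forall i, H (f i), (forall x, H x -> exists i, f i = x) &
   forall c, exists l, [/\ c < size l, all V l, (forall i, i <= c -> nth 0 l i = f i) & D c = T c l]].
Proof.
have [st [stc st0 stv stP]] := stages.
pose fs s := (st s).2; pose u s := (st s).1.
have fsz s : size (fs s) = s by case: (stP s).
have fsV s : all V (fs s) by case/andP: (stv s).
have fsU s : uniq (fs s) by case/andP: (stv s).
have u_le s : u s <= u s.+1 by case: (stP s) => _ [q /and5P [/andP[]]].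
have u_mono s s' : s <= s' -> u s <= u s'.
  elim: s' => [|s' IH]; first by case: s.
  by rewrite leq_eqVlt => /orP[/eqP -> //|/IH h]; exact: leq_trans h (u_le s').
have s_le s : s <= u s.+1 by case: (stP s) => sz [q /and5P [/andP[_]]]; rewrite /= sz.
have entry s x : x \in fs s.+1 -> g (u s.+1, x).
  by case: (stP s) => _ [q /and5P [_ _ /allP h _ _]] /h /andP[].
have Tstep s c : c < s -> T c (fs s) = T c (fs s.+1).
  case: (stP s) => sz [q /and5P [_ _ _ _ /andP [/allP h _]]] cs.
  by apply/eqP; apply: h; rewrite /= mem_iota sz.
(* The truth value of the literal [c] is fixed from stage [c.+1] on, possibly long before the
   entries it speaks of converge. This is what makes the diagram of the limit recursive. *)
have Tchain c s : c < s -> T c (fs s) = T c (fs c.+1).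
  elim: s => // s IH; rewrite ltnS leq_eqVlt => /orP[/eqP-> //|cs].
  by rewrite -Tstep // IH.
have qP s : exists q, [/\ q <= s,
    (forall j, j < s -> ~~ g (u s.+1, nth 0 (fs s) j) -> q <= minn j (nth 0 (fs s) j)),
    q < s -> exists j, [/\ j < s, ~~ g (u s.+1, nth 0 (fs s) j) & minn j (nth 0 (fs s) j) = q],
    (forall i, i < s -> minn i (nth 0 (fs s) i) < q -> nth 0 (fs s.+1) i = nth 0 (fs s) i) &
    q < s -> ~~ g (u s.+1, nth 0 (fs s) q) -> nth 0 (fs s.+1) q \in P (u s.+1)].
  case: (stP s) => sz [q]; rewrite /admissible_step /= sz => /and5P [_ _ _ _ /and5P [_ qs a1 a2 /and3P [a3 a4 _]]].
  exists q; split=> //.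
  - move=> j js nj; move/allP: a1 => /(_ j); rewrite mem_iota /= add0n js => /(_ isT).
    by rewrite (negbTE nj).
  - move=> lt; case/orP: a2 => [/eqP e|/hasP [j]]; first by rewrite e ltnn in lt.
    by rewrite mem_iota /= add0n => js /andP[n /eqP e]; exists j.
  - move=> i il lt; move/allP: a3 => /(_ i); rewrite mem_iota /= add0n il => /(_ isT).
    by rewrite lt => /eqP.
  - by move=> lt n; move: a4; rewrite lt n.
have fair s : H (nfst s) -> g (u s.+1, nfst s) -> nfst s \in fs s.+1.
  case: (stP s) => sz [q]; rewrite /admissible_step /= sz => /and5P [_ _ _ _ /and5P [_ _ _ _ /and3P [_ _ a5]]] hx gx.
  move: a5; rewrite HV // gx /=; case: (boolP (nfst s \in take s (st s.+1).2)) => [h _|_ /eqP <-].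
    exact: mem_take h.
  by apply: mem_nth; rewrite -/(fs s.+1) fsz.
pose stable p s0 := forall s, s0 <= s -> [/\ p <= s,
  (forall i, i < p -> nth 0 (fs s) i = nth 0 (fs s0) i /\ H (nth 0 (fs s0) i)) &
  (forall x, x < p -> H x -> exists2 i, i < s & forall s', s <= s' -> nth 0 (fs s') i = x)].
have stableP p : exists s0, stable p s0.
  elim: p => [|p [s0 S0]]; first by exists 0.
  have [u1 h1] := settled (iota 0 p.+1 ++ take p (fs s0)).
  have [ps0 _ _] := S0 s0 (leqnn _).
  pose s1 := (maxn (maxn s0 p) u1).+1.
  have [l0 lp lu] : [/\ s0 < s1, p < s1 & u1 < s1] by rewrite /s1; split; lia.
  have low s x : s1 <= s -> x <= p -> x \in fs s -> H x.
    case: s => // s ls xp xin; have ls' : u1 <= u s.+1.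
      by apply: leq_trans (s_le s); rewrite -ltnS; exact: leq_trans lu ls.
    apply/asboolP; rewrite -(h1 _ _ ls') ?entry //; last exact: (allP (fsV s.+1)).
    by rewrite mem_cat mem_iota /= add0n ltnS xp.
  have ul s : s1 <= s -> u1 <= u s.+1.
    by move=> ls; apply: leq_trans (s_le s); apply: ltnW; exact: leq_trans lu ls.
  (* From [s1] on the guesses are right about the names up to [p] and about the first [p] entries,
     so a suspected entry has position at least [p] and a name above [p]. *)
  have outP s j : s1 <= s -> j < s -> ~~ g (u s.+1, nth 0 (fs s) j) -> p <= j /\ p < nth 0 (fs s) j.
    move=> ls js; have mj : nth 0 (fs s) j \in fs s by rewrite mem_nth ?fsz.
    have vj := allP (fsV s) _ mj.
    move=> nj; split; rewrite leqNgt; apply/negP => lt; move/negP: nj; apply.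
    - have [_ nm _] := S0 s (leq_trans (ltnW l0) ls); have [e hj] := nm j lt.
      rewrite (h1 _ _ (ul _ ls)) //; first by apply/asboolP; rewrite e.
      rewrite mem_cat e; apply/orP; right; rewrite -(nth_take 0 lt) mem_nth //.
      by rewrite size_take fsz; move: lt ps0; case: (ltnP p s0); lia.
    - rewrite ltnS in lt; rewrite (h1 _ _ (ul _ ls)) //; first by apply/asboolP; exact: low ls lt mj.
      by rewrite mem_cat mem_iota /= add0n ltnS lt.
  (* Hence only the entry at position [p] can have priority [p]; as long as that one looks right,
     every injury happens above [p]. *)
  have inq s q : s1 <= s -> (forall j, j < s -> ~~ g (u s.+1, nth 0 (fs s) j) -> q <= minn j (nth 0 (fs s) j)) ->
      (q < s -> exists j, [/\ j < s, ~~ g (u s.+1, nth 0 (fs s) j) & minn j (nth 0 (fs s) j) = q]) ->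
      q <= s -> g (u s.+1, nth 0 (fs s) p) -> p < q.
    move=> ls h2 h3 qs gp; rewrite ltnNge; apply/negP => qp.
    have qs' : q < s by apply: leq_ltn_trans qp _; exact: leq_trans lp ls.
    have [j [js nj e]] := h3 qs'; have [pj pf] := outP s j ls js nj.
    have ej : j = p by move: e qp pj pf; rewrite /minn; case: ifP; lia.
    by rewrite ej gp in nj.
  (* After [s1] the position [p] is injured at most once: the replacement comes from [P], whose
     members never look wrong again. *)
  have [s3 [l3 in3]] : exists s3, s1 <= s3 /\ forall s, s3 <= s -> g (u s.+1, nth 0 (fs s) p).
    case: (pselect (exists s2, s1 <= s2 /\ ~~ g (u s2.+1, nth 0 (fs s2) p))); last first.
      move=> n; exists s1; split=> // s ls; case: (boolP (g _)) => // ng; case: n.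
      by exists s.
    move=> [s2 [l2 n2]]; exists s2.+1; split; first by exact: leq_trans l2 _.
    have [q [qs h2 h3 h4 h5]] := qP s2; have ps2 : p < s2 by exact: leq_trans lp l2.
    have [_ pf] := outP _ _ l2 ps2 n2.
    have qp : q <= p by apply: leq_trans (h2 _ ps2 n2) _; exact: geq_minl.
    have eq : q = p.
      have [j [js nj e]] := h3 (leq_ltn_trans qp ps2); have [pj pfj] := outP s2 j l2 js nj.
      by move: e qp pj pfj; rewrite /minn; case: ifP; lia.
    rewrite eq in h5; have yP := h5 ps2 n2.
    suff K : forall s, s2 < s -> nth 0 (fs s) p = nth 0 (fs s2.+1) p.
      move=> s ls; rewrite K //; apply: gP; apply: P_sub yP; apply: u_mono.
      exact: ltnW.
    elim=> // s IH; rewrite ltnS leq_eqVlt => /orP[/eqP<- //|ls].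
    have ls1 : s1 <= s by apply: leq_trans l2 (ltnW ls).
    have [q' [qs' h2' h3' h4' h5']] := qP s; rewrite h4' ?IH //.
      exact: leq_trans lp ls1.
    apply: leq_ltn_trans (geq_minl _ _) _; apply: inq ls1 h2' h3' qs' _.
    by rewrite IH //; apply: gP; apply: P_sub yP; apply: u_mono; exact: ltnW.
  have keep s i : s3 <= s -> i < s -> minn i (nth 0 (fs s) i) <= p -> nth 0 (fs s.+1) i = nth 0 (fs s) i.
    move=> ls il le; have [q [qs h2 h3 h4 h5]] := qP s; apply: h4 => //.
    by apply: leq_ltn_trans le _; apply: (inq s) => //; [exact: leq_trans l3 ls | exact: in3].
  have keeps s i s' : s3 <= s -> i < s -> minn i (nth 0 (fs s) i) <= p -> s <= s' ->
      nth 0 (fs s') i = nth 0 (fs s) i.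
    move=> ls il le; elim: s' => [|s' IH]; first by rewrite leqn0 => /eqP ->.
    rewrite leq_eqVlt => /orP[/eqP<- //|]; rewrite ltnS => ls'.
    by rewrite keep ?IH //; [exact: leq_trans ls ls' | exact: leq_trans il ls'].
  have p3 : p < s3 by exact: leq_trans lp l3.
  (* The entry no longer changes and looks right at all later stages, in particular when the guess
     about it has reached its limit. *)
  have Hy : H (nth 0 (fs s3) p).
    have [u2 h2] := settled [:: nth 0 (fs s3) p].
    pose s := maxn s3 u2; have [ls lu2] : s3 <= s /\ u2 <= s by rewrite /s; lia.
    have e := keeps s3 p s (leqnn _) p3 (geq_minl _ _) ls.
    apply/asboolP; rewrite -(h2 (u s.+1)) ?inE //.
    - by rewrite -e; exact: in3.
    - exact: leq_trans lu2 (s_le s).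
    - by apply: (allP (fsV s3)); rewrite mem_nth ?fsz.
  have [s5 [l5 el5]] : exists s5, s3 <= s5 /\ (H p -> exists2 i, i < s5 & nth 0 (fs s5) i = p).
    case: (pselect (H p)) => [hp|n]; last by exists s3.
    (* A stage beyond [s3] with candidate [nfst s = p]; the pairing makes every name the candidate
       infinitely often. *)
    pose s := npair p s3; have ls : s3 <= s by exact: npair_ge2.
    have es : nfst s = p by exact: nfstK.
    have gp : g (u s.+1, p).
      rewrite (h1 _ _ (ul _ (leq_trans l3 ls))) ?HV //; first by apply/asboolP.
      by rewrite mem_cat mem_iota /= add0n ltnS leqnn.
    exists s.+1; split=> [|_]; first by exact: leq_trans ls _.
    have := fair s; rewrite es => /(_ hp gp) /(nthP 0) [i]; rewrite fsz => il e.
    by exists i.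
  exists s5 => s ls; split; first by apply: leq_trans p3 _; exact: leq_trans l5 ls.
  - move=> i; rewrite ltnS leq_eqVlt => /orP[/eqP->|ip].
      rewrite (keeps s3 p s) ?(keeps s3 p s5) ?geq_minl //; exact: leq_trans l5 ls.
    have l05 : s0 <= s5 by apply: leq_trans (ltnW l0) _; exact: leq_trans l3 l5.
    have [_ n1 _] := S0 s (leq_trans l05 ls); have [_ n2 _] := S0 s5 l05.
    by have [-> h] := n1 i ip; have [-> _] := n2 i ip.
  - move=> x; rewrite ltnS leq_eqVlt => /orP[/eqP-> hx|xp hx].
      have [i il e] := el5 hx; exists i; first by exact: leq_trans il ls.
      move=> s' ls'; rewrite -[RHS]e; apply: keeps => //; last by exact: leq_trans ls ls'.
      by rewrite e geq_minr.
    have l05 : s0 <= s5 by apply: leq_trans (ltnW l0) _; exact: leq_trans l3 l5.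
    by have [_ _ n1] := S0 s (leq_trans l05 ls); exact: n1.
have [sp spP] : exists sp : nat -> nat, forall p, stable p (sp p).
  by exists (fun p => projT1 (cid (stableP p))) => p; case: cid.
pose f i := nth 0 (fs (sp i.+1)) i.
have fE i s : sp i.+1 <= s -> i < s /\ nth 0 (fs s) i = f i.
  by move=> ls; have [l n _] := spP i.+1 s ls; have [-> _] := n i (leqnn _).
exists f, (fun c => T c (fs c.+1)); split.
- apply: (comp_comp Tc (f := fun c => (c, fs c.+1))); apply: comp_pair; first exact: comp_id.
  exact: comp_snd (comp_comp stc (comp_succ comp_id)).
- move=> i j e; pose s := maxn (sp i.+1) (sp j.+1).
  have [l1 l2] : sp i.+1 <= s /\ sp j.+1 <= s by rewrite /s; lia.
  have [i1 e1] := fE i s l1; have [j1 e2] := fE j s l2.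
  by apply/eqP; rewrite -(nth_uniq 0 _ _ (fsU s)) ?fsz // e1 e2 e.
- by move=> i; have [_ n _] := spP i.+1 _ (leqnn _); have [_ h] := n i (leqnn _).
- move=> x hx; have [_ _ n] := spP x.+1 _ (leqnn _); have [i il e] := n x (leqnn _) hx.
  exists i; pose s := maxn (sp i.+1) (sp x.+1).
  have [l1 l2] : sp i.+1 <= s /\ sp x.+1 <= s by rewrite /s; lia.
  by rewrite -(fE i s l1).2 e.
- move=> c; pose s := maxn c.+1 (\max_(i < c.+1) sp i.+1); have cs : c < s by rewrite /s; lia.
  exists (fs s); split=> //; [by rewrite fsz | | by rewrite Tchain].
  move=> i ic; have ls : sp i.+1 <= s.
    by apply: leq_trans (leq_maxr _ _); exact: (leq_bigmax (Ordinal (ic : i < c.+1))).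
  exact: (fE i s ls).2.
Qed.

End Priority.

(** * Uniformly definable predicates *)

(** Here quantifiers do occur. Capture is avoided by moving each bound variable above the images of
    all variables free in its scope. *)
Fixpoint ren (s : nat -> nat) (p : formula) : formula :=
  match p with
  | FFalse => FFalse
  | FEq t1 t2 => FEq (tsubst s t1) (tsubst s t2)
  | FRel r ts => FRel r (map (tsubst s) ts)
  | FNot q => FNot (ren s q)
  | FAnd q1 q2 => FAnd (ren s q1) (ren s q2)
  | FEx x q => let z := (foldr maxn 0 (map s (fv q))).+1 in FEx z (ren (upd s x z) q)
  end.

Lemma leq_foldr_maxn s v : v \in s -> v <= foldr maxn 0 s.
Proof. by elim: s => //= a s IH; rewrite inE => /orP[/eqP->|/IH]; lia. Qed.

Lemma ren_sat L (M : structure L) p s (rho : nat -> M) : sat rho (ren s p) <-> sat (rho \o s) p.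
Proof.
elim: p s rho => [|t1 t2|r ts|p IH|p IHp q IHq|x p IH] s rho //=.
- by rewrite !teval_tsubst.
- by rewrite -map_comp (@eq_map _ _ _ (teval (rho \o s))) // => t /=; rewrite teval_tsubst.
- by rewrite IH.
- by rewrite IHp IHq.
- split=> -[a ha]; exists a; move: ha; rewrite IH; apply: sat_fv => v hv;
  rewrite /upd /=; case: (v == x); rewrite ?eqxx //; case: eqP => // e;
  have := @leq_foldr_maxn (map s (fv p)) (s v) (map_f _ hv); rewrite e ltnn //.
Qed.

Lemma wf_map_tsubst L s ts : wf_terms L ts -> wf_terms L (map (tsubst s) ts).
Proof. by move=> h t /List.in_map_iff [u [<- hu]]; apply/wf_tsubst; exact: h. Qed.

Lemma ren_wf L p s : wf_formula L p -> wf_formula L (ren s p).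
Proof.
elim: p s => [|t1 t2|r ts|p IH|p IHp q IHq|x p IH] s //=.
- by rewrite !wf_tsubst.
- by rewrite size_map => -[h1 h2 /wf_map_tsubst h3].
- exact: IH.
- by move=> [h1 h2]; split; [exact: IHp | exact: IHq].
- exact: IH.
Qed.

Lemma ren_fv p s : {subset fv (ren s p) <= map s (fv p)}.
Proof.
elim: p s => [|t1 t2|r ts|p IH|p IHp q IHq|x p IH] s //=.
- by rewrite map_cat !tvars_tsubst.
- move=> v; rewrite map_flatten -!map_comp (@eq_map _ _ _ (map s \o tvars)) // => t /=.
  by rewrite tvars_tsubst.
- move=> v; rewrite map_cat !mem_cat => /orP[/IHp -> //|/IHq ->]; by rewrite orbT.
- move=> v; rewrite mem_filter => /andP[/= nz /IH /mapP [w wp e]].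
  apply/mapP; exists w; last by move: e nz; rewrite /upd; case: eqP => // _ ->; rewrite eqxx.
  by rewrite mem_filter wp /= andbT; apply: contraNneq nz => wx; rewrite e /upd wx eqxx.
Qed.

(** Subtuple by positions. It goes through [onth] because no default element is at hand when one
    definition has to make sense in all structures. *)
Definition sel (A : Type) (l : seq A) (s : seq nat) : seq A := pmap (onth l) s.

Lemma onth_nth' (A : Type) (d : A) (l : seq A) i : i < size l -> onth l i = Some (nth d l i).
Proof. by elim: l i => [|a l IH] [|i] //=; exact: IH. Qed.

Lemma sel_nth (A : Type) (d : A) (l : seq A) s : all (fun i => i < size l) s -> sel l s = map (nth d l) s.
Proof.
by elim: s => //= i s IH /andP[il al]; rewrite /sel /= (onth_nth' d) //= -/(sel l s) IH.
Qed.

Lemma size_sel (A : Type) (l : seq A) s : all (fun i => i < size l) s -> size (sel l s) = size s.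
Proof.
case: l => [|d l] al; first by case: s al.
by rewrite (sel_nth d) // size_map.
Qed.

Lemma In_nth (A : Type) (l : seq A) a : List.In a l -> exists2 i, i < size l & onth l i = Some a.
Proof.
elim: l => //= b l IH [->|/IH [i il e]]; first by exists 0.
by exists i.+1.
Qed.

Lemma onth_In (A : Type) (l : seq A) i a : onth l i = Some a -> List.In a l.
Proof. by elim: l i => [|b l IH] [|i] //= => [[->]|/IH]; [left | right]. Qed.

Lemma InP (A : eqType) (x : A) (s : seq A) : List.In x s <-> x \in s.
Proof.
elim: s => //= a s IH; rewrite inE; split; first by move=> [->|/IH ->]; rewrite ?eqxx ?orbT.
by move=> /orP[/eqP ->|/IH]; [left | right].
Qed.

Lemma In_iota i m n : List.In i (iota m n) <-> m <= i < m + n.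
Proof. by rewrite InP mem_iota. Qed.

Lemma In_rcons (A : Type) (l : seq A) a b : List.In b (rcons l a) <-> List.In b l \/ b = a.
Proof.
rewrite -cats1; split=> [/List.in_app_iff [h|[->|[]]]|h]; [by left | by right |].
by apply/List.in_app_iff; case: h => [h|->]; [left | right; left].
Qed.

Lemma agree_rcons (A : Type) (rho : nat -> A) l a k : size l = k -> agree rho l ->
  agree (upd rho k a) (rcons l a).
Proof.
move=> sl ag; rewrite /agree size_rcons -addn1 iotaD map_cat /= add0n sl /upd eqxx cats1.
congr rcons; rewrite -[RHS]ag sl; apply/eq_in_map => i; rewrite mem_iota /= add0n.
by case: eqP => // ->; rewrite ltnn.
Qed.

Lemma sel_cat (A : Type) (l : seq A) s t : sel l (s ++ t) = sel l s ++ sel l t.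
Proof. exact: pmap_cat. Qed.

Lemma sel_succ (A : Type) (a : A) (l : seq A) s : sel (a :: l) (map S s) = sel l s.
Proof. by elim: s => //= i s; rewrite /sel /= => ->. Qed.

Lemma iotaS m n : iota m.+1 n = map S (iota m n).
Proof. by rewrite -add1n iotaDl. Qed.

Lemma sel_iota (A : Type) (l1 l2 l3 : seq A) : sel (l1 ++ l2 ++ l3) (iota (size l1) (size l2)) = l2.
Proof.
elim: l1 => [|a l1 IH] /=; last by rewrite iotaS sel_succ.
elim: l2 => // a l2 IH.
rewrite -[LHS]/(a :: sel (a :: l2 ++ l3) (iota 1 (size l2))) iotaS sel_succ.
by congr cons; exact: IH.
Qed.

Lemma sel_rcons_some (A : Type) (l : seq A) s i a : onth l i = Some a ->
  sel l (rcons s i) = rcons (sel l s) a.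
Proof. by move=> e; rewrite -!cats1 sel_cat {2}/sel /pmap e. Qed.

Lemma onth_last (A : Type) (l : seq A) a : onth (rcons l a) (size l) = Some a.
Proof. by rewrite -cats1 onth_cat ltnn subnn. Qed.

Lemma onth_rcons_lt (A : Type) (l : seq A) a i : i < size l -> onth (rcons l a) i = onth l i.
Proof. by move=> il; rewrite -cats1 onth_cat il. Qed.

Lemma sel_rcons_lt (A : Type) (l : seq A) a s : all (fun i => i < size l) s ->
  sel (rcons l a) s = sel l s.
Proof.
elim: s => // i s IH /andP[il al].
by rewrite -(cat1s i s) !sel_cat IH // /sel /pmap onth_rcons_lt.
Qed.

Lemma sel_self (A : Type) (l : seq A) : sel l (iota 0 (size l)) = l.
Proof. by have := sel_iota [::] l [::]; rewrite cats0. Qed.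

Lemma all_iota_lt n k : n <= k -> all (fun i => i < k) (iota 0 n).
Proof. by move=> nk; apply/allP => i; rewrite mem_iota add0n => /leq_trans; exact. Qed.

Section Definable.
Variable L : signature.
Implicit Types (k : nat) (F G : forall M : structure L, seq M -> Prop).

(* [F] ranges over families of relations, one on each structure, so that one
   formula defines them all and can be transported between models. *)
Definition Def k F := exists p, [/\ wf_formula L p, below k p &
  forall (M : structure L) (l : seq M) (rho : nat -> M), size l = k -> agree rho l -> (F M l <-> sat rho p)].

Lemma Def_ext k F G : (forall (M : structure L) (l : seq M), size l = k -> (F M l <-> G M l)) -> Def k F -> Def k G.
Proof.
by move=> h [p [wf b e]]; exists p; split=> // M l rho sl ag; rewrite -h // (e M l rho).
Qed.

Lemma Def_not k F : Def k F -> Def k (fun M l => ~ F M l).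
Proof. by move=> [p [wf b e]]; exists (FNot p); split=> // M l rho sl ag /=; rewrite (e M l rho). Qed.

Lemma Def_and k F G : Def k F -> Def k G -> Def k (fun M l => F M l /\ G M l).
Proof.
move=> [p [wf b e]] [q [wf' b' e']]; exists (FAnd p q); split=> //=.
  by rewrite /below /= all_cat; apply/andP.
by move=> M l rho sl ag; rewrite (e M l rho) // (e' M l rho).
Qed.

Lemma Def_false k : Def k (fun M l => False).
Proof. by exists FFalse. Qed.

Lemma Def_true k : Def k (fun M l => True).
Proof. by apply: Def_ext (Def_not (Def_false k)) => M l _; split=> // _ h. Qed.

Lemma Def_or k F G : Def k F -> Def k G -> Def k (fun M l => F M l \/ G M l).
Proof.
move=> hF hG; apply: Def_ext (Def_not (Def_and (Def_not hF) (Def_not hG))) => M l _.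
split=> [h|[h|h] [h1 h2]] //.
by case: (pselect (F M l)) => hf; [left | right; apply: contrapT => hg; apply: h].
Qed.

Lemma Def_imp k F G : Def k F -> Def k G -> Def k (fun M l => F M l -> G M l).
Proof.
move=> hF hG; apply: Def_ext (Def_not (Def_and hF (Def_not hG))) => M l _.
by split=> [h hf|h [hf hg]]; [apply: contrapT => hg; apply: h | apply: hg; exact: h].
Qed.

Lemma Def_cst k (P : Prop) : Def k (fun M l => P).
Proof.
case: (pselect P) => h; [apply: Def_ext (Def_true k)|apply: Def_ext (Def_false k)] => M l _;
by split.
Qed.

Lemma Def_ex k F : Def k.+1 F -> Def k (fun M l => exists a, F M (rcons l a)).
Proof.
move=> [p [wf b e]]; exists (FEx k p); split=> //.
  apply/allP => v; rewrite /= mem_filter => /andP[/= nk /(allP b)].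
  by rewrite ltnS leq_eqVlt (negbTE nk).
move=> M l rho sl ag /=; split=> -[a ha]; exists a; move: ha;
by rewrite (e M (rcons l a) (upd rho k a)) ?size_rcons ?sl //; exact: agree_rcons.
Qed.

Lemma Def_forall k F : Def k.+1 F -> Def k (fun M l => forall a, F M (rcons l a)).
Proof.
move=> hF; apply: Def_ext (Def_not (Def_ex (Def_not hF))) => M l _.
by split=> [h a|h [a]]; [apply: contrapT => ha; apply: h; exists a | exact].
Qed.

Lemma Def_sel k k' F s : Def k F -> size s = k -> all (fun i => i < k') s ->
  Def k' (fun M l => F M (sel l s)).
Proof.
move=> [p [wf b e]] ss al; exists (ren (nth 0 s) p); split.
- exact: ren_wf.
- apply/allP => v /ren_fv /mapP [w /(allP b) wk ->].
  by apply: (allP al); rewrite mem_nth // ss.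
- move=> M l rho sl ag; rewrite ren_sat; apply: e; first by rewrite size_sel // sl.
  rewrite /agree size_sel ?sl // (sel_nth (rho 0)) ?sl // -{3}(take_size s) -(map_nth_iota0 0) //.
  rewrite -map_comp; apply/eq_in_map => i; rewrite mem_iota /= add0n => il.
  by apply: agreeE => //; rewrite sl; apply: (allP al); rewrite mem_nth.
Qed.

Lemma Def_all k (I : Type) (r : seq I) (F : I -> forall M : structure L, seq M -> Prop) :
  (forall i, List.In i r -> Def k (F i)) -> Def k (fun M l => forall i, List.In i r -> F i M l).
Proof.
elim: r => [|i r IH] h; first by apply: Def_ext (Def_true k) => M l _; split.
apply: Def_ext (Def_and (h i (or_introl erefl)) (IH (fun j hj => h j (or_intror hj)))) => M l _.
by split=> [[h1 h2] j [<-|hj]|hj]; [| exact: h2 | split=> [|j jr]; apply: hj; [left | right]].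
Qed.

Lemma Def_has k (I : Type) (r : seq I) (F : I -> forall M : structure L, seq M -> Prop) :
  (forall i, List.In i r -> Def k (F i)) -> Def k (fun M l => exists2 i, List.In i r & F i M l).
Proof.
move=> h; apply: Def_ext (Def_not (Def_all (fun i hi => Def_not (h i hi)))) => M l _.
split=> [n|[i ir fi] hi]; last exact: hi _ ir fi.
by apply: contrapT => ne; apply: n => i ir fi; apply: ne; exists i.
Qed.

Lemma Def_eq k i j : i < k -> j < k -> Def k (fun M l => onth l i = onth l j).
Proof.
move=> ik jk; exists (FEq (TVar i) (TVar j)); split=> //; first by rewrite /below /= ik jk.
move=> M l rho sl ag /=; rewrite !(onth_nth' (rho 0)) ?sl //.
rewrite (agreeE (rho 0) ag (v := i)) ?sl // (agreeE (rho 0) ag (v := j)) ?sl //.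
by split=> [[->]|->].
Qed.

Lemma Def_exs k j F : Def (k + j) F -> Def k (fun M l => exists2 s, size s = j & F M (l ++ s)).
Proof.
elim: j k F => [|j IH] k F hF.
  rewrite addn0 in hF; apply: Def_ext hF => M l _; split=> [h|[s]]; first by exists [::]; rewrite ?cats0.
  by move=> /size0nil ->; rewrite cats0.
rewrite -addSnnS in hF; apply: Def_ext (Def_ex (IH _ _ hF)) => M l _.
split=> [[a [s sj h]]|[[//|a s] [sj] h]].
  by exists (a :: s); rewrite /= ?sj // -cat_rcons.
by exists a; exists s; rewrite // cat_rcons.
Qed.

(** Quantifying over all valuations that extend the tuple avoids choosing one, which would need an
    element of the structure. *)
Definition hold (p : formula) : forall M : structure L, seq M -> Prop :=
  fun M l => forall rho : nat -> M, agree rho l -> sat rho p.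

Lemma Def_hold k p : wf_formula L p -> below k p -> Def k (hold p).
Proof.
move=> wf b; exists p; split=> // M l rho sl ag; split=> [h|h r ag']; first exact: h.
by apply: (sat_agree ag ag' _ h); rewrite sl.
Qed.

Definition atmost (A : Type) (m : nat) (S : A -> Prop) : Prop :=
  exists2 s, size s <= m & forall a, S a -> List.In a s.

Lemma finite_atmost (A : Type) (S : A -> Prop) : finite_set S <-> exists m, atmost m S.
Proof. by split=> [[s h]|[m [s _ h]]]; [exists (size s); exists s | exists s]. Qed.

Lemma Def_atmost k m F : Def k.+1 F -> Def k (fun M l => atmost m (fun a => F M (rcons l a))).
Proof.
move=> hF.
(* The [j] entries after the first [k] list the solutions, and the entry at position [k + j] is
   tested against the list; [j] runs over all lengths up to [m], as [atmost] allows shorter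
   lists. *)
pose G j (M : structure L) (l : seq M) :=
  F M (sel l (rcons (iota 0 k) (k + j))) -> exists2 i, List.In i (iota k j) & onth l i = onth l (k + j).
have hG j : Def (k + j).+1 (G j).
  apply: Def_imp.
    apply: Def_sel hF _ _; first by rewrite size_rcons size_iota.
    rewrite all_rcons ltnS leqnn; apply/allP => i; rewrite mem_iota /= add0n; lia.
  apply: Def_has => i; rewrite In_iota => h; apply: Def_eq; lia.
apply: Def_ext (Def_has (r := iota 0 m.+1) (fun j _ => Def_exs (Def_forall (hG j)))) => M l sl.
have E (s : seq M) a : G (size s) M (rcons (l ++ s) a) <-> (F M (rcons l a) -> List.In a s).
  have lt i : i < size s -> onth (rcons (l ++ s) a) (k + i) = onth s i.
    move=> il; rewrite -cats1 -catA onth_cat sl ltnNge leq_addr /= addKn onth_cat il //.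
  have la : onth (rcons (l ++ s) a) (k + size s) = Some a.
    by rewrite -cats1 onth_cat size_cat sl ltnn subnn.
  rewrite /G -[rcons (iota 0 k) _]cats1 sel_cat.
  have -> : sel (rcons (l ++ s) a) (iota 0 k) = l.
    by have := sel_iota [::] l (s ++ [:: a]); rewrite -cats1 /= sl catA.
  rewrite la /sel /= la /= cats1.
  split=> h hf.
  - have [i /In_iota /andP [i1 i2]] := h hf.
    have -> : i = k + (i - k) by lia.
    rewrite lt; [exact: onth_In | lia].
  - have [i il e] := In_nth (h hf); exists (k + i); last by rewrite lt.
    by apply/In_iota; lia.
split=> [[j /In_iota h [s sj hs]]|[s sm h]].
  by exists s; [rewrite sj; lia | move=> a; apply/E; rewrite sj].
exists (size s); first by apply/In_iota; lia.
by exists s => // a; apply/E; exact: h.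
Qed.

End Definable.

(** * Algebraic closure and dimension *)

Section Finite.
Variable A : Type.
Implicit Types S : A -> Prop.

Lemma finite_sub S1 S2 : (forall a, S1 a -> S2 a) -> finite_set S2 -> finite_set S1.
Proof. by move=> h [l hl]; exists l => a /h /hl. Qed.

Lemma finite_or S1 S2 : finite_set S1 -> finite_set S2 -> finite_set (fun a => S1 a \/ S2 a).
Proof.
move=> [l1 h1] [l2 h2]; exists (l1 ++ l2) => a [/h1 h|/h2 h]; apply/List.in_app_iff; [by left | by right].
Qed.

Lemma finite_bigor (I : Type) (r : seq I) (S : I -> A -> Prop) :
  (forall i, List.In i r -> finite_set (S i)) -> finite_set (fun a => exists2 i, List.In i r & S i a).
Proof.
elim: r => [|i r IH] h; first by exists [::] => a [].
have [l hl] := finite_or (h i (or_introl erefl)) (IH (fun j hj => h j (or_intror hj))).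
exists l => a [j [<-|jr] hj]; apply: hl; first by left.
by right; exists j.
Qed.

Lemma infinite_list S m : ~ finite_set S ->
  exists s, [/\ List.NoDup s, size s = m & forall a, List.In a s -> S a].
Proof.
move=> nf; elim: m => [|m [s [nd sz h]]]; first by exists [::]; split=> //; constructor.
have [a [Sa na]] : exists a, S a /\ ~ List.In a s.
  apply: contrapT => n; apply: nf; exists s => a Sa; apply: contrapT => na; apply: n.
  by exists a.
exists (a :: s); split=> //=; [by constructor | by rewrite sz | by move=> b [<- //|/h]].
Qed.

Lemma atmost_size S m s : atmost m S -> List.NoDup s -> (forall a, List.In a s -> S a) -> size s <= m.
Proof.
move=> [t tm ht] nd h; apply: leq_trans tm; apply/leP.
by apply: List.NoDup_incl_length => // a /h /ht.
Qed.

Lemma In_split_rem (s : seq A) b : List.In b s ->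
  exists2 t, size s = (size t).+1 & forall a, List.In a s -> a <> b -> List.In a t.
Proof.
move=> h; have [t1 [t2 ->]] := List.in_split _ _ h.
exists (t1 ++ t2); first by rewrite !size_cat /= addnS.
move=> a ha ab; apply/List.in_app_iff; case/List.in_app_iff: ha => [|[e|]]; [by left | | by right].
by case: ab.
Qed.

Lemma atmost_rem S m b : atmost m.+1 S -> S b -> atmost m (fun a => S a /\ a <> b).
Proof.
move=> [s sm h] Sb; have [t st ht] := In_split_rem (h b Sb).
by exists t => [|a [/h /ht]]; [rewrite st in sm | apply].
Qed.

Lemma atmost0 S a : atmost 0 S -> ~ S a.
Proof. by move=> [s]; rewrite leqn0 => /nilP -> h Sa; case: (h a Sa). Qed.

End Finite.

Section Closure.
Variables (L : signature) (M : structure L).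
Implicit Types (A B : M -> Prop) (l : seq M) (a b : M).

Lemma acl_mono A B a : (forall y, A y -> B y) -> acl A a -> acl B a.
Proof. by move=> AB [p [x [rho [wf h f s]]]]; exists p, x, rho; split=> // y yp yx; apply: AB; exact: h. Qed.

Lemma acl_finchar A a : acl A a -> exists l, (forall y, List.In y l -> A y) /\ acl (in_list l) a.
Proof.
move=> [p [x [rho [wf h f s]]]]; exists (map rho (filter (predC1 x) (fv p))); split.
  move=> y /List.in_map_iff [v [<- hv]]; have : v \in filter (predC1 x) (fv p).
    elim: (filter _ _) hv => //= w r IH [->|/IH]; rewrite inE ?eqxx // => ->; exact: orbT.
  by rewrite mem_filter => /andP[/= vx vp]; exact: h.
exists p, x, rho; split=> // y yp yx; apply/List.in_map_iff; exists y; split=> //.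
have : y \in filter (predC1 x) (fv p) by rewrite mem_filter /= yx.
by elim: (filter _ _) => //= w r IH; rewrite inE => /orP[/eqP ->|/IH]; [left | right].
Qed.

(** The parameters of an algebraic formula become coordinates of a uniformly definable relation,
    which can then be taken to other tuples and other models. *)
Lemma acl_listP l a : acl (in_list l) a <->
  exists F, [/\ Def (size l).+1 F, finite_set (fun b => F M (rcons l b)) & F M (rcons l a)].
Proof.
split=> [[p [x [rho [wf h f s]]]]|[F [[p [wf b e]] f Fa]]].
- have pos v : exists i, v \in fv p -> v != x -> i < size l /\ onth l i = Some (rho v).
    case: (boolP (v \in fv p)) => vp; last by exists 0.
    case: (boolP (v != x)) => vx; last by exists 0.
    by have [i il e] := In_nth (h v vp vx); exists i.
  have [pf pfP] := choice pos.
  pose s' v := if v == x then size l else pf v.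
  have s'P v : v \in fv p -> v != x -> s' v < size l /\ onth l (s' v) = Some (rho v).
    by move=> vp vx; rewrite /s' (negbTE vx); exact: pfP.
  have E c : hold (ren s' p) (rcons l c) <-> sat (upd rho x c) p.
    have K r : agree r (rcons l c) -> sat r (ren s' p) <-> sat (upd rho x c) p.
      move=> ag; rewrite ren_sat; apply: sat_fvE => v vp /=; rewrite /upd.
      case: (boolP (v == x)) => vx.
        rewrite /s' vx (agreeE c ag) ?size_rcons // nth_rcons ltnn eqxx //.
      have [il e] := s'P v vp vx; rewrite (agreeE c ag) ?size_rcons ?ltnS 1?ltnW //.
      by rewrite nth_rcons il; exact: onth_nth.
    split=> [hh|hs r ag]; last by rewrite K.
    by rewrite -K; [apply: hh|]; exact: (agree_nth c (rcons l c)).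
  exists (hold (ren s' p)); split; last by apply/E.
    apply: Def_hold; first exact: ren_wf.
    apply/allP => v /ren_fv /mapP [w wp ->]; case: (boolP (w == x)) => wx; first by rewrite /s' wx.
    by rewrite ltnS ltnW //; case: (s'P w wp wx).
  by apply: finite_sub f => c /E.
- exists p, (size l), (nth a l).
  have E c : F M (rcons l c) <-> defset (nth a l) (size l) p c.
    by apply: e; rewrite ?size_rcons //; apply: agree_rcons => //; exact: agree_nth.
  split=> //; last by apply/E.
  + move=> y /(allP b); rewrite ltnS leq_eqVlt => /orP[->//|yl _].
    by apply: (onth_In (i := y)); exact: onth_nth'.
  + by apply: finite_sub f => c /E.
Qed.

Lemma acl_refl A a : A a -> acl A a.
Proof.
move=> Aa; apply: (acl_mono (A := in_list [:: a])) => [y [<-//|[]]|].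
apply/acl_listP; exists (fun (M' : structure L) (t : seq M') => onth t 0 = onth t 1); split=> //; first exact: (Def_eq L (k := 2)).
by exists [:: a] => b /= [->]; left.
Qed.

(** The new formula says that some [c] satisfies [S], that [x] satisfies [R] over [c], and that [R]
    has at most [m] solutions over [c]. The bound has to be part of it, because [R] may have
    infinitely many solutions over the other solutions [c] of [S]. *)
Lemma acl_trans1 l a b : acl (in_list l) b -> acl (in_list (rcons l b)) a -> acl (in_list l) a.
Proof.
move=> /acl_listP [S [dS fS Sb]] /acl_listP [R [dR fR Ra]]; apply/acl_listP.
have [m hm] := (finite_atmost _).1 fR; rewrite size_rcons in dR.
exists (fun (M' : structure L) (t : seq M') => let k := size l in exists c, S M' (sel (rcons t c) (rcons (iota 0 k) k.+1)) /\
   (R M' (sel (rcons t c) (rcons (rcons (iota 0 k) k.+1) k)) /\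
    atmost m (fun x => R M' (sel (rcons (rcons t c) x) (rcons (rcons (iota 0 k) k.+1) k.+2))))).
have al n : all (fun i => i < size l + n) (iota 0 (size l)).
  by apply/allP => i; rewrite mem_iota; lia.
have sz0 : size (iota 0 (size l)) = size l by rewrite size_iota.
have ai n : size l <= n -> all (fun i => i < n) (iota 0 (size l)) by exact: all_iota_lt.
have E c x : sel (rcons (rcons l x) c) (rcons (iota 0 (size l)) (size l).+1) = rcons l c.
  rewrite (@sel_rcons_some _ _ _ _ c); last by rewrite -(size_rcons l x) onth_last.
  by rewrite !sel_rcons_lt ?sel_self ?size_rcons ?ai.
have E2 c x : sel (rcons (rcons l x) c) (rcons (rcons (iota 0 (size l)) (size l).+1) (size l)) =
    rcons (rcons l c) x.
  by rewrite (@sel_rcons_some _ _ _ _ x) ?E // onth_rcons_lt ?size_rcons // onth_last.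
have E3 c x y : sel (rcons (rcons (rcons l x) c) y) (rcons (rcons (iota 0 (size l)) (size l).+1) (size l).+2) =
    rcons (rcons l c) y.
  rewrite (@sel_rcons_some _ _ _ _ y); last first.
    have -> : (size l).+2 = size (rcons (rcons l x) c) by rewrite !size_rcons.
    exact: onth_last.
  by rewrite sel_rcons_lt ?E // ?all_rcons !size_rcons ltnSn ai // leqW.
split.
- apply: (Def_ex (F := fun (M' : structure L) (t : seq M') => S M' (sel t (rcons (iota 0 (size l)) (size l).+1)) /\
   (R M' (sel t (rcons (rcons (iota 0 (size l)) (size l).+1) (size l))) /\
    atmost m (fun x => R M' (sel (rcons t x) (rcons (rcons (iota 0 (size l)) (size l).+1) (size l).+2)))))).
  apply: Def_and.
    by apply: Def_sel dS _ _; rewrite ?size_rcons ?sz0 // all_rcons ai ?ltnSn //; lia.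
  apply: Def_and.
    by apply: Def_sel dR _ _; rewrite ?size_rcons ?sz0 // !all_rcons ai ?ltnSn //; lia.
  apply: (@Def_atmost L _ m (fun (M' : structure L) (t : seq M') => R M' (sel t (rcons (rcons (iota 0 (size l)) (size l).+1) (size l).+2)))).
  by apply: Def_sel dR _ _; rewrite ?size_rcons ?sz0 // !all_rcons ai ?ltnSn //; lia.
- have [s hs] := fS.
  apply: finite_sub (finite_bigor (r := s) (S := fun c x => R M (rcons (rcons l c) x) /\
     atmost m (fun x => R M (rcons (rcons l c) x))) _).
    move=> x /= [c []]; rewrite E E2 => Sc [Rcx am]; exists c; first exact: hs.
    split=> //; case: am => t tm ht; exists t => // y hy; apply: ht; by rewrite E3.
  move=> c _; case: (pselect (atmost m (fun x => R M (rcons (rcons l c) x)))) => [am|n].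
    by apply: finite_sub ((finite_atmost _).2 (ex_intro _ m am)) => x [].
  by exists [::] => x [_ /n].
- exists b; rewrite E E2; split=> //; split=> //.
  by case: hm => t tm ht; exists t => // y; rewrite E3; exact: ht.
Qed.

Lemma acl_trans_list l l' a : (forall y, List.In y l' -> acl (in_list l) y) ->
  acl (in_list (l ++ l')) a -> acl (in_list l) a.
Proof.
elim/last_ind: l' => [|l' b IH] h; first by rewrite cats0.
rewrite -rcons_cat => h2; apply: IH; first by move=> y hy; apply: h; apply/In_rcons; left.
have hb : acl (in_list l) b by apply: h; apply/In_rcons; right.
apply: acl_trans1 h2; apply: acl_mono hb => y hy.
by apply/List.in_app_iff; left.
Qed.

Lemma acl_trans A a : acl (acl A) a -> acl A a.
Proof.
move=> /acl_finchar [l' [h ha]].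
suff [l [hl hl']] : exists l, (forall y, List.In y l -> A y) /\ forall y, List.In y l' -> acl (in_list l) y.
  apply: (acl_mono hl); apply: (acl_trans_list hl'); apply: acl_mono ha => y hy.
  by apply/List.in_app_iff; right.
elim: l' h {ha} => [|b l' IH] h; first by exists [::].
have [l [h1 h2]] := IH (fun y hy => h y (or_intror hy)).
have [l2 [h3 h4]] := acl_finchar (h b (or_introl erefl)).
exists (l ++ l2); split=> y; first by move/List.in_app_iff => [/h1|/h3].
by move=> [<-|/h2]; [move: h4|]; apply: acl_mono => x hx; apply/List.in_app_iff; [right | left].
Qed.

Lemma acl_sub A B a : (forall y, A y -> acl B y) -> acl A a -> acl B a.
Proof. by move=> h ha; apply: acl_trans; exact: acl_mono ha. Qed.

End Closure.

Lemma in_list_cat L (M : structure L) (l1 l2 : seq M) y :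
  in_list (l1 ++ l2) y <-> in_list l1 y \/ in_list l2 y.
Proof. exact: List.in_app_iff. Qed.

(** * The pregeometry of a strongly minimal theory *)

Section Minimal.
Variables (L : signature) (T : formula -> Prop).
Hypothesis hsm : strongly_minimal L T.
Variable M : structure L.
Hypothesis hM : is_model T M.
Implicit Types (A B S : M -> Prop) (l b c : seq M) (a x y : M).

Lemma model_infinite : ~ finite_set (fun _ : M => True).
Proof. by have [] := hsm hM. Qed.

Lemma definable_dichotomy l F : Def (size l).+1 F ->
  finite_set (fun a => F M (rcons l a)) \/ finite_set (fun a => ~ F M (rcons l a)).
Proof.
move=> [p [wf _ e]]; have [[d] _] := hM; have [_ h] := hsm hM.
have E (c : M) : F M (rcons l c) <-> defset (nth d l) (size l) p c.
  by apply: e; rewrite ?size_rcons //; apply: agree_rcons => //; exact: agree_nth.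
by case: (h p (nth d l) (size l) wf) => f; [left | right]; apply: finite_sub f => c; rewrite E.
Qed.

(** If [b] were not algebraic over [l] and [a], then [G] would hold of [a] with all but [m]
    elements, for some [m]. As [a] is not algebraic over [l], infinitely many [x] share this
    property. Any [n.+1] of them have a common partner [y], over which [F] then has more than [n]
    solutions, although [G] contains the bound [n]. *)
Lemma acl_exchange l a (b : M) : acl (in_list (rcons l b)) a -> ~ acl (in_list l) a ->
  acl (in_list (rcons l a)) b.
Proof.
move=> /acl_listP [F [dF fF Fa]] na; have [n hn] := (finite_atmost _).1 fF.
rewrite size_rcons in dF; set k := size l.
pose sw := rcons (rcons (iota 0 k) k.+1) k.
pose G (M' : structure L) (t : seq M') := F M' (sel t sw) /\
  atmost n (fun z => F M' (sel (rcons t z) (rcons (rcons (iota 0 k) k.+1) k.+2))).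
have E x y : G M (rcons (rcons l x) y) <-> F M (rcons (rcons l y) x) /\ atmost n (fun z => F M (rcons (rcons l y) z)).
  have e x' y' : sel (rcons (rcons l x') y') sw = rcons (rcons l y') x'.
    rewrite /sw (@sel_rcons_some _ _ _ _ x'); last by rewrite onth_rcons_lt ?size_rcons // onth_last.
    rewrite (@sel_rcons_some _ _ _ _ y'); last by rewrite -(size_rcons l x') onth_last.
    by rewrite !sel_rcons_lt ?sel_self ?size_rcons ?all_iota_lt.
  have e2 z : sel (rcons (rcons (rcons l x) y) z) (rcons (rcons (iota 0 k) k.+1) k.+2) = rcons (rcons l y) z.
    rewrite (@sel_rcons_some _ _ _ _ z); last first.
      have -> : k.+2 = size (rcons (rcons l x) y) by rewrite !size_rcons.
      exact: onth_last.
    rewrite sel_rcons_lt; last by rewrite all_rcons !size_rcons ltnSn all_iota_lt //; lia.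
    rewrite (@sel_rcons_some _ _ _ _ y); last by rewrite -(size_rcons l x) onth_last.
    by rewrite !sel_rcons_lt ?sel_self ?size_rcons ?all_iota_lt.
  rewrite /G e; split=> -[h1 [t tm h]]; split=> //; exists t => // z; first by rewrite -e2; exact: h.
  by rewrite e2; exact: h.
have dG : Def k.+2 G.
  apply: Def_and.
    by apply: Def_sel dF _ _; rewrite ?size_rcons ?size_iota // !all_rcons all_iota_lt ?ltnSn //; lia.
  apply: (@Def_atmost L _ n (fun (M' : structure L) (t : seq M') => F M' (sel t (rcons (rcons (iota 0 k) k.+1) k.+2)))).
  by apply: Def_sel dF _ _; rewrite ?size_rcons ?size_iota // !all_rcons all_iota_lt ?ltnSn //; lia.
have Gab : G M (rcons (rcons l a) b) by apply/E.
have dG' : Def (size (rcons l a)).+1 G by rewrite size_rcons.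
case: (definable_dichotomy dG') => f; first by apply/acl_listP; exists G.
have [m hm] := (finite_atmost _).1 f.
pose Th (M' : structure L) (t : seq M') := atmost m (fun z : M' => ~ G M' (rcons t z)).
have dTh : Def k.+1 Th.
  by apply: (@Def_atmost L _ m (fun (M' : structure L) (t : seq M') => ~ G M' t)); exact: Def_not.
case: (pselect (finite_set (fun x => Th M (rcons l x)))) => fT.
  by case: na; apply/acl_listP; exists Th.
have [s [nd sz hs]] := infinite_list n.+1 fT.
have fU : finite_set (fun y => exists2 x, List.In x s & ~ G M (rcons (rcons l x) y)).
  by apply: finite_bigor => x /hs h; apply/finite_atmost; exists m.
have [y hy] : exists y, forall x, List.In x s -> G M (rcons (rcons l x) y).
  apply: contrapT => n'; apply: model_infinite; apply: finite_sub fU => y _.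
  apply: contrapT => n2; apply: n'; exists y => x xs; apply: contrapT => n3; apply: n2.
  by exists x.
have : atmost n (fun z => F M (rcons (rcons l y) z)).
  by case: s sz hy {nd hs fU} => // x s _ h; have /E [] := h x (or_introl erefl).
by move=> am; have := atmost_size am nd (fun x xs => ((E x y).1 (hy x xs)).1); rewrite sz ltnn.
Qed.

Lemma independent_rcons l a : independent (rcons l a) <-> independent l /\ ~ acl (in_list l) a.
Proof.
split=> [h|[hl na]].
  split=> [l1 x l2 e ha|ha]; last by apply: (h l a [::]); rewrite ?cats1 ?cats0.
  apply: (h l1 x (rcons l2 a)); first by rewrite e rcons_cat.
  by apply: acl_mono ha => y; rewrite !in_list_cat => -[]; [left | right; apply/In_rcons; left].
move=> l1 x; elim/last_ind => [|l2 y _].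
  by rewrite cats1 cats0 => /rcons_inj [<- <-].
rewrite -rcons_cons -rcons_cat => /rcons_inj [el <-] ha.
have nx := hl l1 x l2 el; apply: na; rewrite el.
rewrite -rcons_cat in ha; apply: acl_mono (acl_exchange ha nx) => z.
rewrite !in_list_cat => /In_rcons [/in_list_cat [h|h]|->]; [by left | by right; right | by right; left].
Qed.

Lemma independent_nil : independent ([::] : seq M).
Proof. by move=> [|? ?]. Qed.

(** The list is cut at the first element that makes [y] algebraic, which is where exchange
    applies. *)
Lemma acl_prefix b l y : acl (in_list (b ++ l)) y -> ~ acl (in_list b) y ->
  exists l1 x l2, [/\ l = l1 ++ x :: l2, ~ acl (in_list (b ++ l1)) y & acl (in_list (rcons (b ++ l1) x)) y].
Proof.
elim/last_ind: l => [|l x IH]; first by rewrite cats0.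
rewrite -rcons_cat => h n; case: (pselect (acl (in_list (b ++ l)) y)) => h2.
  have [l1 [z [l2 [-> h3 h4]]]] := IH h2 n.
  by exists l1, z, (rcons l2 x); rewrite rcons_cat.
by exists l, x, [::]; rewrite cats1.
Qed.

Lemma steinitz b l : independent b -> (forall y, List.In y b -> acl (in_list l) y) -> size b <= size l.
Proof.
(* Strengthened for the induction: [b] can replace part of [l] without changing the total length and
   without losing any of the span. *)
suff H : independent b -> (forall y, List.In y b -> acl (in_list l) y) ->
    exists l', size b + size l' = size l /\ forall y, List.In y l -> acl (in_list (b ++ l')) y.
  by move=> h1 h2; have [l' [<- _]] := H h1 h2; exact: leq_addr.
elim/last_ind: b => [|b y IH]; first by exists l; split=> // y hy; exact: acl_refl.
move=> /independent_rcons [ib ny] h.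
have [|l' [sz sp]] := IH ib; first by move=> z hz; apply: h; apply/In_rcons; left.
have hy : acl (in_list (b ++ l')) y.
  by apply: acl_sub (h y _) => [z /sp //|]; apply/In_rcons; right.
have [l1 [x [l2 [e n1 h1]]]] := acl_prefix hy ny.
exists (l1 ++ l2); split; first by rewrite -sz e size_rcons !size_cat /=; lia.
move=> z /sp; apply: acl_sub => w; rewrite e in_list_cat => hw.
have := acl_exchange h1 n1 => hx.
case: hw => [hw|/in_list_cat [hw|[<-|hw]]].
- by apply: acl_refl; rewrite in_list_cat; left; apply/In_rcons; left.
- by apply: acl_refl; rewrite !in_list_cat; right; left.
- apply: acl_mono hx => v /In_rcons [/in_list_cat [hv|hv]|->]; rewrite !in_list_cat.
  + by left; apply/In_rcons; left.
  + by right; left.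
  + by left; apply/In_rcons; right.
- by apply: acl_refl; rewrite !in_list_cat; right; right.
Qed.

(** By [steinitz] independent tuples in the span of [l] are no longer than [l], so the greedy
    extension stops. *)
Lemma ext_basis S b l : independent b -> (forall y, List.In y b -> S y) ->
  (forall y, S y -> acl (in_list l) y) -> exists c, basis_of S (b ++ c).
Proof.
move=> ib bS Sl; move: {2}(size l - size b) (leqnn (size l - size b)) => n.
elim: n b ib bS => [|n IH] b ib bS le.
  exists [::]; rewrite cats0; split=> // y Sy; apply: contrapT => ny.
  have /independent_rcons /steinitz h := conj ib ny.
  have := h l; rewrite size_rcons => /(_ _) h'; suff : size b < size l by lia.
  by apply: h' => z /In_rcons [/bS /Sl|->]; [|exact: Sl].
case: (pselect (forall y, S y -> acl (in_list b) y)) => h; first by exists [::]; rewrite cats0.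
have [y [Sy ny]] : exists y, S y /\ ~ acl (in_list b) y.
  by apply: contrapT => n'; apply: h => y Sy; apply: contrapT => ny; apply: n'; exists y.
have ib' : independent (rcons b y) by apply/independent_rcons.
have bS' z : List.In z (rcons b y) -> S z by move=> /In_rcons [/bS|->].
have [|c hc] := IH _ ib' bS'; first by rewrite size_rcons; lia.
by exists (y :: c); rewrite -cat_rcons.
Qed.

Lemma basis_size S b c : basis_of S b -> basis_of S c -> size b = size c.
Proof.
move=> [ib bS Sb] [ic cS Sc]; apply/eqP; rewrite eqn_leq; apply/andP; split; apply: steinitz => // y hy.
- exact: Sc (bS y hy).
- exact: Sb (cS y hy).
Qed.

(** [dm] is a choice among the lengths of bases, hence usable only once these are known to agree. *)
Lemma dmE S b : basis_of S b -> dm S = size b.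
Proof.
move=> hb; rewrite /dm.
have [c [hc <-]] := epsilon_spec (inhabits 0) (fun d => exists b, basis_of S b /\ size b = d)
  (ex_intro _ (size b) (ex_intro _ b (conj hb erefl))).
exact: basis_size hc hb.
Qed.

Lemma dm_basis S : finite_dim S -> exists b, basis_of S b /\ size b = dm S.
Proof. by move=> [b hb]; exists b; rewrite (dmE hb). Qed.

Lemma span_finite_dim S l : (forall y, S y -> acl (in_list l) y) -> finite_dim S.
Proof. by move=> h; have [c hc] := ext_basis independent_nil (fun y (f : List.In y [::]) => False_ind _ f) h; exists c. Qed.

Lemma dm_le_span S l : (forall y, S y -> acl (in_list l) y) -> dm S <= size l.
Proof.
move=> h; have [b [[ib bS Sb] <-]] := dm_basis (span_finite_dim h).
by apply: steinitz => // y /bS /h.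
Qed.

Lemma indep_le_dm S b : finite_dim S -> independent b -> (forall y, List.In y b -> S y) -> size b <= dm S.
Proof.
move=> /dm_basis [c [[ic cS Sc] <-]] ib bS; apply: steinitz => // y /bS; exact: Sc.
Qed.

Lemma finite_dim_sub A B : (forall y, A y -> acl B y) -> finite_dim B -> finite_dim A.
Proof.
move=> AB [b [ib bS Sb]]; apply: (@span_finite_dim _ b) => y /AB; exact: acl_sub.
Qed.

Lemma dm_mono A B : (forall y, A y -> acl B y) -> finite_dim B -> dm A <= dm B.
Proof.
move=> AB fB; have [b [[ib bS Sb] <-]] := dm_basis (finite_dim_sub AB fB).
have [c [[ic cS Sc] <-]] := dm_basis fB.
apply: steinitz => // y /bS /AB; exact: acl_sub.
Qed.

Lemma dm_lt A B x : (forall y, A y -> acl B y) -> finite_dim B -> acl B x -> ~ acl A x -> dm A < dm B.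
Proof.
move=> AB fB Bx nx; have [b [[ib bS Sb] <-]] := dm_basis (finite_dim_sub AB fB).
have [c [[ic cS Sc] <-]] := dm_basis fB.
have ib' : independent (rcons b x).
  by apply/independent_rcons; split=> // h; apply: nx; exact: acl_mono h.
rewrite -(size_rcons b x); apply: steinitz => // y /In_rcons [/bS /AB|->]; first exact: acl_sub.
exact: acl_sub Bx.
Qed.

Lemma finite_dim_list l : finite_dim (in_list l).
Proof. by apply: (@span_finite_dim _ l) => y; exact: acl_refl. Qed.

Lemma independentP l : independent l <-> size l <= dm (in_list l).
Proof.
split=> [il|le l1 x l2 e h]; first by apply: indep_le_dm => //; exact: finite_dim_list.
have : dm (in_list l) <= size (l1 ++ l2).
  apply: dm_le_span => y; rewrite e in_list_cat => hy.
  case: hy => [hy|[<- //|hy]]; apply: acl_refl; rewrite in_list_cat; [by left | by right].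
by move: le; rewrite e !size_cat /=; lia.
Qed.

(** A basis of the intersection extends to bases of [A] and of [B], and the three parts together
    span the union. *)
Lemma dm_submod A B : closed_set A -> closed_set B -> finite_dim A -> finite_dim B ->
  dm (fun y => A y \/ B y) + dm (fun y => A y /\ B y) <= dm A + dm B.
Proof.
move=> cA cB fA fB.
have fI : finite_dim (fun y => A y /\ B y).
  by apply: finite_dim_sub fA => y [h _]; exact: acl_refl.
have [b [[ib bS Sb] sb]] := dm_basis fI.
have [la [_ _ Sla]] := fA; have [lb [_ _ Slb]] := fB.
have [ca bA] := ext_basis ib (fun y hy => (bS y hy).1) Sla.
have [cb bB] := ext_basis ib (fun y hy => (bS y hy).2) Slb.
rewrite (dmE bA) (dmE bB) -sb.
have : dm (fun y => A y \/ B y) <= size (b ++ ca ++ cb).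
  apply: dm_le_span => y [Ay|By].
    case: bA => _ _ /(_ y Ay); apply: acl_mono => z.
    rewrite !in_list_cat; tauto.
  case: bB => _ _ /(_ y By); apply: acl_mono => z.
  rewrite !in_list_cat; tauto.
by rewrite !size_cat; lia.
Qed.

Lemma finite_dim_or A B : finite_dim A -> finite_dim B -> finite_dim (fun y => A y \/ B y).
Proof.
move=> [a [_ _ ha]] [b [_ _ hb]]; apply: (@span_finite_dim _ (a ++ b)) => y [/ha|/hb];
apply: acl_mono => z; rewrite in_list_cat; by [left | right].
Qed.

End Minimal.

(** * Generic types and elementary embeddings *)

Lemma code_seq_inj : injective code_seq.
Proof.
move=> l l' e; pose k := code_seq l.
by rewrite -(@unseqK k l (leqnn _)) -(@unseqK k l') ?/k e.
Qed.

Lemma npair_inj a b a' b' : npair a b = npair a' b' -> a = a' /\ b = b'.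
Proof.
by move=> e; move: (congr1 nfst e) (congr1 nsnd e); rewrite !(nfstK, nsndK).
Qed.

Lemma map_inj_In (A B : Type) (f : A -> B) s t :
  (forall a, List.In a s -> forall b, f a = f b -> a = b) -> map f s = map f t -> s = t.
Proof.
elim: s t => [|a s IH] [|b t] //= h [/h e /IH ->]; first by rewrite e //; left.
by move=> c hc; apply: h; right.
Qed.

Lemma code_term_inj : injective code_term.
Proof.
elim/term_nested_ind => [v|f ts IH] [v'|f' ts'] /= /npair_inj [] //; first by move=> _ ->.
move=> _ /npair_inj [-> /code_seq_inj e]; congr TApp; apply: map_inj_In e => t /IH h t'; exact: h.
Qed.

Lemma code_formula_inj : injective code_formula.
Proof.
elim=> [|t1 t2|r ts|p IH|p IHp q IHq|x p IH] [|t1' t2'|r' ts'|p'|p' q'|x' p'] //= /npair_inj [] //.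
- by move=> _ /npair_inj [/code_term_inj -> /code_term_inj ->].
- by move=> _ /npair_inj [-> /code_seq_inj /(inj_map code_term_inj) ->].
- by move=> _ /IH ->.
- by move=> _ /npair_inj [/IHp -> /IHq ->].
- by move=> _ /npair_inj [-> /IH ->].
Qed.

Lemma hold_ren L (M : structure L) (l : seq M) (rho : nat -> M) p s :
  (forall v, v \in fv p -> onth l (s v) = Some (rho v)) -> (hold (ren s p) l <-> sat rho p).
Proof.
move=> h; have K r : agree r l -> sat r (ren s p) <-> sat rho p.
  move=> ag; rewrite ren_sat; apply: sat_fvE => v vp /=.
  have e := h v vp; have il : s v < size l by rewrite -onthTE e.
  by rewrite (agreeE (rho 0) ag il); exact: onth_nth.
split=> [hh|hs r ag]; last by rewrite K.
by have ag := agree_nth (rho 0) l; rewrite -K; [exact: hh ag | exact: ag].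
Qed.

Lemma below_ren p s k : (forall v, v \in fv p -> s v < k) -> below k (ren s p).
Proof. by move=> h; apply/allP => v /ren_fv /mapP [w /h wk ->]. Qed.

Lemma NoDup_map_inj (A B : Type) (f : A -> B) s : injective f -> List.NoDup s -> List.NoDup (map f s).
Proof.
move=> fi; elim: s => [|a s IH] nd; first by constructor.
move/List.NoDup_cons_iff: nd => [na nd]; constructor; last exact: IH.
by move=> /List.in_map_iff [b [/fi -> hb]].
Qed.

Lemma finite_enum (A : Type) (S : A -> Prop) : finite_set S ->
  exists s, List.NoDup s /\ forall a, S a <-> List.In a s.
Proof.
move=> [l]; elim: l S => [|b l IH] S h; first by exists [::]; split; [constructor | split=> // /h].
have [|s [nd hs]] := IH (fun a => S a /\ a <> b).
  by move=> a [/h [e|//] ne]; case: ne.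
case: (pselect (S b)) => Sb; last first.
  exists s; split=> // a; rewrite -hs; split=> [Sa|[]//]; split=> // e; apply: Sb.
  by rewrite -e.
exists (b :: s); split; first by constructor => // /hs [].
move=> a /=; rewrite -hs; split=> [Sa|[<- //|[]//]].
by case: (pselect (a = b)) => [->|ne]; [left | right].
Qed.

Section Generic.
Variables (L : signature) (T : formula -> Prop).
Hypothesis hcomp : complete L T.
Hypothesis hsm : strongly_minimal L T.

Lemma elementary_Def (M1 M2 : structure L) (g : M1 -> M2) k F (l : seq M1) :
  is_model T M1 -> elementary g -> Def k F -> size l = k -> (F M1 l <-> F M2 (map g l)).
Proof.
move=> [[d] _] eg [p [wf b e]] sl; have ag := agree_nth d l.
rewrite (e M1 l (nth d l)) // (e M2 (map g l) (g \o nth d l)) ?size_map //; first exact: eg.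
by rewrite /agree size_map map_comp ag.
Qed.

(** The last entry of an independent tuple avoids every finite set definable over the others, so [F]
    holds over the prefix of [l1] with at most [m] exceptions, for some [m]. That is a definable
    property of the prefix, so by induction it passes to the prefix of [l2], where an exception at
    [a2] would make [a2] algebraic. Length 0 is the completeness of [T]. *)
Lemma generic_type (M1 M2 : structure L) (l1 : seq M1) (l2 : seq M2) k F :
  is_model T M1 -> is_model T M2 -> independent l1 -> independent l2 ->
  size l1 = k -> size l2 = k -> Def k F -> F M1 l1 -> F M2 l2.
Proof.
move=> h1 h2; elim: k l1 l2 F => [|k IH] l1 l2 F i1 i2 s1 s2 dF f1.
  move: (size0nil s1) (size0nil s2) f1 => -> -> f1; case: dF => p [wf b e].
  have [[d1] _] := h1; have [[d2] _] := h2.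
  have fv0 : fv p = [::] by move: b; rewrite /below; case: (fv p).
  have [_ /(_ p (conj wf fv0)) [h|h]] := hcomp.
    by rewrite (e M2 [::] (fun=> d2)) //; exact: h.
  by have := (e M1 [::] (fun=> d1) erefl erefl).1 f1 => /h; case.
move: i1 i2 s1 s2 f1; case/lastP: l1 => // l1 a1; case/lastP: l2 => // l2 a2.
move=> /(independent_rcons hsm h1) [i1 n1] /(independent_rcons hsm h2) [i2 n2].
rewrite !size_rcons => -[s1] [s2] f1.
have dF1 : Def (size l1).+1 F by rewrite s1.
case: (definable_dichotomy hsm h1 dF1) => f; first by case: n1; apply/acl_listP; exists F.
have [m hm] := (finite_atmost _).1 f.
have dG : Def k (fun (M : structure L) (l : seq M) => atmost m (fun a => ~ F M (rcons l a))).
  by apply: (@Def_atmost L _ m (fun (M' : structure L) (t : seq M') => ~ F M' t)); exact: Def_not.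
have := IH l1 l2 _ i1 i2 s1 s2 dG hm => am.
apply: contrapT => nf; apply: n2; apply/acl_listP.
exists (fun (M' : structure L) (t : seq M') => ~ F M' t); rewrite s2.
by split=> //; [exact: Def_not | apply/finite_atmost; exists m].
Qed.

Definition same_type (M1 M2 : structure L) (l1 : seq M1) (l2 : seq M2) :=
  size l1 = size l2 /\ forall F, Def (size l1) F -> F M1 l1 -> F M2 l2.

Lemma same_type_iff (M1 M2 : structure L) (l1 : seq M1) (l2 : seq M2) F :
  same_type l1 l2 -> Def (size l1) F -> (F M1 l1 <-> F M2 l2).
Proof.
move=> [_ h] dF; split; first exact: h.
by move=> f2; apply: contrapT => n1; exact: (h _ (Def_not dF) n1).
Qed.

(** An algebraic formula with the fewest solutions isolates the type of [a] over [l1]: if a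
    definable property of [a] failed at another solution, conjoining it would leave fewer. *)
Lemma same_type_extend (M1 M2 : structure L) (l1 : seq M1) (l2 : seq M2) a :
  same_type l1 l2 -> acl (in_list l1) a -> exists b, same_type (rcons l1 a) (rcons l2 b).
Proof.
move=> P /acl_listP [F0 [dF0 /finite_atmost [n0 am0] f0]].
pose Q n := `[< exists F, [/\ Def (size l1).+1 F, F M1 (rcons l1 a) & atmost n (fun x => F M1 (rcons l1 x))] >].
have exQ : exists n, Q n by exists n0; apply/asboolP; exists F0.
case: (ex_minnP exQ) => n /asboolP [F [dF fa am]] nmin.
have [b fb] : exists b, F M2 (rcons l2 b).
  by have [_ h] := P; apply: (h _ (Def_ex dF)); exists a.
exists b; split; first by rewrite !size_rcons; case: P => ->.
move=> G; rewrite size_rcons => dG ga.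
have [_ h] := P; have := h _ (Def_forall (Def_imp dF dG)); apply => // x fx.
apply: contrapT => ngx; case: n am nmin => [am _|n am nmin]; first exact: (atmost0 am fx).
suff : Q n by move=> /nmin; rewrite ltnn.
apply/asboolP; exists (fun (M' : structure L) (t : seq M') => F M' t /\ G M' t).
split=> //; first exact: Def_and.
have [s sn hs] := atmost_rem am fx; exists s => // y [fy gy]; apply: hs; split=> // e.
by apply: ngx; rewrite -e.
Qed.

Section Embed.
Variables (M1 M2 : structure L).
Hypothesis h1 : is_model T M1.
Hypothesis h2 : is_model T M2.
Variables (l1 : seq M1) (l2 : seq M2).
Hypothesis hspan : forall y, acl (in_list l1) y.
Hypothesis hpe : same_type l1 l2.

(** Each element is one of finitely many solutions of a formula over [l1], so it is named by the
    code of the formula and an index in the list of solutions. *)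
Lemma span_countable : exists e : nat -> M1, forall a, exists i, e i = a.
Proof.
have [[d] _] := h1.
have ch (p : formula) : exists s : seq M1, finite_set (fun x => hold p (rcons l1 x)) ->
    forall x, hold p (rcons l1 x) -> List.In x s.
  by case: (pselect (finite_set (fun x => hold p (rcons l1 x)))) => [[s hs]|n]; [exists s | exists [::]].
have [sol solP] := choice ch.
have ch2 (n : nat) : exists a, forall p i, n = npair (code_formula p) i -> onth (sol p) i = Some a \/ onth (sol p) i = None.
  case: (pselect (exists p i, n = npair (code_formula p) i)) => [[p [i e]]|no]; last first.
    by exists d => p i e; case: no; exists p, i.
  exists (odflt d (onth (sol p) i)) => p' i'; rewrite e => /npair_inj [/code_formula_inj <- <-].
  by case: (onth _ _) => /=; [left | right].
have [e eP] := choice ch2; exists e => a.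
have /acl_listP [F [[p [wf b E]] f Fa]] := hspan a.
have EE x : hold p (rcons l1 x) <-> F M1 (rcons l1 x).
  have ag := agree_nth d (rcons l1 x).
  rewrite (E M1 _ _ _ ag) ?size_rcons //; split=> [hh|hs r ag']; first exact: hh.
  by apply: (sat_agree ag ag' _ hs); rewrite size_rcons.
have [|i il ei] := @In_nth _ (sol p) a.
  by apply: solP; [apply: finite_sub f => x /EE | apply/EE].
exists (npair (code_formula p) i); have := eP _ p i erefl.
by rewrite ei => -[[]|].
Qed.

Lemma embed : exists g : M1 -> M2, [/\ elementary g, map g l1 = l2 &
  forall y, acl (in_list l2) y <-> exists x, g x = y].
Proof.
have [e eP] := span_countable; have [[d2] _] := h2.
pose t1 n := l1 ++ map e (iota 0 n).
have t1S n : t1 n.+1 = rcons (t1 n) (e n) by rewrite /t1 -addn1 iotaD map_cat /= add0n cats1 rcons_cat.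
have ch (z : nat * seq M2) : exists b, same_type (t1 z.1) z.2 -> same_type (t1 z.1.+1) (rcons z.2 b).
  case: (pselect (same_type (t1 z.1) z.2)) => [P|n]; last by exists d2.
  have [|b hb] := @same_type_extend _ _ _ _ (e z.1) P; last by exists b; rewrite t1S.
  by apply: acl_mono (hspan _) => y hy; apply/in_list_cat; left.
have [ext extP] := choice ch.
pose t2 := natrec l2 (fun n s => rcons s (ext (n, s))).
pose bb n := ext (n, t2 n).
have t2P n : same_type (t1 n) (t2 n).
  elim: n => [|n IH]; first by rewrite /t1 cats0.
  exact: (extP (n, t2 n) IH).
have t2E n : t2 n = l2 ++ map bb (iota 0 n).
  elim: n => [|n IH]; first by rewrite cats0.
  by rewrite -addn1 iotaD map_cat /= add0n cats1 -rcons_cat addn1 -IH.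
have [sz _] := hpe; set k := size l1 in sz *.
have o1 n i : i < n -> onth (t1 n) (k + i) = Some (e i).
  move=> il; rewrite /t1 onth_cat -/k ltnNge leq_addr /= addKn onth_map.
  by rewrite (onth_nth' 0) ?size_iota // nth_iota.
have o2 n i : i < n -> onth (t2 n) (k + i) = Some (bb i).
  move=> il; rewrite t2E onth_cat -sz ltnNge leq_addr /= addKn onth_map.
  by rewrite (onth_nth' 0) ?size_iota // nth_iota.
have [ix ixP] := choice eP.
pose g a := bb (ix a).
have eg : elementary g.
  move=> p rho wf; pose n := (foldr maxn 0 [seq ix (rho v) | v <- fv p]).+1.
  have lt v : v \in fv p -> ix (rho v) < n.
    by move=> vp; rewrite /n ltnS; apply: leq_foldr_maxn; apply/mapP; exists v.
  pose s v := k + ix (rho v).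
  rewrite -(@hold_ren _ _ (t1 n) rho p s); last by move=> v /lt h; rewrite o1 // ixP.
  rewrite -(@hold_ren _ _ (t2 n) (g \o rho) p s); last by move=> v /lt h; rewrite o2.
  apply: same_type_iff; first exact: t2P.
  apply: Def_hold; first exact: ren_wf.
  by apply: below_ren => v /lt h; rewrite /t1 size_cat size_map size_iota ltn_add2l.
have gl : map g l1 = l2.
  apply: eq_from_onth => j; case: (ltnP j k) => jk; last by rewrite !onth_default ?size_map // -sz.
  have [[d1] _] := h1; rewrite onth_map (onth_nth' d1) //=; set x := nth d1 l1 j.
  have := same_type_iff (t2P (ix x).+1) (Def_eq L (k := size (t1 (ix x).+1)) (i := j) (j := k + ix x) _ _).
  rewrite /t1 size_cat size_map size_iota -/k ltn_add2l ltnSn (leq_trans jk (leq_addr _ _)) => /(_ isT isT).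
  rewrite -/(t1 _) o1 // o2 // {1}/t1 onth_cat -/k jk (onth_nth' d1) // ixP t2E onth_cat -sz jk.
  by move=> [h _]; rewrite h.
exists g; split=> //.
have tr F y : Def k.+1 F -> F M1 (rcons l1 y) <-> F M2 (rcons l2 (g y)).
  by move=> dF; rewrite (elementary_Def h1 eg dF) ?size_rcons // map_rcons gl.
have tr0 F : Def k F -> F M1 l1 <-> F M2 l2.
  by move=> dF; rewrite (elementary_Def h1 eg dF) // gl.
have gi : injective g.
  move=> x y exy; have := elementary_Def h1 eg (Def_eq L (k := 2) (i := 0) (j := 1) isT isT) (l := [:: x; y]) erefl.
  by rewrite /= exy => -[_ /(_ erefl) []].
have amD n F : Def k.+1 F -> Def k (fun (M : structure L) (l : seq M) => atmost n (fun a => F M (rcons l a))).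
  exact: Def_atmost.
move=> y; split=> [/acl_listP [F [dF /finite_atmost [n0 am0] fy]]|[x <-]].
- rewrite -sz in dF.
  (* Surjectivity onto the closure by counting. If [y] were missed, the images of the solutions in
     [M1] would be solutions in [M2] other than [y]; the least bound on the number of solutions
     would drop by one in [M1], hence in [M2]. *)
  pose Q n := `[< atmost n (fun x => F M2 (rcons l2 x)) >].
  have exQ : exists n, Q n by exists n0; apply/asboolP.
  case: (ex_minnP exQ) => n /asboolP am nmin.
  case: n am nmin => [am _|n am nmin]; first by case: (atmost0 am fy).
  have am1 := (tr0 _ (amD n.+1 F dF)).2 am.
  have [s [nd hs]] := finite_enum ((finite_atmost _).2 (ex_intro (fun m => atmost m _) n.+1 am1)).
  apply: contrapT => ny.
  have am' := atmost_rem am fy.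
  have nds : List.NoDup (map g s) by exact: NoDup_map_inj.
  have : size (map g s) <= n; first apply: (atmost_size am' nds).
    move=> z /List.in_map_iff [x [<- /hs fx]]; split; first by apply/tr.
    by move=> ez; apply: ny; exists x.
  rewrite size_map => le.
  suff : Q n by move=> /nmin; rewrite ltnn.
  apply/asboolP; apply/(tr0 _ (amD n F dF)); exists s => // x fx; exact/hs.
- have /acl_listP [F [dF /finite_atmost [n am] fx]] := hspan x.
  apply/acl_listP; rewrite -sz; exists F; split=> //; last by apply/tr.
  by apply/finite_atmost; exists n; apply/(tr0 _ (amD n F dF)).
Qed.

End Embed.

End Generic.

(** * Quantifier-free patterns *)

Lemma nonprincipal_ultrafilter : exists U : (nat -> Prop) -> Prop,
  [/\ forall P Q : nat -> Prop, (forall n, P n -> Q n) -> U P -> U Q,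
      forall P Q : nat -> Prop, U P -> U Q -> U (fun n => P n /\ Q n),
      forall N, U (fun n => N <= n), ~ U (fun _ => False) &
      forall P : nat -> Prop, U P \/ U (fun n => ~ P n)].
Proof.
have [U [ultra sub]] := filter.ultraFilterLemma filter.eventually_filter.
have [prop _] := ultra; have [n0 [_ I S]] := prop.
exists U; split.
- by move=> P Q PQ; apply: S.
- by move=> P Q; exact: I.
- by move=> N; apply: sub; exists N.
- exact: n0.
- by move=> P; have := @filter.in_ultra_setVsetC _ _ P ultra.
Qed.

(** * Ultrapowers over the natural numbers *)

Section Ultrapower.
Variable U : (nat -> Prop) -> Prop.
Hypothesis U_mono : forall P Q : nat -> Prop, (forall n, P n -> Q n) -> U P -> U Q.
Hypothesis U_and : forall P Q : nat -> Prop, U P -> U Q -> U (fun n => P n /\ Q n).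
Hypothesis U_cof : forall N, U (fun n => N <= n).
Hypothesis U_false : ~ U (fun _ => False).
Hypothesis U_ultra : forall P : nat -> Prop, U P \/ U (fun n => ~ P n).
Variables (L : signature) (A : structure L).

Definition germ (f g : nat -> A) := U (fun n => f n = g n).
(** Classes of sequences are kept as predicates, so that equality in the ultrapower is plain
    equality, which the clause for [FEq] in [sat] requires. *)
Definition ucarrier := {c : (nat -> A) -> Prop | exists f, c = germ f}.
Definition cls (f : nat -> A) : ucarrier := exist _ (germ f) (ex_intro _ f erefl).
Definition rep (c : ucarrier) : nat -> A := projT1 (cid (projT2 c)).

Definition upower : structure L := @Structure L ucarrier
  (fun f cs => cls (fun n => sfun A f [seq rep c n | c <- cs]))
  (fun r cs => U (fun n => srel A r [seq rep c n | c <- cs])).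

Lemma U_true : U (fun _ => True). Proof. exact: U_mono (U_cof 0). Qed.

Lemma germ_refl f : germ f f. Proof. exact: U_mono U_true. Qed.

Lemma germ_sym f g : germ f g -> germ g f. Proof. by apply: U_mono => n ->. Qed.

Lemma germ_trans f g h : germ f g -> germ g h -> germ f h.
Proof. by move=> a b; apply: U_mono (U_and a b) => n [-> ->]. Qed.

Lemma clsE f g : cls f = cls g <-> germ f g.
Proof.
split=> [[e]|fg]; first by have := germ_refl g; rewrite -e.
apply: eq_exist => /=; apply/funext => h; apply/propext; split; apply: germ_trans => //.
exact: germ_sym.
Qed.

Lemma rep_cls f : germ (rep (cls f)) f.
Proof.
by rewrite /rep; case: cid => g /= e; have := germ_refl f; rewrite {1}e.
Qed.

Lemma cls_rep c : cls (rep c) = c.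
Proof.
rewrite /rep; case: cid => g /= e; case: c e => c h /= e; apply: eq_exist => /=.
by rewrite e.
Qed.

Lemma U_list (I : Type) (s : seq I) (P : I -> nat -> Prop) :
  (forall i, List.In i s -> U (P i)) -> U (fun n => forall i, List.In i s -> P i n).
Proof.
elim: s => [|i s IH] h; first by apply: U_mono U_true.
apply: U_mono (U_and (h i (or_introl erefl)) (IH (fun j hj => h j (or_intror hj)))) => n [h1 h2] j [<-|] //.
exact: h2.
Qed.

Lemma los_term (rho : nat -> upower) t :
  germ (rep (teval rho t)) (fun n => teval (fun v => rep (rho v) n) t).
Proof.
elim/term_nested_ind: t => [v|f ts IH] /=; first exact: germ_refl.
apply: (germ_trans (rep_cls _)).
apply: U_mono (U_list IH) => n h; congr sfun; rewrite -map_comp.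
by apply: map_ext_In => t /h.
Qed.

Lemma U_iff (P Q : nat -> Prop) : U (fun n => P n <-> Q n) -> (U P <-> U Q).
Proof. by move=> h; split=> a; apply: U_mono (U_and h a) => n [[]]; auto. Qed.

Lemma los p (rho : nat -> upower) : sat rho p <-> U (fun n => sat (fun v => rep (rho v) n) p).
Proof.
elim: p rho => [|t1 t2|r ts|p IH|p IHp q IHq|x p IH] rho /=.
- by split.
- rewrite -{1}(cls_rep (teval rho t1)) -{1}(cls_rep (teval rho t2)) clsE.
  apply: U_iff; apply: U_mono (U_and (los_term rho t1) (los_term rho t2)) => n [-> ->].
  by split.
- apply: U_iff; apply: U_mono (U_list (s := ts) (fun t _ => los_term rho t)) => n h.
  rewrite -map_comp (map_ext_In (g := teval (fun v => rep (rho v) n))) //.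
- rewrite IH; split=> [n|h1 h2]; first by case: (U_ultra (fun n => sat (fun v => rep (rho v) n) p)).
  by apply: U_false; apply: U_mono (U_and h1 h2) => n [].
- rewrite IHp IHq; split=> [[a b]|h]; first exact: U_and.
  by split; apply: U_mono h => n [].
- split=> [[a]|h].
    rewrite IH; apply: U_mono => n h; exists (rep a n); apply: sat_fv h => v _.
    by rewrite /upd; case: (v == x).
  have ch n : exists a, (exists a, sat (upd (fun v => rep (rho v) n) x a) p) ->
      sat (upd (fun v => rep (rho v) n) x a) p.
    case: (pselect (exists a, sat (upd (fun v => rep (rho v) n) x a) p)) => [[a ha]|no].
      by exists a.
    by exists (rep (rho 0) n).
  have [f fP] := choice ch; exists (cls f); rewrite IH.
  apply: U_mono (U_and h (rep_cls f)) => n [/fP h1 e]; apply: sat_fv h1 => v _.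
  by rewrite /upd; case: (v == x).
Qed.

Lemma upower_model T : is_model T A -> is_model T upower.
Proof.
move=> [[d] h]; split; first by constructor; exact: cls (fun=> d).
by move=> p Tp rho; apply/los; apply: U_mono U_true => n _; exact: h.
Qed.

End Ultrapower.

Definition eqv L (A B : structure L) (s : nat) (l : seq A) (l' : seq B) : Prop :=
  forall c, c < s -> (tr c l <-> tr c l').

Lemma tr_atomic L (A : structure L) p (l : seq A) rho : literal p -> wf_formula L p ->
  below (size l) p -> agree rho l -> (tr (code_formula p) l <-> sat rho p).
Proof.
move=> lit wf b ag; split=> [[q [/code_formula_inj -> _ _ _ h]]|hs]; first exact: h.
by exists p; split=> // r ag'; exact: (sat_agree ag ag' b hs).
Qed.

Section GoodPattern.
Variables (L : signature) (T : formula -> Prop).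
Hypothesis hmc : model_complete L T.
Variable A : structure L.
Hypothesis hA : is_model T A.
Hypothesis hc : exists e : nat -> A, forall a, exists i, e i = a.

(* If no quantifier-free pattern of [z ++ y] forced [R], the witnesses against
   the longer and longer finite parts of the diagram of [A] would give, in an
   ultrapower of [A], an embedding of [A] whose image of [z] fails [R]; by model
   completeness that embedding is elementary. *)
Lemma good_pattern k R (z : seq A) : Def k R -> size z = k -> R A z ->
  exists s y, forall z' y' : seq A, size z' = k -> size y' = size y ->
    eqv s (z ++ y) (z' ++ y') -> R A z'.
Proof.
move=> dR sz Rz; apply: contrapT => no; have [e eP] := hc; have [[d] _] := hA.
have ch n : exists zy : seq A * seq A, [/\ size zy.1 = k, size zy.2 = n,
    eqv n (z ++ map e (iota 0 n)) (zy.1 ++ zy.2) & ~ R A zy.1].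
  apply: contrapT => n1; apply: no; exists n, (map e (iota 0 n)) => z' y' sz' sy' h.
  apply: contrapT => nR; apply: n1; exists (z', y'); split=> //.
  by rewrite sy' size_map size_iota.
have [zy zyP] := choice ch.
have [U [um ua uc uf uu]] := nonprincipal_ultrafilter.
have [ix ixP] := choice eP.
pose l n := z ++ map e (iota 0 n); pose l' n := (zy n).1 ++ (zy n).2.
have sl n : size (l n) = k + n by rewrite /l size_cat size_map size_iota sz.
have sl' n : size (l' n) = k + n by have [s1 s2 _ _] := zyP n; rewrite /l' size_cat s1 s2.
have o1 n i : i < n -> nth d (l n) (k + i) = e i.
  move=> il; rewrite nth_cat sz ltnNge leq_addr /= addKn (nth_map 0) ?size_iota //.
  by rewrite nth_iota.
have agl n : agree (nth d (l n)) (l n) by exact: agree_nth.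
have agl' n : agree (nth d (l' n)) (l' n) by exact: agree_nth.
(* The element [a] goes to the class of the entries that occupy, in the successive counterexamples,
   the position of [a] in the enumeration of [A]. *)
pose h a := @cls U L A (fun n => nth d (l' n) (k + ix a)) : upower U A.
have lit p : literal p -> wf_formula L p ->
    exists N, forall n, N <= n -> (sat (nth d (l n)) p <-> sat (nth d (l' n)) p).
  move=> lp wf; pose n0 := (foldr maxn 0 (fv p)).+1.
  have b : below n0 p by apply/allP => v vp; rewrite ltnS; exact: leq_foldr_maxn.
  exists (maxn n0 (code_formula p).+1) => n; rewrite geq_max => /andP[ln cn].
  have b1 : below (k + n) p by apply: sub_all b => v h1; apply: leq_trans h1 _; lia.
  have [_ _ E _] := zyP n.
  rewrite -(tr_atomic lp wf _ (agl n)) ?sl // -(tr_atomic lp wf _ (agl' n)) ?sl' //.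
  exact: E.
have unbounded (vs : seq A) : exists N, forall n v, N <= n -> List.In v vs -> ix v < n.
  elim: vs => [|v vs [N IH]]; first by exists 0.
  exists (maxn N (ix v).+1) => n w; rewrite geq_max => /andP[h1 h2] [<- //|]; exact: IH.
have nl n v : ix v < n -> nth d (l n) (k + ix v) = v by move=> h1; rewrite o1 // ixP.
have rc0 (f : nat -> A) : U (fun n => rep (cls U f) n = f n) by exact: rep_cls.
have eh : embedding h.
  split.
  - move=> a b E0; have /clsE E : h a = h b by []. apply: contrapT => ab.
    pose p := FNot (FEq (TVar (k + ix a)) (TVar (k + ix b))).
    have [||N hN] := lit p; [|by []|].
      by right; exists (FEq (TVar (k + ix a)) (TVar (k + ix b))).
    have [N2 hN2] := unbounded [:: a; b].
    apply: uf; apply: um (ua _ _ (E um ua uc) (uc (maxn N N2))) => n [e1].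
    rewrite geq_max => /andP[h1 h2]; have := (hN n h1).1; rewrite /=.
    rewrite !nl ?(hN2 n) //; [|by right; left | by left].
    by move=> /(_ ab); rewrite e1.
  - move=> f ts ff sts; apply/clsE => //.
    pose b := sfun A f ts.
    pose p := FEq (TApp f [seq TVar (k + ix a) | a <- ts]) (TVar (k + ix b)).
    have [||N hN] := lit p; first by left.
      by rewrite /p; split=> //; apply/wf_TApp; rewrite size_map; split=> // t /List.in_map_iff [a [<-]].
    have [N2 hN2] := unbounded (b :: ts).
    have hr := U_list um ua uc (s := ts) (fun a _ => rc0 (fun n => nth d (l' n) (k + ix a))).
    apply: um (ua _ _ hr (uc (maxn N N2))) => n [e1]; rewrite geq_max => /andP[h1 h2].
    have := (hN n h1).1; rewrite /= -!map_comp => <-.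
      by congr sfun; apply: map_ext_In => a /e1.
    rewrite nl; last by apply: hN2 => //; left.
    congr sfun; rewrite -[RHS]map_id; apply: map_ext_In => a ha /=.
    by apply: nl; apply: hN2 => //; right.
  - move=> r ts rr sts.
    pose p := FRel r [seq TVar (k + ix a) | a <- ts].
    have wfp : wf_formula L p by rewrite /p; split=> //; rewrite ?size_map // => t /List.in_map_iff [a [<-]].
    have [||N hN] := lit p; [by left | exact: wfp |].
    have [N2 hN2] := unbounded ts.
    have hr := U_list um ua uc (s := ts) (fun a _ => rc0 (fun n => nth d (l' n) (k + ix a))).
    have K : U (fun n => srel A r ts <-> srel A r [seq rep (U := U) c n | c <- map h ts]).
      apply: um (ua _ _ hr (uc (maxn N N2))) => n [e1]; rewrite geq_max => /andP[h1 h2].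
      have H : srel A r (map (fun a => nth d (l n) (k + ix a)) ts) <->
          srel A r (map (fun a => nth d (l' n) (k + ix a)) ts).
        by have := hN n h1; rewrite /= -!map_comp.
      have E1 : map (fun a => nth d (l n) (k + ix a)) ts = ts.
        rewrite -[RHS]map_id; apply: map_ext_In => a ha /=; apply: nl; exact: hN2.
      have E2 : [seq rep (U := U) c n | c <- map h ts] = map (fun a => nth d (l' n) (k + ix a)) ts.
        by rewrite -map_comp; apply: map_ext_In => a /e1.
      by rewrite E2 -H E1.
    rewrite /= -(U_iff um ua K); split=> [hs|hu]; first by apply: um (uc 0).
    by apply: contrapT => n1; apply: uf; apply: um hu.
have mU : is_model T (upower U A) by exact: upower_model.
have eg := hmc hA mU eh.
have := (elementary_Def hA eg dR sz).1 Rz; case: dR => p [wf b E].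
pose rho : nat -> upower U A := fun v => h (nth d z v).
have ag : agree rho (map h z).
  by rewrite /agree size_map -[in RHS](agree_nth d z) -map_comp.
rewrite (E _ _ rho) ?size_map // los // => Us; apply: uf.
have [N2 hN2] := unbounded z.
(* The image of [z] was read off the enumerated part. The literal that equates entry [i] of [z] with
   its copy in the enumeration is preserved, so for almost all [n] that image is [(zy n).1], where
   [R] fails. *)
have K : U (fun n => forall i, List.In i (iota 0 k) -> rep (rho i) n = nth d (zy n).1 i).
  apply: U_list => // i /In_iota; rewrite add0n /= => ik.
  have [||N hN] := lit (FEq (TVar i) (TVar (k + ix (nth d z i)))); [by left | by [] |].
  apply: um (ua _ _ (rc0 (fun n => nth d (l' n) (k + ix (nth d z i)))) (uc (maxn N N2))).
  move=> n [-> ]; rewrite geq_max => /andP[h1 h2]; have := (hN n h1).1; rewrite /=.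
  have [s1 _ _ _] := zyP n.
  rewrite nl; last by apply: hN2 => //; apply: (onth_In (i := i)); apply: onth_nth'; rewrite sz.
  rewrite {1}/l nth_cat sz ik {1}/l' nth_cat s1 ik => <- //.
apply: um (ua _ _ K Us) => n [e1 hs]; have [s1 _ _ nR] := zyP n; apply: nR.
have ag2 := agree_nth d (zy n).1.
rewrite (E _ _ _ s1 ag2); apply: sat_fv hs => v /(allP b) vk.
by rewrite e1 //; apply/In_iota.
Qed.

End GoodPattern.

Import GRing.Theory Num.Theory.

(** * Flat pregeometries *)

Section FlatFour.
Variables (L : signature) (M : structure L).
Hypothesis hflat : flat M.

Lemma dm_ext (A B : M -> Prop) : (forall a, A a <-> B a) -> dm A = dm B.
Proof. by move=> h; congr dm; apply/funext => a; apply/propext. Qed.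

(** Subsets of ['I_4] as quadruples of Booleans: the alternating sum over nonempty sets then expands
    into fifteen explicit terms. *)
Let quad := (bool * (bool * (bool * bool)))%type.
Let bits (b : quad) := [:: b.1; b.2.1; b.2.2.1; b.2.2.2].
Let toset (b : quad) : {set 'I_4} := [set i : 'I_4 | nth false (bits b) i].
Let ofset (s : {set 'I_4}) : quad := (inord 0 \in s, (inord 1 \in s, (inord 2 \in s, inord 3 \in s))).

Let ordP (P : 'I_4 -> Prop) : P (inord 0) -> P (inord 1) -> P (inord 2) -> P (inord 3) -> forall i, P i.
Proof.
move=> p0 p1 p2 p3 i; rewrite -(inord_val i).
by case: (nat_of_ord i) (ltn_ord i) => [|[|[|[|]]]].
Qed.

Let toset_bij : bijective toset.
Proof.
exists ofset => [[b0 [b1 [b2 b3]]]|s].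
  by rewrite /ofset /toset !inE !inordK.
by apply/setP; apply: ordP; rewrite /ofset /toset inE inordK.
Qed.

Let card_toset b : #|toset b| = b.1 + b.2.1 + b.2.2.1 + b.2.2.2.
Proof.
rewrite -sum1_card big_mkcond /= !big_ord_recl big_ord0 !inE /= addn0 !addnA.
by case: b => [[] [[] [[] []]]].
Qed.

Let toset0 b : (toset b != set0) = [|| b.1, b.2.1, b.2.2.1 | b.2.2.2].
Proof.
rewrite -cards_eq0 card_toset; by case: b => [[] [[] [[] []]]].
Qed.

Lemma flat4 (E0 E1 E2 E3 : M -> Prop) :
  (closed_set E0 /\ finite_dim E0) -> (closed_set E1 /\ finite_dim E1) ->
  (closed_set E2 /\ finite_dim E2) -> (closed_set E3 /\ finite_dim E3) ->
  dm (fun a => E0 a \/ E1 a \/ E2 a \/ E3 a) +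
  (dm (fun a => E0 a /\ E1 a) + dm (fun a => E0 a /\ E2 a) + dm (fun a => E0 a /\ E3 a) +
   dm (fun a => E1 a /\ E2 a) + dm (fun a => E1 a /\ E3 a) + dm (fun a => E2 a /\ E3 a)) +
  dm (fun a => E0 a /\ E1 a /\ E2 a /\ E3 a) <=
  dm E0 + dm E1 + dm E2 + dm E3 +
  (dm (fun a => E0 a /\ E1 a /\ E2 a) + dm (fun a => E0 a /\ E1 a /\ E3 a) +
   dm (fun a => E0 a /\ E2 a /\ E3 a) + dm (fun a => E1 a /\ E2 a /\ E3 a)).
Proof.
move=> c0 c1 c2 c3; have [_ ineq] := hflat.
pose E (i : 'I_4) := nth E0 [:: E0; E1; E2; E3] i.
have EP i : closed_set (E i) /\ finite_dim (E i).
  by apply: (ordP (P := fun i => closed_set (E i) /\ finite_dim (E i))); rewrite /E inordK.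
have := ineq 4 E EP; rewrite (reindex toset) /=; last exact: onW_bij.
have -> : dm (fun a => exists i, E i a) = dm (fun a => E0 a \/ E1 a \/ E2 a \/ E3 a).
  apply: dm_ext => a; split.
    by move=> [i]; move: i; apply: ordP; rewrite /E inordK //=; tauto.
  by move=> [h|[h|[h|h]]]; [exists (inord 0) | exists (inord 1) | exists (inord 2) | exists (inord 3)];
    rewrite /E inordK.
pose C (b : quad) a := (b.1 -> E0 a) /\ (b.2.1 -> E1 a) /\ (b.2.2.1 -> E2 a) /\ (b.2.2.2 -> E3 a).
have CE b : dm (fun a => forall i, i \in toset b -> E i a) = dm (C b).
  apply: dm_ext => a; split=> [h|[h0 [h1 [h2 h3]]]].
    split; [|split; [|split]] => hb; [have := h (inord 0) | have := h (inord 1) |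
      have := h (inord 2) | have := h (inord 3)]; by rewrite inE inordK // /E inordK //; apply.
  by apply: ordP; rewrite inE inordK // /E inordK.
under eq_bigr => b _ do rewrite CE card_toset.
rewrite big_mkcond /=.
under eq_bigr => b _ do rewrite toset0.
pose G b0 b1 b2 b3 : int := if [|| b0, b1, b2 | b3] then
   ((-1) ^+ (nat_of_bool b0 + b1 + b2 + b3).+1 * (dm (C (b0, (b1, (b2, b3)))))%:Z)%R else 0%R.
rewrite (eq_bigr (fun b => G b.1 b.2.1 b.2.2.1 b.2.2.2)); last by case=> [? [? [? ?]]].
rewrite -(pair_bigA _ (fun b0 (c : bool * (bool * bool)) => G b0 c.1 c.2.1 c.2.2)) /=.
under eq_bigr => b0 _ do rewrite -(pair_bigA _ (fun b1 (c : bool * bool) => G b0 b1 c.1 c.2)) /=.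
under eq_bigr => b0 _ do under eq_bigr => b1 _ do rewrite -(pair_bigA _ (fun b2 b3 => G b0 b1 b2 b3)) /=.
rewrite !big_bool /= /G /= !exprS !expr0 ?mulr1 ?mulN1r ?mulrN ?mul1r ?opprK ?mulN1r ?mul1r.
have D b A : (forall a, C b a <-> A a) -> dm (C b) = dm A by exact: dm_ext.
rewrite (@D (true, (true, (true, true))) (fun a => E0 a /\ E1 a /\ E2 a /\ E3 a)); last by rewrite /C /=; intuition.
rewrite (@D (true, (true, (true, false))) (fun a => E0 a /\ E1 a /\ E2 a)); last by rewrite /C /=; intuition.
rewrite (@D (true, (true, (false, true))) (fun a => E0 a /\ E1 a /\ E3 a)); last by rewrite /C /=; intuition.
rewrite (@D (true, (false, (true, true))) (fun a => E0 a /\ E2 a /\ E3 a)); last by rewrite /C /=; intuition.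
rewrite (@D (false, (true, (true, true))) (fun a => E1 a /\ E2 a /\ E3 a)); last by rewrite /C /=; intuition.
rewrite (@D (true, (true, (false, false))) (fun a => E0 a /\ E1 a)); last by rewrite /C /=; intuition.
rewrite (@D (true, (false, (true, false))) (fun a => E0 a /\ E2 a)); last by rewrite /C /=; intuition.
rewrite (@D (true, (false, (false, true))) (fun a => E0 a /\ E3 a)); last by rewrite /C /=; intuition.
rewrite (@D (false, (true, (true, false))) (fun a => E1 a /\ E2 a)); last by rewrite /C /=; intuition.
rewrite (@D (false, (true, (false, true))) (fun a => E1 a /\ E3 a)); last by rewrite /C /=; intuition.
rewrite (@D (false, (false, (true, true))) (fun a => E2 a /\ E3 a)); last by rewrite /C /=; intuition.
rewrite (@D (true, (false, (false, false))) E0); last by rewrite /C /=; intuition.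
rewrite (@D (false, (true, (false, false))) E1); last by rewrite /C /=; intuition.
rewrite (@D (false, (false, (true, false))) E2); last by rewrite /C /=; intuition.
rewrite (@D (false, (false, (false, true))) E3); last by rewrite /C /=; intuition.
lia.
Qed.

(** This is [flat4] with the third set taken twice, after which the repeated terms cancel. *)
Lemma flat3 (E0 E1 E2 : M -> Prop) :
  (closed_set E0 /\ finite_dim E0) -> (closed_set E1 /\ finite_dim E1) ->
  (closed_set E2 /\ finite_dim E2) ->
  dm (fun a => E0 a \/ E1 a \/ E2 a) +
  (dm (fun a => E0 a /\ E1 a) + dm (fun a => E0 a /\ E2 a) + dm (fun a => E1 a /\ E2 a)) <=
  dm E0 + dm E1 + dm E2 + dm (fun a => E0 a /\ E1 a /\ E2 a).
Proof.
move=> c0 c1 c2; have := flat4 c0 c1 c2 c2.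
have D (A B : M -> Prop) : (forall a, A a <-> B a) -> dm A = dm B by exact: dm_ext.
rewrite (D (fun a => E2 a /\ E2 a) E2); last by intuition.
rewrite (D (fun a => E0 a /\ E1 a /\ E2 a /\ E2 a) (fun a => E0 a /\ E1 a /\ E2 a)); last by intuition.
rewrite (D (fun a => E0 a /\ E2 a /\ E2 a) (fun a => E0 a /\ E2 a)); last by intuition.
rewrite (D (fun a => E1 a /\ E2 a /\ E2 a) (fun a => E1 a /\ E2 a)); last by intuition.
rewrite (D (fun a => E0 a \/ E1 a \/ E2 a \/ E2 a) (fun a => E0 a \/ E1 a \/ E2 a)); last by intuition.
lia.
Qed.
End FlatFour.

(** * Spans, triangles and cycles over a fixed tuple *)

Section FlatGeometry.
Variables (L : signature) (T : formula -> Prop).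
Hypothesis hsm : strongly_minimal L T.
Variable M : structure L.
Hypotheses (hM : is_model T M) (hflat : flat M).
Variable e : seq M.

(** All notions of this section are relative to the parameters [e]: [sp] is closure in the
    localization at [e], [ind] is independence there together with independence of [e] itself, and
    [closed_fd] sets contain [e]. *)
Definition sp (l : seq M) : M -> Prop := acl (in_list (e ++ l)).
Definition ind (l : seq M) : Prop := independent (e ++ l).
Definition closed_fd (S : M -> Prop) : Prop :=
  [/\ closed_set S, finite_dim S & forall y, List.In y e -> S y].
Definition tri (x y z : M) : Prop := [/\ sp [:: x; y] z, sp [:: y; z] x & sp [:: x; z] y].

Fixpoint allS (S : M -> Prop) (l : seq M) : Prop :=
  if l is x :: l' then S x /\ allS S l' else True.

Lemma allSP S l : allS S l <-> forall y, List.In y l -> S y.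
Proof.
elim: l => [|x l IH] /=; first by split=> // _ y [].
rewrite IH; split=> [[Sx h] y [<-|/h] //|h]; split; first by apply: h; left.
by move=> y hy; apply: h; right.
Qed.

Implicit Types (S A B : M -> Prop) (l us : seq M).

Lemma closed_fd_span l : closed_fd (sp l).
Proof.
split=> [a ha|| y hy]; first exact: acl_trans.
  by apply: (span_finite_dim hsm hM (l := e ++ l)).
by apply: acl_refl; rewrite /in_list List.in_app_iff; left.
Qed.

Lemma closed_fd_and A B : closed_fd A -> closed_fd B -> closed_fd (fun y => A y /\ B y).
Proof.
move=> [cA fA eA] [cB fB eB]; split=> [a ha||y hy].
- split; [apply: cA | apply: cB]; apply: acl_mono ha => y; tauto.
- by apply: (finite_dim_sub hsm hM) fA => y [h _]; exact: acl_refl.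
by split; [exact: eA | exact: eB].
Qed.

Lemma closed_fd_sp S l y : closed_fd S -> allS S l -> sp l y -> S y.
Proof.
move=> [cS _ eS] /allSP h hy; apply: cS; apply: acl_mono hy => z.
by rewrite /in_list List.in_app_iff => -[/eS|/h].
Qed.

Lemma sp_in l : allS (sp l) l.
Proof. by apply/allSP => y hy; apply: acl_refl; rewrite /in_list List.in_app_iff; right. Qed.

Lemma closed_fd_or A B : closed_fd A -> closed_fd B -> closed_fd (acl (fun y => A y \/ B y)).
Proof.
move=> [cA fA eA] [cB fB eB]; split=> [a|| y /eA ?]; first exact: acl_trans.
  by apply: (finite_dim_sub hsm hM (B := fun y => A y \/ B y)) => //; exact: (finite_dim_or hsm hM).
by apply: acl_refl; left.
Qed.

Lemma dm_acl S : finite_dim S -> dm (acl S) = dm S.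
Proof.
move=> fS; apply/eqP; rewrite eqn_leq !(dm_mono hsm hM) //.
- by move=> y hy; apply: acl_refl; exact: acl_refl.
by apply: (finite_dim_sub hsm hM) fS.
Qed.

Lemma dm_sp l : dm (sp l) <= size e + size l.
Proof. by rewrite -size_cat; apply: (dm_le_span hsm hM). Qed.

Lemma dm_ge S us : closed_fd S -> ind us -> allS S us -> size e + size us <= dm S.
Proof.
move=> [cS fS eS] iu /allSP h; rewrite -size_cat; apply: (indep_le_dm hsm hM) => // y.
by rewrite List.in_app_iff => -[/eS|/h].
Qed.

Lemma dm_ind l : ind l -> dm (sp l) = size e + size l.
Proof.
move=> il; apply/eqP; rewrite eqn_leq dm_sp; apply: dm_ge => //; [exact: closed_fd_span | exact: sp_in].
Qed.

(** The span of [l'] contains the independent tuple [l], so its dimension is too large for a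
    dependent tuple that is no longer than [l]. *)
Lemma ind_of l l' : ind l -> size l' <= size l -> allS (sp l') l -> ind l'.
Proof.
move=> il le h; apply/(independentP hsm hM); rewrite size_cat.
apply: (@leq_trans (dm (sp l'))); last first.
  by apply: (dm_mono hsm hM) => //; exact: (finite_dim_list hsm hM).
apply: leq_trans (dm_ge (closed_fd_span l') il h); lia.
Qed.

Lemma ind_notin l x : ind (rcons l x) <-> ind l /\ ~ sp l x.
Proof. by rewrite /ind -rcons_cat (independent_rcons hsm hM). Qed.

(** Submodularity turned around: many independent elements in the join force a small intersection.
    Most upper bounds on intersections below come from here. *)
Lemma dm_cap A B us : closed_fd A -> closed_fd B -> ind us -> allS (acl (fun y => A y \/ B y)) us ->
  dm (fun y => A y /\ B y) + size e + size us <= dm A + dm B.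
Proof.
move=> fA fB iu hu; have [cA dA _] := fA; have [cB dB _] := fB.
have := dm_submod hsm hM cA cB dA dB.
have := dm_ge (closed_fd_or fA fB) iu hu.
rewrite dm_acl; [lia | exact: (finite_dim_or hsm hM)].
Qed.

Lemma closed_fd_sub S l y : closed_fd S -> ind l -> allS S l -> dm S <= size e + size l -> S y -> sp l y.
Proof.
move=> fS il hl le Sy; apply: contrapT => nl.
have [cS dS eS] := fS.
have : dm (sp l) < dm S.
  apply: (@dm_lt _ _ hsm _ hM _ _ y) => //; last first.
  - by move=> /acl_trans.
  - exact: acl_refl.
  - by move=> z hz; apply: acl_refl; exact: closed_fd_sp hz.
by rewrite dm_ind // ltnNge le.
Qed.

Lemma dm_lt' A B x : closed_fd A -> closed_fd B -> (forall y, A y -> B y) -> B x -> ~ A x -> dm A < dm B.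
Proof.
move=> [cA fA eA] [cB fB eB] AB Bx nA; apply: (@dm_lt _ _ hsm _ hM _ _ x) => //.
- by move=> y /AB; exact: acl_refl.
- exact: acl_refl.
by move=> /cA.
Qed.

Lemma sp_perm l l' y : (forall z, List.In z l -> List.In z l') -> sp l y -> sp l' y.
Proof.
move=> h; apply: acl_mono => z; rewrite /in_list !List.in_app_iff; move: (h z); tauto.
Qed.

Lemma triC x y z : tri x y z -> tri y x z.
Proof.
move=> [a b c]; split => //; by apply: sp_perm a => w /=; tauto.
Qed.
Lemma triR x y z : tri x y z -> tri y z x.
Proof.
move=> [a b c]; split => //; first by apply: sp_perm c => w /=; tauto.
by apply: sp_perm a => w /=; tauto.
Qed.

Lemma tri3 S x y z : closed_fd S -> tri x y z -> S x -> S y -> S z.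
Proof. by move=> fS [h _ _] Sx Sy; apply: (closed_fd_sp fS _ h) => /=. Qed.
Lemma tri2 S x y z : closed_fd S -> tri x y z -> S x -> S z -> S y.
Proof. by move=> fS [_ _ h] Sx Sy; apply: (closed_fd_sp fS _ h) => /=. Qed.
Lemma tri1 S x y z : closed_fd S -> tri x y z -> S y -> S z -> S x.
Proof. by move=> fS [_ h _] Sx Sy; apply: (closed_fd_sp fS _ h) => /=. Qed.

Lemma fl3 S : closed_fd S -> closed_set S /\ finite_dim S. Proof. by case. Qed.

Lemma sp_mem l y : List.In y l -> sp l y.
Proof. by move=> h; apply: (allSP _ _).1 _ h; exact: sp_in. Qed.

Lemma ind_sub l l' l'' : ind l -> size (l' ++ l'') <= size l -> allS (sp (l' ++ l'')) l -> ind l'.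
Proof.
move=> il le h; have := ind_of il le h; elim/last_ind: l'' {le h} => [|l'' x IH]; first by rewrite cats0.
by rewrite -rcons_cat => /ind_notin [/IH].
Qed.

Ltac mem := repeat split; try assumption; try (apply: sp_mem => /=; tauto).

Lemma acl_orl A B y : A y -> acl (fun y => A y \/ B y) y.
Proof. by move=> h; apply: acl_refl; left. Qed.
Lemma acl_orr A B y : B y -> acl (fun y => A y \/ B y) y.
Proof. by move=> h; apply: acl_refl; right. Qed.

Lemma dm_andA A B S : dm (fun y => A y /\ B y /\ S y) = dm (fun y => (A y /\ B y) /\ S y).
Proof. by apply: dm_ext; tauto. Qed.

(* Flatness is applied to the spans of the three pairs from [u1; u2; u3] and of
   [t1; t2]: all triple intersections are trivial over [e]. *)
Lemma flat_path2 u1 u2 u3 t1 t2 z : ind [:: u1; u2; u3] -> tri u1 u2 t1 -> tri u2 u3 t2 ->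
  sp [:: u1; u3] z -> sp [:: t1; t2] z -> sp [::] z.
Proof.
move=> iu h1 h2 z1 z2; apply: contrapT => nz.
pose E0 := sp [:: u1; u2]; pose E1 := sp [:: u2; u3].
pose E2 := sp [:: u1; u3]; pose E3 := sp [:: t1; t2].
have f0 : closed_fd E0 := closed_fd_span _; have f1 : closed_fd E1 := closed_fd_span _; have f2 : closed_fd E2 := closed_fd_span _; have f3 : closed_fd E3 := closed_fd_span _.
have [a01 [a02 _]] : allS E0 _ := sp_in _; have [a12 [a13 _]] : allS E1 _ := sp_in _.
have [a21 [a23 _]] : allS E2 _ := sp_in _; have [b1 [b2 _]] : allS E3 _ := sp_in _.
have c1 : E0 t1 := tri3 f0 h1 a01 a02.
have c2 : E1 t2 := tri3 f1 h2 a12 a13.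
have i0 : ind [::] by apply: (@ind_sub _ [::] [:: u1; u2; u3] iu) => //; mem.
have iz : ind [:: z] by apply/(ind_notin [::] z); split.
have i1 : ind [:: u1] by apply: (@ind_sub _ [:: u1] [:: u2; u3] iu) => //; mem.
have i2 : ind [:: u2] by apply: (@ind_sub _ [:: u2] [:: u1; u3] iu) => //; mem.
have i3 : ind [:: u3] by apply: (@ind_sub _ [:: u3] [:: u1; u2] iu) => //; mem.
have it1 : ind [:: t1].
  apply: (@ind_sub _ [:: t1] [:: u2; u3] iu) => //; mem.
  by apply: (tri1 (closed_fd_span _) h1); mem.
have it2 : ind [:: t2].
  apply: (@ind_sub _ [:: t2] [:: u2; u1] iu) => //; mem.
  by apply: (tri2 (closed_fd_span _) h2); mem.
have d0 : dm E0 <= size e + 2 := dm_sp _; have d1 : dm E1 <= size e + 2 := dm_sp _.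
have d2 : dm E2 <= size e + 2 := dm_sp _; have d3 : dm E3 <= size e + 2 := dm_sp _.
have f01 := closed_fd_and f0 f1; have f02 := closed_fd_and f0 f2; have f12 := closed_fd_and f1 f2.
have m01 := dm_ge f01 i2 (conj (conj a02 a12) I).
have m02 := dm_ge f02 i1 (conj (conj a01 a21) I).
have m03 := dm_ge (closed_fd_and f0 f3) it1 (conj (conj c1 b1) I).
have m12 := dm_ge f12 i3 (conj (conj a13 a23) I).
have m13 := dm_ge (closed_fd_and f1 f3) it2 (conj (conj c2 b2) I).
have m23 := dm_ge (closed_fd_and f2 f3) iz (conj (conj z1 z2) I).
have m0123 := dm_ge (closed_fd_and f0 (closed_fd_and f1 (closed_fd_and f2 f3))) i0 I.
have mu : size e + 3 <= dm (fun a => E0 a \/ E1 a \/ E2 a \/ E3 a).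
  apply: leq_trans (dm_ge (closed_fd_or f0 f1) iu _) _.
    by split; [apply: acl_orl | split; [apply: acl_orl | split; [apply: acl_orr|]]].
  rewrite dm_acl; last by apply: (finite_dim_or hsm hM); [case: f0 | case: f1].
  apply: (dm_mono hsm hM) => [y h|]; first by apply: acl_refl; tauto.
  by do 3 (apply: (finite_dim_or hsm hM); [by move: (fl3 f0) (fl3 f1) (fl3 f2); tauto|]); case: f3.
have k01 := @dm_cap _ _ [:: u1; u2; u3] f0 f1 iu (conj (acl_orl _ a01) (conj (acl_orl _ a02) (conj (acl_orr _ a13) I))).
have k02 := @dm_cap _ _ [:: u1; u2; u3] f0 f2 iu (conj (acl_orl _ a01) (conj (acl_orl _ a02) (conj (acl_orr _ a23) I))).
have k12 := @dm_cap _ _ [:: u1; u2; u3] f1 f2 iu (conj (acl_orr _ a21) (conj (acl_orl _ a12) (conj (acl_orr _ a23) I))).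
have k012 := @dm_cap _ _ [:: u1; u2; u3] f01 f2 iu (conj (acl_orr _ a21) (conj (acl_orl _ (conj a02 a12)) (conj (acl_orr _ a23) I))).
have k013 : dm (fun y => (E0 y /\ E1 y) /\ E3 y) + size e + 3 <= dm (fun y => E0 y /\ E1 y) + dm E3.
  have fW := closed_fd_or f01 f3; set W := acl _ in fW.
  have w2 : W u2 by apply: acl_orl.
  have w1 : W u1 by apply: (tri1 fW h1 w2); apply: acl_orr.
  have w3 : W u3 by apply: (tri2 fW h2 w2); apply: acl_orr.
  by apply: (dm_cap f01 f3 iu).
have k023 : dm (fun y => (E0 y /\ E2 y) /\ E3 y) + size e + 3 <= dm (fun y => E0 y /\ E2 y) + dm E3.
  have fW := closed_fd_or f02 f3; set W := acl _ in fW.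
  have w1 : W u1 by apply: acl_orl.
  have w2 : W u2 by apply: (tri2 fW h1 w1); apply: acl_orr.
  have w3 : W u3 by apply: (tri2 fW h2 w2); apply: acl_orr.
  by apply: (dm_cap f02 f3 iu).
have k123 : dm (fun y => (E1 y /\ E2 y) /\ E3 y) + size e + 3 <= dm (fun y => E1 y /\ E2 y) + dm E3.
  have fW := closed_fd_or f12 f3; set W := acl _ in fW.
  have w3 : W u3 by apply: acl_orl.
  have w2 : W u2 by apply: (tri1 fW h2 w3); apply: acl_orr.
  have w1 : W u1 by apply: (tri1 fW h1 w2); apply: acl_orr.
  by apply: (dm_cap f12 f3 iu).
(* Relative to [e], the union contributes at least 3 and each of the six pairwise intersections at
   least 1, against 8 from the four sets and nothing from the triple intersections. The sixth pair
   is the one that [z] makes nontrivial. *)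
have := flat4 hflat (fl3 f0) (fl3 f1) (fl3 f2) (fl3 f3).
rewrite !dm_andA in m0123 *.
move: m01 m02 m03 m12 m13 m23 m0123 mu k01 k02 k12 k012 k013 k023 k123 => /=.
lia.
Qed.

Lemma dm_or3 A B S us : closed_fd A -> closed_fd B -> closed_fd S -> ind us ->
  allS (acl (fun y => A y \/ B y)) us -> size e + size us <= dm (fun y => A y \/ B y \/ S y).
Proof.
move=> fA fB fS iu h; apply: leq_trans (dm_ge (closed_fd_or fA fB) iu h) _.
have [_ dA _] := fA; have [_ dB _] := fB; have [_ dS _] := fS.
rewrite dm_acl; last exact: (finite_dim_or hsm hM).
apply: (dm_mono hsm hM) => [y ?|]; first by apply: acl_refl; tauto.
by apply: (finite_dim_or hsm hM) => //; exact: (finite_dim_or hsm hM).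
Qed.

(* Otherwise flatness for the span of the [t]s and the spans of [u1; u2; u3] and
   [u3; u4; u1] gives a nontrivial triple intersection, against [flat_path2]. *)
Lemma flat_cycle4 u1 u2 u3 u4 t1 t2 t3 t4 : ind [:: u1; u2; u3; u4] ->
  tri u1 u2 t1 -> tri u2 u3 t2 -> tri u3 u4 t3 -> tri u4 u1 t4 ->
  allS (sp [:: t1; t2; t3; t4]) [:: u1; u2; u3; u4].
Proof.
move=> iu h1 h2 h3 h4; pose A := sp [:: t1; t2; t3; t4].
have fA : closed_fd A := closed_fd_span _; have [b1 [b2 [b3 [b4 _]]]] : allS A _ := sp_in _.
suff c1 : A u1.
  have c2 := tri2 fA h1 c1 b1; have c3 := tri2 fA h2 c2 b2; have c4 := tri2 fA h3 c3 b3.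
  by [].
apply: contrapT => n1.
pose B := sp [:: u1; u2; u3]; pose D := sp [:: u3; u4; u1].
have fB : closed_fd B := closed_fd_span _; have fD : closed_fd D := closed_fd_span _.
have [x1 [x2 [x3 _]]] : allS B _ := sp_in _; have [y3 [y4 [y1 _]]] : allS D _ := sp_in _.
have p1 : B t1 := tri3 fB h1 x1 x2; have p2 : B t2 := tri3 fB h2 x2 x3.
have q3 : D t3 := tri3 fD h3 y3 y4; have q4 : D t4 := tri3 fD h4 y4 y1.
have i12 : ind [:: t1; t2].
  apply: (@ind_sub _ [:: t1; t2] [:: u2; u4] iu) => //; mem.
  - by apply: (tri1 (closed_fd_span _) h1); mem.
  - by apply: (tri2 (closed_fd_span _) h2); mem.
have i34 : ind [:: t3; t4].
  apply: (@ind_sub _ [:: t3; t4] [:: u4; u2] iu) => //; mem.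
  - by apply: (tri2 (closed_fd_span _) h4); mem.
  - by apply: (tri1 (closed_fd_span _) h3); mem.
have i13 : ind [:: u1; u3] by apply: (@ind_sub _ [:: u1; u3] [:: u2; u4] iu) => //; mem.
have i0 : ind [::] by apply: (@ind_sub _ [::] [:: u1; u2; u3; u4] iu) => //; mem.
have i123 : ind [:: u1; u2; u3] by apply: (@ind_sub _ [:: u1; u2; u3] [:: u4] iu) => //; mem.
have dA : dm A < size e + 4.
  rewrite -[in X in _ < X](dm_ind iu); set U := sp _.
  have fU : closed_fd U := closed_fd_span _; have [w1 [w2 [w3 [w4 _]]]] : allS U _ := sp_in _.
  apply: (dm_lt' fA fU _ w1 n1) => y; apply: closed_fd_sp => //.
  by split; [|split; [|split; [|split]]] => //; [apply: (tri3 fU h1) | apply: (tri3 fU h2) | apply: (tri3 fU h3) | apply: (tri3 fU h4)].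
have dB : dm B <= size e + 3 := dm_sp _; have dD : dm D <= size e + 3 := dm_sp _.
have mAB := dm_ge (closed_fd_and fA fB) i12 (conj (conj b1 p1) (conj (conj b2 p2) I)).
have mAD := dm_ge (closed_fd_and fA fD) i34 (conj (conj b3 q3) (conj (conj b4 q4) I)).
have mBD := dm_ge (closed_fd_and fB fD) i13 (conj (conj x1 y1) (conj (conj x3 y3) I)).
have spanAB : allS (acl (fun y => A y \/ B y)) [:: u1; u2; u3; u4].
  have fW := closed_fd_or fA fB; set W := acl _ in fW *.
  have w3 : W u3 by apply: acl_orr.
  have w4 : W u4 by apply: (tri2 fW h3 w3); apply: acl_orl.
  by do 2 (split; first by apply: acl_orr).
have kBD := @dm_cap _ _ [:: u1; u2; u3; u4] fB fD iu (conj (acl_orl _ x1) (conj (acl_orl _ x2) (conj (acl_orl _ x3) (conj (acl_orr _ y4) I)))).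
have kAB := dm_cap fA fB iu spanAB.
have mU := dm_or3 fA fB fD iu spanAB.
(* By dimension the intersection of [B] and [D] is spanned by [u1] and [u3], and that of [A] and [B]
   by [t1] and [t2], so [flat_path2] applies. *)
have k0 : dm (fun y => A y /\ B y /\ D y) <= size e.
  apply: leq_trans (_ : dm (sp [::]) <= _); last by rewrite dm_ind //= addn0.
  apply: (dm_mono hsm hM); last by case: (closed_fd_span [::]).
  move=> y [Ay [By Dy]]; apply: acl_refl; apply: (flat_path2 i123 h1 h2).
    apply: (closed_fd_sub (closed_fd_and fB fD) i13) => //; move: kBD => /=; lia.
  by apply: (closed_fd_sub (closed_fd_and fA fB) i12) => //; move: kAB => /=; lia.
(* Relative to [e] this is 4 + 2 + 2 + 2 against 3 + 3 + 3 and a triple intersection that is trivial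
   by [k0]. *)
have := flat3 hflat (fl3 fA) (fl3 fB) (fl3 fD).
move: mAB mAD mBD mU => /=; lia.
Qed.
Lemma dm_nind l : ~ ind l -> dm (sp l) < size e + size l.
Proof.
move=> ni; rewrite ltnNge; apply/negP => le; apply: ni; apply/(independentP hsm hM).
rewrite size_cat; apply: leq_trans le _; rewrite /sp dm_acl //; exact: (finite_dim_list hsm hM).
Qed.

Lemma acl_exchange_sp l x y : sp (rcons l x) y -> ~ sp l y -> sp (rcons l y) x.
Proof. by rewrite /sp -!rcons_cat; apply: (acl_exchange hsm hM). Qed.

(** If the four ends were dependent, the inequality for the spans of the two paths and of the ends
    would give a nontrivial [y] in all three. Such a [y] lies in the span of the labels and in that
    of [u1] and [u4], so it labels an edge that closes the first path to a 4-cycle, and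
    [flat_cycle4] puts [u1] into the span of [t1], [t2], [t3]. *)
Lemma flat_paths u1 u2 u3 u4 v1 v2 v3 v4 t1 t2 t3 : ind [:: t1; t2; t3; u1; v1] ->
  tri u1 u2 t1 -> tri u2 u3 t2 -> tri u3 u4 t3 -> tri v1 v2 t1 -> tri v2 v3 t2 -> tri v3 v4 t3 ->
  ind [:: u1; u4; v1; v4].
Proof.
move=> it h1 h2 h3 g1 g2 g3; apply: contrapT => nw.
pose B := sp [:: u1; u2; u3; u4]; pose B' := sp [:: v1; v2; v3; v4]; pose W := sp [:: u1; u4; v1; v4].
have fB : closed_fd B := closed_fd_span _; have fB' : closed_fd B' := closed_fd_span _; have fW : closed_fd W := closed_fd_span _.
have [b1 [b2 [b3 [b4 _]]]] : allS B _ := sp_in _; have [c1 [c2 [c3 [c4 _]]]] : allS B' _ := sp_in _.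
have [w1 [w4 [x1 [x4 _]]]] : allS W _ := sp_in _.
have p1 := tri3 fB h1 b1 b2; have p2 := tri3 fB h2 b2 b3; have p3 := tri3 fB h3 b3 b4.
have q1 := tri3 fB' g1 c1 c2; have q2 := tri3 fB' g2 c2 c3; have q3 := tri3 fB' g3 c3 c4.
have iu' : ind [:: u1; u2; u3; u4; v1].
  apply: (ind_of it) => //; set S := sp _; have fS : closed_fd S := closed_fd_span _.
  have [s1 [s2 [s3 [s4 [s5 _]]]]] : allS S _ := sp_in _.
  by split; [apply: (tri3 fS h1) | split; [apply: (tri3 fS h2) | split; [apply: (tri3 fS h3) | split]]].
have iv' : ind [:: v1; v2; v3; v4; u1].
  apply: (ind_of it) => //; set S := sp _; have fS : closed_fd S := closed_fd_span _.
  have [s1 [s2 [s3 [s4 [s5 _]]]]] : allS S _ := sp_in _.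
  by split; [apply: (tri3 fS g1) | split; [apply: (tri3 fS g2) | split; [apply: (tri3 fS g3) | split]]].
have iu : ind [:: u1; u2; u3; u4] by apply: (@ind_sub _ _ [:: v1] iu') => //; mem.
have iv : ind [:: v1; v2; v3; v4] by apply: (@ind_sub _ _ [:: u1] iv') => //; mem.
have i14 : ind [:: u1; u4] by apply: (@ind_sub _ _ [:: u2; u3] iu) => //; mem.
have j14 : ind [:: v1; v4] by apply: (@ind_sub _ _ [:: v2; v3] iv) => //; mem.
have it3 : ind [:: t1; t2; t3] by apply: (@ind_sub _ _ [:: u1; v1] it) => //; mem.
have i0 : ind [::] by apply: (@ind_sub _ _ [:: t1; t2; t3] it3) => //; mem.
have itu1 : ind [:: t1; t2; t3; u1] by apply: (@ind_sub _ _ [:: v1] it) => //; mem.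
have itu4 : ind [:: t1; t2; t3; u4].
  apply: (ind_of itu1) => //; mem; set S := sp _; have fS : closed_fd S := closed_fd_span _.
  have [s1 [s2 [s3 [s4 _]]]] : allS S _ := sp_in _.
  by apply: (tri1 fS h1 _ s1); apply: (tri1 fS h2 _ s2); apply: (tri1 fS h3 _ s3).
have dB : dm B <= size e + 4 := dm_sp _; have dB' : dm B' <= size e + 4 := dm_sp _.
have dW : dm W < size e + 4 := dm_nind nw.
have mBB := dm_ge (closed_fd_and fB fB') it3 (conj (conj p1 q1) (conj (conj p2 q2) (conj (conj p3 q3) I))).
have mBW := dm_ge (closed_fd_and fB fW) i14 (conj (conj b1 w1) (conj (conj b4 w4) I)).
have mB'W := dm_ge (closed_fd_and fB' fW) j14 (conj (conj c1 x1) (conj (conj c4 x4) I)).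
have sBB' : allS (acl (fun y => B y \/ B' y)) [:: u1; u2; u3; u4; v1].
  by do 4 (split; first by apply: acl_orl); split=> //; apply: acl_orr.
have sBW : allS (acl (fun y => B y \/ W y)) [:: u1; u2; u3; u4; v1].
  by do 4 (split; first by apply: acl_orl); split=> //; apply: acl_orr.
have kBB := dm_cap fB fB' iu' sBB'; have kBW := dm_cap fB fW iu' sBW.
have mU := dm_or3 fB fB' fW iu' sBB'.
have k0 : dm (fun y => B y /\ B' y /\ W y) <= size e.
  apply: leq_trans (_ : dm (sp [::]) <= _); last by rewrite dm_ind //= addn0.
  apply: (dm_mono hsm hM); last by case: (closed_fd_span [::]).
  move=> y [By [B'y Wy]]; apply: acl_refl; apply: contrapT => ny.
  have ty : sp [:: t1; t2; t3] y.
    by apply: (closed_fd_sub (closed_fd_and fB fB') it3) => //; move: kBB => /=; lia.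
  have uy : sp [:: u1; u4] y.
    by apply: (closed_fd_sub (closed_fd_and fB fW) i14) => //; move: kBW => /=; lia.
  have /(ind_notin [:: t1; t2; t3]) [_ nu1] := itu1.
  have /(ind_notin [:: t1; t2; t3]) [_ nu4] := itu4.
  have ny1 : ~ sp [:: u1] y.
    by move=> /(@acl_exchange_sp [::])/(_ ny) /= h; apply: nu1; apply: (closed_fd_sp (closed_fd_span _) _ h).
  have ny4 : ~ sp [:: u4] y.
    by move=> /(@acl_exchange_sp [::])/(_ ny) /= h; apply: nu4; apply: (closed_fd_sp (closed_fd_span _) _ h).
  have h4 : tri u4 u1 y.
    split; [by apply: sp_perm uy => z /=; tauto | |].
    - exact: (@acl_exchange_sp [:: u1] u4 y uy ny1).
    have uy' : sp [:: u4; u1] y by apply: sp_perm uy => z /=; tauto.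
    exact: (@acl_exchange_sp [:: u4] u1 y uy' ny4).
  have [a1 _] := flat_cycle4 iu h1 h2 h3 h4; apply: nu1; apply: (closed_fd_sp (closed_fd_span _) _ a1).
  by mem.
(* Relative to [e] this is 5 + 3 + 2 + 2 against 4 + 4 + 3 and the triple intersection, which [k0]
   bounds by 0. *)
have := flat3 hflat (fl3 fB) (fl3 fB') (fl3 fW).
move: mBB mBW mB'W mU => /=; lia.
Qed.

Lemma dm_or4 A B S D us : closed_fd A -> closed_fd B -> closed_fd S -> closed_fd D -> ind us ->
  allS (acl (fun y => A y \/ B y)) us -> size e + size us <= dm (fun y => A y \/ B y \/ S y \/ D y).
Proof.
move=> fA fB fS fD iu h; apply: leq_trans (dm_ge (closed_fd_or fA fB) iu h) _.
have [_ dA _] := fA; have [_ dB _] := fB; have [_ dS _] := fS; have [_ dD _] := fD.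
rewrite dm_acl; last exact: (finite_dim_or hsm hM).
apply: (dm_mono hsm hM) => [y ?|]; first by apply: acl_refl; tauto.
by do 3 (apply: (finite_dim_or hsm hM) => //).
Qed.

(** Here [u5] may lie in the span of the other vertices: only [u1] to [u4], and [u1], [u4], [u5],
    are independent, which is what [ind_okB] establishes for the two 5-cycles it glues. The chord
    from [u1] to [u4] cuts the cycle into a path and a triangle. *)
Lemma flat_cycle5 u1 u2 u3 u4 u5 t1 t2 t3 t4 t5 : ind [:: u1; u2; u3; u4] -> ind [:: u1; u4; u5] ->
  tri u1 u2 t1 -> tri u2 u3 t2 -> tri u3 u4 t3 -> tri u4 u5 t4 -> tri u5 u1 t5 ->
  allS (sp [:: t1; t2; t3; t4; t5]) [:: u1; u2; u3; u4; u5].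
Proof.
move=> iu iv h1 h2 h3 h4 h5; pose A := sp [:: t1; t2; t3; t4; t5].
have fA : closed_fd A := closed_fd_span _; have [b1 [b2 [b3 [b4 [b5 _]]]]] : allS A _ := sp_in _.
suff c1 : A u1.
  have c2 := tri2 fA h1 c1 b1; have c3 := tri2 fA h2 c2 b2; have c4 := tri2 fA h3 c3 b3.
  by have c5 := tri2 fA h4 c4 b4.
apply: contrapT => n1.
pose B := sp [:: u1; u2; u3]; pose E := sp [:: u3; u4]; pose D := sp [:: u1; u4; u5].
have fB : closed_fd B := closed_fd_span _; have fE : closed_fd E := closed_fd_span _; have fD : closed_fd D := closed_fd_span _.
have [x1 [x2 [x3 _]]] : allS B _ := sp_in _; have [y3 [y4 _]] : allS E _ := sp_in _.
have [z1 [z4 [z5 _]]] : allS D _ := sp_in _.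
have p1 : B t1 := tri3 fB h1 x1 x2; have p2 : B t2 := tri3 fB h2 x2 x3.
have q3 : E t3 := tri3 fE h3 y3 y4.
have q4 : D t4 := tri3 fD h4 z4 z5; have q5 : D t5 := tri3 fD h5 z5 z1.
have i12 : ind [:: t1; t2].
  apply: (@ind_sub _ [:: t1; t2] [:: u2; u4] iu) => //; mem.
  - by apply: (tri1 (closed_fd_span _) h1); mem.
  - by apply: (tri2 (closed_fd_span _) h2); mem.
have i45 : ind [:: t4; t5].
  apply: (@ind_sub _ [:: t4; t5] [:: u5] iv) => //; mem.
  - by apply: (tri2 (closed_fd_span _) h5); mem.
  - by apply: (tri1 (closed_fd_span _) h4); mem.
have it3 : ind [:: t3].
  apply: (@ind_sub _ [:: t3] [:: u1; u2; u3] iu) => //; mem.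
  by apply: (tri2 (closed_fd_span _) h3); mem.
have i0 : ind [::] by apply: (@ind_sub _ [::] [:: u1; u2; u3; u4] iu) => //; mem.
have i1 : ind [:: u1] by apply: (@ind_sub _ _ [:: u2; u3; u4] iu) => //; mem.
have i3 : ind [:: u3] by apply: (@ind_sub _ _ [:: u1; u2; u4] iu) => //; mem.
have i4 : ind [:: u4] by apply: (@ind_sub _ _ [:: u1; u2; u3] iu) => //; mem.
have i13 : ind [:: u1; u3] by apply: (@ind_sub _ [:: u1; u3] [:: u2; u4] iu) => //; mem.
have i123 : ind [:: u1; u2; u3] by apply: (@ind_sub _ [:: u1; u2; u3] [:: u4] iu) => //; mem.
have dB : dm B <= size e + 3 := dm_sp _; have dD : dm D <= size e + 3 := dm_sp _.
have dE : dm E <= size e + 2 := dm_sp _.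
have mAB := dm_ge (closed_fd_and fA fB) i12 (conj (conj b1 p1) (conj (conj b2 p2) I)).
have mAD := dm_ge (closed_fd_and fA fD) i45 (conj (conj b4 q4) (conj (conj b5 q5) I)).
have dA r us : ind us -> size us = r -> (forall S, closed_fd S -> S u1 -> S u2 -> S u3 -> S u4 -> S u5 -> allS S us) ->
   (forall S, closed_fd S -> allS S us -> S u1 /\ S u2 /\ S u3 /\ S u4 /\ S u5) -> dm A < size e + r.
  move=> ius <- hus hus'; rewrite -[in X in _ < X](dm_ind ius); set U := sp _.
  have fU : closed_fd U := closed_fd_span _; have [w1 [w2 [w3 [w4 w5]]]] := hus' U fU (sp_in us).
  apply: (dm_lt' fA fU _ w1 n1) => y; apply: closed_fd_sp => //.
  by split; [|split; [|split; [|split; [|split]]]] => //; [apply: (tri3 fU h1) | apply: (tri3 fU h2) | apply: (tri3 fU h3) | apply: (tri3 fU h4) | apply: (tri3 fU h5)].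
have spanA S : closed_fd S -> (forall y, A y -> S y) -> S u1 \/ S u2 \/ S u3 \/ S u4 -> [/\ S u1, S u2, S u3, S u4 & S u5].
  move=> fS AS; have := AS _ b1; have := AS _ b2; have := AS _ b3; have := AS _ b4; have := AS _ b5.
  move=> s5 s4 s3 s2 s1 hS.
  have r1 : S u1.
    have r2 : S u2 -> S u1 by move=> r; exact: (tri1 fS h1 r).
    have r3 : S u3 -> S u1 by move=> r; apply: r2; exact: (tri1 fS h2 r).
    have r4 : S u4 -> S u1 by move=> r; apply: r3; exact: (tri1 fS h3 r).
    by case: hS => [|[|[|]]].
  have r2 := tri2 fS h1 r1 s1; have r3 := tri2 fS h2 r2 s2; have r4 := tri2 fS h3 r3 s3.
  by have r5 := tri2 fS h4 r4 s4; split.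
(* If [u3] lies in the span [D] of the triangle, the sets [A], [B], [D] suffice, with 4 + 2 + 2 + 2
   against 3 + 3 + 3. Otherwise the edge [E] from [u3] to [u4] is needed as a fourth set. *)
have [D3|nD3] := pselect (D u3).
  have iv4 : ind [:: u1; u4; u3] by apply: (@ind_sub _ _ [:: u2] iu) => //; mem.
  have D5 : sp [:: u1; u4; u3] u5.
    have h : ~ sp [:: u1; u4] u3 by have /(ind_notin [:: u1; u4] u3) [] := iv4.
    exact: (@acl_exchange_sp [:: u1; u4] u5 u3 D3 h).
  have {}dA : dm A < size e + 4.
    apply: (dA _ _ iu) => // S fS [s1 [s2 [s3 [s4 _]]]]; split=> //; split=> //; split=> //; split=> //.
    by apply: (closed_fd_sp fS _ D5).
  have spanAB : allS (acl (fun y => A y \/ B y)) [:: u1; u2; u3; u4].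
    have [] := spanA _ (closed_fd_or fA fB) (fun y h => acl_orl _ h) (or_introl (acl_orr _ x1)).
    by [].
  have kAB := dm_cap fA fB iu spanAB; have mU := dm_or3 fA fB fD iu spanAB.
  have kBD := @dm_cap _ _ [:: u1; u2; u3; u4] fB fD iu (conj (acl_orl _ x1) (conj (acl_orl _ x2) (conj (acl_orl _ x3) (conj (acl_orr _ z4) I)))).
  have mBD := dm_ge (closed_fd_and fB fD) i13 (conj (conj x1 z1) (conj (conj x3 D3) I)).
  have k0 : dm (fun y => A y /\ B y /\ D y) <= size e.
    apply: leq_trans (_ : dm (sp [::]) <= _); last by rewrite dm_ind //= addn0.
    apply: (dm_mono hsm hM); last by case: (closed_fd_span [::]).
    move=> y [Ay [By Dy]]; apply: acl_refl; apply: (flat_path2 i123 h1 h2).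
      apply: (closed_fd_sub (closed_fd_and fB fD) i13) => //; move: kBD => /=; lia.
    by apply: (closed_fd_sub (closed_fd_and fA fB) i12) => //; move: kAB => /=; lia.
  have := flat3 hflat (fl3 fA) (fl3 fB) (fl3 fD).
  move: mAB mAD mBD mU => /=; lia.
have i1453 : ind [:: u1; u4; u5; u3] by apply/(ind_notin [:: u1; u4; u5] u3); split.
have [r [us [ius sus hus hus']]] : exists r us, [/\ ind us, size us = r,
    (forall S, closed_fd S -> S u1 -> S u2 -> S u3 -> S u4 -> S u5 -> allS S us) &
    (forall S, closed_fd S -> allS S us -> S u1 /\ S u2 /\ S u3 /\ S u4 /\ S u5)].
  have [U5|nU5] := pselect (sp [:: u1; u2; u3; u4] u5).
    exists 4, [:: u1; u2; u3; u4]; split=> // S fS [s1 [s2 [s3 [s4 _]]]].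
    by do 4 (split=> //); apply: (closed_fd_sp fS _ U5).
  exists 5, [:: u1; u2; u3; u4; u5]; split=> //; last by move=> S fS; rewrite /=; tauto.
  by apply/(ind_notin [:: u1; u2; u3; u4] u5).
have {}dA := dA _ _ ius sus hus hus'.
have capA S : closed_fd S -> S u1 \/ S u2 \/ S u3 \/ S u4 -> dm (fun y => A y /\ S y) + size e + r <= dm A + dm S.
  move=> fS hS; have fW := closed_fd_or fA fS; rewrite -sus; apply: dm_cap => //.
  have [] : [/\ acl (fun y => A y \/ S y) u1, acl (fun y => A y \/ S y) u2, acl (fun y => A y \/ S y) u3,
     acl (fun y => A y \/ S y) u4 & acl (fun y => A y \/ S y) u5].
    apply: spanA => // [y|]; first exact: acl_orl.
    by move: hS => [h|[h|[h|h]]]; [left | right; left | right; right; left | right; right; right]; apply: acl_orr.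
  by move=> *; apply: hus.
have fBE := closed_fd_and fB fE; have fBD := closed_fd_and fB fD; have fED := closed_fd_and fE fD.
have kBE := @dm_cap _ _ [:: u1; u2; u3; u4] fB fE iu (conj (acl_orl _ x1) (conj (acl_orl _ x2) (conj (acl_orl _ x3) (conj (acl_orr _ y4) I)))).
have kED := @dm_cap _ _ [:: u1; u4; u5; u3] fE fD i1453 (conj (acl_orr _ z1) (conj (acl_orr _ z4) (conj (acl_orr _ z5) (conj (acl_orl _ y3) I)))).
have kBED := @dm_cap _ _ [:: u1; u4; u5; u3] fBE fD i1453 (conj (acl_orr _ z1) (conj (acl_orr _ z4) (conj (acl_orr _ z5) (conj (acl_orl _ (conj x3 y3)) I)))).
have kABE := capA _ fBE (or_intror (or_intror (or_introl (conj x3 y3)))).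
have kAED := capA _ fED (or_intror (or_intror (or_intror (conj y4 z4)))).
have kABD : dm (fun y => A y /\ B y /\ D y) < dm (fun y => B y /\ D y).
  by apply: (dm_lt' (closed_fd_and fA fBD) fBD _ (conj x1 z1)) => [y []|[]].
have mAE := dm_ge (closed_fd_and fA fE) it3 (conj (conj b3 q3) I).
have mBE := dm_ge fBE i3 (conj (conj x3 y3) I).
have mED := dm_ge fED i4 (conj (conj y4 z4) I).
have m0 := dm_ge (closed_fd_and fA (closed_fd_and fB (closed_fd_and fE fD))) i0 I.
have mU : size e + r <= dm (fun y => A y \/ B y \/ E y \/ D y).
  rewrite -sus; apply: dm_or4 => //.
  have [] : [/\ acl (fun y => A y \/ B y) u1, acl (fun y => A y \/ B y) u2, acl (fun y => A y \/ B y) u3,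
     acl (fun y => A y \/ B y) u4 & acl (fun y => A y \/ B y) u5].
    apply: spanA => [|y|]; [exact: closed_fd_or | exact: acl_orl | by left; apply: acl_orr].
  by move=> *; apply: hus => //; exact: closed_fd_or.
(* Let [r] be the dimension of the five vertices and [d] that of the intersection of [B] and [D],
   relative to [e]. The left side is at least [r + 7 + d], the right side at most
   [(r - 1) + 8 + (d - 1)]. The final [- 1] is due to [u1], which lies in [B] and [D] but not in
   [A]. *)
have := flat4 hflat (fl3 fA) (fl3 fB) (fl3 fE) (fl3 fD).
move: kBED; rewrite -dm_andA.
move: mAB mAD mAE mBE mED m0 mU kBE kED kABE kAED kABD => /=; lia.
Qed.

End FlatGeometry.

(** * Counting cycles of a ternary relation *)

Lemma card_dep (A B : finType) (P : {set A}) (R : A -> {set B}) :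
  #|[set p | (p.1 \in P) && (p.2 \in R p.1)]| = \sum_(a in P) #|R a|.
Proof.
rewrite -sum1_card (eq_bigl (fun p : A * B => (p.1 \in P) && (p.2 \in R p.1))); last by move=> p; rewrite inE.
rewrite -(pair_big_dep (fun a => a \in P) (fun a b => b \in R a) (fun _ _ => 1)) /=.
by apply: eq_bigr => a _; rewrite sum1_card.
Qed.

Lemma card_dep_const (A B : finType) (P : {set A}) (R : A -> {set B}) c :
  (forall a, a \in P -> #|R a| = c) -> #|[set p | (p.1 \in P) && (p.2 \in R p.1)]| = #|P| * c.
Proof.
by move=> h; rewrite card_dep (eq_bigr (fun _ => c)) // sum_nat_const.
Qed.

Lemma swap_inj (A : Type) : injective (fun p : A * A => (p.2, p.1)).
Proof. by move=> [a b] [c d] [-> ->]. Qed.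

Section CycleCount.
Variables (V : finType) (Q : V -> V -> V -> bool) (good : V -> V -> bool).
Variables (C B m l4 l5 : nat).

(** The tuple [u] lists vertices and [w] labels, [Q x y z] making [z] a label of the edge from [x]
    to [y]. As [Q] is symmetric, vertices and labels can exchange roles, which the gluing of cycles
    exploits. *)
Definition cyc4 (u w : V * V * V * V) : bool :=
  let: (u1, u2, u3, u4) := u in let: (w1, w2, w3, w4) := w in
  [&& Q u1 u2 w1, Q u2 u3 w2, Q u3 u4 w3 & Q u4 u1 w4].

Definition cyc5 (u t : V * V * V * V * V) : bool :=
  let: (u1, u2, u3, u4, u5) := u in let: (t1, t2, t3, t4, t5) := t in
  [&& Q u1 u2 t1, Q u2 u3 t2, Q u3 u4 t3, Q u4 u5 t4 & Q u5 u1 t5].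

Definition good4 (u : V * V * V * V) : bool :=
  let: (u1, u2, u3, u4) := u in [&& good u1 u2, good u2 u3, good u3 u4 & good u4 u1].
Definition good5 (u : V * V * V * V * V) : bool :=
  let: (u1, u2, u3, u4, u5) := u in [&& good u1 u2, good u2 u3, good u3 u4, good u4 u5 & good u5 u1].

(* A 5-cycle through [u1] whose first three labels are [t1; t2; t3] starts with
   such a path. *)
Definition path3 (t1 t2 t3 u1 : V) (p : V * V * V) : bool :=
  let: (u2, u3, u4) := p in [&& Q u1 t1 u2, Q u2 t2 u3 & Q u3 t3 u4].
Variables (E4 Bad4 : {set V * V * V * V}) (E5 Bad5 BadB : {set V * V * V * V * V}).

Hypothesis Qc : forall x y z, Q x y z = Q y x z.
Hypothesis Qr : forall x y z, Q x y z = Q y z x.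
Hypothesis Qgood : forall x y, good x y -> #|[set z | Q x y z]| = m.
Hypothesis Qbound : forall x y, #|[set z | Q x y z]| <= B.
Hypothesis N4 : forall w, w \notin E4 -> #|[set x | cyc4 x w]| = l4.
Hypothesis N5 : forall t, t \notin E5 -> #|[set u | cyc5 u t]| = l5.
Hypothesis cE5 : #|E5| <= C * #|V| ^ 4.
Hypothesis cBad4 : #|Bad4| <= C * #|V| ^ 3.
Hypothesis cBad5 : #|Bad5| <= C * #|V| ^ 4.
Hypothesis cBadB : #|BadB| <= C * #|V| ^ 4.
Hypothesis Bad4P : forall u, u \notin Bad4 -> good4 u /\ forall w, cyc4 u w -> w \notin E4.
Hypothesis Bad5P : forall u, u \notin Bad5 -> good5 u /\ forall t, cyc5 u t -> t \notin E5.
(** For a generic choice of three labels and two starting points, whatever completes them is generic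
    too, so that the exact counts apply at every stage of the gluing. In a closing 4-cycle [x] the
    components [x.1.1.2] and [x.2] are the labels [t4] and [t5] still missing. *)
Hypothesis BadBP : forall t1 t2 t3 u1 v1, (t1, t2, t3, u1, v1) \notin BadB ->
  [/\ u1 != v1, good u1 t1 && good v1 t1,
      (forall u2 u3, Q u1 t1 u2 -> good u2 t2 /\ (Q u2 t2 u3 -> good u3 t3)),
      (forall u2 u3, Q v1 t1 u2 -> good u2 t2 /\ (Q u2 t2 u3 -> good u3 t3)) &
      forall p p', path3 t1 t2 t3 u1 p -> path3 t1 t2 t3 v1 p' ->
        (p.2, p'.2, v1, u1) \notin E4 /\
        forall x, cyc4 x (p.2, p'.2, v1, u1) -> (t1, t2, t3, x.1.1.2, x.2) \notin E5].

Lemma card_cyc4 (u : V * V * V * V) : good4 u -> #|[set w | cyc4 u w]| = m ^ 4.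
Proof.
case: u => [[[u1 u2] u3] u4] /and4P [g1 g2 g3 g4].
have -> : [set w | cyc4 (u1, u2, u3, u4) w] =
    setX (setX (setX [set z | Q u1 u2 z] [set z | Q u2 u3 z]) [set z | Q u3 u4 z]) [set z | Q u4 u1 z].
  by apply/setP => -[[[w1 w2] w3] w4]; rewrite !inE /= -!andbA.
by rewrite !cardsX !Qgood // !expnSr mul1n.
Qed.

Lemma card_cyc5 (u : V * V * V * V * V) : #|[set t | cyc5 u t]| <= B ^ 5 /\ (good5 u -> #|[set t | cyc5 u t]| = m ^ 5).
Proof.
case: u => [[[[u1 u2] u3] u4] u5].
have -> : [set w | cyc5 (u1, u2, u3, u4, u5) w] =
    setX (setX (setX (setX [set z | Q u1 u2 z] [set z | Q u2 u3 z]) [set z | Q u3 u4 z]) [set z | Q u4 u5 z]) [set z | Q u5 u1 z].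
  by apply/setP => -[[[[w1 w2] w3] w4] w5]; rewrite !inE /= -!andbA.
rewrite !cardsX; split; last by move=> /and5P [g1 g2 g3 g4 g5]; rewrite !Qgood // !expnSr mul1n.
by rewrite [B ^ _]expnSr (expnSr B 3) (expnSr B 2) (expnSr B 1) expn1; do 4 (apply: leq_mul => //).
Qed.

Lemma cards4 : #|{: V * V * V * V}| = #|V| ^ 4.
Proof. by rewrite !card_prod !expnSr mul1n. Qed.
Lemma cards5 : #|{: V * V * V * V * V}| = #|V| ^ 5.
Proof. by rewrite !card_prod !expnSr mul1n. Qed.

(** Incidences between vertex cycles and label tuples are counted twice: a cycle outside [Bad4] has
    [m ^ 4] label tuples, and a label tuple outside [E4] belongs to [l4] cycles. If [l4 < m ^ 4],
    then [#|V| ^ 4] would be at most [#|Bad4| * m ^ 4], which has order [#|V| ^ 3]. *)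
Lemma l4_ge : C * m ^ 4 < #|V| -> m ^ 4 <= l4.
Proof.
move=> unbounded; pose S := [set p : (V * V * V * V) * (V * V * V * V) | (p.1 \in ~: Bad4) && (p.2 \in [set w | cyc4 p.1 w])].
pose S' := [set p : (V * V * V * V) * (V * V * V * V) | (p.1 \in ~: E4) && (p.2 \in [set u | cyc4 u p.1])].
have cS : #|S| = #|~: Bad4| * m ^ 4.
  by apply: (card_dep_const (R := fun a => [set w | cyc4 a w])) => u; rewrite inE => /Bad4P [/card_cyc4].
have cS' : #|S'| = #|~: E4| * l4.
  by apply: (card_dep_const (R := fun a => [set u | cyc4 u a])) => u; rewrite inE => /N4.
have le : #|S| <= #|S'|.
  rewrite -(card_imset _ (@swap_inj (V * V * V * V)%type)).
  apply: subset_leq_card; apply/subsetP => q /imsetP [[u w]]; rewrite !inE /= => /andP [/Bad4P [_ h] c] ->.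
  by rewrite /= c (h w c).
have c1 : #|~: Bad4| + #|Bad4| = #|V| ^ 4 by rewrite addnC cardsC cards4.
have c2 : #|~: E4| + #|E4| = #|V| ^ 4 by rewrite addnC cardsC cards4.
rewrite leqNgt; apply/negP => lt.
have : #|~: Bad4| * m ^ 4 <= #|V| ^ 4 * l4.
  by rewrite -cS; apply: leq_trans le _; rewrite cS' leq_mul2r; apply/orP; right; lia.
have -> : #|~: Bad4| = #|V| ^ 4 - #|Bad4| by lia.
have l1 : #|V| ^ 4 * l4 <= #|V| ^ 4 * (m ^ 4 - 1) by apply: leq_mul => //; lia.
rewrite mulnBl => h.
have h2 : #|V| ^ 4 <= #|Bad4| * m ^ 4.
  have : #|V| ^ 4 <= #|V| ^ 4 * m ^ 4 by rewrite leq_pmulr //; lia.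
  by move: h l1; rewrite mulnBr muln1; lia.
have : #|V| ^ 4 <= C * #|V| ^ 3 * m ^ 4 by apply: leq_trans h2 _; rewrite leq_mul2r cBad4 orbT.
have -> : C * #|V| ^ 3 * m ^ 4 = #|V| ^ 3 * (C * m ^ 4) by lia.
by rewrite expnSr leq_pmul2l ?expn_gt0; lia.
Qed.

(** The same incidences, for 5-cycles and in the other direction. Exceptional cycles cannot be
    dropped from an upper bound, so they are charged at the crude rate [B ^ 5]. *)
Lemma l5_le : C * B ^ 5 + l5 * C < #|V| -> l5 <= m ^ 5.
Proof.
move=> unbounded; pose S := [set p : (V * V * V * V * V) * (V * V * V * V * V) | (p.1 \in setT) && (p.2 \in [set w | cyc5 p.1 w])].
pose S' := [set p : (V * V * V * V * V) * (V * V * V * V * V) | (p.1 \in ~: E5) && (p.2 \in [set u | cyc5 u p.1])].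
have cS : #|S| <= #|V| ^ 5 * m ^ 5 + #|Bad5| * B ^ 5.
  rewrite (card_dep setT (fun a => [set w | cyc5 a w])) (bigID (fun a => a \in Bad5)) /= addnC; apply: leq_add.
    rewrite -cards5 -sum_nat_const big_mkcond [X in _ <= X]big_mkcond; apply: leq_sum => u _.
    by rewrite !inE; case: ifP => // /Bad5P [/(card_cyc5 u).2 ->].
  rewrite -sum_nat_const; rewrite big_mkcond [X in _ <= X]big_mkcond; apply: leq_sum => u _.
  by have [le5 _] := card_cyc5 u; rewrite !inE; case: (u \in Bad5).
have cS' : #|S'| = #|~: E5| * l5.
  by apply: (card_dep_const (R := fun a => [set u | cyc5 u a])) => u; rewrite inE => /N5.
have le : #|S'| <= #|S|.
  rewrite -(card_imset _ (@swap_inj (V * V * V * V * V)%type)).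
  apply: subset_leq_card; apply/subsetP => q /imsetP [[u w]]; rewrite !inE /= => /andP [_ c] ->.
  by rewrite /= c ?inE.
have c1 : #|~: E5| = #|V| ^ 5 - #|E5| by rewrite -cards5 -(cardsC E5); lia.
rewrite leqNgt; apply/negP => lt.
have := leq_trans le cS; rewrite cS' c1 mulnBl => h.
have h1 : #|V| ^ 5 * l5 <= #|V| ^ 5 * m ^ 5 + #|Bad5| * B ^ 5 + #|E5| * l5 by lia.
have h2 : #|V| ^ 5 * (m ^ 5).+1 <= #|V| ^ 5 * l5 by rewrite leq_mul.
have h3 : #|Bad5| * B ^ 5 <= C * #|V| ^ 4 * B ^ 5 by rewrite leq_mul2r cBad5 orbT.
have h4 : #|E5| * l5 <= C * #|V| ^ 4 * l5 by rewrite leq_mul2r cE5 orbT.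
have h5 : #|V| ^ 5 <= #|V| ^ 4 * (C * B ^ 5 + l5 * C).
  have -> : #|V| ^ 4 * (C * B ^ 5 + l5 * C) = C * #|V| ^ 4 * B ^ 5 + C * #|V| ^ 4 * l5 by lia.
  rewrite mulnS in h2; lia.
by move: h5; rewrite expnSr leq_pmul2l ?expn_gt0; lia.
Qed.

Lemma card_path3 t1 t2 t3 u1 : good u1 t1 ->
  (forall u2 u3, Q u1 t1 u2 -> good u2 t2 /\ (Q u2 t2 u3 -> good u3 t3)) ->
  #|[set p | path3 t1 t2 t3 u1 p]| = m * m * m.
Proof.
move=> g1 g2.
have -> : [set p | path3 t1 t2 t3 u1 p] = [set p : V * V * V | (p.1 \in [set q : V * V | (q.1 \in [set u2 | Q u1 t1 u2]) && (q.2 \in [set u3 | Q q.1 t2 u3])]) && (p.2 \in [set u4 | Q p.1.2 t3 u4])].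
  by apply/setP => -[[u2 u3] u4]; rewrite !inE /= -!andbA.
rewrite (card_dep_const (R := fun p : V * V => [set u4 | Q p.2 t3 u4]) (c := m)); last first.
  by move=> [u2 u3]; rewrite !inE /= => /andP [/(g2 _ u3) [_ h] /h /Qgood].
rewrite (card_dep_const (R := fun p => [set u4 | Q p t2 u4]) (c := m)) ?Qgood //.
by move=> u2; rewrite inE => /(g2 _ u2) [/Qgood].
Qed.

Notation V5 := (V * V * V * V * V)%type.
Notation V4 := (V * V * V * V)%type.
Notation V3 := (V * V * V)%type.

Let paths (b : V5) : {set V3 * V3} :=
  let: (t1, t2, t3, u1, v1) := b in setX [set p | path3 t1 t2 t3 u1 p] [set p | path3 t1 t2 t3 v1 p].
(* Two paths with the same labels, from [u1] to [u4] and from [v1] to [v4], are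
   completed to two 5-cycles [u], [v] with common labels [t] by the entries
   [(u5, t4, v5, t5)] of a 4-cycle labelled [(u4, v4, v1, u1)]. *)
Let closing (b : V5) (q : V3 * V3) : {set V4} := [set x | cyc4 x (q.1.2, q.2.2, b.2, b.1.2)].
Let ND := [set z : V5 * ((V3 * V3) * V4) | (z.1 \in ~: BadB) &&
  (z.2 \in [set y : (V3 * V3) * V4 | (y.1 \in paths z.1) && (y.2 \in closing z.1 y.1)])].
Let glue (z : V5 * ((V3 * V3) * V4)) : V5 * (V5 * V5) :=
  let: ((t1, t2, t3, u1, v1), ((u2, u3, u4, (v2, v3, v4)), (u5, t4, v5, t5))) := z in
  ((t1, t2, t3, t4, t5), ((u1, u2, u3, u4, u5), (v1, v2, v3, v4, v5))).

Lemma card_ND : #|ND| = #|~: BadB| * (m * m * m * (m * m * m) * l4).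
Proof.
apply: (card_dep_const (R := fun b => [set y : (V3 * V3) * V4 | (y.1 \in paths b) && (y.2 \in closing b y.1)])).
move=> [[[[t1 t2] t3] u1] v1]; rewrite inE => /BadBP [_ /andP [g1 g2] p1 p2 h].
rewrite (card_dep_const (R := closing (t1, t2, t3, u1, v1)) (c := l4)).
  by rewrite cardsX !card_path3.
by move=> [p p']; rewrite !inE /= => /andP [hp hp']; apply: N4; case: (h _ _ hp hp').
Qed.

(* A generic label tuple is that of [l5 <= m ^ 5] 5-cycles, so there are at most
   about [m ^ 10 * #|V| ^ 5] pairs of 5-cycles with equal labels.  The diagonal
   contributes [m ^ 5 * #|V| ^ 5] of them and the pairs in [ND] another
   [m ^ 6 * l4 * #|V| ^ 5], with [m ^ 4 <= l4]. *)
Lemma cycle_count : #|V| <= C * m ^ 4 + (C * B ^ 5 + l5 * C) + C * (m ^ 5 + 1) \/ m = 0.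
Proof.
have [m0|m_gt0] := posnP m; [by right | left; rewrite leqNgt; apply/negP => unbounded].
have h4 : m ^ 4 <= l4 by apply: l4_ge; lia.
have h5 : l5 <= m ^ 5 by apply: l5_le; lia.
pose S := [set p : V5 * (V5 * V5) | (p.1 \in ~: E5) && (p.2 \in setX [set u | cyc5 u p.1] [set u | cyc5 u p.1])].
have cS : #|S| <= #|V| ^ 5 * (m ^ 5 * m ^ 5).
  rewrite (card_dep_const (R := fun t => setX [set u | cyc5 u t] [set u | cyc5 u t]) (c := l5 * l5)).
    apply: leq_mul; [rewrite -cards5; exact: max_card | exact: leq_mul].
  by move=> t; rewrite inE cardsX => /N5 ->.
pose D := [set p : V5 * V5 | (p.1 \in ~: Bad5) && (p.2 \in [set t | cyc5 p.1 t])].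
have cD : #|D| = #|~: Bad5| * m ^ 5.
  by apply: (card_dep_const (R := fun a => [set w | cyc5 a w])) => u; rewrite inE => /Bad5P [/(card_cyc5 u).2].
pose dg (p : V5 * V5) := (p.2, (p.1, p.1)).
have dg_inj : injective dg by move=> [u t] [u' t'] [-> ->].
have glue_inj : injective glue.
  by move=> [[[[[? ?] ?] ?] ?] [[[[? ?] ?] [[? ?] ?]] [[[? ?] ?] ?]]]
            [[[[[? ?] ?] ?] ?] [[[[? ?] ?] [[? ?] ?]] [[[? ?] ?] ?]]] /= [] *; subst.
(* By the symmetry of [Q], the edges of the closing 4-cycle become the last two edges of each of the
   two 5-cycles. *)
have sub : dg @: D :|: glue @: ND \subset S.
  apply/subsetP => y; rewrite inE => /orP [/imsetP [[u t]]|/imsetP [z]].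
    by rewrite !inE /= => /andP [/Bad5P [_ h] c] ->; rewrite /= c (h t c).
  move: z => [[[[[t1 t2] t3] u1] v1] [[[[u2 u3] u4] [[v2 v3] v4]] [[[u5 t4] v5] t5]]].
  rewrite !inE /= -!andbA => /andP [/BadBP [_ _ _ _ h]].
  move=> /and5P [a1 a2 a3 b1 /and5P [b2 b3 c1 c2 /andP [c3 c4]]] ->.
  have [_ h'] := h (u2, u3, u4) (v2, v3, v4) (introT and3P (And3 a1 a2 a3)) (introT and3P (And3 b1 b2 b3)).
  have nE : (t1, t2, t3, t4, t5) \notin E5 by apply: (h' (u5, t4, v5, t5)); rewrite /= c1 c2 c3 c4.
  have Qs a b c : Q a b c = Q a c b by rewrite Qr Qr Qc.
  rewrite nE /= (Qs u1) a1 (Qs u2) a2 (Qs u3) a3 (Qs v1) b1 (Qs v2) b2 (Qs v3) b3.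
  by rewrite (Qr u4) c1 (Qc v4) -(Qr t4) c2 -(Qr t5) c4 (Qs v5) c3.
(* On the diagonal the two 5-cycles coincide, whereas those glued from [ND] start at different
   vertices. *)
have disj : [disjoint dg @: D & glue @: ND].
  apply/pred0P => y /=; apply/negbTE/negP => /andP [/imsetP [[u t] _ ->] /imsetP [z]].
  move: z => [[[[[t1 t2] t3] u1] v1] [[[[u2 u3] u4] [[v2 v3] v4]] [[[u5 t4] v5] t5]]].
  by rewrite !inE /= => /andP [/BadBP [ne _ _ _ _] _] [_ -> [e _ _ _ _]]; rewrite e eqxx in ne.
have := leq_trans (subset_leq_card sub) cS.
have := cardsUI (dg @: D) (glue @: ND); rewrite (disjoint_setI0 disj) cards0 addn0 => ->; rewrite !card_imset // cD card_ND.
have e1 : #|~: Bad5| = #|V| ^ 5 - #|Bad5| by rewrite -cards5 -(cardsC Bad5); lia.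
have e2 : #|~: BadB| = #|V| ^ 5 - #|BadB| by rewrite -cards5 -(cardsC BadB); lia.
have f1 : #|Bad5| <= #|V| ^ 5 by rewrite -cards5 max_card.
have f2 : #|BadB| <= #|V| ^ 5 by rewrite -cards5 max_card.
have f3 : m ^ 10 <= m * m * m * (m * m * m) * l4.
  have -> : m ^ 10 = m * m * m * (m * m * m) * m ^ 4 by rewrite !expnSr; lia.
  by rewrite leq_mul2l h4 orbT.
have p10 : m ^ 10 = m ^ 5 * m ^ 5 by rewrite -expnD.
have g : #|~: BadB| * (m ^ 5 * m ^ 5) <= #|~: BadB| * (m * m * m * (m * m * m) * l4).
  by rewrite -p10 leq_mul2l f3 orbT.
move=> h.
have {g h} : #|~: Bad5| * m ^ 5 + #|~: BadB| * (m ^ 5 * m ^ 5) <= #|V| ^ 5 * (m ^ 5 * m ^ 5).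
  by apply: leq_trans h; rewrite leq_add2l.
rewrite e1 e2 !mulnBl.
have g1 : #|Bad5| * m ^ 5 <= C * #|V| ^ 4 * m ^ 5 by rewrite leq_mul2r cBad5 orbT.
have g2 : #|BadB| * (m ^ 5 * m ^ 5) <= C * #|V| ^ 4 * (m ^ 5 * m ^ 5) by rewrite leq_mul2r cBadB orbT.
have g3 : #|Bad5| * m ^ 5 <= #|V| ^ 5 * m ^ 5 by rewrite leq_mul2r f1 orbT.
have g4 : #|BadB| * (m ^ 5 * m ^ 5) <= #|V| ^ 5 * (m ^ 5 * m ^ 5) by rewrite leq_mul2r f2 orbT.
(* The terms [#|V| ^ 5 * m ^ 10] cancel, which leaves the diagonal term to be absorbed by errors of
   order [#|V| ^ 4]. *)
move=> h; have {h} : #|V| ^ 5 * m ^ 5 <= C * #|V| ^ 4 * m ^ 5 + C * #|V| ^ 4 * (m ^ 5 * m ^ 5) by lia.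
have -> : #|V| ^ 5 * m ^ 5 = #|V| ^ 4 * m ^ 5 * #|V| by rewrite expnSr; lia.
have -> : C * #|V| ^ 4 * m ^ 5 + C * #|V| ^ 4 * (m ^ 5 * m ^ 5) = #|V| ^ 4 * m ^ 5 * (C * (m ^ 5 + 1)) by lia.
rewrite leq_pmul2l; last by rewrite muln_gt0 !expn_gt0 m_gt0; lia.
lia.
Qed.
End CycleCount.

(** * Exceptional sets and derivation rules *)

Section Atmost.

Lemma atmost_sub (A : Type) m (S1 S2 : A -> Prop) : (forall a, S1 a -> S2 a) -> atmost m S2 -> atmost m S1.
Proof. by move=> h [s sm hs]; exists s => // a /h /hs. Qed.

Lemma atmost_or (A : Type) m1 m2 (S1 S2 : A -> Prop) : atmost m1 S1 -> atmost m2 S2 ->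
  atmost (m1 + m2) (fun a => S1 a \/ S2 a).
Proof.
move=> [s1 l1 h1] [s2 l2 h2]; exists (s1 ++ s2); first by rewrite size_cat leq_add.
by move=> a [/h1|/h2] h; apply/List.in_app_iff; [left | right].
Qed.

Lemma atmost_dep (A B D : Type) m c (S1 : A -> Prop) (R : A -> B -> Prop) (h : A -> B -> D) (S : D -> Prop) :
  atmost m S1 -> (forall x, S1 x -> atmost c (R x)) ->
  (forall d, S d -> exists x y, [/\ S1 x, R x y & d = h x y]) -> atmost (m * c) S.
Proof.
move=> [s sm hs] hR hS.
have ch x : exists u : seq B, size u <= c /\ (S1 x -> forall y, R x y -> List.In y u).
  case: (pselect (S1 x)) => [/hR [u ul hu]|n]; first by exists u.
  by exists [::].
have [t tP] := choice ch.
exists (flatten [seq map (h x) (t x) | x <- s]).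
  apply: (@leq_trans (size s * c)); last by rewrite leq_mul2r sm orbT.
  elim: s {sm hs} => //= x s IH; rewrite size_cat size_map mulSn leq_add //; exact: (tP x).1.
move=> d /hS [x [y [Sx Rxy ->]]]; have := hs _ Sx; elim: s {sm hs} => //= x' s IH hx.
apply/List.in_app_iff; case: hx => [->|/IH]; [left | by right].
by apply: List.in_map; exact: (tP x).2.
Qed.

(** Phrased through [atmost] and a finite list of smaller bounds, so that it is visibly
    first-order. *)
Definition exactly (A : Type) m (S : A -> Prop) : Prop :=
  atmost m S /\ forall m', List.In m' (iota 0 m) -> ~ atmost m' S.

Lemma exactlyP (A : Type) m (S : A -> Prop) : exactly m S ->
  exists s, [/\ List.NoDup s, size s = m & forall a, List.In a s <-> S a].
Proof.
move=> [am nm]; have [s [nd hs]] := finite_enum ((finite_atmost _).2 (ex_intro (fun m => atmost m _) m am)).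
exists s; split=> //; last by move=> a; rewrite hs.
apply/eqP; rewrite eqn_leq (atmost_size am nd) => [|a /hs //].
rewrite leqNgt; apply/negP => lt; apply: (nm (size s)); first by apply/In_iota.
by exists s => // a /hs.
Qed.

Lemma exactly_ex (A : Type) (S : A -> Prop) : finite_set S -> exists m, exactly m S.
Proof.
move=> f; have [s [nd hs]] := finite_enum f; exists (size s); split; first by exists s => // a /hs.
move=> m /In_iota /andP [_ lt] /atmost_size /(_ nd) h.
by have := h (fun a => (hs a).2); rewrite leqNgt lt.
Qed.

Fixpoint tuples (A : Type) (X : seq A) (n : nat) : seq (seq A) :=
  if n is n'.+1 then flatten [seq map (cons x) (tuples X n') | x <- X] else [:: [::]].

Lemma In_tuples (A : Type) (X : seq A) w : (forall y, List.In y w -> List.In y X) ->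
  List.In w (tuples X (size w)).
Proof.
elim: w => [|x w IH] h /=; first by left.
have hx := h x (or_introl erefl); have {}IH := IH (fun y hy => h y (or_intror hy)).
move: (tuples X (size w)) IH => Y IH.
elim: X hx {h} => //= x' X IHX hx; apply/List.in_app_iff; case: hx => [->|/IHX]; [left | by right].
by apply: List.in_map.
Qed.

Lemma size_tuples (A : Type) (X : seq A) n : size (tuples X n) = size X ^ n.
Proof.
elim: n => //= n IH; rewrite size_flatten /shape -map_comp.
rewrite (eq_map (g := fun=> size X ^ n)); last by move=> x /=; rewrite size_map IH.
by rewrite expnS; move: (size X ^ n) => c; elim: X {IH} => //= x s ->.
Qed.

End Atmost.

Section DefTuples.
Variable L : signature.
Implicit Types (k : nat) (F G : forall M : structure L, seq M -> Prop).

Lemma Def_foralls k j F : Def (k + j) F -> Def k (fun M l => forall s, size s = j -> F M (l ++ s)).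
Proof.
move=> hF; apply: Def_ext (Def_not (Def_exs (Def_not hF))) => M l _.
by split=> [h s sj|h [s sj]]; [apply: contrapT => ns; apply: h; exists s | apply; exact: h].
Qed.

Lemma Def_atmosts k j m F : Def (k + j) F ->
  Def k (fun M l => atmost m (fun t => size t = j /\ F M (l ++ t))).
Proof.
move=> hF.
(* As in [Def_atmost], the list of [i] tuples being stored as [i * j] consecutive entries. *)
pose G i (M : structure L) (l : seq M) := F M (sel l (iota 0 k ++ iota (k + i * j) j)) ->
  exists2 i', List.In i' (iota 0 i) & forall p, List.In p (iota 0 j) -> onth l (k + i' * j + p) = onth l (k + i * j + p).
have hG i : Def (k + i * j + j) (G i).
  apply: Def_imp.
    apply: (@Def_sel _ _ _ _ _ hF); first by rewrite size_cat !size_iota.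
    rewrite all_cat; apply/andP; split; apply/allP => v; rewrite mem_iota; lia.
  apply: Def_has => i'; rewrite In_iota => h; apply: Def_all => p; rewrite In_iota => hp.
  by apply: Def_eq; nia.
apply: Def_ext (Def_has (r := iota 0 m.+1) (fun i _ => Def_exs (Def_foralls (hG i)))) => M l sl.
have szf (s : seq (seq M)) : (forall t, List.In t s -> size t = j) -> size (flatten s) = size s * j.
  by elim: s => //= t s IH h; rewrite size_cat h ?IH ?mulSn //; [move=> t' ht; apply: h; right | left].
have chunk (s : seq (seq M)) t i p : (forall t, List.In t s -> size t = j) -> p < j -> i < size s ->
    onth (flatten s ++ t) (i * j + p) = onth (nth [::] s i) p.
  elim: s i => // t' s IH [|i] h pj il; rewrite /= -catA onth_cat (h t' (or_introl erefl)); last first.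
    rewrite ifF; last by lia.
    have -> : i.+1 * j + p - j = i * j + p by lia.
    by apply: IH => // t'' ht; apply: h; right.
  by rewrite mul0n add0n pj.
have E (s : seq (seq M)) t : (forall t, List.In t s -> size t = j) -> size t = j ->
    G (size s) M ((l ++ flatten s) ++ t) <-> (F M (l ++ t) -> List.In t s).
  move=> hs tj; rewrite /G sel_cat.
  have -> : sel ((l ++ flatten s) ++ t) (iota 0 k) = l.
    by have := sel_iota [::] l (flatten s ++ t); rewrite /= sl catA.
  have -> : sel ((l ++ flatten s) ++ t) (iota (k + size s * j) j) = t.
    by have := sel_iota (l ++ flatten s) t [::]; rewrite cats0 size_cat sl szf // tj.
  have o1 i p : p < j -> i < size s -> onth ((l ++ flatten s) ++ t) (k + i * j + p) = onth (nth [::] s i) p.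
    move=> pj il; rewrite -catA onth_cat sl ifF; last by lia.
    have -> : k + i * j + p - k = i * j + p by lia.
    exact: chunk.
  have o2 p : onth ((l ++ flatten s) ++ t) (k + size s * j + p) = onth t p.
    rewrite onth_cat size_cat sl szf // ifF; last by lia.
    by congr onth; lia.
  split=> h hf.
  - have [i /In_iota /andP [_ il] e] := h hf; rewrite add0n in il.
    suff -> : t = nth [::] s i.
      elim: s i il {hs h hf o1 o2 e} => // t' s IH [|i] il /=; [by left | by right; exact: IH].
    apply: eq_from_onth => p; case: (ltnP p j) => pj; last first.
      rewrite !onth_default ?tj // hs //; elim: s i il {hs h hf o1 o2 e} => // t' s IH [|i] il /=; [by left | by right; exact: IH].
    by rewrite -(o1 i p) // -(o2 p); apply/esym; apply: e; apply/In_iota.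
  - have [i il e] := In_nth (h hf); exists i; first by apply/In_iota.
    move=> p /In_iota /andP [_ pj]; rewrite o1 // o2 (onth_nth' [::] il) in e *.
    by case: e => ->.
split=> [[i /In_iota h [u su hu]]|[s sm h]].
- pose s := reshape (nseq i j) u.
  have fs : flatten s = u by apply: reshapeKr; rewrite sumn_nseq su mulnC.
  have ss : size s = i by rewrite size_reshape size_nseq.
  have hs : forall t, List.In t s -> size t = j.
    move=> t /(@In_nth _ s) [p ps e]; rewrite (onth_nth' [::] ps) in e; case: e => <-.
    rewrite nth_reshape; move: (reshapeKl (sh := nseq i j) (s := u)).
    rewrite sumn_nseq su mulnC leqnn => /(_ isT) sh.
    have : nth 0 (shape s) p = j by rewrite sh nth_nseq -ss ps.
    by rewrite (nth_map [::]) // nth_reshape.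
  exists s; first by rewrite ss; lia.
  move=> t [tj Ft]; apply: ((E s t hs tj).1 _ Ft); rewrite fs ss; exact: hu.
- pose s' := filter (fun t => size t == j) s.
  have hs t : List.In t s' <-> List.In t s /\ size t = j.
    by rewrite List.filter_In; split=> -[? /eqP].
  exists (size s'); first by apply/In_iota; rewrite /= size_filter add0n ltnS (leq_trans (count_size _ _)).
  have hs' : forall t, List.In t s' -> size t = j by move=> t /hs [].
  exists (flatten s'); first by rewrite szf.
  by move=> t tj; apply/E => // Ft; apply/hs; split=> //; apply: h.
Qed.

Lemma Def_exactly k j m F : Def (k + j) F ->
  Def k (fun M l => exactly m (fun t => size t = j /\ F M (l ++ t))).
Proof.
move=> hF; apply: Def_and; first exact: Def_atmosts.
apply: (@Def_all _ _ _ (iota 0 m) (fun m' (M : structure L) (l : seq M) => ~ atmost m' (fun t => size t = j /\ F M (l ++ t)))) => m' _.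
by apply: Def_not; exact: Def_atmosts.
Qed.

End DefTuples.

Lemma sel_cat_lt (A : Type) (l u : seq A) s : all (fun i => i < size l) s -> sel (l ++ u) s = sel l s.
Proof.
move=> h; elim/last_ind: u => [|u a IH]; first by rewrite cats0.
rewrite -rcons_cat sel_rcons_lt //; apply: sub_all h => i; rewrite size_cat; lia.
Qed.

(** * Finite solution sets and exceptional tuples *)

Section Solutions.
Variables (L : signature) (T : formula -> Prop).
Hypothesis hsm : strongly_minimal L T.
Variable M : structure L.
Hypothesis hM : is_model T M.
Hypothesis unbounded : forall l : seq M, exists y, ~ acl (in_list l) y.
Implicit Types (F R : forall M : structure L, seq M -> Prop).

(** Passing from solution tuples to their single entries brings the question to dimension one, where
    strong minimality speaks. *)
Lemma Def_entry k b R : Def (k + b) R ->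
  Def k.+1 (fun (M : structure L) (l : seq M) => exists2 u, size u = b &
    R M (sel l (iota 0 k) ++ u) /\ exists2 i, List.In i (iota 0 b) & onth u i = onth l k).
Proof.
move=> dR.
pose G (M : structure L) (l : seq M) := R M (sel l (iota 0 k ++ iota k.+1 b)) /\
  exists2 i, List.In i (iota 0 b) & onth l (k.+1 + i) = onth l k.
have dG : Def (k.+1 + b) G.
  apply: Def_and.
    apply: (@Def_sel _ _ _ _ _ dR); first by rewrite size_cat !size_iota.
    by rewrite all_cat; apply/andP; split; apply/allP => v; rewrite mem_iota; lia.
  by apply: Def_has => i; rewrite In_iota => h; apply: Def_eq; lia.
apply: Def_ext (Def_exs dG) => M' l sl.
have E (u : seq M') : size u = b -> G M' (l ++ u) <->
    R M' (sel l (iota 0 k) ++ u) /\ exists2 i, List.In i (iota 0 b) & onth u i = onth l k.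
  move=> su; rewrite /G sel_cat.
  have -> : sel (l ++ u) (iota k.+1 b) = u.
    by have := sel_iota l u [::]; rewrite cats0 sl su.
  have -> : sel (l ++ u) (iota 0 k) = sel l (iota 0 k).
    by apply: sel_cat_lt; rewrite sl all_iota_lt.
  have -> : onth (l ++ u) k = onth l k by rewrite onth_cat sl ltnSn.
  split=> -[hR [i ib e]]; split=> //; exists i => //; move: e; rewrite onth_cat sl ifF ?addKn //; lia.
by split=> -[u su hu]; exists u => //; apply/E.
Qed.

(** For the converse, the entries of solutions form a definable set, finite or cofinite. Were it
    cofinite, the elements outside it would be algebraic over [l], as those inside are by
    hypothesis, and nothing would remain outside the closure of [l]. *)
Lemma finite_solutions k b R (l : seq M) : Def (k + b) R -> size l = k ->
  (finite_set (fun u => size u = b /\ R M (l ++ u)) <->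
   forall u, size u = b -> R M (l ++ u) -> forall y, List.In y u -> acl (in_list l) y).
Proof.
move=> dR sl; have dE := Def_entry dR.
set F := (fun (M : structure L) (l : seq M) => _) in dE.
have FE y : F M (rcons l y) <-> exists u, [/\ size u = b, R M (l ++ u) & List.In y u].
  rewrite /F -cats1.
  have -> : sel (l ++ [:: y]) (iota 0 k) = l by have := sel_iota [::] l [:: y]; rewrite /= sl.
  have -> : onth (l ++ [:: y]) k = Some y by rewrite cats1 -sl onth_last.
  split=> [[u su [hR [i _ ei]]]|[u [su hR yu]]]; last have [i il ei] := In_nth yu.
    by exists u; split=> //; exact: onth_In ei.
  by exists u => //; split=> //; exists i => //; apply/In_iota; rewrite -su.
split=> [fin u su hR y yu|h].
  apply/acl_listP; exists F; rewrite sl; split=> //; last by apply/FE; exists u.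
  move: fin => [s hs]; exists (flatten s) => z /FE [v [sv hv zv]].
  have := hs v (conj sv hv); elim: s {hs} => //= a s IH [->|/IH h]; apply/List.in_app_iff; [by left | by right].
have fF : finite_set (fun y => F M (rcons l y)).
  rewrite -sl in dE; case: (definable_dichotomy hsm hM dE) => // f.
  have [y ny] := unbounded l; exfalso; apply: (ny); apply/acl_listP.
  exists (fun (M' : structure L) (t : seq M') => ~ F M' t); split=> //; first exact: Def_not.
  by move=> /FE [u [su hR yu]]; apply: ny; exact: h su hR _ yu.
move: fF => [Y hY]; exists (tuples Y b) => u [su hR].
by rewrite -su; apply: In_tuples => y yu; apply: hY; apply/FE; exists u.
Qed.

Section Generic.
Variables (e : seq M) (q : nat).
Hypotheses (hcomp : complete L T) (se : size e = q) (ie : independent e).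

Lemma extend_ind (l : seq M) a : independent l -> exists w, size w = a /\ independent (l ++ w).
Proof.
move=> il; elim: a => [|a [w [sw iw]]]; first by exists [::]; rewrite cats0.
have [y ny] := unbounded (l ++ w); exists (rcons w y); rewrite size_rcons sw; split=> //.
by rewrite -rcons_cat; apply/(independent_rcons hsm hM).
Qed.

Lemma generic_all a F : Def (q + a) F -> (exists w, [/\ size w = a, independent (e ++ w) & F M (e ++ w)]) ->
  forall w, size w = a -> independent (e ++ w) -> F M (e ++ w).
Proof.
move=> dF [w0 [s0 i0 f0]] w sw iw.
apply: (generic_type hcomp hsm hM hM i0 iw _ _ dF f0); by rewrite size_cat se ?s0 ?sw.
Qed.

(* By induction on [a]: over a generic prefix the last entry ranges over a
   finite set of bounded size, and the nongeneric prefixes are few. *)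
Lemma few_exceptions a F : Def (q + a.+1) F ->
  (forall w, size w = a.+1 -> independent (e ++ w) -> ~ F M (e ++ w)) ->
  exists C, forall X : seq M, atmost (C * size X ^ a)
    (fun w => [/\ size w = a.+1, (forall y, List.In y w -> List.In y X) & F M (e ++ w)]).
Proof.
elim: a F => [|a IH] F dF gF.
  have dF1 : Def (size e).+1 F by rewrite se -addn1.
  case: (definable_dichotomy hsm hM dF1) => [/finite_atmost [C am]|f]; last first.
    have [y ny] := unbounded e; exfalso; apply: (ny); apply/acl_listP.
    exists (fun (M' : structure L) (t : seq M') => ~ F M' t); split=> //; first exact: Def_not.
    rewrite -cats1; apply: gF => //; rewrite cats1; exact/(independent_rcons hsm hM).
  exists C => X; rewrite expn0 muln1.
  have -> : C = 1 * C by rewrite mul1n.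
  apply: (atmost_dep (S1 := fun _ : unit => True) (R := fun _ y => F M (rcons e y)) (h := fun _ y => [:: y])) => //.
    by exists [:: tt] => // -[] _; left.
  by move=> [|y [|z w]] [] // _ _ hF; exists tt, y; rewrite -cats1.
have [w0 [s0 i0]] := extend_ind a.+1 ie.
have sz w : size w = a.+1 -> size (e ++ w) = q + a.+1 by move=> sw; rewrite size_cat se sw.
have dF1 : Def (size (e ++ w0)).+1 F by rewrite sz // -addnS.
case: (definable_dichotomy hsm hM dF1) => [/finite_atmost [m am]|f]; last first.
  have [y ny] := unbounded (e ++ w0); exfalso; apply: (ny); apply/acl_listP.
  exists (fun (M' : structure L) (t : seq M') => ~ F M' t); split=> //; first exact: Def_not.
  rewrite rcons_cat; apply: gF; first by rewrite size_rcons s0.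
  by rewrite -rcons_cat; exact/(independent_rcons hsm hM).
pose G (M' : structure L) (l : seq M') := atmost m (fun y => F M' (rcons l y)).
have dG : Def (q + a.+1) G.
  by apply: (@Def_atmost L _ m F); rewrite -addnS.
have gG := generic_all dG (ex_intro _ w0 (And3 s0 i0 am)).
have [|C hC] := IH _ (Def_not dG); first by move=> w sw iw; apply; exact: gG.
exists (C + m) => X.
(* A prefix that is exceptional for the induction hypothesis may take any last entry from [X]; every
   other prefix, at most [size X ^ a.+1] in number, takes at most [m]. *)
have -> : (C + m) * size X ^ a.+1 = C * size X ^ a * size X + size X ^ a.+1 * m by rewrite expnSr; lia.
have amX (S : M -> Prop) : atmost (size X) (fun y => List.In y X /\ S y) by exists X => // y [].
have B1 := atmost_dep (S := fun w => exists w' y, [/\ size w' = a.+1, (forall y, List.In y w' -> List.In y X),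
   ~ G M (e ++ w'), List.In y X & w = rcons w' y]) (h := @rcons M) (hC X) (fun x _ => amX (fun=> True)).
have am2 : atmost (size X ^ a.+1) (fun w => [/\ size w = a.+1, (forall y, List.In y w -> List.In y X) & G M (e ++ w)]).
  exists (tuples X a.+1); first by rewrite size_tuples.
  by move=> w [<- hw _]; exact: In_tuples.
have B2 := atmost_dep (S := fun w => exists w' y, [/\ size w' = a.+1, (forall y, List.In y w' -> List.In y X),
   G M (e ++ w'), F M (rcons (e ++ w') y) & w = rcons w' y]) (h := @rcons M) am2 (fun x h => let: And3 _ _ hG := h in hG).
apply: atmost_sub (atmost_or (B1 _) (B2 _)); last 2 first.
- by move=> w [w' [y [sw hw nG yX ->]]]; exists w', y; split.
- by move=> w [w' [y [sw hw hG hF ->]]]; exists w', y; split.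
move=> w [sw hw hF]; case/lastP: w sw hw hF => // w y; rewrite size_rcons => -[sw] hw hF.
have hw' z : List.In z w -> List.In z X by move=> h; apply: hw; apply/In_rcons; left.
have hy : List.In y X by apply: hw; apply/In_rcons; right.
case: (pselect (G M (e ++ w))) => g; [right | left]; exists w, y; split=> //.
by rewrite rcons_cat.
Qed.
End Generic.
End Solutions.

Definition rmatch (L : signature) (M : structure L) (bits : seq bool) (l : seq M) : Prop :=
  forall c, List.In c (iota 0 (size bits)) -> (tr c l <-> nth false bits c).

Definition rule := (nat * nat * nat * seq bool)%type.

(* A rule [(a, b, j, bits)] derives the [b]-tuple [x] from the [a]-tuple [w]
   when some [j]-tuple [y] makes [e w x y] satisfy the quantifier-free pattern
   [bits]. *)
Definition rapp (L : signature) (M : structure L) (e : seq M) (r : rule) (w x y : seq M) : Prop :=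
  [/\ size w = r.1.1.1, size x = r.1.1.2, size y = r.1.2 & rmatch r.2 (((e ++ w) ++ x) ++ y)].

Definition rclosed (L : signature) (M : structure L) (e : seq M) (rl : seq rule) (X : seq M) : Prop :=
  forall r w x y, List.In r rl -> rapp e r w x y -> (forall z, List.In z w -> List.In z X) ->
    forall z, List.In z x -> List.In z X.

Lemma Def_tr (L : signature) k c : Def k (fun (M : structure L) (l : seq M) => tr c l).
Proof.
case: (pselect (exists p, [/\ code_formula p = c, literal p, wf_formula L p & below k p])) => [[p [pc lp wp bp]]|no].
  apply: Def_ext (Def_hold wp bp) => M l sl; split=> [h|[p' [e _ _ _ h]]].
    by exists p; split=> //; rewrite sl.
  by move: e; rewrite -pc => /code_formula_inj <-.
apply: Def_ext (Def_false L k) => M l sl; split=> // -[p [pc lp wp bp _]].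
by apply: no; exists p; rewrite -sl.
Qed.

Lemma Def_rmatch (L : signature) k bits : Def k (fun (M : structure L) (l : seq M) => rmatch bits l).
Proof.
apply: (@Def_all _ _ _ (iota 0 (size bits)) (fun c (M : structure L) (l : seq M) => tr c l <-> nth false bits c)) => c _.
have h : Def k (fun (M : structure L) (l : seq M) => (tr c l -> nth false bits c) /\ (nth false bits c -> tr c l)).
  by apply: Def_and; apply: Def_imp; (exact: Def_tr || exact: Def_cst).
by apply: Def_ext h => M l _; split=> [[]|[]].
Qed.

Section Cover.
Variables (L : signature) (T : formula -> Prop).
Hypotheses (hsm : strongly_minimal L T) (hcomp : complete L T) (hmc : model_complete L T).
Variable M : structure L.
Hypothesis hM : is_model T M.
Hypothesis hc : exists e : nat -> M, forall a, exists i, e i = a.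
Hypothesis unbounded : forall l : seq M, exists y, ~ acl (in_list l) y.
Variables (e : seq M) (q : nat).
Hypotheses (se : size e = q) (ie : independent e).

(** A generic [w0] has some number [lam] of solutions, and [good_pattern] gives each of them a
    pattern that forces it. The bound [lam] is forced as well, so the output of a rule is algebraic
    over its input, generic or not. That there are exactly [lam] solutions and the rules find them
    all is a definable property of [w0], hence of every generic tuple; [E] is its failure. *)
Lemma rule_cover a b (R : forall M : structure L, seq M -> Prop) : Def (q + a + b) R ->
  (forall w : seq M, size w = a -> independent (e ++ w) -> finite_set (fun x => size x = b /\ R M ((e ++ w) ++ x))) ->
  exists lam rl E, [/\ Def (L := L) (q + a) E,
    (forall w, size w = a -> independent (e ++ w) -> ~ E M (e ++ w)),
    (forall r w x y, List.In r rl -> rapp e r w x y -> forall z, List.In z x -> acl (in_list (e ++ w)) z) &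
    (forall w, size w = a -> ~ E M (e ++ w) -> exactly lam (fun x => size x = b /\ R M ((e ++ w) ++ x)) /\
       forall x, size x = b -> R M ((e ++ w) ++ x) -> exists r y, List.In r rl /\ rapp e r w x y)].
Proof.
move=> dR fin; have [w0 [s0 i0]] := extend_ind hsm hM unbounded a ie.
have [lam ex0] := exactly_ex (fin w0 s0 i0); have [xs [_ _ xsP]] := exactlyP ex0.
have sz w : size w = a -> size (e ++ w) = q + a by move=> sw; rewrite size_cat se sw.
pose R' (M' : structure L) (l : seq M') := R M' l /\
  atmost lam (fun x => size x = b /\ R M' (sel l (iota 0 (q + a)) ++ x)).
have dR' : Def (q + a + b) R'.
  apply: Def_and => //.
  apply: (@Def_sel _ _ _ (fun (M' : structure L) (l : seq M') => atmost lam (fun x => size x = b /\ R M' (l ++ x)))).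
  - exact: Def_atmosts dR.
  - by rewrite size_iota.
  - by apply: all_iota_lt; lia.
have R'E w x : size w = a -> R' M ((e ++ w) ++ x) <->
    R M ((e ++ w) ++ x) /\ atmost lam (fun x => size x = b /\ R M ((e ++ w) ++ x)).
  move=> sw; rewrite /R' sel_cat_lt; last by rewrite sz // all_iota_lt.
  by rewrite -(sz w sw) sel_self.
have ch x : exists r : rule, List.In x xs -> [/\ r.1.1.1 = a, r.1.1.2 = b,
   (forall w' x' y', rapp e r w' x' y' -> R' M ((e ++ w') ++ x')) & exists y, rapp e r w0 x y].
  case: (pselect (List.In x xs)) => [/xsP [sx Rx]|n]; last by exists (0, 0, 0, [::]).
  have zx : R' M ((e ++ w0) ++ x) by apply/R'E => //; split=> //; case: ex0.
  have szx w' x' : size w' = a -> size x' = b -> size ((e ++ w') ++ x') = q + a + b.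
    by move=> sw sx'; rewrite size_cat sz // sx'.
  have [s [y gp]] := good_pattern hmc hM hc dR' (szx _ _ s0 sx) zx.
  exists (a, b, size y, mkseq (fun c => `[< tr c (((e ++ w0) ++ x) ++ y) >]) s) => _; split=> //.
    move=> w' x' y' [/= sw' sx' sy' m]; apply: (gp _ y') => //; first exact: szx.
    move=> c cs; have := m c; rewrite size_mkseq nth_mkseq // => ->; last by apply/In_iota.
    by split=> /asboolP.
  exists y; split=> //= c; rewrite size_mkseq => /In_iota /andP [_ cs]; rewrite nth_mkseq //.
  by split=> /asboolP.
have [rr rrP] := choice ch; pose rl := map rr xs.
pose G (M' : structure L) (l : seq M') := exactly lam (fun x => size x = b /\ R M' (l ++ x)) /\
  forall x, size x = b -> R M' (l ++ x) -> exists2 r : rule, List.In r rl & exists2 y, size y = r.1.2 & rmatch r.2 ((l ++ x) ++ y).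
have dG : Def (q + a) G.
  apply: Def_and; first exact: Def_exactly.
  apply: (@Def_foralls _ _ _ (fun (M' : structure L) (l : seq M') => R M' l ->
    exists2 r : rule, List.In r rl & exists2 y, size y = r.1.2 & rmatch r.2 (l ++ y))).
  apply: Def_imp => //.
  apply: (@Def_has _ _ _ rl (fun r (M' : structure L) (l : seq M') => exists2 y, size y = r.1.2 & rmatch r.2 (l ++ y))) => r _.
  by apply: (@Def_exs _ _ _ (fun (M' : structure L) (l : seq M') => rmatch r.2 l)); exact: Def_rmatch.
have rlP r : List.In r rl -> exists2 x, List.In x xs & r = rr x.
  by move=> /List.in_map_iff [x [<- hx]]; exists x.
exists lam, rl, (fun (M' : structure L) (l : seq M') => ~ G M' l); split; first exact: Def_not.
- move=> w sw iw nG; apply: nG; apply: (generic_all hsm hM hcomp se dG _ sw iw).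
  exists w0; split=> //; split=> // x sx Rx.
  have hx : List.In x xs by apply/xsP.
  have [ra rb _ [y [_ _ sy m]]] := rrP x hx.
  by exists (rr x); [apply: List.in_map | exists y].
- move=> r w x y /rlP [x0 /rrP [ra rb h _] ->] ha z zx.
  have [sw sx _ _] := ha; rewrite ra in sw; rewrite rb in sx.
  have [Rx am] := (R'E w x sw).1 (h _ _ _ ha).
  apply: ((finite_solutions hsm hM unbounded dR (sz _ sw)).1 _ x sx Rx) => //.
  by apply/finite_atmost; exists lam.
- move=> w sw nE; have [ex hw] : G M (e ++ w) by apply: contrapT.
  split=> // x sx Rx; have [r hr [y sy m]] := hw x sx Rx.
  have [x0 /rrP [ra rb _ _] rE] := rlP r hr.
  by exists r, y; split=> //; split=> //; rewrite rE ?ra ?rb.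
Qed.
End Cover.

Section Fat.
Variables (L : signature) (q : nat).
Implicit Types F : forall M : structure L, seq M -> Prop.

(** Positions in [s] are counted from the end of the parameters: the parameters stay in place and
    only the variables after them are rearranged. *)
Definition Fat F (s : seq nat) (M : structure L) (l : seq M) : Prop := F M (sel l (iota 0 q ++ map (addn q) s)).

Lemma Def_Fat F s a : Def (q + size s) F -> all (fun i => i < a) s -> Def (q + a) (Fat F s).
Proof.
move=> dF h; apply: (@Def_sel _ _ _ _ _ dF); first by rewrite size_cat size_iota size_map.
rewrite all_cat; apply/andP; split; first by apply: all_iota_lt; lia.
by rewrite all_map; apply: sub_all h => i /=; rewrite ltn_add2l.
Qed.

Lemma sel_addn (A : Type) (e u : seq A) s : sel (e ++ u) (map (addn (size e)) s) = sel u s.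
Proof.
elim: s => // i s IH; rewrite [map _ _]/= -cat1s -[i :: s]cat1s !sel_cat IH; congr (_ ++ _).
by rewrite /sel /pmap onth_cat ifF ?addKn //; lia.
Qed.

Lemma FatE F s (M : structure L) (e u : seq M) : size e = q -> Fat F s (e ++ u) = F M (e ++ sel u s).
Proof.
move=> se; rewrite /Fat sel_cat -se sel_addn; congr (F M (_ ++ _)).
exact: (sel_iota [::] e u).
Qed.

End Fat.

Lemma uniq_NoDup (A : eqType) (s : seq A) : uniq s -> List.NoDup s.
Proof.
elim: s => [_|a s IH /= /andP [n /IH h]]; first by constructor.
by constructor=> // /InP h'; rewrite h' in n.
Qed.

Lemma NoDup_nth_inj (A : Type) (d : A) (X : seq A) i j : List.NoDup X -> i < size X -> j < size X ->
  nth d X i = nth d X j -> i = j.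
Proof.
have inX (s : seq A) k : k < size s -> List.In (nth d s k) s.
  by move=> ks; apply: (@onth_In _ _ k); rewrite (onth_nth' d).
elim: X i j => // x X IH [|i] [|j] nd //= il jl h; inversion nd as [|? ? n nd']; subst.
- by case: n; exact: inX.
- by case: n; exact: inX.
- by rewrite (IH i j).
Qed.

Lemma card_atmost (S : finType) (A : Type) (f : S -> A) (P : pred S) c (Pt : A -> Prop) :
  injective f -> atmost c Pt -> (forall s, P s -> Pt (f s)) -> #|[set s | P s]| <= c.
Proof.
move=> fi am h; rewrite cardE -(size_map f); apply: (atmost_size am).
  by apply: NoDup_map_inj => //; apply: uniq_NoDup; exact: enum_uniq.
by move=> a /List.in_map_iff [s [<- /InP]]; rewrite mem_enum inE => /h.
Qed.

Lemma card_exactly (S : finType) (A : Type) (f : S -> A) (P : pred S) c (Pt : A -> Prop) :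
  injective f -> exactly c Pt -> (forall s, P s -> Pt (f s)) -> (forall a, Pt a -> exists2 s, P s & f s = a) ->
  #|[set s | P s]| = c.
Proof.
move=> fi ex h h'; have [am _] := ex; apply/eqP; rewrite eqn_leq (card_atmost fi am h) /=.
have [l [nd <- lP]] := exactlyP ex.
have [t [tl tP]] : exists t : seq S, map f t = l /\ forall s, s \in t -> P s.
  have : forall a, List.In a l -> Pt a by move=> a /lP.
  elim: l {nd lP} => [|a l IH] hl; first by exists [::].
  have [s Ps <-] := h' a (hl a (or_introl erefl)).
  have [t [<- ht]] := IH (fun a ha => hl a (or_intror ha)).
  by exists (s :: t); split=> // s'; rewrite inE => /orP [/eqP ->|/ht].
have ut : uniq t.
  rewrite -tl in nd; elim: t {tl tP} nd => //= s t IH nd; inversion nd as [|? ? n nd']; subst.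
  rewrite (IH nd') andbT; apply/negP => /InP hs; apply: n; exact: List.in_map.
rewrite -tl size_map -(card_uniqP ut); apply: subset_leq_card.
by apply/subsetP => s /tP; rewrite inE.
Qed.

Ltac mem := repeat split; try assumption; try (apply: sp_mem => /=; tauto).

(** * The rules of a symmetric algebraic ternary relation *)

Section RuleTheorem.
Variables (L : signature) (T : formula -> Prop).
Hypotheses (hsm : strongly_minimal L T) (hcomp : complete L T) (hmc : model_complete L T).
Variable M : structure L.
Hypothesis hM : is_model T M.
Hypothesis hflat : flat M.
Hypothesis hc : exists e : nat -> M, forall a, exists i, e i = a.
Hypothesis unbounded : forall l : seq M, exists y, ~ acl (in_list l) y.
Variables (e : seq M) (q : nat).
Hypotheses (se : size e = q) (ie : independent e).
Variable Qd : forall M : structure L, seq M -> Prop.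
Hypothesis dQ : Def (q + 3) Qd.
Let Qp x y z := Qd (e ++ [:: x; y; z]).
Hypothesis Qc : forall x y z, Qp x y z -> Qp y x z.
Hypothesis Qr : forall x y z, Qp x y z -> Qp y z x.
Variable B : nat.
Hypothesis QB : forall x y, atmost B (Qp x y).
Hypothesis Qex : exists x y z, ind e [:: x; y] /\ Qp x y z.

Notation tri := (tri e). Notation ind := (ind e). Notation sp := (sp e).

Let spfl l : closed_fd e (sp l) := closed_fd_span hsm hM e l.

Lemma Q_sp x y z : Qp x y z -> sp [:: x; y] z.
Proof.
move=> h; apply/acl_listP; exists Qd; split.
- by rewrite size_cat se -addnS.
- by apply/finite_atmost; exists B; apply: atmost_sub (QB x y) => c; rewrite -cats1 -catA.
- by rewrite -cats1 -catA.
Qed.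

Lemma Q_tri x y z : Qp x y z -> tri x y z.
Proof.
move=> h; split; first exact: Q_sp.
  by apply: Q_sp; apply: Qr.
by apply: Q_sp; apply: Qc; apply: Qr; apply: Qr.
Qed.

Let Qs x y z : Qp x y z -> Qp x z y.
Proof. by move=> h; apply: Qc; apply: Qr; apply: Qr. Qed.

Local Notation "F @@ s" := (Fat q F s) (at level 9).

(** After the parameters come the labels, at positions 0 to 3, and then the vertices, at positions 4
    to 7; in [R5] they are at 0 to 4 and 5 to 9. *)
Let R4 (M' : structure L) (l : seq M') := [/\ Qd @@ [:: 4; 5; 0] l, Qd @@ [:: 5; 6; 1] l, Qd @@ [:: 6; 7; 2] l & Qd @@ [:: 7; 4; 3] l].
Let R5 (M' : structure L) (l : seq M') := [/\ Qd @@ [:: 5; 6; 0] l, Qd @@ [:: 6; 7; 1] l, Qd @@ [:: 7; 8; 2] l, Qd @@ [:: 8; 9; 3] l & Qd @@ [:: 9; 5; 4] l].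

Let cy4 u1 u2 u3 u4 w1 w2 w3 w4 := [/\ Qp u1 u2 w1, Qp u2 u3 w2, Qp u3 u4 w3 & Qp u4 u1 w4].
Let cy5 u1 u2 u3 u4 u5 t1 t2 t3 t4 t5 := [/\ Qp u1 u2 t1, Qp u2 u3 t2, Qp u3 u4 t3, Qp u4 u5 t4 & Qp u5 u1 t5].

(** By [Qex] some generic edge has a label, so the generic number [m] of labels is positive; this
    excludes the degenerate case of [cycle_count]. *)
Lemma cover2 : exists m rl E, [/\ 0 < m, Def (L := L) (q + 2) E,
    (forall x y, ind [:: x; y] -> ~ E M (e ++ [:: x; y])),
    (forall r w x y, List.In r rl -> rapp e r w x y -> forall z, List.In z x -> acl (in_list (e ++ w)) z) &
    (forall x y, ~ E M (e ++ [:: x; y]) -> exactly m (Qp x y) /\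
       forall z, Qp x y z -> exists r u, List.In r rl /\ rapp e r [:: x; y] [:: z] u)].
Proof.
have dR : Def (q + 2 + 1) Qd by rewrite -addnA.
have szw (w : seq M) : size w = 2 -> size (e ++ w) = q + 2 by move=> sw; rewrite size_cat se sw.
have fin (w : seq M) : size w = 2 -> independent (e ++ w) -> finite_set (fun x => size x = 1 /\ Qd ((e ++ w) ++ x)).
  move=> sw iw; apply/(finite_solutions hsm hM unbounded dR (szw w sw)).
  case: w sw iw => [|a [|b [|]]] // _ iw [|c [|]] // _; rewrite -catA => /Q_sp h y [<-|[]]; exact: h.
have [m [rl [E [dE gE hrl hE]]]] := rule_cover hsm hcomp hmc hM hc unbounded se ie dR fin.
have hE' x y : ~ E M (e ++ [:: x; y]) -> exactly m (Qp x y) /\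
    forall z, Qp x y z -> exists r u, List.In r rl /\ rapp e r [:: x; y] [:: z] u.
  move=> /(hE [:: x; y] erefl) [ex h]; split; last first.
    by move=> z hz; apply: h => //; rewrite -catA.
  have tr c : atmost c (fun t => size t = 1 /\ Qd ((e ++ [:: x; y]) ++ t)) <-> atmost c (Qp x y).
    split=> [am|[s sc h']].
      have := atmost_dep (c := 1) (h := fun t (_ : unit) => head x t) (S := Qp x y) (R := fun _ _ => True) am.
      rewrite muln1; apply; first by move=> t _; exists [:: tt] => // -[] _; left.
      by move=> z hz; exists [:: z], tt; split=> //; rewrite -catA.
    exists (map (fun z => [:: z]) s); first by rewrite size_map.
    move=> [|z [|z' w]] [] // _; rewrite -catA => /h' hz.
    exact: (List.in_map (fun z => [:: z])).
  case: ex => am nm; split; first exact/tr.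
  by move=> m' hm' /tr; exact: nm.
exists m, rl, E; split=> //; last by move=> x y ixy; apply: gE.
have [x [y [z [ixy hz]]]] := Qex; have [am _] := (hE' x y (gE [:: x; y] erefl ixy)).1.
by case: m am {hE hE'} => // am; case: (atmost0 am hz).
Qed.

(** An independent tuple inside the span of [l] and at least as long as [l] exhausts the dimension
    of that span. *)
Lemma sp_sub l l' : allS (sp l) l' -> ind l' -> size l <= size l' -> allS (sp l') l.
Proof.
move=> h il le; apply/allSP => y yl; apply: (closed_fd_sub hsm hM (S := sp l)) => //.
  by apply: leq_trans (dm_sp hsm hM e l) _; rewrite leq_add2l.
exact: sp_mem.
Qed.

Lemma cyc4_sub u1 u2 u3 u4 w1 w2 w3 w4 S : closed_fd e S -> cy4 u1 u2 u3 u4 w1 w2 w3 w4 -> allS S [:: u1; u2; u3; u4] ->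
  allS S [:: w1; w2; w3; w4].
Proof.
move=> fS [/Q_tri h1 /Q_tri h2 /Q_tri h3 /Q_tri h4] [s1 [s2 [s3 [s4 _]]]].
by split; [apply: (tri3 fS h1) | split; [apply: (tri3 fS h2) | split; [apply: (tri3 fS h3) | split; [apply: (tri3 fS h4)|]]]].
Qed.

Lemma cyc5_sub u1 u2 u3 u4 u5 w1 w2 w3 w4 w5 S : closed_fd e S -> cy5 u1 u2 u3 u4 u5 w1 w2 w3 w4 w5 ->
  allS S [:: u1; u2; u3; u4; u5] -> allS S [:: w1; w2; w3; w4; w5].
Proof.
move=> fS [/Q_tri h1 /Q_tri h2 /Q_tri h3 /Q_tri h4 /Q_tri h5] [s1 [s2 [s3 [s4 [s5 _]]]]].
by split; [apply: (tri3 fS h1) | split; [apply: (tri3 fS h2) | split; [apply: (tri3 fS h3) | split; [apply: (tri3 fS h4)|split; [apply: (tri3 fS h5)|]]]]].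
Qed.

(** Generic labels have finitely many cycles: they lie in the span of equally many vertices, so by
    dimension the vertices lie in the span of the labels. *)
Lemma cover4 : exists lam rl E, [/\ Def (L := L) (q + 4) E,
    (forall w, size w = 4 -> ind w -> ~ E M (e ++ w)),
    (forall r w x y, List.In r rl -> rapp e r w x y -> forall z, List.In z x -> acl (in_list (e ++ w)) z) &
    (forall w1 w2 w3 w4, ~ E M (e ++ [:: w1; w2; w3; w4]) -> exists S : seq M -> Prop,
      [/\ (forall u, S u <-> exists u1 u2 u3 u4, u = [:: u1; u2; u3; u4] /\ cy4 u1 u2 u3 u4 w1 w2 w3 w4), exactly lam S &
       forall u, S u -> exists r y, List.In r rl /\ rapp e r [:: w1; w2; w3; w4] u y])].
Proof.
have dR : Def (q + 4 + 4) R4.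
  apply: (Def_ext (F := fun M l => Qd @@ [:: 4; 5; 0] l /\ Qd @@ [:: 5; 6; 1] l /\ Qd @@ [:: 6; 7; 2] l /\ Qd @@ [:: 7; 4; 3] l)).
    by move=> M' l _; split=> [[? [? []]]|[]].
  by rewrite -addnA; do 3 (apply: Def_and; first exact: Def_Fat); exact: Def_Fat.
have R4E u1 u2 u3 u4 w1 w2 w3 w4 : R4 ((e ++ [:: w1; w2; w3; w4]) ++ [:: u1; u2; u3; u4]) <-> cy4 u1 u2 u3 u4 w1 w2 w3 w4.
  by rewrite /R4 -catA !FatE.
have szw (w : seq M) : size w = 4 -> size (e ++ w) = q + 4 by move=> sw; rewrite size_cat se sw.
have fin (w : seq M) : size w = 4 -> independent (e ++ w) -> finite_set (fun x => size x = 4 /\ R4 ((e ++ w) ++ x)).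
  move=> sw iw; apply/(finite_solutions hsm hM unbounded dR (szw w sw)).
  case: w sw iw => [|w1 [|w2 [|w3 [|w4 [|]]]]] // _ iw [|u1 [|u2 [|u3 [|u4 [|]]]]] // _ /R4E h.
  by apply/allSP; apply: sp_sub => //; apply: cyc4_sub h _; [exact: spfl | exact: sp_in].
have [m [rl [E [dE gE hrl hE]]]] := rule_cover hsm hcomp hmc hM hc unbounded se ie dR fin.
exists m, rl, E; split=> // w1 w2 w3 w4 /(hE [:: w1; w2; w3; w4] erefl) [ex h].
exists (fun x => size x = 4 /\ R4 ((e ++ [:: w1; w2; w3; w4]) ++ x)); split=> // [u|u [su hu]]; last exact: h.
split=> [[]|[u1 [u2 [u3 [u4 [-> hu]]]]]]; last by split=> //; apply/R4E.
by case: u => [|u1 [|u2 [|u3 [|u4 [|]]]]] // _ /R4E hu; exists u1, u2, u3, u4.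
Qed.

Lemma cover5 : exists lam rl E, [/\ Def (L := L) (q + 5) E,
    (forall w, size w = 5 -> ind w -> ~ E M (e ++ w)),
    (forall r w x y, List.In r rl -> rapp e r w x y -> forall z, List.In z x -> acl (in_list (e ++ w)) z) &
    (forall w1 w2 w3 w4 w5, ~ E M (e ++ [:: w1; w2; w3; w4; w5]) -> exists S : seq M -> Prop,
      [/\ (forall u, S u <-> exists u1 u2 u3 u4 u5, u = [:: u1; u2; u3; u4; u5] /\ cy5 u1 u2 u3 u4 u5 w1 w2 w3 w4 w5), exactly lam S &
       forall u, S u -> exists r y, List.In r rl /\ rapp e r [:: w1; w2; w3; w4; w5] u y])].
Proof.
have dR : Def (q + 5 + 5) R5.
  apply: (Def_ext (F := fun M l => Qd @@ [:: 5; 6; 0] l /\ Qd @@ [:: 6; 7; 1] l /\ Qd @@ [:: 7; 8; 2] l /\ Qd @@ [:: 8; 9; 3] l /\ Qd @@ [:: 9; 5; 4] l)).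
    by move=> M' l _; split=> [[? [? [? []]]]|[]].
  by rewrite -addnA; do 4 (apply: Def_and; first exact: Def_Fat); exact: Def_Fat.
have R5E u1 u2 u3 u4 u5 w1 w2 w3 w4 w5 : R5 ((e ++ [:: w1; w2; w3; w4; w5]) ++ [:: u1; u2; u3; u4; u5]) <-> cy5 u1 u2 u3 u4 u5 w1 w2 w3 w4 w5.
  by rewrite /R5 -catA !FatE.
have szw (w : seq M) : size w = 5 -> size (e ++ w) = q + 5 by move=> sw; rewrite size_cat se sw.
have fin (w : seq M) : size w = 5 -> independent (e ++ w) -> finite_set (fun x => size x = 5 /\ R5 ((e ++ w) ++ x)).
  move=> sw iw; apply/(finite_solutions hsm hM unbounded dR (szw w sw)).
  case: w sw iw => [|w1 [|w2 [|w3 [|w4 [|w5 [|]]]]]] // _ iw [|u1 [|u2 [|u3 [|u4 [|u5 [|]]]]]] // _ /R5E h.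
  by apply/allSP; apply: sp_sub => //; apply: cyc5_sub h _; [exact: spfl | exact: sp_in].
have [m [rl [E [dE gE hrl hE]]]] := rule_cover hsm hcomp hmc hM hc unbounded se ie dR fin.
exists m, rl, E; split=> // w1 w2 w3 w4 w5 /(hE [:: w1; w2; w3; w4; w5] erefl) [ex h].
exists (fun x => size x = 5 /\ R5 ((e ++ [:: w1; w2; w3; w4; w5]) ++ x)); split=> // [u|u [su hu]]; last exact: h.
split=> [[]|[u1 [u2 [u3 [u4 [u5 [-> hu]]]]]]]; last by split=> //; apply/R5E.
by case: u => [|u1 [|u2 [|u3 [|u4 [|u5 [|]]]]]] // _ /R5E hu; exists u1, u2, u3, u4, u5.
Qed.

Section Exceptions.
Variables E2 E4 E5 : forall M : structure L, seq M -> Prop.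
Hypotheses (dE2 : Def (q + 2) E2) (dE4 : Def (q + 4) E4) (dE5 : Def (q + 5) E5).
Hypothesis gE2 : forall x y, ind [:: x; y] -> ~ E2 (e ++ [:: x; y]).
Hypothesis gE4 : forall w, size w = 4 -> ind w -> ~ E4 (e ++ w).
Hypothesis gE5 : forall w, size w = 5 -> ind w -> ~ E5 (e ++ w).

Let gd x y := ~ E2 (e ++ [:: x; y]).

Definition ok4 u1 u2 u3 u4 := (gd u1 u2 /\ gd u2 u3 /\ gd u3 u4 /\ gd u4 u1) /\
  forall w1 w2 w3 w4, cy4 u1 u2 u3 u4 w1 w2 w3 w4 -> ~ E4 (e ++ [:: w1; w2; w3; w4]).
Definition ok5 u1 u2 u3 u4 u5 := (gd u1 u2 /\ gd u2 u3 /\ gd u3 u4 /\ gd u4 u5 /\ gd u5 u1) /\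
  forall w1 w2 w3 w4 w5, cy5 u1 u2 u3 u4 u5 w1 w2 w3 w4 w5 -> ~ E5 (e ++ [:: w1; w2; w3; w4; w5]).
(** The ten further elements are all quantified in front, although each clause mentions only some of
    them, so that a single [Def_foralls] covers the condition. The elements [x1], [x2], [x3], [x4]
    play the parts of [u5], [t4], [v5], [t5]. *)
Definition okB t1 t2 t3 u1 v1 := forall u2 u3 u4 v2 v3 v4 x1 x2 x3 x4,
  (u1 <> v1 /\ gd u1 t1 /\ gd v1 t1) /\
  ((Qp u1 t1 u2 -> gd u2 t2 /\ (Qp u2 t2 u3 -> gd u3 t3)) /\
   (Qp v1 t1 v2 -> gd v2 t2 /\ (Qp v2 t2 v3 -> gd v3 t3))) /\
  (Qp u1 t1 u2 /\ Qp u2 t2 u3 /\ Qp u3 t3 u4 /\ Qp v1 t1 v2 /\ Qp v2 t2 v3 /\ Qp v3 t3 v4 ->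
   ~ E4 (e ++ [:: u4; v4; v1; u1]) /\
   (Qp x1 x2 u4 /\ Qp x2 x3 v4 /\ Qp x3 x4 v1 /\ Qp x4 x1 u1 -> ~ E5 (e ++ [:: t1; t2; t3; x2; x4]))).

Ltac defs := repeat match goal with
  | |- Def ?k (fun M l => @?P M l /\ @?Q M l) => apply (@Def_and _ k P Q)
  | |- Def ?k (fun M l => ~ @?P M l) => apply (@Def_not _ k P)
  | |- Def ?k (fun M l => @?P M l -> @?Q M l) => apply (@Def_imp _ k P Q)
  | |- Def _ (fun M l => onth _ _ = onth _ _) => apply: Def_eq; lia
  | |- Def _ _ => exact: Def_Fat
  end.

(** Generic vertices have generic labels, because [flat_cycle4] recovers the vertices from the
    labels. So the condition fails at nongeneric tuples only, and [few_exceptions] counts those. *)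
Lemma ok4_small : exists C, forall X : seq M, atmost (C * size X ^ 3) (fun w => exists u1 u2 u3 u4,
  [/\ w = [:: u1; u2; u3; u4], forall y, List.In y w -> List.In y X & ~ ok4 u1 u2 u3 u4]).
Proof.
pose F0 (M' : structure L) (l : seq M') := (~ E2 @@ [:: 0; 1] l /\ ~ E2 @@ [:: 1; 2] l /\ ~ E2 @@ [:: 2; 3] l /\ ~ E2 @@ [:: 3; 0] l) /\
  (Qd @@ [:: 0; 1; 4] l /\ Qd @@ [:: 1; 2; 5] l /\ Qd @@ [:: 2; 3; 6] l /\ Qd @@ [:: 3; 0; 7] l -> ~ E4 @@ [:: 4; 5; 6; 7] l).
have dF : Def (q + 4) (fun (M' : structure L) (l : seq M') => ~ forall s, size s = 4 -> F0 M' (l ++ s)).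
  by apply: Def_not; apply: Def_foralls; rewrite -addnA /F0; defs.
have FE u1 u2 u3 u4 : (forall s, size s = 4 -> F0 M ((e ++ [:: u1; u2; u3; u4]) ++ s)) <-> ok4 u1 u2 u3 u4.
  split=> [h|[h1 h2] [|w1 [|w2 [|w3 [|w4 [|]]]]] // _].
    split; first by have := h [:: u1; u1; u1; u1] erefl; rewrite /F0 -catA !FatE // => -[].
    move=> w1 w2 w3 w4 [? ? ? ?]; have := h [:: w1; w2; w3; w4] erefl; rewrite /F0 -catA !FatE //.
    by move=> -[_]; apply.
  rewrite /F0 -catA !FatE //; split; first exact: h1.
  by move=> [? [? [? ?]]]; apply: h2.
have [|C hC] := few_exceptions hsm hM unbounded hcomp se ie dF.
  move=> [|u1 [|u2 [|u3 [|u4 [|]]]]] // _ iu; apply; apply/FE.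
  split=> [|w1 w2 w3 w4 hw].
    split; [|split; [|split]]; apply: gE2.
    - by apply: (ind_sub hsm hM (l'' := [:: u3; u4]) iu) => //; mem.
    - by apply: (ind_sub hsm hM (l'' := [:: u1; u4]) iu) => //; mem.
    - by apply: (ind_sub hsm hM (l'' := [:: u1; u2]) iu) => //; mem.
    - by apply: (ind_sub hsm hM (l'' := [:: u2; u3]) iu) => //; mem.
  apply: gE4 => //; have [/Q_tri h1 /Q_tri h2 /Q_tri h3 /Q_tri h4] := hw.
  by apply: (ind_of hsm hM iu) => //; apply: (flat_cycle4 hsm hM hflat iu h1 h2 h3 h4).
exists C => X; apply: atmost_sub (hC X) => w [u1 [u2 [u3 [u4 [-> hX nok]]]]]; split=> //.
by move=> /FE.
Qed.

Lemma ind5_ok5 u1 u2 u3 u4 u5 : ind [:: u1; u2; u3; u4; u5] -> ok5 u1 u2 u3 u4 u5.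
Proof.
move=> iu; split=> [|w1 w2 w3 w4 w5 hw].
  split; [|split; [|split; [|split]]]; apply: gE2.
  - by apply: (ind_sub hsm hM (l'' := [:: u3; u4; u5]) iu) => //; mem.
  - by apply: (ind_sub hsm hM (l'' := [:: u1; u4; u5]) iu) => //; mem.
  - by apply: (ind_sub hsm hM (l'' := [:: u1; u2; u5]) iu) => //; mem.
  - by apply: (ind_sub hsm hM (l'' := [:: u1; u2; u3]) iu) => //; mem.
  - by apply: (ind_sub hsm hM (l'' := [:: u2; u3; u4]) iu) => //; mem.
apply: gE5 => //; have [/Q_tri h1 /Q_tri h2 /Q_tri h3 /Q_tri h4 /Q_tri h5] := hw.
have i4 : ind [:: u1; u2; u3; u4] by apply: (ind_sub hsm hM (l'' := [:: u5]) iu) => //; mem.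
have i3 : ind [:: u1; u4; u5] by apply: (ind_sub hsm hM (l'' := [:: u2; u3]) iu) => //; mem.
by apply: (ind_of hsm hM iu) => //; apply: (flat_cycle5 hsm hM hflat i4 i3 h1 h2 h3 h4 h5).
Qed.

Lemma ok5_small : exists C, forall X : seq M, atmost (C * size X ^ 4) (fun w => exists u1 u2 u3 u4 u5,
  [/\ w = [:: u1; u2; u3; u4; u5], forall y, List.In y w -> List.In y X & ~ ok5 u1 u2 u3 u4 u5]).
Proof.
pose F0 (M' : structure L) (l : seq M') := (~ E2 @@ [:: 0; 1] l /\ ~ E2 @@ [:: 1; 2] l /\ ~ E2 @@ [:: 2; 3] l /\ ~ E2 @@ [:: 3; 4] l /\ ~ E2 @@ [:: 4; 0] l) /\
  (Qd @@ [:: 0; 1; 5] l /\ Qd @@ [:: 1; 2; 6] l /\ Qd @@ [:: 2; 3; 7] l /\ Qd @@ [:: 3; 4; 8] l /\ Qd @@ [:: 4; 0; 9] l -> ~ E5 @@ [:: 5; 6; 7; 8; 9] l).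
have dF : Def (q + 5) (fun (M' : structure L) (l : seq M') => ~ forall s, size s = 5 -> F0 M' (l ++ s)).
  by apply: Def_not; apply: Def_foralls; rewrite -addnA /F0; defs.
have FE u1 u2 u3 u4 u5 : (forall s, size s = 5 -> F0 M ((e ++ [:: u1; u2; u3; u4; u5]) ++ s)) <-> ok5 u1 u2 u3 u4 u5.
  split=> [h|[h1 h2] [|w1 [|w2 [|w3 [|w4 [|w5 [|]]]]]] // _].
    split; first by have := h [:: u1; u1; u1; u1; u1] erefl; rewrite /F0 -catA !FatE // => -[].
    move=> w1 w2 w3 w4 w5 [? ? ? ? ?]; have := h [:: w1; w2; w3; w4; w5] erefl; rewrite /F0 -catA !FatE //.
    by move=> -[_]; apply.
  rewrite /F0 -catA !FatE //; split; first exact: h1.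
  by move=> [? [? [? [? ?]]]]; apply: h2.
have [|C hC] := few_exceptions hsm hM unbounded hcomp se ie dF.
  by move=> [|u1 [|u2 [|u3 [|u4 [|u5 [|]]]]]] // _ iu; apply; apply/FE; exact: ind5_ok5.
exists C => X; apply: atmost_sub (hC X) => w [u1 [u2 [u3 [u4 [u5 [-> hX nok]]]]]]; split=> //.
by move=> /FE.
Qed.

(** Independence is handed on by dimension counts. By [flat_paths] the four ends are independent;
    they are the labels of the closing 4-cycle, so its vertices are independent too. This gives both
    5-cycles the hypotheses of [flat_cycle5], which recovers [u1] and [v1] from [t1], [t2], [t3] and
    the two new labels. *)
Lemma ind_okB t1 t2 t3 u1 v1 : ind [:: t1; t2; t3; u1; v1] -> okB t1 t2 t3 u1 v1.
Proof.
move=> it u2 u3 u4 v2 v3 v4 x1 x2 x3 x4.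
have half a b a2 a3 : ind [:: t1; t2; t3; a; b] ->
    gd a t1 /\ (Qp a t1 a2 -> gd a2 t2 /\ (Qp a2 t2 a3 -> gd a3 t3)).
  move=> ia; split.
    by apply: gE2; apply: (ind_sub hsm hM (l'' := [:: t2; t3; b]) ia) => //; mem.
  move=> /Q_tri h1; have ia2 : ind [:: a2; t2; t1; t3; b].
    apply: (ind_of hsm hM ia) => //; mem.
    by apply: (tri1 (spfl _) h1); mem.
  split; first by apply: gE2; apply: (ind_sub hsm hM (l'' := [:: t1; t3; b]) ia2) => //; mem.
  move=> /Q_tri h2; apply: gE2; apply: (ind_sub hsm hM (l'' := [:: t1; t2; b]) ia2) => //; mem.
  by apply: (tri1 (spfl _) h2); mem.
have it' : ind [:: t1; t2; t3; v1; u1] by apply: (ind_of hsm hM it) => //; mem.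
have [gu hu] := half u1 v1 u2 u3 it; have [gv hv] := half v1 u1 v2 v3 it'.
split; [split; last by split | split; first by split].
  move=> ee; rewrite ee in it; move: it => /(ind_notin hsm hM e [:: t1; t2; t3; v1] v1) [_].
  by apply; mem.
move=> [/Qs/Q_tri h1 [/Qs/Q_tri h2 [/Qs/Q_tri h3 [/Qs/Q_tri k1 [/Qs/Q_tri k2 /Qs/Q_tri k3]]]]].
have iw := flat_paths hsm hM hflat it h1 h2 h3 k1 k2 k3.
have iw' : ind [:: u4; v4; v1; u1] by apply: (ind_of hsm hM iw) => //; mem.
split; first exact: gE4.
move=> [/Q_tri c1 [/Q_tri c2 [/Q_tri c3 /Q_tri c4]]].
have ix : ind [:: x1; x2; x3; x4].
  apply: (ind_of hsm hM iw') => //; set S := sp _; have fS : closed_fd e S := spfl _.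
  have [s1 [s2 [s3 [s4 _]]]] : allS S _ := sp_in _ _.
  by split; [apply: (tri3 fS c1) | split; [apply: (tri3 fS c2) | split; [apply: (tri3 fS c3) | split; [apply: (tri3 fS c4)|]]]].
have i41 : ind [:: u1; u4; x1].
  apply: (ind_sub hsm hM (l'' := [:: x3]) ix) => //; mem.
    by apply: (tri2 (spfl _) c1); mem.
  by apply: (tri1 (spfl _) c4); mem.
have j41 : ind [:: v1; v4; x3].
  apply: (ind_sub hsm hM (l'' := [:: x1]) ix) => //; mem.
    by apply: (tri1 (spfl _) c2); mem.
  by apply: (tri2 (spfl _) c3); mem.
have iu : ind [:: u1; u2; u3; u4].
  apply: (ind_sub hsm hM (l'' := [:: v1]) it) => //; mem.
  - by apply: (tri3 (spfl _) h1); mem.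
  - by apply: (tri3 (spfl _) h2); mem.
  - by apply: (tri3 (spfl _) h3); mem.
have iv : ind [:: v1; v2; v3; v4].
  apply: (ind_sub hsm hM (l'' := [:: u1]) it') => //; mem.
  - by apply: (tri3 (spfl _) k1); mem.
  - by apply: (tri3 (spfl _) k2); mem.
  - by apply: (tri3 (spfl _) k3); mem.
apply: gE5 => //; apply: (ind_of hsm hM it) => //.
have [a1 _] := flat_cycle5 hsm hM hflat iu i41 h1 h2 h3 (triR (triR c1)) (triR c4).
have [a2 _] := flat_cycle5 hsm hM hflat iv j41 k1 k2 k3 (triC (triR c2)) (triR (triC c3)).
by mem.
Qed.

Lemma okB_small : exists C, forall X : seq M, atmost (C * size X ^ 4) (fun w => exists t1 t2 t3 u1 v1,
  [/\ w = [:: t1; t2; t3; u1; v1], forall y, List.In y w -> List.In y X & ~ okB t1 t2 t3 u1 v1]).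
Proof.
pose F0 (M' : structure L) (l : seq M') :=
  (~ onth l (q + 3) = onth l (q + 4) /\ ~ E2 @@ [:: 3; 0] l /\ ~ E2 @@ [:: 4; 0] l) /\
  ((Qd @@ [:: 3; 0; 5] l -> ~ E2 @@ [:: 5; 1] l /\ (Qd @@ [:: 5; 1; 6] l -> ~ E2 @@ [:: 6; 2] l)) /\
   (Qd @@ [:: 4; 0; 8] l -> ~ E2 @@ [:: 8; 1] l /\ (Qd @@ [:: 8; 1; 9] l -> ~ E2 @@ [:: 9; 2] l))) /\
  (Qd @@ [:: 3; 0; 5] l /\ Qd @@ [:: 5; 1; 6] l /\ Qd @@ [:: 6; 2; 7] l /\
   Qd @@ [:: 4; 0; 8] l /\ Qd @@ [:: 8; 1; 9] l /\ Qd @@ [:: 9; 2; 10] l ->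
   ~ E4 @@ [:: 7; 10; 4; 3] l /\
   (Qd @@ [:: 11; 12; 7] l /\ Qd @@ [:: 12; 13; 10] l /\ Qd @@ [:: 13; 14; 4] l /\ Qd @@ [:: 14; 11; 3] l ->
    ~ E5 @@ [:: 0; 1; 2; 12; 14] l)).
have dF : Def (q + 5) (fun (M' : structure L) (l : seq M') => ~ forall s, size s = 10 -> F0 M' (l ++ s)).
  by apply: Def_not; apply: Def_foralls; rewrite -addnA /F0; defs.
have FE t1 t2 t3 u1 v1 : (forall s, size s = 10 -> F0 M ((e ++ [:: t1; t2; t3; u1; v1]) ++ s)) <-> okB t1 t2 t3 u1 v1.
  have o i (s : seq M) : onth (e ++ s) (q + i) = onth s i by rewrite onth_cat -se ifF ?addKn //; lia.
  have neq : (~ Some u1 = Some v1) <-> u1 <> v1 by split=> [h h'|h [] h']; apply: h => //; rewrite h'.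
  split=> [h u2 u3 u4 v2 v3 v4 x1 x2 x3 x4|h].
    have := h [:: u2; u3; u4; v2; v3; v4; x1; x2; x3; x4] erefl.
    by rewrite /F0 -catA !FatE // !o /= neq.
  case=> [|u2 [|u3 [|u4 [|v2 [|v3 [|v4 [|x1 [|x2 [|x3 [|x4 [|]]]]]]]]]]] // _.
  by have := h u2 u3 u4 v2 v3 v4 x1 x2 x3 x4; rewrite /F0 -catA !FatE // !o /= neq.
have [|C hC] := few_exceptions hsm hM unbounded hcomp se ie dF.
  by move=> [|u1 [|u2 [|u3 [|u4 [|u5 [|]]]]]] // _ iu; apply; apply/FE; exact: ind_okB.
exists C => X; apply: atmost_sub (hC X) => w [u1 [u2 [u3 [u4 [u5 [-> hX nok]]]]]]; split=> //.
by move=> /FE.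
Qed.

End Exceptions.

(** Away from the exceptional tuples, counting labels and cycles inside a closed [X] gives the true
    numbers, because the rules bring every solution into [X]. So [cycle_count] applies with the
    indices of [X] as vertices. *)
Lemma rules_bounded : exists rl K0,
  (forall r w x y, List.In r rl -> rapp e r w x y -> forall z, List.In z x -> acl (in_list (e ++ w)) z) /\
  forall X : seq M, List.NoDup X -> rclosed e rl X -> size X <= K0.
Proof.
have [m [rl2 [E2 [m_gt0 dE2 gE2 hrl2 hE2]]]] := cover2.
have [l4 [rl4 [E4 [dE4 gE4 hrl4 hE4]]]] := cover4.
have [l5 [rl5 [E5 [dE5 gE5 hrl5 hE5]]]] := cover5.
have [C1 hC1] := ok4_small dE2 dE4 gE2 gE4; have [C2 hC2] := ok5_small dE2 dE5 gE2 gE5.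
have [C3 hC3] := okB_small dE2 dE4 dE5 gE2 gE4 gE5.
have [C4 hC4] := few_exceptions hsm hM unbounded hcomp se ie dE5 gE5.
(* A single constant that dominates all four families of exceptional tuples. *)
pose C := C1 + C2 + C3 + C4.
exists (rl2 ++ rl4 ++ rl5), (C * m ^ 4 + (C * B ^ 5 + l5 * C) + C * (m ^ 5 + 1)).
split=> [r w x y|X ndX clX].
  rewrite !List.in_app_iff => -[h|[h|h]]; [exact: hrl2 h | exact: hrl4 h | exact: hrl5 h].
have {clX} [cl2 cl4 cl5] : [/\ rclosed e rl2 X, rclosed e rl4 X & rclosed e rl5 X].
  by split=> r w x y hr; apply: clX; rewrite !List.in_app_iff; [left | right; left | right; right].
have [[d] _] := hM; pose V := 'I_(size X); pose val (i : V) := nth d X i.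
have valX i : List.In (val i) X by apply: (@onth_In _ _ i); rewrite (onth_nth' d) ?ltn_ord.
have valK y : List.In y X -> exists i, val i = y.
  move=> yX; have [i il] := In_nth yX; rewrite (onth_nth' d) // => -[<-].
  by exists (Ordinal il).
have val_inj : injective val.
  by move=> i j eij; apply: ord_inj; exact: (NoDup_nth_inj ndX (ltn_ord i) (ltn_ord j) eij).
pose Qb x y z := `[< Qp (val x) (val y) (val z) >].
pose gdb x y := `[< ~ E2 M (e ++ [:: val x; val y]) >].
pose f4 (u : V * V * V * V) := let: (a, b, c, d) := u in [:: val a; val b; val c; val d].
pose f5 (u : V * V * V * V * V) := let: (a, b, c, d, g) := u in [:: val a; val b; val c; val d; val g].
have f4i : injective f4.
  by move=> [[[? ?] ?] ?] [[[? ?] ?] ?] [] /val_inj -> /val_inj -> /val_inj -> /val_inj ->.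
have f5i : injective f5.
  by move=> [[[[? ?] ?] ?] ?] [[[[? ?] ?] ?] ?] [] /val_inj -> /val_inj -> /val_inj -> /val_inj -> /val_inj ->.
have f4X u y : List.In y (f4 u) -> List.In y X by case: u => [[[? ?] ?] ?] [<-|[<-|[<-|[<-|[]]]]].
have f5X u y : List.In y (f5 u) -> List.In y X by case: u => [[[[? ?] ?] ?] ?] [<-|[<-|[<-|[<-|[<-|[]]]]]].
pose E4s := [set w | `[< E4 M (e ++ f4 w) >]]; pose E5s := [set w | `[< E5 M (e ++ f5 w) >]].
pose B4s := [set u : V * V * V * V | let: (a, b, c, d) := u in ~~ `[< ok4 E2 E4 (val a) (val b) (val c) (val d) >]].
pose B5s := [set u : V * V * V * V * V | let: (a, b, c, d, g) := u in ~~ `[< ok5 E2 E5 (val a) (val b) (val c) (val d) (val g) >]].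
pose BBs := [set u : V * V * V * V * V | let: (a, b, c, d, g) := u in ~~ `[< okB E2 E4 E5 (val a) (val b) (val c) (val d) (val g) >]].
have cy4P u w : cyc4 Qb u w <-> (let: (u1, u2, u3, u4) := u in let: (w1, w2, w3, w4) := w in
    cy4 (val u1) (val u2) (val u3) (val u4) (val w1) (val w2) (val w3) (val w4)).
  case: u w => [[[? ?] ?] ?] [[[? ?] ?] ?] /=.
  by split=> [/and4P [/asboolP ? /asboolP ? /asboolP ? /asboolP ?]|[? ? ? ?]] //; apply/and4P; split; apply/asboolP.
have cy5P u w : cyc5 Qb u w <-> (let: (u1, u2, u3, u4, u5) := u in let: (w1, w2, w3, w4, w5) := w in
    cy5 (val u1) (val u2) (val u3) (val u4) (val u5) (val w1) (val w2) (val w3) (val w4) (val w5)).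
  case: u w => [[[[? ?] ?] ?] ?] [[[[? ?] ?] ?] ?] /=.
  by split=> [/and5P [/asboolP ? /asboolP ? /asboolP ? /asboolP ? /asboolP ?]|[? ? ? ? ?]] //; apply/and5P; split; apply/asboolP.
have leC c k : c <= C -> c * size X ^ k <= C * #|V| ^ k by move=> h; rewrite card_ord leq_mul2r h orbT.
suff [] : #|V| <= C * m ^ 4 + (C * B ^ 5 + l5 * C) + C * (m ^ 5 + 1) \/ m = 0.
  - by rewrite card_ord.
  - by move=> m0; rewrite m0 in m_gt0.
apply: (@cycle_count V Qb gdb C B m l4 l5 E4s B4s E5s B5s BBs).
- by move=> x y z; apply/asboolP/asboolP; exact: Qc.
- by move=> x y z; apply/asboolP/asboolP => h; [exact: Qr | apply: Qr; exact: Qr].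
- move=> x y /asboolP/hE2 [ex h]; apply: (card_exactly val_inj ex) => [s /asboolP //|a Qa].
  have [r [u [hr ha]]] := h a Qa; have /valK [i vi] : List.In a X.
    by apply: (cl2 _ _ _ _ hr ha) => [z [<-|[<-|[]]]|]; [exact: valX | exact: valX | left].
  by exists i => //; apply/asboolP; rewrite vi.
- by move=> x y; apply: (card_atmost val_inj (QB (val x) (val y))) => s /asboolP.
- move=> [[[w1 w2] w3] w4]; rewrite inE => /asboolPn /hE4 [S [SE ex h]].
  apply: (card_exactly f4i ex) => [[[[u1 u2] u3] u4] /cy4P hu|u Su].
    by apply/SE; exists (val u1), (val u2), (val u3), (val u4).
  have uX z : List.In z u -> List.In z X.
    have [r [y [hr ha]]] := h u Su; apply: (cl4 _ _ _ _ hr ha) => z'.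
    exact: (f4X (w1, w2, w3, w4)).
  have [a1 [a2 [a3 [a4 [eu hu]]]]] := (SE u).1 Su; rewrite eu in uX.
  have [[i1 e1] [i2 e2]] := (valK a1 (uX a1 ltac:(by rewrite /=; tauto)), valK a2 (uX a2 ltac:(by rewrite /=; tauto))).
  have [[i3 e3] [i4 e4]] := (valK a3 (uX a3 ltac:(by rewrite /=; tauto)), valK a4 (uX a4 ltac:(by rewrite /=; tauto))).
  by exists (i1, i2, i3, i4); [apply/cy4P; rewrite e1 e2 e3 e4 | rewrite eu /= e1 e2 e3 e4].
- move=> [[[[w1 w2] w3] w4] w5]; rewrite inE => /asboolPn /hE5 [S [SE ex h]].
  apply: (card_exactly f5i ex) => [[[[[u1 u2] u3] u4] u5] /cy5P hu|u Su].
    by apply/SE; exists (val u1), (val u2), (val u3), (val u4), (val u5).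
  have uX z : List.In z u -> List.In z X.
    have [r [y [hr ha]]] := h u Su; apply: (cl5 _ _ _ _ hr ha) => z'.
    exact: (f5X (w1, w2, w3, w4, w5)).
  have [a1 [a2 [a3 [a4 [a5 [eu hu]]]]]] := (SE u).1 Su; rewrite eu in uX.
  have [[i1 e1] [i2 e2]] := (valK a1 (uX a1 ltac:(by rewrite /=; tauto)), valK a2 (uX a2 ltac:(by rewrite /=; tauto))).
  have [[i3 e3] [i4 e4]] := (valK a3 (uX a3 ltac:(by rewrite /=; tauto)), valK a4 (uX a4 ltac:(by rewrite /=; tauto))).
  have [i5 e5] := valK a5 (uX a5 ltac:(by rewrite /=; tauto)).
  by exists (i1, i2, i3, i4, i5); [apply/cy5P; rewrite e1 e2 e3 e4 e5 | rewrite eu /= e1 e2 e3 e4 e5].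
- apply: leq_trans (card_atmost f5i (hC4 X) _) (leC _ _ _); last by rewrite /C; lia.
  by move=> s /asboolP hs; split=> //; [case: s {hs} => [[[[? ?] ?] ?] ?] | exact: f5X].
- apply: leq_trans (card_atmost f4i (hC1 X) _) (leC _ _ _); last by rewrite /C; lia.
  move=> s hs; move: (f4X s) hs; case: s => [[[a1 a2] a3] a4] hX /asboolPn hs.
  by exists (val a1), (val a2), (val a3), (val a4).
- apply: leq_trans (card_atmost f5i (hC2 X) _) (leC _ _ _); last by rewrite /C; lia.
  move=> s hs; move: (f5X s) hs; case: s => [[[[a1 a2] a3] a4] a5] hX /asboolPn hs.
  by exists (val a1), (val a2), (val a3), (val a4), (val a5).
- apply: leq_trans (card_atmost f5i (hC3 X) _) (leC _ _ _); last by rewrite /C; lia.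
  move=> s hs; move: (f5X s) hs; case: s => [[[[a1 a2] a3] a4] a5] hX /asboolPn hs.
  by exists (val a1), (val a2), (val a3), (val a4), (val a5).
- move=> [[[u1 u2] u3] u4]; rewrite inE negbK => /asboolP [[g1 [g2 [g3 g4]]] h]; split.
    by apply/and4P; split; apply/asboolP.
  move=> [[[w1 w2] w3] w4] /cy4P hw; rewrite inE; apply/asboolPn; exact: h hw.
- move=> [[[[u1 u2] u3] u4] u5]; rewrite inE negbK => /asboolP [[g1 [g2 [g3 [g4 g5]]]] h]; split.
    by apply/and5P; split; apply/asboolP.
  move=> [[[[w1 w2] w3] w4] w5] /cy5P hw; rewrite inE; apply/asboolPn; exact: h hw.
- move=> t1 t2 t3 u1 v1; rewrite inE negbK => /asboolP hB.
  have hB' u2 u3 u4 v2 v3 v4 x1 x2 x3 x4 := hB (val u2) (val u3) (val u4) (val v2) (val v3) (val v4) (val x1) (val x2) (val x3) (val x4).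
  have [[ne [g1 g1']] _] := hB' u1 u1 u1 u1 u1 u1 u1 u1 u1 u1.
  split.
  - by apply/eqP => eu; apply: ne; rewrite eu.
  - by apply/andP; split; apply/asboolP.
  - move=> u2 u3 /asboolP h; have [_ [[hu _] _]] := hB' u2 u3 u1 u1 u1 u1 u1 u1 u1 u1.
    have [g h'] := hu h; split; first exact/asboolP.
    by move=> /asboolP/h' ?; apply/asboolP.
  - move=> u2 u3 /asboolP h; have [_ [[_ hu] _]] := hB' u1 u1 u1 u2 u3 u1 u1 u1 u1 u1.
    have [g h'] := hu h; split; first exact/asboolP.
    by move=> /asboolP/h' ?; apply/asboolP.
  move=> [[u2 u3] u4] [[v2 v3] v4] /and3P [/asboolP p1 /asboolP p2 /asboolP p3] /and3P [/asboolP p1' /asboolP p2' /asboolP p3'].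
  split.
    rewrite inE; apply/asboolPn; have [_ [_ hw]] := hB' u2 u3 u4 v2 v3 v4 u1 u1 u1 u1.
    by case: hw.
  move=> [[[x1 x2] x3] x4] /cy4P [c1 c2 c3 c4]; have [_ [_ hw]] := hB' u2 u3 u4 v2 v3 v4 x1 x2 x3 x4.
  rewrite inE; apply/asboolPn; have [|_ hx] := hw; first by [].
  by apply: hx.
Qed.

End RuleTheorem.

(** * From a circuit to a rule system *)

Section Circuit.
Variables (L : signature) (T : formula -> Prop).
Hypothesis hsm : strongly_minimal L T.
Variable M : structure L.
Hypothesis hM : is_model T M.

(** The type to be realized consists of the negations of all formulas over [l] with finitely many
    solutions; since the model is infinite, each finite part of it is satisfiable. *)
Lemma saturated_big : saturated M -> forall l : seq M, exists y, ~ acl (in_list l) y.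
Proof.
move=> sat_M l; have [[d] _] := hM; pose rho := nth d l.
pose P p := wf_formula L p /\ (forall y, y \in fv p -> y = size l \/ y < size l) /\
  exists p', p = FNot p' /\ finite_set (defset rho (size l) p').
have [p [wf [fp _]] //|r hr|a ha] := sat_M rho (size l) (size l) P.
  have fr p : List.In p r -> finite_set (fun a => ~ sat (upd rho (size l) a) p).
    move=> /hr [_ [_ [p' [-> f]]]]; apply: finite_sub f => a /=; exact: contrapT.
  apply: contrapT => no; apply: (model_infinite hsm hM); apply: finite_sub (finite_bigor fr) => a _.
  apply: contrapT => h; apply: no; exists a => p pr; apply: contrapT => np; apply: h; by exists p.
exists a => /acl_listP [F [[p [wf b E]] f Fa]].
have FE (c : M) : F M (rcons l c) <-> defset rho (size l) p c.
  by apply: E; rewrite ?size_rcons //; apply: agree_rcons => //; exact: agree_nth.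
have : sat (upd rho (size l) a) (FNot p).
  apply: ha; split=> //; split=> [y yp|].
    by move: (allP b y yp); rewrite ltnS leq_eqVlt => /orP [/eqP|]; [left | right].
  by exists p; split=> //; apply: finite_sub f => c /FE.
by apply; apply/FE.
Qed.

(** Conjoined with a bound on its own number of solutions, a formula becomes algebraic uniformly,
    over every tuple of the same length. *)
Lemma acl_bounded l a : acl (in_list l) a -> exists F B, [/\ Def (L := L) (size l).+1 F, F M (rcons l a) &
  forall l' : seq M, size l' = size l -> atmost B (fun b => F M (rcons l' b))].
Proof.
move=> /acl_listP [F [dF /finite_atmost [B am] Fa]]; set k := size l in dF *.
have selE (l' : seq M) b : size l' = k -> sel (rcons l' b) (iota 0 k) = l'.
  by move=> sl; have := sel_iota [::] l' [:: b]; rewrite /= cats1 sl.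
exists (fun M' l => F M' l /\ atmost B (fun b => F M' (rcons (sel l (iota 0 k)) b))), B; split.
- apply: Def_and => //.
  apply: (@Def_sel _ _ _ (fun (M' : structure L) (l : seq M') => atmost B (fun b => F M' (rcons l b)))).
  + exact: (@Def_atmost L k B F dF).
  + by rewrite size_iota.
  + by apply: all_iota_lt; lia.
- by rewrite selE.
move=> l' sl; case: (pselect (atmost B (fun b => F M (rcons l' b)))) => h.
  by apply: atmost_sub h => b [].
by exists [::] => // b [_]; rewrite selE // => /h.
Qed.

Lemma independent_perm (l l' : seq M) : size l = size l' -> (forall y, List.In y l <-> List.In y l') ->
  independent l -> independent l'.
Proof.
move=> s h /(independentP hsm hM) i; apply/(independentP hsm hM).
by rewrite -s (leq_trans i) // (@dm_ext _ _ (in_list l) (in_list l')).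
Qed.

Hypotheses (hcomp : complete L T) (hmc : model_complete L T).
Hypothesis hflat : flat M.
Hypothesis hc : exists e : nat -> M, forall a, exists i, e i = a.
Hypothesis hsat : saturated M.

(** Over all but three elements of the circuit, taken as parameters [e], any two of the remaining
    [x], [y], [z] are independent and the third is algebraic over them. *)
Lemma circuit_rules (c : seq M) n : 2 <= n -> circuit c -> size c = n.+1 -> exists (e : seq M) rl K0,
  [/\ size e = n - 2, independent e,
  (forall r w x y, List.In r rl -> rapp e r w x y -> forall z, List.In z x -> acl (in_list (e ++ w)) z) &
  forall X : seq M, List.NoDup X -> rclosed e rl X -> size X <= K0].
Proof.
move=> n2 [nc cm] sc; have unbounded : forall l : seq M, exists y, ~ acl (in_list l) y by exact: saturated_big.
case: c nc cm sc => [|x [|y [|z e]]] nc cm /= sc; try by lia.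
have se : size e = n - 2 by lia.
have mt b : size (b ++ nseq (size e) true) = size b + size e by rewrite size_cat size_nseq.
have me b (l : seq M) : size b = size l -> mask (b ++ nseq (size e) true) (l ++ e) = mask b l ++ e.
  by move=> s; rewrite mask_cat // mask_true.
have sub b : size b = 3 -> false \in b -> independent (mask b [:: x; y; z] ++ e).
  move=> sb fb; rewrite -me //; apply: cm; first by rewrite mt sb.
  by rewrite mem_cat fb.
have fin l : (forall u, List.In u l <-> u = x \/ u = y \/ u = z) -> forall u v w, l = [:: u; v; w] ->
   independent (e ++ [:: u; v]) -> acl (in_list (e ++ [:: u; v])) w.
  move=> hl u v w el i; apply: contrapT => nw; apply: nc.
  have : independent (rcons (e ++ [:: u; v]) w) by apply/(independent_rcons hsm hM).
  apply: independent_perm; first by rewrite size_rcons size_cat /= addn2.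
  move=> t; rewrite In_rcons List.in_app_iff; have := hl t; rewrite el /=.
  have -> : (x = t) = (t = x) by apply/propext; split.
  have -> : (y = t) = (t = y) by apply/propext; split.
  have -> : (z = t) = (t = z) by apply/propext; split.
  have -> : (w = t) = (t = w) by apply/propext; split.
  tauto.
have pm (a b : M) : independent ([:: a; b] ++ e) -> independent (e ++ [:: a; b]).
  by apply: independent_perm => [|u]; [rewrite !size_cat addnC | rewrite List.in_app_iff /=; tauto].
have ixy := pm _ _ (sub [:: true; true; false] erefl erefl).
have ixz := pm _ _ (sub [:: true; false; true] erefl erefl).
have iyz := pm _ _ (sub [:: false; true; true] erefl erefl).
have az : acl (in_list (e ++ [:: x; y])) z by apply: (fin [:: x; y; z]) => // u /=; intuition.
have ay : acl (in_list (e ++ [:: x; z])) y by apply: (fin [:: x; z; y]) => // u /=; intuition.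
have ax : acl (in_list (e ++ [:: y; z])) x by apply: (fin [:: y; z; x]) => // u /=; intuition.
set q := n - 2 in se.
have sz2 (a b : M) : size (e ++ [:: a; b]) = q + 2 by rewrite size_cat se.
have [F3 [B3 [d3 f3 b3]]] := acl_bounded az; have [F2 [B2 [d2 f2 b2]]] := acl_bounded ay.
have [F1 [B1 [d1 f1 b1]]] := acl_bounded ax.
rewrite sz2 -addnS in d1; rewrite sz2 -addnS in d2; rewrite sz2 -addnS in d3.
(* Each of the three elements is algebraic over the other two by a formula with a uniform bound.
   [Qd] is the disjunction over the six orders, which makes it symmetric and keeps it bounded. *)
pose R0 (M' : structure L) (l : seq M') := Fat q F3 [:: 0; 1; 2] l /\ Fat q F1 [:: 1; 2; 0] l /\ Fat q F2 [:: 0; 2; 1] l.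
have dR0 : Def (q + 3) R0 by do 2 (apply: Def_and; first exact: Def_Fat); exact: Def_Fat.
pose R a b c := [/\ F3 M (e ++ [:: a; b; c]), F1 M (e ++ [:: b; c; a]) & F2 M (e ++ [:: a; c; b])].
have R0E a b c : R0 M (e ++ [:: a; b; c]) <-> R a b c.
  by rewrite /R0 !FatE //=; split=> [[? []]|[]].
pose Qd (M' : structure L) (l : seq M') := Fat q R0 [:: 0; 1; 2] l \/ (Fat q R0 [:: 1; 0; 2] l \/
  (Fat q R0 [:: 0; 2; 1] l \/ (Fat q R0 [:: 2; 0; 1] l \/ (Fat q R0 [:: 1; 2; 0] l \/ Fat q R0 [:: 2; 1; 0] l)))).
have dQ : Def (q + 3) Qd by do 5 (apply: Def_or; first exact: Def_Fat); exact: Def_Fat.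
have QE a b c : Qd M (e ++ [:: a; b; c]) <->
    R a b c \/ (R b a c \/ (R a c b \/ (R c a b \/ (R b c a \/ R c b a)))).
  by rewrite /Qd !FatE //= !R0E.
have bd F B : (forall l', size l' = size (e ++ [:: x; y]) -> atmost B (fun b => F M (rcons l' b))) ->
    forall a b, atmost B (fun c => F M (e ++ [:: a; b; c])).
  move=> h a b; have := h (e ++ [:: a; b]); rewrite !sz2 => /(_ erefl); apply: atmost_sub => c.
  by rewrite -cats1 -catA.
have ie : independent e.
  have /(independent_rcons hsm hM) [] : independent (rcons (rcons e x) y) by rewrite -!cats1 -catA.
  by move=> /(independent_rcons hsm hM) [].
have QC a b c : Qd M (e ++ [:: a; b; c]) -> Qd M (e ++ [:: b; a; c]) by rewrite !QE; tauto.
have QR a b c : Qd M (e ++ [:: a; b; c]) -> Qd M (e ++ [:: b; c; a]) by rewrite !QE; tauto.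
have QB a b : atmost (B3 + (B3 + (B2 + (B2 + (B1 + B1))))) (fun c => Qd M (e ++ [:: a; b; c])).
  apply: (@atmost_sub _ _ _ (fun c => R a b c \/ (R b a c \/ (R a c b \/ (R b c a \/ (R c a b \/ R c b a)))))).
    by move=> c; rewrite QE; tauto.
  have h3 := bd _ _ b3; have h2 : forall a b, atmost B2 (fun c => F2 M (e ++ [:: a; b; c])).
    by apply: bd => l'; rewrite sz2 -(sz2 x z); exact: b2.
  have h1 : forall a b, atmost B1 (fun c => F1 M (e ++ [:: a; b; c])).
    by apply: bd => l'; rewrite sz2 -(sz2 y z); exact: b1.
  apply: atmost_or; first by apply: atmost_sub (h3 a b) => c [].
  apply: atmost_or; first by apply: atmost_sub (h3 b a) => c [].
  apply: atmost_or; first by apply: atmost_sub (h2 a b) => c [].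
  apply: atmost_or; first by apply: atmost_sub (h2 b a) => c [].
  apply: atmost_or; first by apply: atmost_sub (h1 a b) => c [].
  by apply: atmost_sub (h1 b a) => c [].
have QX : exists a b c, ind e [:: a; b] /\ Qd M (e ++ [:: a; b; c]).
  exists x, y, z; split=> //; rewrite QE; left; rewrite /R.
  by move: f3 f2 f1; rewrite -!cats1 -!catA.
have [rl [K0 [h1 h2]]] := rules_bounded hsm hcomp hmc hM hflat hc unbounded se ie dQ QC QR QB QX.
by exists e, rl, K0.
Qed.

End Circuit.

(** * A recursively enumerable infinite subset *)

Section Transfer.
Variables (L : signature) (T : formula -> Prop) (M1 M2 : structure L) (G : M1 -> M2).
Hypotheses (h1 : is_model T M1) (eG : elementary G).

Lemma elementary_inj : injective G.
Proof.
move=> x y exy; have := elementary_Def h1 eG (Def_eq L (k := 2) (i := 0) (j := 1) isT isT) (l := [:: x; y]) erefl.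
by rewrite /= exy => -[_ /(_ erefl) []].
Qed.

Lemma elementary_acl l a : acl (in_list (map G l)) (G a) -> acl (in_list l) a.
Proof.
move=> /acl_listP [F [dF /finite_atmost [m am] Fa]]; rewrite size_map in dF; apply/acl_listP.
exists F; split=> //; last by apply/(elementary_Def h1 eG dF); rewrite ?size_rcons // map_rcons.
apply/finite_atmost; exists m.
by apply/(elementary_Def h1 eG (@Def_atmost _ _ m _ dF)).
Qed.

Variables (eN : seq M1) (rl : seq rule) (K0 : nat).
Hypothesis img : forall w z, acl (in_list (map G (eN ++ w))) z -> exists x, G x = z.
Hypothesis outs : forall r w x y, List.In r rl -> rapp (map G eN) r w x y ->
  forall z, List.In z x -> acl (in_list (map G eN ++ w)) z.
Hypothesis bounded : forall X : seq M2, List.NoDup X -> rclosed (map G eN) rl X -> size X <= K0.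

Lemma rapp_elementary r w x y : rapp eN r w x y <-> rapp (map G eN) r (map G w) (map G x) (map G y).
Proof.
rewrite /rapp !size_map -!map_cat.
by split=> -[-> -> -> m]; split=> //; apply/(elementary_Def h1 eG (Def_rmatch _ _ r.2) erefl).
Qed.

Lemma rule_outs r w x y : List.In r rl -> rapp eN r w x y ->
  forall z, List.In z x -> acl (in_list (eN ++ w)) z.
Proof.
move=> hr /rapp_elementary ha z zx; apply: elementary_acl; rewrite map_cat.
by apply: (outs hr ha); exact: List.in_map.
Qed.

Lemma map_preimage (A B : Type) (f : A -> B) (s : seq B) : (forall b, List.In b s -> exists a, f a = b) ->
  exists t, map f t = s.
Proof.
elim: s => [|b s IH] h; first by exists [::].
have [t <-] := IH (fun c hc => h c (or_intror hc)); have [a <-] := h b (or_introl erefl).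
by exists (a :: t).
Qed.

(** A rule applied in [M2] to elements of the image has its output in the image, by [img], but its
    auxiliary tuple [y] may lie outside. The existence of some [y] is first-order, so another one is
    found in [M1]. *)
Lemma closed_bounded X : List.NoDup X -> rclosed eN rl X -> size X <= K0.
Proof.
move=> nd cl; rewrite -(size_map G); apply: bounded; first exact: NoDup_map_inj elementary_inj nd.
move=> r w x y hr ha wX z zx.
have [w' ew] : exists w', map G w' = w.
  by apply: map_preimage => b /wX /List.in_map_iff [a [<- _]]; exists a.
subst w.
have [x' ex] : exists x', map G x' = x.
  by apply: map_preimage => b bx; apply: (img (w := w')); rewrite map_cat; exact: (outs hr ha).
subst x; have w'X a : List.In a w' -> List.In a X.
  by move=> /(List.in_map G) /wX /List.in_map_iff [b [/elementary_inj <- ]].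
have [sw sx sy m] := ha; rewrite !size_map in sw sx.
have dE : Def (size ((eN ++ w') ++ x')) (fun (M : structure L) (l : seq M) => exists2 y, size y = r.1.2 & rmatch r.2 (l ++ y)).
  by apply: (@Def_exs _ _ _ (fun (M' : structure L) (l : seq M') => rmatch r.2 l)); exact: Def_rmatch.
have [y' sy' m'] : exists2 y', size y' = r.1.2 & rmatch r.2 (((eN ++ w') ++ x') ++ y').
  by apply/(elementary_Def h1 eG dE) => //; exists y => //; rewrite !map_cat.
move: zx => /List.in_map_iff [z' [<- z'x]]; apply: List.in_map.
by apply: (cl r w' x' y' hr _ w'X z' z'x).
Qed.

End Transfer.

Lemma mem_mapP (A : Type) (B : eqType) (f : A -> B) s x : x \in map f s <-> exists2 y, List.In y s & x = f y.
Proof.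
rewrite -InP List.in_map_iff; split=> [[y [<- h]]|[y h ->]]; by exists y.
Qed.

Section ComputableClosure.
Variables (L : signature) (N : structure L) (iota : N -> nat).
Hypothesis hN : recursive_structure iota.
Variables (eN : seq N) (rl : seq rule) (K0 : nat) (H : N -> Prop) (Y0 : seq N).
Hypothesis Hcl : forall a, acl H a -> H a.
Hypothesis eH : forall z, List.In z eN -> H z.
Hypothesis outs : forall r w x y, List.In r rl -> rapp eN r w x y ->
  forall z, List.In z x -> acl (in_list (eN ++ w)) z.
Hypothesis bounded : forall X : seq N, List.NoDup X -> rclosed eN rl X -> size X <= K0.
Hypotheses (Y0nd : List.NoDup Y0) (Y0s : size Y0 = K0.+1) (Y0H : forall y, List.In y Y0 -> H y).

Local Notation inst := (nat * (seq nat * (seq nat * seq nat)))%type.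
Let rule_of (z : inst) : rule := nth (0, 0, 0, [::]) rl z.1.

Definition fires (z : inst) : bool :=
  let r := rule_of z in let w := z.2.1 in let x := z.2.2.1 in let y := z.2.2.2 in
  [&& z.1 < size rl, size w == r.1.1.1, size x == r.1.1.2, size y == r.1.2, all (inN iota) (w ++ (x ++ y)) &
    all (fun c => truth iota c (map iota eN ++ (w ++ (x ++ y))) == nth false r.2 c) (seq.iota 0 (size r.2))].

Lemma comp_fires : comp fires.
Proof.
have cr : comp rule_of by apply: comp_nth; ct.
rewrite /fires; apply: comp_and; first by apply: comp_leq; ct.
do 3 (apply: comp_and; first by apply: comp_eqn; ct).
apply: comp_and.
  apply: (comp_all (g := fun z : inst * nat => inN iota z.2)); last by ct.
  by apply: (comp_inN hN); ct.
apply: (comp_all (g := fun z : inst * nat => truth iota z.2 (map iota eN ++ (z.1.2.1 ++ (z.1.2.2.1 ++ z.1.2.2.2))) == nth false (rule_of z.1).2 z.2)); last by ct; ct.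
apply: comp_eqb; first by apply: (comp_truth hN); ct.
by apply: comp_nth; ct; apply: comp_comp cr _; ct.
Qed.

(** Stage [m] tries the rule instance coded by [nsnd m]; the free component [nfst m] makes every
    instance return at arbitrarily late stages, when its premises may have appeared. *)
Definition derived (u : nat) : seq nat :=
  natrec (map iota Y0) (fun m r => let z : inst := dec (nsnd m) in
    r ++ (if fires z && all (fun x => x \in r) z.2.1 then z.2.2.1 else [::])) u.

Lemma derivedS u : derived u.+1 = derived u ++ (if fires (dec (nsnd u)) && all (fun x => x \in derived u) (dec (nsnd u) : inst).2.1
  then (dec (nsnd u) : inst).2.2.1 else [::]).
Proof. by []. Qed.

Lemma comp_derived : comp derived.
Proof.
apply: (@comp_natrec _ _ _ _ (fun=> map iota Y0) (fun w : nat * (seq nat * nat) =>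
  w.2.1 ++ (if fires (dec (nsnd w.1)) && all (fun x => x \in w.2.1) (dec (nsnd w.1) : inst).2.1 then (dec (nsnd w.1) : inst).2.2.1 else [::]))); [by ct | | by ct].
have cd : comp (fun w : nat * (seq nat * nat) => dec (nsnd w.1) : inst).
  by apply: comp_dec; ct.
apply: comp_cat; first by ct.
apply: comp_if; [apply: comp_and | by ct; ct | by ct].
  exact: comp_comp comp_fires cd.
apply: (comp_all (g := fun w : (nat * (seq nat * nat)) * nat => w.2 \in w.1.2.1)); first by apply: comp_mem; ct.
by ct; ct.
Qed.

Lemma derived_sub u u' : u <= u' -> {subset derived u <= derived u'}.
Proof.
move=> /subnK <-; elim: (u' - u) => [|k IH] // x /IH hx.
by rewrite addSn /derived /= mem_cat -/(derived _) hx.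
Qed.

Lemma inN_map (s : seq nat) : all (inN iota) s -> exists t, map iota t = s.
Proof.
move=> h; apply: map_preimage => b /InP bs; exact/asboolP/(allP h).
Qed.

Lemma firesP z : fires z <-> exists w x y, [/\ z.2 = (map iota w, (map iota x, map iota y)), z.1 < size rl &
  rapp eN (rule_of z) w x y].
Proof.
split.
- case: z => ri [w [x y]] /and5P [/= hr /eqP sw /eqP sx /eqP sy /andP [hN' ht]].
  move: hN'; rewrite !all_cat => /and3P [/inN_map [w' ew] /inN_map [x' ex] /inN_map [y' ey]]; subst.
  exists w', x', y'; split=> //; rewrite !size_map in sw sx sy; split=> //.
  move=> c /In_iota /andP [_ cs]; rewrite -(truthP hN) !map_cat -!catA.
  have := allP ht c; rewrite mem_iota /= => /(_ cs) /eqP ->; exact: iff_refl.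
- move: z => [ri z2] [w [x [y [/= -> hr [sw sx sy m]]]]].
  rewrite /fires /= hr !size_map sw sx sy !eqxx /= !all_cat; apply/andP; split.
    have h (s : seq N) : all (inN iota) (map iota s).
      by apply/allP => v /mem_mapP [a _ ->]; apply/asboolP; exists a.
    by rewrite !h.
  apply/allP => c; rewrite mem_iota => /andP [_ cs].
  have := m c; rewrite -(truthP hN) !map_cat -!catA => /(_ ((In_iota _ _ _).2 _)) h.
  by apply/eqP; apply/idP/idP => ?; apply/h.
Qed.

Lemma derived_H u x : x \in derived u -> exists2 y, iota y = x & H y.
Proof.
have [inj _] := hN.
elim: u x => [|u IH] x.
  by move=> /mem_mapP [y yY ->]; exists y => //; exact: Y0H.
rewrite derivedS mem_cat => /orP [/IH //|]; move: (dec (nsnd u) : inst) => z.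
case: ifP => // /andP [/firesP [w [x' [y [e hr ha]]]] hw].
rewrite e /= in hw *; move=> /mem_mapP [t tx ->]; exists t => //; apply: Hcl.
have hin : List.In (rule_of z) rl by apply: (@onth_In _ _ z.1); rewrite (onth_nth' (0, 0, 0, [::])).
apply: acl_sub (outs hin ha tx) => t1; rewrite /in_list List.in_app_iff => -[/eH|tw]; first exact: acl_refl.
have /IH [t' /inj <- ht'] : iota t1 \in derived u by apply: (allP hw); apply/mem_mapP; exists t1.
exact: acl_refl.
Qed.

(** Otherwise the derived elements would form a finite set closed under the rules, which has at most
    [K0] elements but contains the [K0.+1] elements of [Y0]. *)
Lemma derived_infinite (a : seq nat) : exists u y, y \in derived u /\ y \notin a.
Proof.
apply: contrapT => no.
have sub u y : y \in derived u -> y \in a.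
  by move=> h; apply: contrapT => /negP n; apply: no; exists u, y.
have [inj _] := hN.
have fin : finite_set (fun y : N => exists u, iota y \in derived u).
  have : finite_set (fun y : N => iota y \in a).
    elim: (a) => [|c s [t ht]]; first by exists [::].
    case: (pselect (exists y, iota y = c)) => [[y ey]|n].
      by exists (y :: t) => z; rewrite inE => /orP [/eqP|/ht]; [rewrite -ey => /inj ->; left | right].
    by exists t => z; rewrite inE => /orP [/eqP e|/ht //]; case: n; exists z.
  by apply: finite_sub => y [u /sub].
have [X [nd hX]] := finite_enum fin.
have : size X <= K0.
  apply: bounded => // r w x y hr ha wX z zx.
  have [u0 hu0] : exists u0, forall t, List.In t w -> iota t \in derived u0.
    elim: w wX {ha} => [|t w IH] wX; first by exists 0.
    have [u1 h1] := IH (fun t ht => wX t (or_intror ht)).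
    have [u2 h2] := (hX t).2 (wX t (or_introl erefl)).
    exists (maxn u1 u2) => t' [<-|/h1]; first exact: derived_sub (leq_maxr _ _) _ h2.
    exact: derived_sub (leq_maxl _ _) _.
  have [ri ril eri] := In_nth hr; rewrite (onth_nth' (0, 0, 0, [::])) // in eri.
  pose zz : inst := (ri, (map iota w, (map iota x, map iota y))).
  apply/hX; exists (npair u0 (enc zz)).+1; rewrite derivedS nsndK encK mem_cat.
  have -> : fires zz by apply/firesP; exists w, x, y; split=> //; rewrite /rule_of /=; case: eri => ->.
  have -> : all (fun t => t \in derived (npair u0 (enc zz))) zz.2.1.
    apply/allP => v /mem_mapP [t tw ->]; exact: derived_sub (npair_ge1 _ _) _ (hu0 t tw).
  by apply/orP; right; apply/mem_mapP; exists z.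
apply/negP; rewrite -ltnNge -Y0s; apply/leP; apply: List.NoDup_incl_length => // y yY.
by apply/hX; exists 0; apply/mem_mapP; exists y.
Qed.

End ComputableClosure.

(** * Limit guessing and the presentation *)

(** Read [ok ((p, x), v)] as: [v] does not refute the claim [p] about [x]. At time [u] the guess
    follows the least claim not refuted so far. Smaller false claims are refuted in time, so the
    guess settles on the least correct claim, and [par] decodes what that claim says. *)
Lemma sigma_limit (V H : nat -> Prop) (ok : (nat * nat) * nat -> bool) (par : nat -> bool) :
  comp ok -> comp par ->
  (forall x, V x -> exists p, forall v, ok ((p, x), v)) ->
  (forall x p, V x -> (forall v, ok ((p, x), v)) -> par p = `[< H x >]) ->
  exists g : nat * nat -> bool, comp g /\ forall x, V x -> exists u0, forall u, u0 <= u -> g (u, x) = `[< H x >].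
Proof.
move=> okc parc ex hp.
pose okk (z : (nat * nat) * nat) := all (fun v => ok ((z.2, z.1.2), v)) (iota 0 z.1.1.+1).
have okkc : comp okk.
  apply: (comp_all (g := fun w : ((nat * nat) * nat) * nat => ok ((w.1.2, w.1.1.2), w.2))); last by ct.
  by apply: comp_comp okc _; ct.
exists (fun z : nat * nat => has (fun p => (okk (z, p) && par p) && all (fun p' => ~~ okk (z, p')) (iota 0 p)) (iota 0 z.1.+1)).
split.
  apply: (comp_has (g := fun w : (nat * nat) * nat => (okk (w.1, w.2) && par w.2) && all (fun p' => ~~ okk (w.1, p')) (iota 0 w.2))); last by ct.
  apply: comp_and; first by apply: comp_and; [apply: comp_comp okkc _; ct | apply: comp_comp parc _; ct].
  apply: (comp_all (g := fun w : ((nat * nat) * nat) * nat => ~~ okk (w.1.1, w.2))); last by ct.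
  by apply: comp_not; apply: comp_comp okkc _; ct.
move=> x Vx; have exb : exists p, `[< forall v, ok ((p, x), v) >] by have [p hv] := ex x Vx; exists p; apply/asboolP.
case: (ex_minnP exb) => p0 /asboolP v0 pmin.
have ch p : exists v, p < p0 -> ~~ ok ((p, x), v).
  case: (ltnP p p0) => pp; last by exists 0.
  apply: contrapT => no; have : p0 <= p; last by rewrite leqNgt pp.
  apply: pmin; apply/asboolP => v; apply: contrapT => /negP n; apply: no; by exists v.
have [r rP] := choice ch.
(* Late enough to consider [p0] and to have met a refutation of every smaller claim. *)
exists (p0 + \max_(p < p0) r p) => u hu.
have ok0 : okk ((u, x), p0) by apply/allP => v _; exact: v0.
have nok p : p < p0 -> ~~ okk ((u, x), p).
  move=> pp; apply/negP => /allP h; have := rP p pp; rewrite h // mem_iota add0n ltnS.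
  have h2 : r p <= \max_(p < p0) r p by exact: (@leq_bigmax _ (fun p : 'I_p0 => r p) (Ordinal pp)).
  exact: leq_trans h2 (leq_trans (leq_addl _ _) hu).
rewrite -(hp x p0 Vx v0); apply/hasP/idP => [[p _ /andP [/andP [pointer_test parp] /allP least]]|par0].
  case: (ltngtP p p0) => [/nok|pp|<- //]; first by rewrite pointer_test.
  by have := least p0; rewrite mem_iota pp ok0 => /(_ isT).
exists p0; first by rewrite mem_iota add0n ltnS (leq_trans (leq_addr _ _) hu).
rewrite ok0 par0; apply/allP => p; rewrite mem_iota add0n => /andP [_]; exact: nok.
Qed.

Lemma In_take (A : Type) (s : seq A) i j z : i <= j -> List.In z (take i s) -> List.In z (take j s).
Proof.
move=> ij; rewrite -(take_takel s ij) -{2}(cat_take_drop i (take j s)) => h.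
by apply/List.in_app_iff; left.
Qed.

Section Guess.
Variables (L : signature) (T : formula -> Prop).
Hypotheses (hsm : strongly_minimal L T) (hmc : model_complete L T).
Variables (N : structure L) (iota : N -> nat).
Hypotheses (hN : is_model T N) (hr : recursive_structure iota).

Lemma structure_countable : exists e : nat -> N, forall a, exists i, e i = a.
Proof.
have [[d] _] := hN; have [inj _] := hr.
have ch i : exists a, (exists b, iota b = i) -> iota a = i.
  by case: (pselect (exists b, iota b = i)) => [[b e]|n]; [exists b | exists d].
have [e eP] := choice ch; exists e => a; exists (iota a); apply: inj; apply: eP; by exists a.
Qed.

(* The bound [m] on names makes the right-hand side a universal condition on the
   atomic diagram: membership in a finitely generated closed set is Sigma_2. *)
Lemma acl_pattern (c : seq N) y : acl (in_list c) y <-> exists m s l,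
  forall l', size l' = size (y :: l) -> eqv s (c ++ y :: l) (c ++ l') -> forall y' l'', l' = y' :: l'' -> iota y' < m.
Proof.
split=> [/acl_listP [F [dF [t ht] Fy]]|[m [s [l h]]]].
  have [s [l gp]] := good_pattern hmc hN structure_countable dF (size_rcons c y) Fy.
  exists (foldr maxn 0 (map iota t)).+1, s, l => l' sl' eq y' l'' e; subst l'.
  have /ht tin : F N (rcons c y').
    by apply: (gp _ l''); rewrite ?size_rcons // -?cats1 -?catA //; case: sl'.
  rewrite ltnS; apply: leq_foldr_maxn; apply/mem_mapP; by exists y'.
pose bits := mkseq (fun i => `[< tr i (c ++ y :: l) >]) s.
pose F (M : structure L) (t : seq M) := exists2 u, size u = size l & rmatch bits (t ++ u).
apply/acl_listP; exists F; split.
- by apply: (@Def_exs _ _ _ (fun (M' : structure L) (l : seq M') => rmatch bits l)); exact: Def_rmatch.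
- have fin : finite_set (fun y' : N => iota y' < m).
    have [inj _] := hr; elim: m {h} => [|m [t ht]]; first by exists [::].
    case: (pselect (exists z, iota z = m)) => [[z ez]|no].
      exists (z :: t) => y'; rewrite ltnS leq_eqVlt => /orP [/eqP|/ht]; last by right.
      by rewrite -ez => /inj ->; left.
    by exists t => y'; rewrite ltnS leq_eqVlt => /orP [/eqP e|/ht //]; case: no; exists y'.
  apply: finite_sub fin => y' [u su m']; apply: (h (y' :: u)) (erefl _); first by rewrite /= su.
  move=> i si; have := m' i; rewrite size_mkseq nth_mkseq // -cats1 -catA /= => ->; last by apply/In_iota.
  by split=> /asboolP.
- exists l => // i; rewrite size_mkseq => /In_iota /andP [_ si]; rewrite nth_mkseq // -cats1 -catA /=.
  by split=> /asboolP.
Qed.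

Variables (b : seq N) (k : nat).
Hypotheses (ib : independent b) (sb : forall y, acl (in_list b) y) (kb : k <= size b).

(* The complement of a span is Sigma_2 as well. *)
Lemma notin_span x : ~ acl (in_list (take k b)) x <->
  exists i y, [/\ k <= i, onth b i = Some y & acl (in_list (rcons (take i b) x)) y].
Proof.
split=> [nx|[i [y [ki iy hy]]] hx].
  (* At the least [j] such that [x] lies in the span of the first [j] basis elements, exchange makes
     the last of these algebraic over the earlier ones and [x]. Such a [j] exists as the basis is
     finite, and it exceeds [k]. *)
  have exj : exists j, `[< acl (in_list (take j b)) x >].
    by exists (size b); apply/asboolP; rewrite take_size.
  case: (ex_minnP exj) => j /asboolP hj jmin.
  have kj : k < j.
    rewrite ltnNge; apply/negP => jk; apply: nx; apply: acl_mono hj => z; exact: In_take.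
  case: j hj jmin kj => // j hj jmin kj.
  have jb : j < size b.
    rewrite ltnNge; apply/negP => bj; have := jmin j; rewrite ltnn => /(_ _) h; apply: notF; apply: h.
    by apply/asboolP; rewrite take_oversize //; exact: sb.
  have [[d] _] := hN; exists j, (nth d b j); split=> //; first by rewrite (onth_nth' d).
  rewrite (take_nth d jb) in hj; apply: (acl_exchange hsm hN hj) => h.
  by have := jmin j; rewrite ltnn => /(_ _) h'; apply: notF; apply: h'; apply/asboolP.
have ib' : size b > i by rewrite ltnNge; apply/negP => bi; rewrite onth_default in iy.
have [[d] _] := hN; rewrite (onth_nth' d) // in iy; case: iy => ey.
have := ib (l1 := take i b) (a := y) (l2 := drop i.+1 b).
rewrite -ey -drop_nth // cat_take_drop => /(_ erefl); apply.
apply: (acl_mono (A := in_list (take i b))); first by move=> z; rewrite /in_list List.in_app_iff; left.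
rewrite ey; apply: acl_trans1 hy; apply: acl_mono hx => z; exact: In_take.
Qed.

Local Notation ptr := (nat * (nat * (nat * seq nat)))%type.

Let base (x j : nat) : seq nat := if j == 0 then map iota (take k b) else rcons (take j.-1 (map iota b)) x.
Let target (x j : nat) : nat := if j == 0 then x else nth 0 (map iota b) j.-1.

(* A pointer [(j, (m, (s, l)))] claims, by [acl_pattern], that the element named
   [x] lies in the span of [take k b] if [j = 0], and that the entry [j.-1] of [b]
   lies in the span of the preceding ones and [x] otherwise; [l'] is a possible
   refutation. *)
Definition pointer_ok (p : ptr) (x : nat) (l' : seq nat) : bool :=
  [&& (p.1 == 0) || (k < p.1) && (p.1 <= size b), 0 < size p.2.2.2, all (inN iota) p.2.2.2,
    head 0 p.2.2.2 == target x p.1 &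
    ([&& size l' == size p.2.2.2, all (inN iota) l' &
        all (fun i => truth iota i (base x p.1 ++ p.2.2.2) == truth iota i (base x p.1 ++ l')) (seq.iota 0 p.2.2.1)])
    ==> (head 0 l' < p.2.1)].

Definition pointer_test (z : (nat * nat) * nat) : bool := pointer_ok (dec z.1.1) z.1.2 (dec z.2).

Lemma pointer_testE p x v : pointer_test ((enc p, x), v) = pointer_ok p x (dec v).
Proof. by rewrite -[LHS]/(pointer_ok (dec (enc p)) x (dec v)) encK. Qed.

Lemma comp_pointer_test : comp pointer_test.
Proof.
have cp : comp (fun z : (nat * nat) * nat => dec z.1.1 : ptr) by apply: comp_dec; ct.
have cl : comp (fun z : (nat * nat) * nat => dec z.2 : seq nat) by apply: comp_dec; ct.
have cj : comp (fun z : (nat * nat) * nat => (dec z.1.1 : ptr).1) by exact: comp_fst cp.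
have cpl : comp (fun z : (nat * nat) * nat => (dec z.1.1 : ptr).2.2.2) by exact: comp_snd (comp_snd (comp_snd cp)).
have ccb : comp (fun z : (nat * nat) * nat => base z.1.2 (dec z.1.1 : ptr).1).
  apply: comp_if; [by apply: comp_eqn; ct | by ct |].
  apply: comp_ext (_ : comp (fun z : (nat * nat) * nat => take (dec z.1.1 : ptr).1.-1 (map iota b) ++ [:: z.1.2])).
    by move=> z; rewrite cats1.
  by apply: comp_cat; [apply: comp_take; [exact: comp_pred cj | ct] | ct].
have ct' : comp (fun z : (nat * nat) * nat => target z.1.2 (dec z.1.1 : ptr).1).
  apply: comp_if; [by apply: comp_eqn; ct | by ct |].
  by apply: comp_nth; [ct | exact: comp_pred cj | ct].
rewrite /pointer_test /pointer_ok; apply: comp_and; first by apply: comp_or; [apply: comp_eqn; ct | apply: comp_and; apply: comp_leq; ct; exact: comp_succ].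
apply: comp_and; first by apply: comp_leq; [ct | exact: comp_size].
apply: comp_and.
  by apply: (comp_all (g := fun w : ((nat * nat) * nat) * nat => inN iota w.2)) => //; apply: (comp_inN hr); ct.
apply: comp_and; first by apply: comp_eqn => //; apply: comp_headn => //; ct.
apply: comp_imp; last first.
  apply: comp_leq; first by apply: comp_succ; apply: comp_headn => //; ct.
  exact: comp_fst (comp_snd cp).
apply: comp_and; first by apply: comp_eqn; exact: comp_size.
apply: comp_and.
  by apply: (comp_all (g := fun w : ((nat * nat) * nat) * nat => inN iota w.2)) => //; apply: (comp_inN hr); ct.
apply: (comp_all (g := fun w : ((nat * nat) * nat) * nat =>
  truth iota w.2 (base w.1.1.2 (dec w.1.1.1 : ptr).1 ++ (dec w.1.1.1 : ptr).2.2.2) ==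
  truth iota w.2 (base w.1.1.2 (dec w.1.1.1 : ptr).1 ++ (dec w.1.2 : seq nat)))); last first.
  by apply: comp_iota; exact: comp_fst (comp_snd (comp_snd cp)).
have c1 : comp (fun w : ((nat * nat) * nat) * nat => w.1) by ct.
by apply: comp_eqb; apply: (comp_truth hr); [ct | apply: comp_cat; [exact: comp_comp ccb c1 | exact: comp_comp cpl c1]
  | ct | apply: comp_cat; [exact: comp_comp ccb c1 | exact: comp_comp cl c1]].
Qed.

Lemma pointer_testP (j m s x : nat) (l : seq N) y (c : seq N) : (j == 0) || (k < j) && (j <= size b) ->
  map iota c = base x j -> iota y = target x j ->
  (forall v, pointer_test ((enc (j, (m, (s, map iota (y :: l)))), x), v)) <->
  forall l', size l' = size (y :: l) -> eqv s (c ++ y :: l) (c ++ l') -> forall y' l'', l' = y' :: l'' -> iota y' < m.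
Proof.
move=> hj ec ey; split=> [h l' sl' eq y' l'' e|h v].
  have := h (@enc _ (@enc_seq nat enc_nat) (map iota l')); rewrite pointer_testE encK => /and5P [_ _ _ _ /implyP].
  rewrite -ec e; apply; rewrite -e; apply/and3P; split.
  - by rewrite !size_map sl'.
  - by apply/allP => z /mem_mapP [z' _ ->]; apply/asboolP; exists z'.
  - apply/allP => i; rewrite mem_iota add0n => /andP [_ si]; apply/eqP.
    rewrite -[_.2.2.2]/(map iota (y :: l)) -!map_cat.
    by apply/idP/idP => /(truthP hr) hh; apply/(truthP hr); apply/(eq i si).
rewrite pointer_testE; apply/and5P; split=> //.
- by apply/allP => z /mem_mapP [z' _ ->]; apply/asboolP; exists z'.
- by rewrite /= ey.
apply/implyP => /and3P []; move: (dec v) => w; rewrite -ec => /eqP sw aw /allP hw.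
have [l' el'] := inN_map aw; subst w; rewrite !size_map in sw.
case: l' sw hw aw => // y' l'' sw hw _ /=; apply: (h (y' :: l'')) (erefl _) => //.
move=> i si; have := hw i; rewrite mem_iota si => /(_ isT) /eqP.
rewrite -!map_cat => e; split=> /(truthP hr) hh; apply/(truthP hr); by rewrite ?e // -e.
Qed.

Let encp (p : ptr) : nat := enc p.
Let par (p : nat) : bool := (dec p : ptr).1 == 0.

Lemma limit_guess (P : nat -> seq nat) : comp P ->
  (forall u x, x \in P u -> exists2 y, iota y = x & acl (in_list (take k b)) y) ->
  exists g : nat * nat -> bool, [/\ comp g,
    forall u x, x \in P u -> g (u, x) &
    forall x, inN iota x -> exists u0, forall u, u0 <= u ->
      g (u, x) = `[< exists2 y, iota y = x & acl (in_list (take k b)) y >]].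
Proof.
move=> Pc PH; have [inj _] := hr.
have [||||g0 [gc gl]] := @sigma_limit (fun x => inN iota x) (fun x => exists2 y, iota y = x & acl (in_list (take k b)) y) pointer_test par.
- exact: comp_pointer_test.
- by apply: comp_eqn; [apply: comp_fst; apply: comp_dec; ct | ct].
- move=> x /asboolP [y0 ex]; case: (pselect (acl (in_list (take k b)) y0)) => [/acl_pattern [m [s [l h]]]|].
    exists (encp (0, (m, (s, map iota (y0 :: l))))).
    exact: ((@pointer_testP 0 m s x l y0 (take k b) isT erefl ex).2 h).
  move=> /notin_span [i [y [ki iy /acl_pattern [m [s [l h]]]]]].
  exists (encp (i.+1, (m, (s, map iota (y :: l))))).
  have ib' : i < size b by rewrite ltnNge; apply/negP => bi; rewrite onth_default in iy.
  apply: ((@pointer_testP i.+1 m s x l y (rcons (take i b) y0) _ _ _).2 h).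
  + by rewrite ltnS ki ib'.
  + by rewrite /base /= map_rcons map_take ex.
  + by rewrite /target /=; rewrite (onth_nth' y) // in iy; case: iy => <-; rewrite (nth_map y).
- move=> x p /asboolP [y0 ex] h; rewrite /par.
  have := h; rewrite -(decK p : enc (dec p : ptr) = p); move: (dec p : ptr) => [j [m [s l]]] h'.
  have := h' 0; rewrite pointer_testE => /and5P [hj sl /inN_map [l0 el] /eqP hd _].
  rewrite /= in hj el hd sl; rewrite encK /=; subst l.
  case: l0 sl hd h' => //= y l _ hd h'; case: eqP => ej.
    subst j; apply/esym/asboolP; exists y0 => //.
    apply/acl_pattern; exists m, s, l; have -> : y0 = y by apply: inj; rewrite ex hd.
    by apply: ((@pointer_testP 0 m s x l y (take k b) isT erefl hd).1 h').
  apply/esym/asboolPn => -[y1 ey1 h1]; have e01 : y1 = y0 by apply: inj; rewrite ex.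
  subst y1; case: j ej hj hd h' => // j _ hj hd h'.
  have jb : j < size b by move: hj; rewrite /= => /andP [].
  apply: (notin_span y0).2 h1; exists j, y; split; first by case/andP: hj.
    rewrite (onth_nth' y) //; congr Some; apply: inj; rewrite hd /target /=.
    by rewrite (nth_map y).
  apply/acl_pattern; exists m, s, l.
  by apply: ((@pointer_testP j.+1 m s x l y (rcons (take j b) y0) hj _ hd).1 h'); rewrite /base /= map_rcons map_take ex.
(* Members of [P u] are accepted at once. The limit is unaffected, since they lie in the span, and a
   replacement taken from [P] is never suspected again. *)
exists (fun z => (z.2 \in P z.1) || g0 z); split.
- apply: comp_or => //; apply: comp_mem; first by ct.
  by apply: comp_comp Pc _; ct.
- by move=> u x /= ->.
move=> x Vx; have [u0 hu] := gl x Vx; exists u0 => u hu'; rewrite /= hu //.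
by case: (boolP (x \in P u)) => // /PH h; apply/esym/asboolP.
Qed.

End Guess.

Lemma onth_sel (A : Type) (l : seq A) s p : all (fun i => i < size l) s -> p < size s ->
  onth (sel l s) p = onth l (nth 0 s p).
Proof.
elim: s p => // i s IH p /andP [il hs] ps.
have [d _] : exists d : A, True by case: l il {IH hs} => // d l' _; exists d.
have -> : sel l (i :: s) = nth d l i :: sel l s by rewrite -[i :: s]cat1s sel_cat {1}/sel /= (onth_nth' d).
by case: p ps => [_|p ps] /=; [rewrite (onth_nth' d) | exact: IH].
Qed.

(** * Moving tuples into a closed set *)

Section Move.
Variables (L : signature) (T : formula -> Prop).
Hypothesis hsm : strongly_minimal L T.
Variable N : structure L.
Hypothesis hN : is_model T N.
Variable H : N -> Prop.
Hypothesis Hcl : forall a, acl H a -> H a.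
Hypothesis Hinf : forall s : seq N, exists2 y, H y & ~ List.In y s.

(* The possible values of the entry [j], the entries in [K] being fixed, form a
   definable set over [H]; it contains an element outside [H], so it is cofinite. *)
Lemma move_one n (R : forall M : structure L, seq M -> Prop) (Z : N -> Prop) (l : seq N) (K : nat -> bool) j y0 :
  Def n R -> size l = n -> R N l -> (forall i y, K i -> onth l i = Some y -> H y) ->
  (forall s : seq N, exists2 y, Z y & ~ List.In y s) -> onth l j = Some y0 -> ~ H y0 ->
  exists u y, [/\ size u = n, R N u, (forall i, i < n -> K i -> onth u i = onth l i), onth u j = Some y & Z y].
Proof.
move=> dR sl Rl KH Zinf lj nH; have jn : j < n.
  by rewrite -sl ltnNge; apply/negP => h; rewrite onth_default in lj.
pose ks := filter K (iota 0 n); pose c := sel l ks.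
have ksn : all (fun i => i < size l) ks.
  by apply/allP => i; rewrite mem_filter mem_iota sl => /andP [_].
have sc : size c = size ks by exact: size_sel.
pose F (M : structure L) (t : seq M) := exists2 u, size u = n & R M u /\
  ((forall p, List.In p (iota 0 (size ks)) -> onth u (nth 0 ks p) = onth t p) /\ onth u j = onth t (size ks)).
have dF : Def (size c).+1 F.
  pose G (M : structure L) (t : seq M) := R M (sel t (iota (size ks).+1 n)) /\
    ((forall p, List.In p (iota 0 (size ks)) -> onth t ((size ks).+1 + nth 0 ks p) = onth t p) /\
     onth t ((size ks).+1 + j) = onth t (size ks)).
  have dG : Def ((size ks).+1 + n) G.
    apply: Def_and.
      apply: (@Def_sel _ _ _ _ _ dR); first by rewrite size_iota.
      by apply/allP => i; rewrite mem_iota => /andP [].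
    apply: Def_and; last by apply: Def_eq; lia.
    apply: (@Def_all _ _ _ (iota 0 (size ks)) (fun p (M : structure L) (t : seq M) => onth t ((size ks).+1 + nth 0 ks p) = onth t p)).
    move=> p /In_iota /andP [_ pk]; apply: Def_eq; last by lia.
    by have := allP ksn (nth 0 ks p) (mem_nth _ pk); rewrite sl; lia.
  rewrite sc; apply: Def_ext (Def_exs dG) => M t st.
  have E (u : seq M) : size u = n -> G M (t ++ u) <-> R M u /\
      ((forall p, List.In p (iota 0 (size ks)) -> onth u (nth 0 ks p) = onth t p) /\ onth u j = onth t (size ks)).
    move=> su; rewrite /G.
    have -> : sel (t ++ u) (iota (size ks).+1 n) = u by have := sel_iota t u [::]; rewrite cats0 st su.
    have o1 i : onth (t ++ u) ((size ks).+1 + i) = onth u i by rewrite onth_cat st ifF ?addKn //; lia.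
    have o2 i : i < (size ks).+1 -> onth (t ++ u) i = onth t i by move=> h; rewrite onth_cat st h.
    rewrite o1 o2 //; split=> -[hR [h1 h2]]; split=> //; split=> // p hp.
      by rewrite -o1 h1 // o2 //; move: hp => /In_iota; lia.
    by rewrite o1 h1 // o2 //; move: hp => /In_iota; lia.
  by split=> -[u su hu]; exists u => //; apply/E.
have cE p : p < size ks -> onth c p = onth l (nth 0 ks p) by exact: onth_sel.
have Fy0 : F N (rcons c y0).
  exists l => //; split=> //; split; last by rewrite -sc onth_last.
  by move=> p /In_iota /andP [_ pk]; rewrite onth_rcons_lt ?sc // cE.
case: (definable_dichotomy hsm hN dF) => [f|[s hs]].
  case: nH; apply: Hcl; have h : acl (in_list c) y0 by apply/acl_listP; exists F.
  apply: acl_mono h => z zc; have [p pc e] := In_nth zc; rewrite sc in pc; rewrite cE // in e.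
  apply: KH e; have := mem_nth 0 pc; by rewrite mem_filter => /andP [].
have [y Zy nys] := Zinf s.
have [u su [Ru [hu uj]]] : F N (rcons c y) by apply: contrapT => nF; apply: nys; exact: hs.
exists u, y; split=> //; last by rewrite uj -sc onth_last.
move=> i il Ki; have ik : i \in ks by rewrite mem_filter Ki mem_iota.
have pk : index i ks < size ks by rewrite index_mem.
have := hu (index i ks) ((In_iota _ _ _).2 _); rewrite nth_index // => -> //.
by rewrite onth_rcons_lt ?sc // cE // nth_index.
Qed.

(** Positions are treated one after another; those already inside [H] join the ones that must stay
    fixed. *)
Lemma move_all n (R : forall M : structure L, seq M -> Prop) (l : seq N) (K : nat -> bool) :
  Def n R -> size l = n -> R N l -> (forall i y, K i -> onth l i = Some y -> H y) ->
  exists u, [/\ size u = n, R N u, (forall i, i < n -> K i -> onth u i = onth l i) & forall y, List.In y u -> H y].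
Proof.
move=> dR sl Rl KH.
suff h2 m : m <= n -> exists u, [/\ size u = n, R N u, (forall i, i < n -> K i -> onth u i = onth l i) &
    forall i y, i < m -> onth u i = Some y -> H y].
  have [u [su Ru ul uH]] := h2 n (leqnn n); exists u; split=> // y yu.
  have [i il e] := In_nth yu; apply: uH e; by rewrite -su.
elim: m => [_|m IH mn]; first by exists l.
have [u [su Ru ul uH]] := IH (ltnW mn).
case: (pselect (forall y, onth u m = Some y -> H y)) => [hm|nm].
  by exists u; split=> // i y; rewrite ltnS leq_eqVlt => /orP [/eqP ->|/uH h1]; [exact: hm | exact: h1].
have [y0 [uy0 ny0]] : exists y0, onth u m = Some y0 /\ ~ H y0.
  by apply: contrapT => no; apply: nm => y uy; apply: contrapT => ny; apply: no; exists y.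
have KH' i y : K i || (i < m) -> onth u i = Some y -> H y.
  case: (ltnP i m) => im; first by move=> _; exact: uH.
  rewrite orbF => Ki e; have il : i < n by rewrite -su ltnNge; apply/negP => hi; rewrite onth_default in e.
  by apply: (KH i) => //; rewrite -ul.
have [v [y [sv Rv vu vm Hy]]] := move_one dR su Ru KH' Hinf uy0 ny0.
exists v; split=> // [i il Ki|i z].
  by rewrite vu ?Ki // ul.
rewrite ltnS leq_eqVlt => /orP [/eqP ->|im e]; first by rewrite vm => -[<-].
by apply: (uH i) => //; rewrite -vu ?im ?orbT //; apply: ltn_trans im mn.
Qed.
End Move.

Lemma tvars_code t v : v \in tvars t -> v <= code_term t.
Proof.
elim/term_nested_ind: t v => [w|f ts IH] v /=; first by rewrite inE => /eqP ->; exact: npair_ge2.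
move=> h; apply: leq_trans (npair_ge2 _ _); apply: leq_trans (npair_ge2 _ _).
elim: ts IH h => //= t ts IHs IH; rewrite mem_cat => /orP [/IH h|h]; apply: ltnW; rewrite ltnS.
  by apply: leq_trans (npair_ge1 _ _); apply: h; left.
by apply: leq_trans (npair_ge2 _ _); apply: IHs => // t' ht'; apply: IH; right.
Qed.

(** Because codes dominate variables, the literal of code [c] speaks of positions up to [c] only,
    and extending a sequence longer than [c] cannot change its truth value. *)
Lemma fv_code p v : v \in fv p -> v <= code_formula p.
Proof.
elim: p v => [|t1 t2|r ts|p IH|p IHp p' IHp'|x p IH] v //=.
- rewrite mem_cat => h; apply: leq_trans (npair_ge2 _ _).
  by case/orP: h => /tvars_code h; apply: leq_trans h _; [exact: npair_ge1 | exact: npair_ge2].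
- by move=> h; have /tvars_code /= := (h : v \in tvars (TApp r ts)); rewrite /npair; lia.
- by move=> /IH h; apply: leq_trans h (npair_ge2 _ _).
- rewrite mem_cat => h; apply: leq_trans (npair_ge2 _ _).
  by case/orP: h => [/IHp|/IHp'] h; apply: leq_trans h _; [exact: npair_ge1 | exact: npair_ge2].
rewrite mem_filter => /andP [_ /IH h]; apply: leq_trans (npair_ge2 _ _).
by apply: leq_trans h _; exact: npair_ge2.
Qed.

Lemma tr_prefix L (M : structure L) c (l l' : seq M) : c < size l -> tr c (l ++ l') <-> tr c l.
Proof.
move=> cl; have [[|d t] //] : exists t, t = l by exists l.
  by move=> e; rewrite -e in cl.
move=> _; have ag : agree (nth d (l ++ l')) l.
  rewrite /agree -[RHS](take_size l) -(map_nth_iota0 d) //; apply/eq_in_map => i.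
  by rewrite mem_iota add0n nth_cat => /andP [_ ->].
have bel p : code_formula p = c -> below (size l) p.
  by move=> pc; apply/allP => v /fv_code; rewrite pc => /leq_ltn_trans; apply.
split=> -[p [pc lp wp bp h]]; exists p; split=> //.
- exact: bel.
- move=> rho ag'; apply: (sat_agree ag ag' (bel p pc)); apply: h; exact: agree_nth.
- by rewrite size_cat; apply: sub_all (bel p pc) => v hv; rewrite /= ltn_addr.
- move=> rho ag'; have := h (nth d (l ++ l')) ag.
  apply: (sat_agree (agree_nth d (l ++ l')) ag').
  by rewrite size_cat; apply: sub_all bp => v hv; rewrite /= ltn_addr.
Qed.

Section MoveCodes.
Variables (L : signature) (T : formula -> Prop).
Hypothesis hsm : strongly_minimal L T.
Variables (N : structure L) (iota : N -> nat).
Hypotheses (hN : is_model T N) (hr : recursive_structure iota).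
Variables (H : N -> Prop) (P : nat -> seq nat).
Hypothesis Hcl : forall a, acl H a -> H a.
Hypothesis PH : forall u x, x \in P u -> exists2 y, iota y = x & H y.
Hypothesis Pinf : forall a : seq nat, exists u y, y \in P u /\ y \notin a.

Lemma P_outside (s : seq N) : exists2 y, (exists u, iota y \in P u) & ~ List.In y s.
Proof.
have [u [x [xP xs]]] := Pinf (map iota s); have [y ey _] := PH xP.
exists y; first by exists u; rewrite ey.
by move=> ys; move/negP: xs; apply; apply/mem_mapP; exists y.
Qed.

Lemma H_outside (s : seq N) : exists2 y, H y & ~ List.In y s.
Proof.
have [inj _] := hr; have [y [u yP] ys] := P_outside s; exists y => //.
by have [z /inj <-] := PH yP.
Qed.

Lemma move_codes (f : seq nat) (K : nat -> bool) q : all (inN iota) f -> uniq f ->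
  (forall i, i < size f -> K i -> exists2 y, iota y = nth 0 f i & H y) ->
  exists a, [/\ size a = size f, uniq a, (forall x, x \in a -> exists2 y, iota y = x & H y),
    (forall c, c < size f -> truth iota c f = truth iota c a) &
    (forall i, i < size f -> K i -> nth 0 a i = nth 0 f i) /\
    (q < size f -> ~~ K q -> ~ (exists2 y, iota y = nth 0 f q & H y) -> exists u, nth 0 a q \in P u)].
Proof.
move=> /inN_map [l <-]; rewrite size_map; set n := size l => ul KH; have [inj _] := hr.
have [[d] _] := hN.
pose bits := mkseq (fun c => `[< tr c l >]) n.
(* Distinctness of the entries is demanded separately, because literals of small code need not
   express it. *)
pose R (M : structure L) (t : seq M) := rmatch bits t /\
  forall i, List.In i (seq.iota 0 n) -> forall j, List.In j (seq.iota 0 n) -> i <> j -> onth t i <> onth t j.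
have dR : Def n R.
  apply: Def_and; first exact: Def_rmatch.
  apply: (@Def_all _ _ _ (seq.iota 0 n) (fun i (M : structure L) (t : seq M) => forall j, List.In j (seq.iota 0 n) -> i <> j -> onth t i <> onth t j)).
  move=> i /In_iota /andP [_ ii].
  apply: (@Def_all _ _ _ (seq.iota 0 n) (fun j (M : structure L) (t : seq M) => i <> j -> onth t i <> onth t j)).
  move=> j /In_iota /andP [_ jj]; apply: Def_imp; first exact: Def_cst.
  by apply: Def_not; apply: Def_eq.
have nthE (t : seq N) i : i < size t -> nth 0 (map iota t) i = iota (nth d t i) by move=> h; rewrite (nth_map d).
have Rl : R N l.
  split=> [c|i /In_iota /andP [_ ii] j /In_iota /andP [_ jj] ij].
    by rewrite size_mkseq => /In_iota /andP [_ cn]; rewrite nth_mkseq //; split=> /asboolP.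
  rewrite !(onth_nth' d) // => -[e]; apply: ij; apply/eqP.
  by rewrite -(nth_uniq 0 _ _ ul) ?size_map // !nthE // e.
have KH' i y : K i && (i < n) -> onth l i = Some y -> H y.
  move=> /andP [Ki il]; rewrite (onth_nth' d) // => -[<-].
  by have [z] := KH i il Ki; rewrite nthE // => /inj ->.
have fin (u : seq N) : size u = n -> R N u -> uniq (map iota u) /\ forall c, c < n -> truth iota c (map iota l) = truth iota c (map iota u).
  move=> su [hb hd]; split.
    apply/(uniqP 0) => i j; rewrite !inE size_map su => ii jj; rewrite !nthE ?su // => /inj e.
    apply: contrapT => ij; apply: (hd i _ j _ ij); try by apply/In_iota.
    by rewrite !(onth_nth' d) ?su // e.
  move=> c cn; have h : tr c u <-> `[< tr c l >].
    by have := hb c; rewrite size_mkseq nth_mkseq //; apply; apply/In_iota.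
  apply/idP/idP => /(truthP hr) hh; apply/(truthP hr); first by apply/h/asboolP.
  by apply/asboolP; apply/h.
suff [u [su Ru ul' uH uq]] : exists u, [/\ size u = n, R N u, (forall i, i < n -> K i -> onth u i = onth l i),
    (forall y, List.In y u -> H y) & q < n -> ~~ K q -> ~ H (nth d l q) -> exists v, iota (nth d u q) \in P v].
  have [uu tu] := fin u su Ru; exists (map iota u); split=> //; first by rewrite size_map.
    by move=> x /mem_mapP [y yu ->]; exists y => //; exact: uH.
  split=> [i il Ki|qn nK nH].
    by rewrite !nthE ?su //; have := ul' i il Ki; rewrite !(onth_nth' d) ?su // => -[->].
  by rewrite nthE ?su //; apply: uq => // hq; apply: nH; exists (nth d l q); rewrite ?nthE.
case: (pselect (q < n /\ ~~ K q /\ ~ H (nth d l q))) => [[qn [nK nH]]|no]; last first.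
  have [u [su Ru ul' uH]] := move_all hsm hN Hcl H_outside dR (erefl : size l = n) Rl KH'.
  exists u; split=> // [i il Ki|qn nK nH]; first by rewrite ul' ?Ki ?il.
  by case: no.
have lq : onth l q = Some (nth d l q) by rewrite (onth_nth' d).
(* The wrong entry [q] is moved first, with the members of the sets [P v] as admissible values. It
   then lies in [H] and can be held fixed while the remaining entries are moved. *)
have [u [y [su Ru ul' uq [v yv]]]] := move_one hsm hN Hcl dR (erefl : size l = n) Rl KH' P_outside lq nH.
have KH2 i z : (K i && (i < n)) || (i == q) -> onth u i = Some z -> H z.
  case/orP => [h|/eqP ->].
    have /andP [Ki il] := h; rewrite ul' //; exact: KH'.
  by rewrite uq => -[<-]; have [z' /inj <-] := PH yv.
have [w [sw Rw wu wH]] := move_all hsm hN Hcl H_outside dR su Ru KH2.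
exists w; split=> // [i il Ki|_ _ _]; first by rewrite wu ?Ki ?il // ul' ?Ki ?il.
exists v; have := wu q qn; rewrite eqxx orbT uq => /(_ isT).
by rewrite (onth_nth' d) ?sw // => -[->].
Qed.

End MoveCodes.

(** * The recursive presentation *)

Section Presentation.
Variables (L : signature) (N M : structure L) (iota : N -> nat) (g : M -> N).
Hypotheses (hr : recursive_structure iota) (eg : elementary g) (gi : injective g).

(** No new structure is built: [M] itself receives names, [m] being called by the index of its image
    in the enumeration [f]. The literal of code [c] concerns indices up to [c], where the sequence
    [l] that produced [D c] already agrees with [f]. *)
Lemma presentation (f : nat -> nat) (D : nat -> bool) :
  comp D -> injective f -> (forall i, exists m, iota (g m) = f i) -> (forall m, exists i, f i = iota (g m)) ->
  (forall c, exists l, [/\ c < size l, all (inN iota) l, (forall i, i <= c -> nth 0 l i = f i) & D c = truth iota c l]) ->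
  has_recursive_presentation M.
Proof.
move=> Dc fi fM Mf hD; have [inj _] := hr.
have [s sP] := choice fM; have [ix ixP] := choice Mf.
have sK m : s (ix m) = m by apply: gi; apply: inj; rewrite sP ixP.
have iK i : ix (s i) = i by apply: fi; rewrite ixP sP.
exists M, ix, (fun m : M => m); split; last first.
  split; last by exists id.
  by split=> // [h ts _ _|r ts _ _]; rewrite map_id.
split; first exact: can_inj sK.
apply/recursive_set_comp; apply: comp_ext Dc => c; apply/idP/asboolP.
- have [l [cl /inN_map [l' el] lf ->]] := hD c; subst l; rewrite size_map in cl => /(truthP hr) [p [pc lp wp bp h]].
  exists p; split=> // [v _|rho hrho]; first by exists (s v).
  apply/(eg rho wp); have := h (nth (g (rho 0)) l') (agree_nth _ _); apply: sat_fv => v vp /=.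
  have vc : v <= c by rewrite -pc; exact: fv_code.
  apply: inj; rewrite -(nth_map _ 0) ?(leq_ltn_trans vc) // lf // -{2}(iK v) hrho.
  by rewrite sP.
- move=> [p [lp wp _ pc h]]; have [l [cl /inN_map [l' el] lf ->]] := hD c; subst l; rewrite size_map in cl.
  apply/(truthP hr); exists p; split=> // [|rho ag].
    by apply/allP => v /fv_code; rewrite pc => /leq_ltn_trans; apply.
  have hs : sat s p by apply: h => m; exact: sK.
  have := (eg s wp).1 hs; apply: sat_fv => v vp /=.
  have vc : v <= c by rewrite -pc; exact: fv_code.
  rewrite (agreeE (rho 0) ag (leq_ltn_trans vc cl)); apply: inj.
  by rewrite -(nth_map _ 0) ?(leq_ltn_trans vc) // lf // sP.
Qed.

End Presentation.

Theorem theorem5p4 (L : signature) (T : formula -> Prop)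
  (hL : recursive_signature L) (hT : theory L T)
  (hcomp : complete L T) (hmc : model_complete L T) (hsm : strongly_minimal L T)
  (MM : structure L) (hMM : countable_saturated_model T MM) (hflat : flat MM)
  (n : nat) (hn : circuit_number MM n)
  (N : structure L) (hN : is_model T N) (iotaN : N -> nat)
  (hNrec : recursive_structure iotaN)
  (dN : nat) (hdN : model_dim N dN)
  (k : nat) (hk1 : n <= k) (hk2 : k <= dN)
  (M : structure L) (hM : is_model T M) (hdM : model_dim M k) :
  has_recursive_presentation M.
Proof.
have [hMod hcount hsat] := hMM; have [n2 [c [cc sc]] _] := hn.
have [b [[ib _ sb] szb]] := hdN; have [bM [[ibM _ sbM] szM]] := hdM.
have {}sb y : acl (in_list b) y by exact: sb.
have {}sbM y : acl (in_list bM) y by exact: sbM.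
have [inj _] := hNrec.
have prefix_ind (l1 l2 : seq N) : independent (l1 ++ l2) -> independent l1.
  elim/last_ind: l2 => [|l2 x IH]; first by rewrite cats0.
  by rewrite -rcons_cat => /(independent_rcons hsm hN) [/IH].
pose bk := take k b; have szk : size bk = k by rewrite size_takel ?szb.
have ibk : independent bk by apply: (prefix_ind _ (drop k b)); rewrite cat_take_drop.
(* Independent tuples of the common length [k] have the same type, so [M] embeds elementarily in [N]
   with image the closure of [bk]. *)
have peM : same_type bM bk.
  split=> [|F dF]; first by rewrite szM szk.
  by rewrite szM in dF; apply: (generic_type hcomp hsm hM hN ibM ibk szM szk dF).
have [g [eg gb gim]] := embed hM hN sbM peM.
have gi := elementary_inj hM eg.
have [e [rl [K0 [se ie outs bounded]]]] := circuit_rules hsm hMod hcomp hmc hflat hcount hsat n2 cc sc.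
(* The parameters [e] are completed to an independent tuple as long as the basis of [N]. So [N]
   embeds in the saturated model with [e] as image of the first [n - 2] basis elements, which belong
   to [bk] because [n <= k]. *)
have [w [sw iw]] := extend_ind hsm hMod (saturated_big hsm hMod hsat) (dN - (n - 2)) ie.
have sew : size (e ++ w) = dN by rewrite size_cat se sw; lia.
have peN : same_type b (e ++ w).
  split=> [|F dF]; first by rewrite szb sew.
  by rewrite szb in dF; apply: (generic_type hcomp hsm hN hMod ib iw szb sew dF).
have [G [eG Gb Gim]] := embed hN hMod sb peN.
pose eN := take (n - 2) b.
have GeN : map G eN = e by rewrite map_take Gb -se take_size_cat.
have img w' z : acl (in_list (map G (eN ++ w'))) z -> exists x, G x = z.
  move=> hz; apply/Gim; apply: acl_sub hz => y /List.in_map_iff [x [<- _]].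
  by apply/Gim; exists x.
rewrite -GeN in outs bounded.
have outsN := rule_outs hN eG outs; have boundedN := closed_bounded hN eG img outs bounded.
pose H := acl (in_list bk).
have Hcl a : acl H a -> H a by exact: acl_trans.
have eH z : List.In z eN -> H z.
  by move=> h; apply: acl_refl; apply: In_take h; lia.
(* [H] is the image of [M] under [g], and models of [T] are infinite. *)
have infH : ~ finite_set H.
  move=> [s hs]; apply: (model_infinite hsm hM).
  have [|t ht] := @map_preimage _ _ g (filter (fun y => `[< exists m, g m = y >]) s).
    by move=> y /List.filter_In [_ /asboolP].
  exists t => m _; have : List.In (g m) (map g t).
    rewrite ht; apply/List.filter_In; split; last by apply/asboolP; exists m.
    by apply: hs; apply/gim; exists m.
  by move=> /List.in_map_iff [m' [/gi ->]].
have [Y0 [Y0nd Y0s Y0H]] := infinite_list K0.+1 infH.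
pose P := derived iotaN eN rl Y0.
have Pc : comp P := comp_derived hNrec eN rl Y0.
have PH := derived_H hNrec Hcl eH outsN Y0H : forall u x, x \in P u -> exists2 y, iotaN y = x & H y.
have Pinf := derived_infinite hNrec boundedN Y0nd Y0s.
have [gg [gc gP gl]] := limit_guess hsm hmc hN hNrec ib sb Pc PH.
have HV x : (exists2 y, iotaN y = x & H y) -> inN iotaN x by move=> [y ey _]; apply/asboolP; exists y.
have T_rcons c' l y : all (inN iotaN) l -> inN iotaN y -> c' < size l ->
    truth iotaN c' (rcons l y) = truth iotaN c' l.
  move=> /inN_map [l' <-] /asboolP [y' <-]; rewrite size_map -map_rcons => cl.
  by apply/idP/idP => /(truthP hNrec) h; apply/(truthP hNrec); move: h; rewrite -cats1 tr_prefix.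
have Hinf (a : seq nat) : exists2 x, (exists2 y, iotaN y = x & H y) & x \notin a.
  by have [u [x [xP xa]]] := Pinf a; exists x => //; exact: PH xP.
have Psub u u' : u <= u' -> {subset P u <= P u'} by exact: derived_sub.
have Vc : comp (fun x => inN iotaN x) by apply: (comp_inN hNrec); exact: comp_id.
have Tc : comp (fun z : nat * seq nat => truth iotaN z.1 z.2) by apply: (comp_truth hNrec); ct.
have [f [D [Dc fi fH Hf hD]]] := priority_limit Vc Tc gc Pc HV gl Psub gP T_rcons Hinf
  (move_codes hsm hN hNrec Hcl PH Pinf).
apply: (presentation hNrec eg gi Dc fi _ _ hD).
- by move=> i; have [y ey /gim [m em]] := fH i; exists m; rewrite em.
- by move=> m; apply: Hf; exists (g m) => //; apply/gim; exists m.
Qed.
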